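(* Let $d\ge 2$, let $T>0$, and let $(\rho,v)$ be a weak solution on $(0,T)\times\mathbb{T}^d$, with initial data $(\rho_0,v_0)$, of the general compressible Navier-Stokes equations $$\rho_t+\mathrm{div}(\rho v)=0,\qquad (\rho v)_t+\mathrm{div}(\rho v\otimes v)+\nabla \mathfrak{p}(\rho)-\mathrm{div}(\nu(\rho)\mathbb{D}v)-\nabla(\mu(\rho)\,\mathrm{div}\,v)=0 .$$ Let $1<p,q<\infty$ and assume that there are constants $c_1,c_2$ with $$0<c_1\le\rho\le c_2<\infty,$$ and that $$v\in L^\infty(0,T;L^2(\mathbb{T}^d)),\qquad \nabla v\in L^2(0,T;L^2(\mathbb{T}^d)),$$ $$v\in L^{\frac{2p}{p-1}}(0,T;L^{\frac{2q}{q-1}}(\mathbb{T}^d)),\qquad \nabla v\in L^p(0,T;L^q(\mathbb{T}^d)),$$ $$\sqrt{\rho_0}\,v_0\in L^{2+\delta}(\mathbb{T}^d)\quad\text{for any }\delta>0 .$$ Then the energy is globally conserved: for every $t\in[0,T]$, $$\mathcal{E}(t)+\int_0^t\int_{\mathbb{T}^d}\left[\nu(\rho)|\mathbb{D}v|^2+\mu(\rho)|\mathrm{div}\,v|^2\right]dx\,ds=\mathcal{E}(0).$$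
   Context: $\mathbb{T}^d$ is the $d$-dimensional torus (periodic boundary conditions). The unknowns are the density $\rho$ (scalar) and the velocity $v$ ($\mathbb{R}^d$-valued); $\mathbb{D}v=\frac12(\nabla v+\nabla v^{T})$. The pressure function $\mathfrak{p}$ satisfies $0\le\mathfrak{p}\in C^1(0,\infty)$ and $\mathfrak{p}'>0$; the viscosity coefficients $\nu,\mu:(0,\infty)\to[0,\infty)$ are continuous. Put $$P(\rho)=\rho\int_1^\rho\frac{\mathfrak{p}(z)}{z^2}\,dz,\qquad \mathcal{E}(t)=\int_{\mathbb{T}^d}\left[\tfrac12\rho|v|^2+P(\rho)\right](x,t)\,dx,\qquad \mathcal{E}(0)=\int_{\mathbb{T}^d}\left[\tfrac12\rho_0|v_0|^2+P(\rho_0)\right]dx .$$ Definition (weak solution). $(\rho,v)$ is a weak solution with initial data $(\rho_0,v_0)$ if: (i) the two equations hold in the sense of distributions on $(0,T)\times\mathbb{T}^d$, and $P(\rho),\ \rho|v|^2\in L^\infty(0,T;L^1(\mathbb{T}^d))$, $\nabla v\in L^2(0,T;L^2(\mathbb{T}^d))$; (ii) $\lim_{t\to0}\int_{\mathbb{T}^d}\rho(x,t)\varphi(x)\,dx=\int_{\mathbb{T}^d}\rho_0(x)\varphi(x)\,dx$ for every $\varphi\in C_0^\infty(\mathbb{T}^d)$; (iii) $\lim_{t\to0}\int_{\mathbb{T}^d}(\rho v)(x,t)\cdot\psi(x)\,dx=\int_{\mathbb{T}^d}(\rho_0v_0)(x)\cdot\psi(x)\,dx$ for every $\psi\in C_0^\infty(\mathbb{T}^d)^d$;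 (iv) the energy inequality holds: $\mathcal{E}(t)+\int_0^t\int_{\mathbb{T}^d}[\nu(\rho)|\mathbb{D}v|^2+\mu(\rho)|\mathrm{div}\,v|^2]\,dx\,ds\le\mathcal{E}(0)$. Values at individual times $t$ are understood through the weakly continuous in time representatives of $\rho$ and $\rho v$. *)

(* Defs.v *)
From HB Require Import structures.
From mathcomp Require Import all_boot all_order all_algebra.
From mathcomp Require Import all_classical all_reals all_analysis.

Set Implicit Arguments.
Unset Strict Implicit.
Unset Printing Implicit Defensive.

Import Order.TTheory GRing.Theory Num.Theory.
Import numFieldNormedType.Exports.

Local Open Scope classical_set_scope.
Local Open Scope ring_scope.

(* Real matrices carry the sigma-algebra generated by the entries, which is
   the Borel one. *)
Definition mx_display : measure_display. Proof. exact. Qed.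

Definition mx_entry_sets (R : realType) (m n : nat) : set (set 'M[R]_(m, n)) :=
  [set B | exists (ij : 'I_m * 'I_n) (A : set R),
    measurable A /\ B = (fun M : 'M[R]_(m, n) => M ij.1 ij.2) @^-1` A].

HB.instance Definition _ (R : realType) (m n : nat) :=
  @isMeasurable.Build mx_display 'M[R]_(m, n) <<s @mx_entry_sets R m n >>
    (@sigma_algebra0 _ setT _) (@sigma_algebraC _ _)
    (@sigma_algebra_bigcup _ setT _).

Lemma measurable_fun_mx d (T : measurableType d) (R : realType) (m n : nat)
    (f : T -> 'M[R]_(m, n)) :
  (forall i j, measurable_fun setT (fun t => f t i j)) -> measurable_fun setT f.
Proof.
move=> mf; apply: (@measurability _ _ _ _ _ _ (@mx_entry_sets R m n)) => //.
by move=> _ [_ [[i j] [A [mA ->]]] <-]; exact: mf.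
Qed.

Lemma measurable_mx_entry (R : realType) (m n : nat) (i : 'I_m) (j : 'I_n) :
  measurable_fun setT (fun M : 'M[R]_(m, n) => M i j).
Proof.
move=> _ A mA; rewrite setTI; apply: sub_sigma_algebra.
by exists (i, j), A.
Qed.

Section TorusMeasure.
Variable R : realType.

Definition row_cons (n : nat) (z : measurableTypeR R * 'rV[R]_n) :
  'rV[R]_n.+1 := row_mx (z.1 : R)%:M z.2 : 'rV[R]_(1 + n).

Lemma measurable_row_cons (n : nat) : measurable_fun setT (@row_cons n).
Proof.
apply: measurable_fun_mx => i j; rewrite [i]ord1.
rewrite /row_cons; case: (splitP (j : 'I_(1 + n))) => k jk.
  rewrite (_ : (fun _ => _) = fst)//.
  apply/funext => z; have -> : j = lshift n k by exact/val_inj.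
  by apply: (etrans (row_mxEl _ _ _ _)); rewrite mxE !ord1 eqxx.
rewrite (_ : (fun _ => _) = (fun v : 'rV[R]_n => v 0 k) \o snd).
  apply: (measurableT_comp (@measurable_mx_entry R 1 n 0 k)).
  exact: measurable_snd.
apply/funext => z; have -> : j = rshift 1 k by exact/val_inj.
exact: row_mxEr.
Qed.

HB.instance Definition _ (n : nat) := @isMeasurableFun.Build _ _
  (measurableTypeR R * 'rV[R]_n)%type 'rV[R]_n.+1 (@row_cons n)
  (@measurable_row_cons n).

(* T^d = R^d / Z^d: functions on the torus are Z^d-periodic functions on R^d,
   and integrals over the torus are integrals over the cell [0, 1]^d. The
   measure below is Lebesgue measure on R^d restricted to that cell. *)
Fixpoint torus (n : nat) : probability 'rV[R]_n R :=
  match n with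
  | 0 => \d_(0 : 'rV[R]_0)
  | m.+1 => distribution (uniform_prob (@ltr01 R) \x torus m)%E (@row_cons m)
  end.

End TorusMeasure.

Section FunctionSpaces.
Variables (R : realType) (d : nat).
Implicit Types (T : R) (u w phi : R * 'rV[R]_d -> R).

Definition torus_function (A : Type) (f : 'rV[R]_d -> A) : Prop :=
  forall x k, f (x + delta_mx 0 k) = f x.

(* In finite dimension, C^k amounts to continuity of all iterated directional
   derivatives of order at most k. *)
Fixpoint Ck (V : normedModType R) (k : nat) (f : V -> R) : Prop :=
  continuous f /\
  match k with
  | 0 => True
  | m.+1 => (forall x e, derivable f x e) /\
            (forall e, Ck m (fun x => 'D_e f x))
  end.

Definition smooth (V : normedModType R) (f : V -> R) : Prop :=
  forall k, Ck k f.

Definition torus_test (phi : 'rV[R]_d -> R) : Prop :=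
  smooth phi /\ torus_function phi.

(* C_c^oo ((0, T) x T^d) *)
Definition spacetime_test T phi : Prop :=
  [/\ smooth phi, forall t, torus_function (fun x => phi (t, x)) &
      exists a b, [/\ 0 < a, b < T &
        forall t x, ~~ (a <= t <= b) -> phi (t, x) = 0]].

Definition d_t phi : R * 'rV[R]_d -> R := fun z => 'D_(1, 0) phi z.

Definition d_x (j : 'I_d) phi : R * 'rV[R]_d -> R :=
  fun z => 'D_(0, delta_mx 0 j) phi z.

Definition spacetime : {measure set (measurableTypeR R * 'rV[R]_d) -> \bar R} :=
  (lebesgue_measure \x torus R d)%E.

Definition cylinder T : set (R * 'rV[R]_d) := `]0, T[ `*` setT.

Definition L1loc T u : Prop :=
  forall a b, 0 < a -> b < T ->
    spacetime.-integrable (`[a, b] `*` setT) (EFin \o u).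

Definition pairing T u w : R := \int[spacetime]_(z in cylinder T) (u z * w z).

(* u \in L^p (0, T; L^q (T^d)) for the exponents p and q, possibly infinite *)
Definition LpLq T (p q : \bar R) u : Prop :=
  measurable_fun (cylinder T) (u : measurableTypeR R * 'rV[R]_d -> R) /\
  ('N[mrestr lebesgue_measure (measurable_itv `]0%R, T[)]_p
    [(fun t => 'N[torus R d]_q[(fun x => (u (t, x))%:E)])] < +oo)%E.

Definition in_Lp (p : \bar R) (f : 'rV[R]_d -> R) : Prop :=
  measurable_fun setT f /\ ('N[torus R d]_p [EFin \o f] < +oo)%E.

Definition enorm (m n : nat) (M : 'M[R]_(m, n)) : R :=
  Num.sqrt (\sum_i \sum_j M i j ^+ 2).

(* G i j is the distributional derivative of the i-th component of v with
   respect to x_j. *)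
Record weak_gradient T (v : R * 'rV[R]_d -> 'rV[R]_d)
    (G : R * 'rV[R]_d -> 'M[R]_d) : Prop := {
  wg_measurable : measurable_fun (cylinder T)
    (G : measurableTypeR R * 'rV[R]_d -> 'M[R]_d) ;
  wg_torus : forall t, 0 < t < T -> torus_function (fun x => G (t, x)) ;
  wg_locl : forall i, L1loc T (fun z => v z 0 i) ;
  wg_locr : forall i j, L1loc T (fun z => G z i j) ;
  wg_eq : forall i j phi, spacetime_test T phi ->
    pairing T (fun z => v z 0 i) (d_x j phi) =
    - pairing T (fun z => G z i j) phi
}.

End FunctionSpaces.

Section NavierStokes.
Variables (R : realType) (d : nat).
Implicit Types (T : R) (pr nu mu : R -> R).
Implicit Types (rho : R * 'rV[R]_d -> R) (v : R * 'rV[R]_d -> 'rV[R]_d).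
Implicit Types (G : R * 'rV[R]_d -> 'M[R]_d).

Definition pressure_law pr : Prop :=
  forall r, 0 < r ->
    [/\ 0 <= pr r, derivable pr r 1, {for r, continuous (derive1 pr)} &
      0 < derive1 pr r].

Definition viscosity_law nu : Prop :=
  forall r, 0 < r -> 0 <= nu r /\ {for r, continuous nu}.

(* The integral from 1 to r is oriented. *)
Definition potential pr (r : R) : R :=
  r * (if 1 <= r
       then \int[lebesgue_measure]_(z in `[1, r]) (pr z / z ^+ 2)
       else - \int[lebesgue_measure]_(z in `[r, 1]) (pr z / z ^+ 2)).

Definition energy pr (r : 'rV[R]_d -> R) (w : 'rV[R]_d -> 'rV[R]_d) : \bar R :=
  (\int[torus R d]_x
     (2^-1 * r x * enorm (w x) ^+ 2 + potential pr (r x))%:E)%E.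

Definition energy_at pr rho v (t : R) : \bar R :=
  energy pr (fun x => rho (t, x)) (fun x => v (t, x)).

Definition sym_grad (A : 'M[R]_d) : 'M[R]_d := 2^-1 *: (A + A^T).

(* G stands for the velocity gradient, so that its trace is the divergence. *)
Definition dissipation nu mu rho G (t : R) : \bar R :=
  (\int[lebesgue_measure]_(s in `]0%R, t[) \int[torus R d]_x
     (nu (rho (s, x)) * enorm (sym_grad (G (s, x))) ^+ 2
      + mu (rho (s, x)) * (\tr (G (s, x))) ^+ 2)%:E)%E.

Definition mass_equation T rho v : Prop :=
  [/\ L1loc T rho, forall j, L1loc T (fun z => rho z * v z 0 j) &
      forall phi, spacetime_test T phi ->
        pairing T rho (d_t phi)
        + \sum_j pairing T (fun z => rho z * v z 0 j) (d_x j phi) = 0].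

(* Each component of the equation, multiplied by -1 and tested against phi *)
Record momentum_equation T pr nu mu rho v G : Prop := {
  me_momentum : forall i, L1loc T (fun z => rho z * v z 0 i) ;
  me_convection : forall i j, L1loc T (fun z => rho z * v z 0 i * v z 0 j) ;
  me_pressure : L1loc T (fun z => pr (rho z)) ;
  me_shear : forall i j, L1loc T (fun z => nu (rho z) * sym_grad (G z) i j) ;
  me_bulk : L1loc T (fun z => mu (rho z) * \tr (G z)) ;
  me_eq : forall i phi, spacetime_test T phi ->
    pairing T (fun z => rho z * v z 0 i) (d_t phi)
    + \sum_j pairing T (fun z => rho z * v z 0 i * v z 0 j) (d_x j phi)
    + pairing T (fun z => pr (rho z)) (d_x i phi)
    - \sum_j pairing T (fun z => nu (rho z) * sym_grad (G z) i j) (d_x j phi)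
    - pairing T (fun z => mu (rho z) * \tr (G z)) (d_x i phi) = 0
}.

(* f is weakly continuous on [0, T] with values in L^1(T^d). *)
Definition weakly_continuous T (f : R * 'rV[R]_d -> R) : Prop :=
  (forall t, 0 <= t <= T ->
     (torus R d).-integrable setT (fun x => (f (t, x))%:E)) /\
  forall phi, torus_test phi ->
    {within `[0, T], continuous
       (fun t => \int[torus R d]_x (f (t, x) * phi x))}.

(* rho and v are functions defined at every time of [0, T], such that rho and
   rho v are the weakly continuous in time representatives. *)
Record weak_solution T pr nu mu rho v G
    (rho0 : 'rV[R]_d -> R) (v0 : 'rV[R]_d -> 'rV[R]_d) : Prop := {
  ws_rho_measurable : measurable_fun (`[0, T] `*` setT)
    (rho : measurableTypeR R * 'rV[R]_d -> R) ;
  ws_v_measurable : measurable_fun (`[0, T] `*` setT)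
    (v : measurableTypeR R * 'rV[R]_d -> 'rV[R]_d) ;
  ws_torus : forall t, 0 <= t <= T ->
    torus_function (fun x => rho (t, x)) /\ torus_function (fun x => v (t, x)) ;
  ws_rho0_measurable : measurable_fun setT rho0 ;
  ws_v0_measurable : measurable_fun setT v0 ;
  ws_torus0 : torus_function rho0 /\ torus_function v0 ;
  ws_rho0_integrable : (torus R d).-integrable setT (EFin \o rho0) ;
  ws_momentum0_integrable : forall i,
    (torus R d).-integrable setT (fun x => (rho0 x * v0 x 0 i)%:E) ;
  ws_rho_continuous : weakly_continuous T rho ;
  ws_momentum_continuous : forall i,
    weakly_continuous T (fun z => rho z * v z 0 i) ;
  ws_gradient : weak_gradient T v G ;
  ws_mass : mass_equation T rho v ;
  ws_momentum : momentum_equation T pr nu mu rho v G ;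
  ws_potential_bound : LpLq T +oo 1 (fun z => potential pr (rho z)) ;
  ws_kinetic_bound : LpLq T +oo 1 (fun z => rho z * enorm (v z) ^+ 2) ;
  ws_gradient_bound : LpLq T 2%:E 2%:E (fun z => enorm (G z)) ;
  ws_rho_initial : forall phi, torus_test phi ->
    \int[torus R d]_x (rho (t, x) * phi x) @[t --> 0^'+] -->
    \int[torus R d]_x (rho0 x * phi x) ;
  ws_momentum_initial : forall psi : 'I_d -> 'rV[R]_d -> R,
    (forall i, torus_test (psi i)) ->
    \int[torus R d]_x (\sum_i rho (t, x) * v (t, x) 0 i * psi i x)
      @[t --> 0^'+] -->
    \int[torus R d]_x (\sum_i rho0 x * v0 x 0 i * psi i x) ;
  ws_energy : forall t, 0 <= t <= T ->
    (energy_at pr rho v t + dissipation nu mu rho G t <= energy pr rho0 v0)%E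
}.

End NavierStokes.

(* Main.v *)
(* Mollify in space only, and follow the energy of the Favre average
   W_n = (rho v)_n / rho_n. The mollified equations are ordinary differential
   equations in time at every point x, so the chain rule applies to
   |(rho v)_n|^2 / (2 rho_n) + P (rho_n), and no time regularity of v is needed:
   after integration in x the energy changes by the integral of a flux made of
   the commutator of the convective term with grad W_n, of
   p(rho)_n - p(rho_n) against div W_n, and of the stress S_n against grad W_n.
   Since rho is bounded away from 0 and infinity, up to constants the commutator
   is at most \int K_n(h) |v(x+h) - v(x)|^2 dh and |grad W_n| is at most n times
   the mean of |v(x+h) - v(x)| over |h| <= 1/n. The first tends to 0 in L^s,
   s = q/(q-1), as v is in L^(2s); the second is bounded in L^q by the L^q norm
   of grad v. Hoelder's inequality in space kills the commutator at almost every
   time and Young's inequality with exponents p and p/(p-1) provides the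
   dominating function in time. The stress term converges weakly to the
   dissipation, and p(rho)_n - p(rho_n) tends to 0 in L^2. The energy inequality
   is used only to have v(t) in L^2 at every time t, which together with the
   weak continuity identifies the endpoint energies. *)
Require Import Defs.
From HB Require Import structures.
From mathcomp Require Import all_boot all_order all_algebra.
From mathcomp Require Import all_classical all_reals all_analysis.
From mathcomp Require Import measurable_realfun lebesgue_integral_under.
From mathcomp Require Import ring lra.

Set Implicit Arguments.
Unset Strict Implicit.
Unset Printing Implicit Defensive.

Import Order.TTheory GRing.Theory Num.Theory.
Import numFieldNormedType.Exports.

Local Open Scope classical_set_scope.
Local Open Scope ring_scope.

(** * Smooth functions and test functions *)

(** What shapes the proof is that the identity is claimed at every time while most of the data hold
    almost everywhere. The solution is therefore replaced by versions satisfying every bound at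
    every point: time is retracted to [[0, T]], the density is truncated to [[c1, c2]], and the
    gradient is set to 0 at times where its slice is not in L^2. Weak continuity carries the density
    bounds to every time slice, so the truncation changes each slice on a null set only, and the
    mollified density and momentum stay continuous in time. Absolute continuity in time is expressed
    by the relation [prim], an integral identity on [[0, T]] that is closed under products and
    compositions. The factor n lost in differentiating the kernel is regained because a shift by 1/n
    moves the velocity in L^r by at most 1/n times the norm of its gradient. The commutator is a
    covariance; this makes it quadratic in the increments, and its integral also measures the
    kinetic energy lost by mollification. The hypothesis on the initial data enters with [delta]
    equal to 1: it makes the initial energy finite, so that the energy inequality bounds every
    slice. *)

Section CkTheory.
Context {R : realType}.
Implicit Types V W : normedModType R.

Lemma CkW V k (f : V -> R) : Ck k.+1 f -> Ck k f.
Proof.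
elim: k f => [f [cf _]//|k IH f [cf [df Df]]]; split => //; split => // e.
exact: IH (Df e).
Qed.

Lemma Ck_cst V k (c : R) : Ck k (fun _ : V => c).
Proof.
elim: k c => [|k IH] c; split => //; try exact: cst_continuous.
split => [x e|e]; first exact: derivable_cst.
have -> : (fun x : V => 'D_e (fun _ : V => c) x) = (fun=> 0) => //.
by apply/funext => x; exact: derive_cst.
Qed.

Lemma CkD V k (f g : V -> R) : Ck k f -> Ck k g -> Ck k (fun x => f x + g x).
Proof.
elim: k f g => [|k IH] f g.
  by move=> [cf _] [cg _]; split=> // x; apply: continuousD; [exact: cf|exact: cg].
move=> [cf [df Df]] [cg [dg Dg]]; split.
  by move=> x; apply: continuousD; [exact: cf|exact: cg].
split => [x e|e]; first exact: (@derivableD _ _ _ f g).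
have -> : (fun x => 'D_e (fun x => f x + g x) x) = (fun x => 'D_e f x + 'D_e g x).
  by apply/funext => x; rewrite -(@deriveD _ _ _ f g).
exact: (IH _ _ (Df e) (Dg e)).
Qed.

Lemma CkM V k (f g : V -> R) : Ck k f -> Ck k g -> Ck k (fun x => f x * g x).
Proof.
elim: k f g => [|k IH] f g.
  by move=> [cf _] [cg _]; split=> // x; apply: continuousM; [exact: cf|exact: cg].
move=> Cf Cg; have [cf [df Df]] := Cf; have [cg [dg Dg]] := Cg; split.
  by move=> x; apply: continuousM; [exact: cf|exact: cg].
split => [x e|e]; first exact: (@derivableM _ _ f g).
have -> : (fun x => 'D_e (fun x => f x * g x) x) =
    (fun x => f x * 'D_e g x + g x * 'D_e f x).
  by apply/funext => x; rewrite -[LHS]/('D_e (f * g) x) deriveM.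
apply: CkD; [exact: (IH _ _ (CkW Cf) (Dg e)) | exact: (IH _ _ (CkW Cg) (Df e))].
Qed.

Lemma CkZ V k c (f : V -> R) : Ck k f -> Ck k (fun x => c * f x).
Proof. by move=> Cf; apply: CkM => //; exact: Ck_cst. Qed.

Lemma Ck_prod V k (I : Type) (r : seq I) (f : I -> V -> R) :
  (forall i, Ck k (f i)) -> Ck k (fun x => \prod_(i <- r) f i x).
Proof.
move=> Cf; elim: r => [|i r IH].
  rewrite (_ : (fun _ => _) = (fun=> 1)); first exact: Ck_cst.
  by apply/funext => x; rewrite big_nil.
rewrite (_ : (fun _ => _) = (fun x => f i x * \prod_(j <- r) f j x)).
  exact: CkM.
by apply/funext => x; rewrite big_cons.
Qed.

(** [L] is the linear part of [A]. In this form the difference quotients of [f \o A] in direction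
    [e] are literally those of [f] in direction [L e], so [affine_derive] is an identity of limits
    and asks no differentiability of [f]. *)
Definition affine_with V W (A L : V -> W) : Prop :=
  continuous A /\ forall (h : R) e x, A (h *: e + x) = h *: L e + A x.

Lemma affine_derive V W (A L : V -> W) (f : W -> R) x e :
  affine_with A L ->
  ('D_e (f \o A) x = 'D_(L e) f (A x)) /\
  (derivable f (A x) (L e) -> derivable (f \o A) x e).
Proof.
move=> [_ AL]; rewrite /derive /derivable.
rewrite (_ : (fun h => h^-1 *: ((f \o A) (h *: e + x) - (f \o A) x)) =
  (fun h => h^-1 *: (f (h *: L e + A x) - f (A x))))//.
by apply/funext => h /=; rewrite AL.
Qed.

Lemma Ck_affine V W k (A L : V -> W) (f : W -> R) :
  affine_with A L -> Ck k f -> Ck k (f \o A).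
Proof.
move=> AL; elim: k f => [|k IH] f [cf].
  by move=> _; split=> // x; apply: continuous_comp; [exact: AL.1|exact: cf].
move=> [df Df]; split.
  by move=> x; apply: continuous_comp; [exact: AL.1|exact: cf].
split => [x e|e]; first by apply: (affine_derive f x e AL).2.
have -> : (fun x => 'D_e (f \o A) x) = (fun y => 'D_(L e) f y) \o A.
  by apply/funext => x; rewrite (affine_derive f x e AL).1.
exact: (IH _ (Df (L e))).
Qed.

Lemma near_eq_derive_near V (f g : V -> R) (x e : V) :
  (\forall y \near x, f y = g y) -> \forall y \near x, 'D_e f y = 'D_e g y.
Proof. by move/near_join; apply: filterS => y; exact: near_eq_derive. Qed.

(** Made for periodised bumps: near each point they agree with a smooth function, but the function
    depends on the point. *)
Lemma Ck_local V k (f : V -> R) :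
  (forall x : V, exists2 g, Ck k g & \forall y \near x, f y = g y) -> Ck k f.
Proof.
have C0 (h : V -> R) : (forall x : V, exists2 g, continuous g &
    \forall y \near x, h y = g y) -> continuous h.
  move=> H x; have [g cg hg] := H x.
  have hxg : h x = g x by apply: (nbhs_singleton hg).
  rewrite /continuous_at hxg; apply: cvg_trans (cg x); apply: near_eq_cvg.
  by apply: filterS hg => y ->.
elim: k f => [|k IH] f H.
  by split => //; apply: C0 => x; have [g [cg _] fg] := H x; exists g.
split; first by apply: C0 => x; have [g [cg _] fg] := H x; exists g.
split => [x e|e].
  have [g [_ [dg _]] fg] := H x.
  by apply: near_eq_derivable (dg x e); apply: filterS fg => y ->.
apply: IH => x; have [g [_ [dg Dg]] fg] := H x.
by exists (fun y => 'D_e g y); [exact: Dg | exact: near_eq_derive_near].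
Qed.

Lemma smooth_cst V (c : R) : smooth (fun _ : V => c).
Proof. by move=> k; exact: Ck_cst. Qed.

Lemma smoothM V (f g : V -> R) : smooth f -> smooth g -> smooth (fun x => f x * g x).
Proof. by move=> sf sg k; exact: CkM. Qed.

Lemma smooth_affine V W (A L : V -> W) (f : W -> R) :
  affine_with A L -> smooth f -> smooth (f \o A).
Proof. by move=> AL sf k; exact: Ck_affine AL _. Qed.

Lemma smooth_derive V (f : V -> R) e : smooth f -> smooth (fun x => 'D_e f x).
Proof. by move=> sf k; have [_ [_ Df]] := sf k.+1; exact: Df. Qed.

Lemma smooth_derivable V (f : V -> R) x e : smooth f -> derivable f x e.
Proof. by move=> sf; have [_ [df _]] := sf 1%N. Qed.

Lemma smooth_continuous V (f : V -> R) : smooth f -> continuous f.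
Proof. by move=> sf; have [cf] := sf 0%N. Qed.

(** On the line [Ck] still quantifies over all directions [e], zero included, whereas one-variable
    calculus supplies direction 1. *)
Lemma is_derive_dir (f : R -> R) (x e : R) df :
  is_derive x 1 f df -> is_derive x e f (e * df).
Proof.
move=> fdf; have [->|e0] := eqVneq e 0.
  by rewrite mul0r; exact: is_derive0.
have [df1 df2] := fdf.
have ddf : differentiable f x by apply/derivable1_diffP.
apply: DeriveDef; first exact: diff_derivable.
by rewrite -df2 !deriveE// -[LHS]/('d f x e) -{1}(mulr1 e) -[e * 1]/(e *: 1) linearZ.
Qed.

(** The induction on the order of differentiation runs over the whole family at once, because the
    derivative of one member involves the others. *)
Lemma smooth_chain (I : Type) (F : I -> R -> R) :
  (forall n, continuous (F n)) ->
  (forall n, exists s : seq (R * I),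
    forall x : R, is_derive x 1 (F n) (\sum_(p <- s) p.1 * F p.2 x)) ->
  forall n, smooth (F n).
Proof.
move=> cF dF n k; elim: k n => [|k IH] n; split => //.
have [s dFn] := dF n; split => [x e|e].
  by have [] := is_derive_dir e (dFn x).
have -> : (fun x => 'D_e (F n) x) = (fun x => e * \sum_(p <- s) p.1 * F p.2 x).
  by apply/funext => x; have [_ ->] := is_derive_dir e (dFn x).
apply: CkZ; elim: s {dFn} => [|p s IHs].
  have -> : (fun x => \sum_(p <- [::]) p.1 * F p.2 x) = (fun=> 0 : R).
    by apply/funext => x; rewrite big_nil.
  exact: Ck_cst.
have -> : (fun x => \sum_(q <- p :: s) q.1 * F q.2 x) =
    (fun x => p.1 * F p.2 x + \sum_(q <- s) q.1 * F q.2 x).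
  by apply/funext => x; rewrite big_cons.
by apply: CkD => //; exact: CkZ.
Qed.

Lemma smooth_primitive (f F : R -> R) :
  (forall x : R, is_derive x 1 F (f x)) -> smooth f -> smooth F.
Proof.
move=> dF sf [|k].
  by split => // x; apply/differentiable_continuous/derivable1_diffP; have [] := dF x.
split.
  by move=> x; apply/differentiable_continuous/derivable1_diffP; have [] := dF x.
split => [x e|e]; first by have [] := is_derive_dir e (dF x).
have -> : (fun x => 'D_e F x) = (fun x => e * f x).
  by apply/funext => x; have [_ ->] := is_derive_dir e (dF x).
by apply: CkZ.
Qed.

End CkTheory.

(** * Smooth bumps and smooth steps on the line *)

Section Bump.
Context {R : realType}.
Implicit Types (x y : R) (k : nat).

(** The classical flat function [exp (- 1/x)] multiplied by powers of [1/x]; with the index [k] the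
    family is stable under differentiation up to linear combinations. *)
Definition flat k x : R := if 0 < x then x^-1 ^+ k * expR (- x^-1) else 0.

Lemma flat_le0 k x : x <= 0 -> flat k x = 0.
Proof. by move=> x0; rewrite /flat ltNge x0. Qed.

Lemma flat_ge0 k x : 0 <= flat k x.
Proof.
rewrite /flat; case: ifPn => // x0.
by rewrite mulr_ge0 ?expR_ge0// exprn_ge0// invr_ge0 ltW.
Qed.

(** The term of order [k.+1] of the exponential series at [1/x] beats the power [x^-1 ^+ k] and
    leaves one factor [x], which gives continuity at 0. *)
Lemma flat_bound k x : `|flat k x| <= k.+1`!%:R * `|x|.
Proof.
have [x0|x0] := leP x 0.
  by rewrite flat_le0// normr0 mulr_ge0.
rewrite ger0_norm ?flat_ge0// gtr0_norm// /flat x0.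
have y0 : 0 < x^-1 by rewrite invr_gt0.
rewrite expRN ler_pdivrMr ?expR_gt0//.
have k0 : 0 < k.+1`!%:R :> R by rewrite ltr0n fact_gt0.
have h : x^-1 ^+ k.+1 / k.+1`!%:R <= expR x^-1.
  by apply: le_trans (expR_ge1Dxn k (ltW y0)); rewrite lerDr.
apply: (@le_trans _ _ (k.+1`!%:R * x * (x^-1 ^+ k.+1 / k.+1`!%:R))).
  rewrite exprS -[_ * x]mulrC; set q := k.+1`!%:R in k0 *; set z := _ ^+ k.
  by have -> : x * q * (x^-1 * z / q) = z; [field; rewrite !gt_eqF|].
by rewrite ler_wpM2l// mulr_ge0// ltW.
Qed.

Lemma flat_cvg0 k : flat k x @[x --> (0:R)] --> 0.
Proof.
apply/cvgr0Pnorm_lt => e e0; near=> x.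
apply: le_lt_trans (flat_bound k x) _.
rewrite mulrC -ltr_pdivlMr ?ltr0n ?fact_gt0//.
near: x; apply: cvgr0_norm_lt; first exact: cvg_id.
by rewrite divr_gt0// ltr0n fact_gt0.
Unshelve. all: by end_near. Qed.

Lemma is_derive_flat k x :
  is_derive x 1 (flat k) (flat k.+2 x - k%:R * flat k.+1 x).
Proof.
have [x0|x0|->] := ltgtP x 0.
- rewrite !flat_le0 ?ltW// mulr0 subr0.
  apply: (near_eq_is_derive _ (is_derive_cst 0 x 1)) => //.
  by near=> y; rewrite flat_le0 ?ltW//; near: y; exact: lt_nbhsl.
- pose g y := y^-1 ^+ k * expR (- y^-1).
  apply: (@near_eq_is_derive _ _ _ g).
    by near=> y; rewrite /flat ifT//; near: y; exact: lt_nbhsr.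
  have dV : is_derive x 1 (fun y : R => y^-1) (- x ^- 2).
    apply: is_derive_eq; first exact: (@is_deriveV _ id x 1 1 (lt0r_neq0 x0)).
    by rewrite scaler1.
  have dE : is_derive x 1 (fun y : R => expR (- y^-1)) (expR (- x^-1) * x ^- 2).
    apply: (@is_derive1_comp _ expR (fun y => - y^-1)).
    have -> : (fun y : R => - y^-1) = - (fun y : R => y^-1) by [].
    by rewrite -[X in is_derive _ _ _ X]opprK; exact: is_deriveN.
  have dX := is_deriveX k dV.
  have XE y : ((fun y : R => y^-1) ^+ k) y = y^-1 ^+ k.
    by elim: (k) => [|m IHm]; rewrite ?expr0// !exprS -IHm.
  have -> : g = ((fun y : R => y^-1) ^+ k) * (fun y => expR (- y^-1)).
    by apply/funext => y; rewrite /g -XE.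
  have dXE := is_deriveM dX dE.
  apply: (is_derive_eq dXE).
  rewrite /flat x0 /= /GRing.scale/=.
  have -> : (x^-1 ^+ k.+2) = x ^- 2 * x^-1 ^+ k by rewrite -exprVn -exprD.
  rewrite XE.
  clear; case: k => [|m] /=; first by rewrite !mul0r expr0; ring.
  rewrite -!exprVn !exprS expr0; ring.
(* At 0 the difference quotient of [flat k] is [flat k.+1 h] on both sides, and this tends to 0. *)
- have F0 : flat k.+2 0 - k%:R * flat k.+1 0 = 0 by rewrite !flat_le0// mulr0 subrr.
  rewrite F0; have h0 : h^-1 *: (flat k (h *: 1 + 0) - flat k 0) @[h --> (0:R)^'] --> 0.
    apply: (@cvg_trans _ (flat k.+1 h @[h --> (0:R)^'])); last first.
      by apply: cvg_trans (flat_cvg0 k.+1); apply: cvg_app; exact: nbhs_dnbhs.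
    apply: near_eq_cvg; near=> h; rewrite addr0 [flat k 0]flat_le0// subr0.
    have -> : h *: (1 : R) = h by exact: mulr1.
    have [h0|h0] := leP h 0; first by rewrite !flat_le0// scaler0.
    by rewrite /flat h0 exprS -mulrA.
  by apply: DeriveDef; [apply/cvg_ex; exists 0 | exact/cvg_lim].
Unshelve. all: by end_near. Qed.

Lemma smooth_flat k : smooth (flat k).
Proof.
apply: (smooth_chain (I := nat)) => {}k.
  move=> x; apply/differentiable_continuous/derivable1_diffP.
  by have [] := is_derive_flat k x.
exists [:: (1, k.+2); (- k%:R, k.+1)] => x.
by rewrite !big_cons big_nil /= addr0 mul1r mulNr; exact: is_derive_flat.
Qed.

Lemma bump_exists : exists b : R -> R,
  [/\ smooth b, forall x, 0 <= b x, forall x, x <= 0 -> b x = 0,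
      forall x, 1 <= x -> b x = 0 & 0 < b 2^-1].
Proof.
exists (fun x => flat 0 x * flat 0 (1 - x)); split.
- apply: smoothM; first exact: smooth_flat.
  apply: (@smooth_affine _ _ _ (fun x : R => 1 - x) (fun x => - x) (flat 0)).
    split; last by move=> h e x; rewrite scalerN opprD addrCA.
    by move=> x; apply: cvgB; [exact: cvg_cst|exact: cvg_id].
  exact: smooth_flat.
- by move=> x; rewrite mulr_ge0 ?flat_ge0.
- by move=> x x0; rewrite flat_le0// mul0r.
- by move=> x x0; rewrite [X in _ * X]flat_le0 ?mulr0// subr_le0.
- have h : (0:R) < 2^-1 by [].
  have -> : 1 - 2^-1 = 2^-1 :> R by field.
  by rewrite /flat h !expr0 !mul1r mulr_gt0// expR_gt0.
Qed.

Lemma step_exists : exists H b : R -> R,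
  [/\ smooth H, smooth b, forall x : R, is_derive x 1 H (b x) & forall x, 0 <= b x] /\
  [/\ forall x, x <= 0 -> b x = 0, forall x, 1 <= x -> b x = 0,
      forall x, x <= 0 -> H x = 0 & forall x, 1 <= x -> H x = 1].
Proof.
have [c [sc c0 cl cr cpos]] := bump_exists.
(* The base point -1 lies strictly to the left of the support of [c], so the fundamental theorem of
   calculus also applies at 0; for negative [x] the primitive is locally 0. *)
pose J x := (\int[lebesgue_measure]_(t in `[-1, x]) c t)%R.
have cc : continuous c := smooth_continuous sc.
have ic x : lebesgue_measure.-integrable `[-1, x] (EFin \o c).
  by apply: continuous_compact_integrable; [exact: segment_compact|exact: continuous_subspaceT].
have Jl x : x <= 0 -> J x = 0.
  move=> x0; rewrite /J (@eq_Rintegral _ _ _ _ _ (fun=> 0)) ?Rintegral_cst ?mul0r//.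
  by move=> t; rewrite inE/= in_itv/= => /andP[_ tx]; rewrite cl// (le_trans tx).
have dJ (x : R) : is_derive x 1 J (c x).
  have [x0|x0] := ltP x 0.
    rewrite cl ?ltW//; apply: (near_eq_is_derive _ (is_derive_cst 0 x 1)) => //.
    by near=> y; rewrite Jl ?ltW//; near: y; exact: lt_nbhsl.
  have x1 : x < x + 1 by rewrite ltrDl.
  have [|d1 d2] := @continuous_FTC1_closed _ c (-1) x _ x1 (ic _) _ (cc x).
    by apply: lt_le_trans x0; rewrite ltrN10.
  by apply: DeriveDef; [exact: d1|rewrite -derive1E; exact: d2].
have cJ : continuous J.
  by move=> z; apply/differentiable_continuous/derivable1_diffP; have [] := dJ z.
have Jmono : {homo J : x y / x <= y}.
  move=> x y xy.
  have [|z _] := @MVT_segment _ J c x y xy.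
  - by apply: continuous_subspaceT; exact: cJ.
  - by move=> h; rewrite -subr_ge0 h mulr_ge0// subr_ge0.
(* If [J 1] were 0, monotonicity would make [J] vanish on [[0, 1]], hence its derivative [c] at 1/2,
   where [c] is positive. *)
have J1 : 0 < J 1.
  rewrite lt_neqAle -{2}(Jl 0)// Jmono ?ler01// andbT; apply/eqP => J10.
  have J00 y : 0 <= y <= 1 -> J y = 0.
    move=> /andP[y0 y1]; apply/eqP; rewrite eq_le.
    by rewrite {1}J10 -{1}(Jl 0)// !Jmono.
  have : is_derive (2^-1 : R) 1 J 0.
    apply: (@near_eq_is_derive _ _ _ (cst 0)).
    near=> y; rewrite J00//.
    have : y \in `]0, 1[ by near: y; apply: near_in_itvoo; rewrite in_itv/=; lra.
    by rewrite in_itv/= => /andP[? ?]; rewrite !ltW.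
  move=> [_ e1]; have [_ e2] := dJ 2^-1; move: cpos.
  by rewrite -e2 e1 ltxx.
have Jr x : 1 <= x -> J x = J 1.
  rewrite le_eqVlt => /predU1P[<-//|x1].
  have [|z] := @MVT_segment _ J c 1 x (ltW x1).
  - by apply: continuous_subspaceT; exact: cJ.
  - by rewrite in_itv/= => /andP[z1 _]; rewrite cr// mul0r => /eqP; rewrite subr_eq0 => /eqP.
exists (fun x => J x / J 1), (fun x => c x / J 1); split; split.
- by move=> k; under eq_fun do rewrite mulrC; apply: CkZ; exact: (smooth_primitive dJ).
- by move=> k; under eq_fun do rewrite mulrC; apply: CkZ.
- move=> x; under eq_fun do rewrite mulrC; rewrite mulrC.
  exact: (@is_deriveZ _ _ _ J).
- by move=> x; rewrite divr_ge0// ltW.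
- by move=> x x0; rewrite cl// mul0r.
- by move=> x x0; rewrite cr// mul0r.
- by move=> x x0; rewrite Jl// mul0r.
- by move=> x x1; rewrite Jr// divff// gt_eqF.
Unshelve. all: by end_near. Qed.

End Bump.

(** * Periodic mollifiers in one variable *)

Section Kernel1.
Context {R : realType}.

Lemma is_derive_affine (a b s : R) : is_derive s 1 (fun s' => a * s' + b) a.
Proof.
have h := is_deriveD (is_deriveZ a (is_derive_id s (1 : R))) (is_derive_cst b s 1).
by apply: (is_derive_eq h); rewrite addr0 /GRing.scale/= mulr1.
Qed.

(** A zero of a nonnegative function is a minimum. This covers the end points of the support of a
    bump, where the support condition describes one side only. *)
Lemma derive_at_zero_min (f : R -> R) (x : R) :
  (forall y, 0 <= f y) -> (forall y : R, derivable f y 1) -> f x = 0 -> 'D_1 f x = 0.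
Proof.
move=> f0 df fx0.
have [||||_ ->//] := @derive1_at_min _ f (x - 1) (x + 1) x.
- by rewrite lerD2l; lra.
- by move=> t _; exact: df.
- by rewrite in_itv/=; apply/andP; split; lra.
- by move=> t _; rewrite fx0.
Qed.

Lemma continuous_bounded_supp (f : R -> R) : continuous f ->
  (forall x, x <= 0 -> f x = 0) -> (forall x, 1 <= x -> f x = 0) ->
  exists2 C, 0 < C & forall x, `|f x| <= C.
Proof.
move=> cf f0 f1.
have [|c _ cmax] := @EVT_max R (fun x => `|f x|) 0 1 ler01.
  by apply: continuous_subspaceT => x; apply: cvg_norm; exact: cf.
exists (`|f c| + 1); first by rewrite ltr_wpDl.
move=> x; have [x0|x0] := leP x 0; first by rewrite f0// normr0 addr_ge0.
have [x1|x1] := leP 1 x; first by rewrite f1// normr0 addr_ge0.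
by rewrite (@le_trans _ _ `|f c|)// ?lerDl// cmax// in_itv/= !ltW.
Qed.

(* [k] is a mollifier on the circle R/Z with support in [0, 1/(n + 2)] modulo 1. *)
Record kernel1 (C : R) (n : nat) (k k' : R -> R) : Prop := {
  k1_smooth : smooth k ;
  k1_derive : forall s : R, is_derive s 1 k (k' s) ;
  k1_cont' : continuous k' ;
  k1_periodic : forall s, k (s + 1) = k s ;
  k1_periodic' : forall s, k' (s + 1) = k' s ;
  k1_ge0 : forall s, 0 <= k s ;
  k1_le : forall s, k s <= C * n.+2%:R ;
  k1_le' : forall s, `|k' s| <= C * n.+2%:R ^+ 2 ;
  k1_supp : forall s, n.+2%:R^-1 <= s <= 1 -> k s = 0 ;
  k1_supp' : forall s, n.+2%:R^-1 <= s <= 1 -> k' s = 0 ;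
  k1_int : (\int[lebesgue_measure]_(s in `[0%R, 1%R]) (k s)%:E = 1)%E
}.

Lemma kernel1_exists : exists2 C : R, 0 < C &
  forall n, exists k k', kernel1 C n k k'.
Proof.
have [H [b [[sH sb dH b0] [bl br Hl Hr]]]] := @step_exists R.
have db (x : R) : derivable b x 1 by exact: smooth_derivable.
have b'0 x : b x = 0 -> 'D_1 b x = 0 by apply: derive_at_zero_min.
have sb' : smooth (fun x => 'D_1 b x) by exact: smooth_derive.
have b'l x : x <= 0 -> 'D_1 b x = 0 by move=> /bl/b'0.
have b'r x : 1 <= x -> 'D_1 b x = 0 by move=> /br/b'0.
have [C1 C10 bC1] := continuous_bounded_supp (smooth_continuous sb) bl br.
have [C2 C20 bC2] := continuous_bounded_supp (smooth_continuous sb') b'l b'r.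
exists (C1 + C2); first exact: addr_gt0.
move=> n; set N : R := n.+2%:R.
have N2 : 2 <= N by rewrite ler_nat.
have N0 : 0 < N by lra.
(* The kernel is [N * b (N * fr s)], where the fractional part [fr] periodises the rescaled bump. It
   is smooth because [fr] jumps only where [b] is flat. *)
pose fr (s : R) := s - (Num.floor s)%:~R.
have frE s (m : int) : m%:~R <= s < m%:~R + 1 -> fr s = s - m%:~R.
  by move=> h; rewrite /fr (@floor_def _ _ m)// intrD.
have fr01 s : 0 <= fr s < 1.
  by have := floor_itv s; rewrite intrD /fr => /andP[? ?]; apply/andP; split; lra.
have frP s : fr (s + 1) = fr s.
  have := fr01 s; rewrite {1 2}/fr => /andP[h1 h2].
  by rewrite (frE _ (Num.floor s + 1)) /fr intrD; lra.
(* Just to the left of an integer the fractional part exceeds 1/2, so [N * fr s >= 1] and [c]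
   vanishes there. This uses [N >= 2], and is the reason why the scales are [n.+2] rather than
   [n.+1]. *)
have loc (c : R -> R) : (forall x, x <= 0 -> c x = 0) -> (forall x, 1 <= x -> c x = 0) ->
    forall (m : int) s, -2^-1 < s - m%:~R < 1 -> c (N * fr s) = c (N * (s - m%:~R)).
  move=> cl cr m s /andP[h1 h2].
  have [h3|h3] := leP 0 (s - m%:~R).
    by rewrite (frE _ m)//; apply/andP; split; lra.
  rewrite (frE _ (m - 1)); last by rewrite intrB; apply/andP; split; lra.
  by rewrite cr ?cl// ?intrB; nra.
have locn (c : R -> R) a : (forall x, x <= 0 -> c x = 0) -> (forall x, 1 <= x -> c x = 0) ->
    forall s : R, \forall s' \near s, a * c (N * fr s') = a * c (N * (s' - (Num.floor s)%:~R)).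
  move=> cl cr s; near=> s'; rewrite (loc _ cl cr (Num.floor s))//.
  have : s' \in `]((Num.floor s)%:~R - 2^-1), ((Num.floor s)%:~R + 1)[.
    near: s'; apply: near_in_itvoo; rewrite in_itv/=.
    by have := floor_itv s; rewrite intrD => /andP[? ?]; apply/andP; split; lra.
  by rewrite in_itv/= => /andP[? ?]; apply/andP; split; lra.
have aff (m : R) : affine_with (fun s : R => N * (s - m)) (fun s => N * s).
  split.
    by move=> x; apply: cvgM; [exact: cvg_cst|apply: cvgB; [exact: cvg_id|exact: cvg_cst]].
  by move=> h e x; rewrite /GRing.scale/=; ring.
have smo (c : R -> R) a : (forall x, x <= 0 -> c x = 0) -> (forall x, 1 <= x -> c x = 0) ->
    smooth c -> smooth (fun s => a * c (N * fr s)).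
  move=> cl cr sc j; apply: Ck_local => s.
  exists (fun s' => a * c (N * (s' - (Num.floor s)%:~R))); last exact: locn.
  apply: CkZ; exact: (smooth_affine (aff _) sc).
exists (fun s => N * b (N * fr s)), (fun s => N ^+ 2 * 'D_1 b (N * fr s)).
split.
- exact: smo.
- move=> s; set m : R := (Num.floor s)%:~R.
  have -> : N ^+ 2 * 'D_1 b (N * fr s) = N * ('D_1 b (N * (s - m)) * N).
    by rewrite -/(fr s) expr2; ring.
  apply: (@near_eq_is_derive _ _ _ (fun s' => N * b (N * (s' - m)))).
    by apply: filterS (locn b N bl br s) => s' ->.
  apply: (@is_deriveZ _ _ _ (fun s' => b (N * (s' - m)))).
  apply: (@is_derive1_comp _ b (fun s' => N * (s' - m))).
    exact: derivableP.
  have -> : (fun s' => N * (s' - m)) = (fun s' => N * s' + - (N * m)).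
    by apply/funext => s'; rewrite mulrBr.
  exact: is_derive_affine.
- exact: (smooth_continuous (smo _ (N ^+ 2) b'l b'r sb')).
- by move=> s; rewrite frP.
- by move=> s; rewrite frP.
- by move=> s; rewrite mulr_ge0// ltW.
- move=> s; rewrite mulrC ler_wpM2r ?(ltW N0)// (le_trans (ler_norm _))// (le_trans (bC1 _))//.
  by rewrite lerDl ltW.
- move=> s; rewrite normrM (@ger0_norm _ (N ^+ 2)) ?exprn_ge0 ?(ltW N0)// mulrC.
  by rewrite ler_wpM2r ?exprn_ge0 ?(ltW N0)// (le_trans (bC2 _))// lerDr ltW.
- move=> s /andP[s0 s1].
  have [->|s1'] := eqVneq s 1; first by rewrite (frE _ 1) ?subrr ?mulr0 ?bl ?mulr0//; lra.
  rewrite (frE _ 0) ?subr0.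
    by rewrite br ?mulr0// -ler_pdivrMl// mulr1.
  by rewrite add0r (le_trans _ s0) ?invr_ge0 ?ltW//= lt_neqAle s1'.
- move=> s /andP[s0 s1].
  have [->|s1'] := eqVneq s 1; first by rewrite (frE _ 1) ?subrr ?mulr0 ?b'l ?mulr0//; lra.
  rewrite (frE _ 0) ?subr0.
    by rewrite b'r ?mulr0// -ler_pdivrMl// mulr1.
  by rewrite add0r (le_trans _ s0) ?invr_ge0 ?ltW//= lt_neqAle s1'.
- have dHN (s : R) : is_derive s 1 (fun s => H (N * s)) (N * b (N * s)).
    rewrite mulrC; apply: (@is_derive1_comp _ H (fun s' => N * s')).
    have -> : (fun s' => N * s') = (fun s' => N * s' + 0).
      by apply/funext => s'; rewrite addr0.
    exact: is_derive_affine.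
  have cHN : continuous (fun s => H (N * s)).
    by move=> s; apply/differentiable_continuous/derivable1_diffP; have [] := dHN s.
  transitivity (\int[lebesgue_measure]_(s in `[0%R, 1%R]) (N * b (N * s))%:E)%E.
    apply: eq_integral => s; rewrite inE/= in_itv/= => /andP[s0 s1].
    have [->|s1'] := eqVneq s 1; first last.
      by rewrite (frE _ 0) ?subr0// s0 add0r lt_neqAle s1'.
    rewrite (frE _ 1); last by lra.
    by rewrite subrr mulr0 bl// br// mulr1; lra.
  rewrite (@continuous_FTC2 _ _ (fun s => H (N * s)))//.
  - by rewrite mulr0 (Hl 0)// mulr1 (Hr N) ?sube0//; lra.
  - apply: continuous_subspaceT => s; apply: cvgM; first exact: cvg_cst.
    apply: (continuous_comp (f := fun s => N * s)); last exact: smooth_continuous.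
    by apply: cvgM; [exact: cvg_cst|exact: cvg_id].
  - split; first by move=> s _; have [] := dHN s.
    + by apply: cvg_at_right_filter; exact: cHN.
    + by apply: cvg_at_left_filter; exact: cHN.
  - by move=> s _; rewrite derive1E; have [_ ->] := dHN s.
Unshelve. all: by end_near. Qed.

End Kernel1.

Lemma is_derive_prod (R : realType) (V : normedModType R) (I : eqType) (r : seq I)
    (f : I -> V -> R) (df : I -> R) (x e : V) :
  uniq r -> (forall i, is_derive x e (f i) (df i)) ->
  is_derive x e (fun y => \prod_(i <- r) f i y)
    (\sum_(i <- r) df i * \prod_(j <- r | j != i) f j x).
Proof.
move=> ur dfi; elim: r ur => [_|i r IH /= /andP[ir ur]].
  have -> : (fun y => \prod_(i <- [::]) f i y) = cst 1.
    by apply/funext => y; rewrite big_nil.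
  by rewrite big_nil; exact: is_derive_cst.
have -> : (fun y => \prod_(j <- i :: r) f j y) = f i * (fun y => \prod_(j <- r) f j y).
  by apply/funext => y; rewrite big_cons.
have h := is_deriveM (dfi i) (IH ur).
apply: (is_derive_eq h); rewrite [RHS]big_cons big_cons eqxx /= addrC; congr (_ + _).
  rewrite [LHS]mulrC; congr (_ * _); rewrite big_seq [RHS]big_seq_cond.
  apply: eq_bigl => j; case: eqP => [->|_]; last by rewrite andbT.
  by rewrite andbF; apply/negbTE.
rewrite -[LHS]/(_ * _) mulr_sumr [LHS]big_seq [RHS]big_seq; apply: eq_bigr => j jr.
rewrite big_cons ifT 1?mulrCA//; apply/eqP => ij.
by move: ir; rewrite ij jr.
Qed.

(** * Tensor products of one-dimensional kernels *)

Section ProductKernel.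
Context {R : realType} {d : nat}.
Implicit Types (k kd : R -> R) (x y z h : 'rV[R]_d).

Definition prodk k y : R := \prod_(i < d) k (y 0 i).

Definition dprodk k kd (j : 'I_d) y : R := kd (y 0 j) * \prod_(i < d | i != j) k (y 0 i).

Lemma affine_coord (i : 'I_d) :
  affine_with (fun y : 'rV[R]_d => y 0 i) (fun y : 'rV[R]_d => y 0 i).
Proof. by split; [exact: coord_continuous|move=> h e x; rewrite !mxE]. Qed.

Lemma is_derive_prodk k kd z h : (forall s : R, is_derive s 1 k (kd s)) ->
  is_derive z h (prodk k) (\sum_(i < d) h 0 i * dprodk k kd i z).
Proof.
move=> dk.
have dki (i : 'I_d) : is_derive z h (fun y => k (y 0 i)) (h 0 i * kd (z 0 i)).
  have [e1 e2] := affine_derive k z h (affine_coord i).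
  have [d1 d2] := is_derive_dir (h 0 i) (dk (z 0 i)).
  by apply: DeriveDef; [exact: e2|rewrite -d2; exact: e1].
have := is_derive_prod (index_enum_uniq _) dki.
by under eq_bigr do rewrite -mulrA.
Qed.

Lemma smooth_prodk k : smooth k -> smooth (prodk k).
Proof.
move=> sk n; apply: Ck_prod => i.
exact: (Ck_affine (affine_coord i) (sk n)).
Qed.

Lemma affine_subr x : affine_with (fun y : 'rV[R]_d => y - x) id.
Proof.
split; last by move=> a e y; rewrite addrA.
by move=> y; exact: (@cvgB R 'rV[R]_d 'rV[R]_d (nbhs y) _ id (cst x) y x cvg_id (cvg_cst x)).
Qed.

Lemma affine_subl x : affine_with (fun y : 'rV[R]_d => x - y) (fun y => - y).
Proof.
split; last by move=> a e y; rewrite opprD scalerN addrCA.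
by move=> y; exact: (@cvgB R 'rV[R]_d 'rV[R]_d (nbhs y) _ (cst x) id x y (cvg_cst x) cvg_id).
Qed.

Lemma affine_line z h : affine_with (fun s : R => z + s *: h) (fun s : R => s *: h).
Proof.
split; last by move=> a e s; rewrite scalerDl addrCA scalerA.
by move=> s; apply: cvgD; [exact: cvg_cst|apply: cvgZr_tmp; exact: cvg_id].
Qed.

Lemma torus_test_sub f x : torus_test f -> torus_test (fun y : 'rV[R]_d => f (y - x)).
Proof.
move=> [sf pf]; split; first exact: (smooth_affine (affine_subr x) sf).
by move=> y k; rewrite addrAC pf.
Qed.

Lemma torus_test_subl f x : torus_test f -> torus_test (fun y : 'rV[R]_d => f (x - y)).
Proof.
move=> [sf pf]; split; first exact: (smooth_affine (affine_subl x) sf).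
by move=> y k; rewrite -[LHS](pf _ k) opprD addrA subrK.
Qed.

Lemma derive_subr (f : 'rV[R]_d -> R) x y e :
  'D_e (fun y => f (y - x)) y = 'D_e f (y - x).
Proof. exact: (affine_derive f y e (affine_subr x)).1. Qed.

Lemma derive_subl (f : 'rV[R]_d -> R) x y e :
  'D_e (fun y => f (x - y)) y = 'D_(- e) f (x - y).
Proof. exact: (affine_derive f y e (affine_subl x)).1. Qed.

Lemma periodic_prodk k : (forall s, k (s + 1) = k s) -> torus_function (prodk k).
Proof.
move=> pk y j; apply: eq_bigr => i _; rewrite !mxE eqxx /=.
by case: eqP => _; rewrite ?addr0.
Qed.

Lemma periodic_dprodk k kd j : (forall s, k (s + 1) = k s) ->
  (forall s, kd (s + 1) = kd s) -> torus_function (dprodk k kd j).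
Proof.
move=> pk pkd y l; congr (_ * _); last apply: eq_bigr => i _; rewrite !mxE eqxx /=.
  by case: eqP => _; rewrite ?addr0.
by case: eqP => _; rewrite ?addr0.
Qed.

Lemma torus_test_prodk k : smooth k -> (forall s, k (s + 1) = k s) ->
  torus_test (prodk k).
Proof. by move=> sk pk; split; [exact: smooth_prodk|exact: periodic_prodk]. Qed.

Lemma measurable_coord (i : 'I_d) : measurable_fun setT (fun y : 'rV[R]_d => y 0 i).
Proof. exact: measurable_mx_entry. Qed.

Lemma measurable_comp_coord k i : continuous k ->
  measurable_fun setT (fun y : 'rV[R]_d => k (y 0 i)).
Proof.
move=> ck; apply: (measurableT_comp (f := k : measurableTypeR R -> measurableTypeR R)); last exact: measurable_coord.
exact: measurable_realfun.continuous_measurable_fun.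
Qed.

Lemma measurable_prodk k : continuous k -> measurable_fun setT (prodk k).
Proof.
by move=> ck; apply: measurable_prod => i _; exact: measurable_comp_coord.
Qed.

Lemma measurable_dprodk k kd j : continuous k -> continuous kd ->
  measurable_fun setT (dprodk k kd j).
Proof.
move=> ck ckd; apply: measurable_funM; first exact: measurable_comp_coord.
under eq_fun do rewrite big_mkcond/=.
apply: measurable_prod => i _; case: (i != j); last exact: measurable_cst.
exact: measurable_comp_coord.
Qed.

Lemma bounded_prodk k M : 0 <= M -> (forall s, `|k s| <= M) ->
  forall y, `|prodk k y| <= M ^+ d.
Proof.
move=> M0 kM y; rewrite /prodk normr_prod.
apply: (@le_trans _ _ (\prod_(i < d) M)); last by rewrite prodr_const card_ord.
by apply: ler_prod => i _; rewrite normr_ge0 kM.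
Qed.

Lemma bounded_dprodk k kd M Md j : 1 <= M -> 0 <= Md -> (forall s, `|k s| <= M) ->
  (forall s, `|kd s| <= Md) -> forall y, `|dprodk k kd j y| <= Md * M ^+ d.
Proof.
move=> M1 Md0 kM kdM y; rewrite normrM ler_pM//.
rewrite normr_prod big_mkcond/=.
apply: (@le_trans _ _ (\prod_(i < d) M)); last by rewrite prodr_const card_ord.
by apply: ler_prod => i _; case: ifP => _; rewrite ?ler01 ?normr_ge0 ?kM.
Qed.

End ProductKernel.

(** * Test functions that separate time and space *)

Section SpacetimeTest.
Context {R : realType} {d : nat}.
Implicit Types (th : R -> R) (psi : 'rV[R]_d -> R) (z : R * 'rV[R]_d).

Lemma affine_fst : affine_with (@fst R 'rV[R]_d) fst.
Proof. by split=> // x; exact: cvg_fst. Qed.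

Lemma affine_snd : affine_with (@snd R 'rV[R]_d) snd.
Proof. by split=> // x; exact: cvg_snd. Qed.

Definition tensor th psi z : R := th z.1 * psi z.2.

Lemma spacetime_test_tensor T th psi a b : 0 < a -> b < T ->
  smooth th -> (forall t, ~~ (a <= t <= b) -> th t = 0) -> torus_test psi ->
  spacetime_test T (tensor th psi).
Proof.
move=> a0 bT sth th0 [spsi ppsi]; split.
- apply: smoothM; first exact: (smooth_affine affine_fst sth).
  exact: (smooth_affine affine_snd spsi).
- by move=> t x k; rewrite /tensor/= ppsi.
- by exists a, b; split=> // t x tab; rewrite /tensor/= th0// mul0r.
Qed.

Lemma derive_tensor th psi z (e : R * 'rV[R]_d) : smooth th -> smooth psi ->
  'D_e (tensor th psi) z = th z.1 * 'D_(e.2) psi z.2 + psi z.2 * 'D_(e.1) th z.1.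
Proof.
move=> sth spsi.
have [e1 d1] := affine_derive th z e affine_fst.
have [e2 d2] := affine_derive psi z e affine_snd.
rewrite (_ : tensor th psi = (th \o fst) * (psi \o snd))//.
rewrite deriveM; first by rewrite e1 e2.
- by apply: d1; exact: smooth_derivable.
- by apply: d2; exact: smooth_derivable.
Qed.

Lemma d_t_tensor th psi z : smooth th -> smooth psi ->
  d_t (tensor th psi) z = 'D_1 th z.1 * psi z.2.
Proof. by move=> sth spsi; rewrite /d_t derive_tensor//= derive0 mulr0 add0r mulrC. Qed.

Lemma d_x_tensor j th psi z : smooth th -> smooth psi ->
  d_x j (tensor th psi) z = th z.1 * 'D_(delta_mx 0 j) psi z.2.
Proof. by move=> sth spsi; rewrite /d_x derive_tensor//= derive0 mulr0 addr0. Qed.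

End SpacetimeTest.

(** * Integrals of real-valued functions *)

Section Toolkit.
Context {dT : measure_display} {T : measurableType dT} {R : realType}.
Variable mu : {measure set T -> \bar R}.
Implicit Types (f g : T -> R).

Definition L1 f : Prop := mu.-integrable setT (EFin \o f).

Lemma L1_meas f : L1 f -> measurable_fun setT f.
Proof. by move=> /integrableP[/measurable_EFinP]. Qed.

Lemma L1P f : L1 f <-> measurable_fun setT f /\ (\int[mu]_x `|f x|%:E < +oo)%E.
Proof.
split=> [/integrableP[/measurable_EFinP mf fi]//|[mf fi]].
by apply/integrableP; split=> //; exact/measurable_EFinP.
Qed.

Lemma L1_fin f : L1 f -> (\int[mu]_x (f x)%:E)%E \is a fin_num.
Proof. exact: integrable_fin_num. Qed.

Lemma EFinI f : L1 f -> (\int[mu]_x f x)%:E = (\int[mu]_x (f x)%:E)%E.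
Proof. by move=> fi; rewrite /Rintegral fineK// L1_fin. Qed.

Lemma L1_dom g f : measurable_fun setT f -> L1 g -> (forall x, `|f x| <= g x) -> L1 f.
Proof.
move=> mf gi fg; apply: (le_integrable measurableT _ _ gi).
  exact/measurable_EFinP.
by move=> x _ /=; rewrite lee_fin (le_trans (fg x))// ler_norm.
Qed.

Lemma L1D f g : L1 f -> L1 g -> L1 (fun x => f x + g x).
Proof. by move=> fi gi; exact: (integrableD measurableT fi gi). Qed.

Lemma L1B f g : L1 f -> L1 g -> L1 (fun x => f x - g x).
Proof. by move=> fi gi; exact: (integrableB measurableT fi gi). Qed.

Lemma L1Z k f : L1 f -> L1 (fun x => k * f x).
Proof. by move=> fi; exact: (integrableZl measurableT k fi). Qed.

Lemma L1N f : L1 f -> L1 (fun x => - f x).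
Proof. by move=> fi; exact: (integrableN fi). Qed.

Lemma L1_norm f : L1 f -> L1 (fun x => `|f x|).
Proof. by move=> fi; exact: (integrable_abse fi). Qed.

Lemma L1_0 : L1 (fun=> 0).
Proof. exact: integrable0. Qed.

Lemma L1_sum (I : Type) (s : seq I) (F : I -> T -> R) :
  (forall i, L1 (F i)) -> L1 (fun x => \sum_(i <- s) F i x).
Proof.
move=> Fi; elim: s => [|i s IH].
  by under eq_fun do rewrite big_nil; exact: L1_0.
by under eq_fun do rewrite big_cons; exact: L1D.
Qed.

Lemma L1_mulb M f g : L1 f -> measurable_fun setT g -> (forall x, `|g x| <= M) ->
  L1 (fun x => f x * g x).
Proof.
move=> fi mg gM; apply: (@L1_dom (fun x => M * `|f x|)).
- by apply: measurable_funM => //; exact: L1_meas.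
- by apply: L1Z; exact: L1_norm.
- by move=> x; rewrite normrM mulrC ler_wpM2r.
Qed.

Lemma ID f g : L1 f -> L1 g ->
  \int[mu]_x (f x + g x) = \int[mu]_x f x + \int[mu]_x g x.
Proof. by move=> fi gi; exact: RintegralD. Qed.

Lemma IB f g : L1 f -> L1 g ->
  \int[mu]_x (f x - g x) = \int[mu]_x f x - \int[mu]_x g x.
Proof. by move=> fi gi; exact: RintegralB. Qed.

Lemma IZ k f : L1 f -> \int[mu]_x (k * f x) = k * \int[mu]_x f x.
Proof. by move=> fi; exact: RintegralZl. Qed.

Lemma IN f : L1 f -> \int[mu]_x (- f x) = - \int[mu]_x f x.
Proof.
move=> fi; rewrite -mulN1r -IZ//.
by apply: eq_Rintegral => x _; rewrite mulN1r.
Qed.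

Lemma I0 : \int[mu]_x 0 = 0 :> R.
Proof. by rewrite /Rintegral integral0. Qed.

Lemma Isum (I : Type) (s : seq I) (F : I -> T -> R) : (forall i, L1 (F i)) ->
  \int[mu]_x (\sum_(i <- s) F i x) = \sum_(i <- s) \int[mu]_x F i x.
Proof.
move=> Fi; elim: s => [|i s IH].
  by rewrite big_nil -[RHS]I0; apply: eq_Rintegral => x _; rewrite big_nil.
rewrite big_cons -IH -ID//; last exact: L1_sum.
by apply: eq_Rintegral => x _; rewrite big_cons.
Qed.

Lemma Ile f g : L1 f -> L1 g -> (forall x, f x <= g x) ->
  \int[mu]_x f x <= \int[mu]_x g x.
Proof. by move=> fi gi fg; exact: le_Rintegral. Qed.

Lemma I_ge0 f : (forall x, 0 <= f x) -> 0 <= \int[mu]_x f x.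
Proof. by move=> f0; apply: Rintegral_ge0. Qed.

Lemma Iabs f : L1 f -> `|\int[mu]_x f x| <= \int[mu]_x `|f x|.
Proof. by move=> fi; exact: le_normr_Rintegral. Qed.

Lemma Idom f g : measurable_fun setT f -> L1 g -> (forall x, `|f x| <= g x) ->
  `|\int[mu]_x f x| <= \int[mu]_x g x.
Proof.
move=> mf gi fg; have fi := L1_dom mf gi fg.
by apply: (le_trans (Iabs fi)); apply: Ile => //; exact: L1_norm.
Qed.

Lemma Iae f g : measurable_fun setT f -> measurable_fun setT g ->
  {ae mu, forall x, f x = g x} -> \int[mu]_x f x = \int[mu]_x g x.
Proof.
move=> mf mg fg; rewrite /Rintegral; congr fine; apply: ae_eq_integral => //.
- exact/measurable_EFinP.
- exact/measurable_EFinP.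
- by apply: filterS fg => x ->.
Qed.

Lemma L1_ae f g : measurable_fun setT g ->
  {ae mu, forall x, f x = g x} -> L1 f -> L1 g.
Proof.
move=> mg fg /L1P[mf fi]; apply/L1P; split => //.
rewrite (@ge0_ae_eq_integral _ _ _ _ _ _ (fun x => `|f x|%:E))//.
- by apply/measurable_EFinP; exact: measurableT_comp.
- by apply/measurable_EFinP; exact: measurableT_comp.
- by apply: filterS fg => x ->.
Qed.

Lemma IDCT (f_ : nat -> T -> R) f g : (forall n, measurable_fun setT (f_ n)) ->
  measurable_fun setT f -> {ae mu, forall x, f_ n x @[n --> \oo] --> f x} ->
  L1 g -> (forall n, {ae mu, forall x, `|f_ n x| <= g x}) ->
  L1 f /\ \int[mu]_x f_ n x @[n --> \oo] --> \int[mu]_x f x.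
Proof.
move=> mf_ mf f_f gi f_g.
have [||| |fi _ cvgf] := @dominated_convergence _ _ _ mu setT measurableT
    (fun n => EFin \o f_ n) (EFin \o f) (EFin \o g) _ _ _ gi.
- by move=> n; exact/measurable_EFinP.
- exact/measurable_EFinP.
- by apply: filterS f_f => x fx _; apply: cvg_EFin => //; exact: nearW.
- have /ae_foralln : forall n, \forall x \ae mu, `|f_ n x| <= g x by [].
  by apply: filterS => x h n _; rewrite lee_fin.
split => //; apply/fine_cvg; rewrite fineK ?L1_fin//.
Qed.

End Toolkit.

Section ToolkitProb.
Context {dT : measure_display} {T : measurableType dT} {R : realType}.
Variable mu : probability T R.
Implicit Types (f g : T -> R).

Lemma L1_bdd M f : measurable_fun setT f -> (forall x, `|f x| <= M) -> L1 mu f.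
Proof.
move=> mf fM; apply: measurable_bounded_integrable => //.
  exact: fin_num_fun_lty.
exists M; split; first exact: num_real.
by move=> x Mx y _ /=; apply: le_trans (fM y) (ltW Mx).
Qed.

Lemma L1_cst c : L1 mu (fun=> c).
Proof. by apply: (@L1_bdd `|c|). Qed.

Lemma I_cst c : \int[mu]_x c = c.
Proof. by rewrite /Rintegral integral_cst// [X in (_ * X)%E]probability_setT mule1. Qed.

End ToolkitProb.

Section MeasurableParam.
Context {d1 d2 : measure_display} {T1 : measurableType d1} {T2 : measurableType d2}
  {R : realType}.
Variable (m2 : {sigma_finite_measure set T2 -> \bar R}).
Implicit Types (f : T1 * T2 -> R).

(** Tonelli's theorem is applied to the positive and to the negative part. Where the difference of
    the two integrals is infinite, the real integral takes the default value of [fine]. *)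
Lemma measurable_param f : measurable_fun setT f ->
  measurable_fun setT (fun x => \int[m2]_y f (x, y)).
Proof.
move=> mf; rewrite /Rintegral; apply: measurableT_comp => //.
under eq_fun do rewrite integralE.
apply: emeasurable_funB.
- set F := (X in measurable_fun _ X).
  have -> : F = fubini_F m2 (fun z => ((EFin \o f)^\+ z)%E).
    by apply/funext => x; apply: eq_integral => y _; rewrite !funeposE.
  apply: measurable_fun_fubini_tonelli_F => //.
  by apply: measurable_funepos; exact/measurable_EFinP.
- set F := (X in measurable_fun _ X).
  have -> : F = fubini_F m2 (fun z => ((EFin \o f)^\- z)%E).
    by apply/funext => x; apply: eq_integral => y _; rewrite !funenegE.
  apply: measurable_fun_fubini_tonelli_F => //.
  by apply: measurable_funeneg; exact/measurable_EFinP.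
Qed.

Lemma measurable_swap_fun f : measurable_fun setT f ->
  measurable_fun setT (fun z : T2 * T1 => f (z.2, z.1)).
Proof.
move=> mf; apply: (measurableT_comp mf).
by apply/measurable_fun_pairP; split => /=; [exact: measurable_snd|exact: measurable_fst].
Qed.

End MeasurableParam.

Section ToolkitFubini.
Context {d1 d2 : measure_display} {T1 : measurableType d1} {T2 : measurableType d2}
  {R : realType}.
Variables (m1 : {sigma_finite_measure set T1 -> \bar R})
  (m2 : {sigma_finite_measure set T2 -> \bar R}).
Implicit Types (f : T1 * T2 -> R).

Lemma L1_prod f : measurable_fun setT f ->
  (\int[m1]_x \int[m2]_y `|f (x, y)|%:E < +oo)%E -> L1 (m1 \x m2)%E f.
Proof.
by move=> mf fi; apply/integrable12ltyP => //; exact/measurable_EFinP.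
Qed.

Lemma L1_prod_bound f g : measurable_fun setT f -> L1 m1 g ->
  (forall x, L1 m2 (fun y => f (x, y))) ->
  (forall x, \int[m2]_y `|f (x, y)| <= g x) -> L1 (m1 \x m2)%E f.
Proof.
move=> mf gi fi fg; apply: L1_prod => //.
apply: (@le_lt_trans _ _ (\int[m1]_x (g x)%:E)%E); last first.
  by have := L1_fin gi; rewrite ge0_fin_numE//; apply: integral_ge0 => x _;
    rewrite lee_fin (le_trans _ (fg x))// I_ge0.
apply: ge0_le_integral => //.
- by move=> x _; exact: integral_ge0.
- apply: (measurable_fun_fubini_tonelli_F (fun z => `|f z|%:E)) => //.
  by apply/measurable_EFinP; exact: measurableT_comp.
- by apply/measurable_EFinP; exact: L1_meas gi.
- by move=> x _; rewrite -EFinI ?lee_fin//; exact: L1_norm.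
Qed.

(** The slices are integrable for almost every [x] only, so the real inner integral and the extended
    one of Fubini's theorem are compared almost everywhere; measurability comes from
    [measurable_param]. *)
Lemma L1_fubini1 f : L1 (m1 \x m2)%E f -> L1 m1 (fun x => \int[m2]_y f (x, y)).
Proof.
move=> fi; have mf := L1_meas fi.
have aei := ae_integrable1 fi.
apply/integrableP; split; first by apply/measurable_EFinP; exact: measurable_param.
have /integrableP[mF FI] := integrable_fubini_F fi.
apply: le_lt_trans FI; apply: ae_ge0_le_integral => //.
- by apply: measurableT_comp => //; apply/measurable_EFinP; exact: measurable_param.
- exact: measurableT_comp.
- by apply: filterS aei => x fx _; rewrite /comp (EFinI fx).
Qed.

Lemma I_prod f : L1 (m1 \x m2)%E f ->
  \int[(m1 \x m2)%E]_z f z = \int[m1]_x \int[m2]_y f (x, y).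
Proof.
move=> fi; have mf := L1_meas fi; rewrite /Rintegral.
rewrite -(integral12_prod_meas1 fi); congr fine; apply: ae_eq_integral => //.
- exact: measurable_fubini_F fi.
- by apply/measurable_EFinP; exact: measurable_param.
- by apply: filterS (ae_integrable1 fi) => x fx _; rewrite /fubini_F /= -EFinI.
Qed.

End ToolkitFubini.

Lemma I_fubini {d1 d2 : measure_display} {T1 : measurableType d1} {T2 : measurableType d2}
  {R : realType} (m1 : {sigma_finite_measure set T1 -> \bar R})
  (m2 : {sigma_finite_measure set T2 -> \bar R}) (f : T1 * T2 -> R) :
  L1 (m1 \x m2)%E f ->
  \int[m1]_x \int[m2]_y f (x, y) = \int[m2]_y \int[m1]_x f (x, y).
Proof.
move=> fi; have mf := L1_meas fi; rewrite -I_prod// /Rintegral.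
rewrite -(integral21_prod_meas1 fi); congr fine; apply: ae_eq_integral => //.
- exact: measurable_fubini_G fi.
- apply/measurable_EFinP.
  have h := measurable_param m1 (measurable_swap_fun mf); exact: h.
- by apply: filterS (ae_integrable2 fi) => x fx _; rewrite /fubini_G /= -EFinI.
Qed.

(** * Translations and convolutions on the torus *)

Section TranslationLine.
Context {R : realType}.
Local Notation leb := (@lebesgue_measure R).

Lemma measurable_shift (a : R) :
  measurable_fun setT ((fun s => s + a) : measurableTypeR R -> measurableTypeR R).
Proof. exact: measurable_funD. Qed.

(** By uniqueness of Lebesgue measure it suffices to test the pushforward on intervals []x, y]]. *)
Lemma lebesgue_measure_shift (a : R) (A : set (measurableTypeR R)) : measurable A ->
  pushforward leb ((fun s => s + a) : measurableTypeR R -> measurableTypeR R) A = leb A.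
Proof.
move=> mA.
pose phi : measurableTypeR R -> measurableTypeR R := fun s => s + a.
pose H1 := @isMeasurableFun.Build _ _ _ _ phi (measurable_shift a).
pose F : {mfun measurableTypeR R >-> measurableTypeR R} := HB.pack phi H1.
rewrite -[LHS]/(pushforward leb F A).
apply/esym/lebesgue_measure_unique => //= _ [[x y]] _ <-.
rewrite /pushforward.
have -> : phi @^-1` [set` `]x, y]] = `](x - a), (y - a)]%classic.
  by apply/seteqP; split => s /=; rewrite !in_itv/= /phi ltrBlDr lerBrDr.
rewrite !lebesgue_measure_itv/= !lte_fin ltrD2r.
by case: ifP => // _; rewrite -!EFinB opprB addrA subrK.
Qed.

Lemma ge0_integral_shift (a : R) (D : set R) (f : R -> \bar R) : measurable D ->
  measurable_fun D f -> (forall s, D s -> 0 <= f s)%E ->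
  (\int[leb]_(s in D) f s =
   \int[leb]_(s in (fun s => s + a)%R @^-1` D) f (s + a)%R)%E.
Proof.
move=> mD mf f0.
pose phi : measurableTypeR R -> measurableTypeR R := fun s => s + a.
pose H1 := @isMeasurableFun.Build _ _ _ _ phi (measurable_shift a).
pose F : {mfun measurableTypeR R >-> measurableTypeR R} := HB.pack phi H1.
rewrite -(@ge0_integral_pushforward _ _ _ _ _ _ (measurable_funP F) leb D f)//; last first.
  by move=> y; rewrite inE => /f0.
by apply: eq_measure_integral => A mA _; apply/esym; exact: (lebesgue_measure_shift a).
Qed.

Lemma periodic_int (A : Type) (f : R -> A) : (forall s, f (s + 1) = f s) ->
  forall (m : int) s, f (s + m%:~R) = f s.
Proof.
move=> pf; have pn (n : nat) s : f (s + n%:R) = f s.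
  by elim: n s => [|n IH] s; rewrite ?addr0// -natr1 addrA pf.
by move=> [n|n] s; [exact: pn|rewrite NegzE mulrNz -[in RHS](subrK n.+1%:R s) pn].
Qed.

(** Once the integer part of [a] is removed, [[a, a + 1[] is cut at 1 and its right piece is moved
    back to [[0, a[]. Half-open intervals keep the pieces disjoint. *)
Lemma ge0_integral_periodic (a : R) (f : R -> \bar R) : measurable_fun setT f ->
  (forall s, 0 <= f s)%E -> (forall s, f (s + 1) = f s) ->
  (\int[leb]_(s in `[0%R, 1%R]) f (s + a)%R = \int[leb]_(s in `[0%R, 1%R]) f s)%E.
Proof.
move=> mf f0 pf.
wlog a01 : a / 0 <= a < 1.
  move=> h; rewrite -(h (a - (Num.floor a)%:~R)).
    by apply: eq_integral => s _; rewrite addrA -mulrNz periodic_int.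
  by have := floor_itv a; rewrite intrD => /andP[? ?]; apply/andP; split; lra.
have mfD (D : set R) : measurable_fun D f by exact: measurable_funTS.
have sh (x y : R) : (\int[leb]_(s in `[x, y[) f s =
    \int[leb]_(s in `[(x - 1)%R, (y - 1)%R[) f s)%E.
  rewrite (ge0_integral_shift 1)//.
  have -> : (fun s => s + 1) @^-1` [set` `[x, y[] = `[(x - 1), (y - 1)[%classic.
    by apply/seteqP; split => s /=; rewrite !in_itv/= lerBlDr ltrBrDr.
  by apply: eq_integral => s _; exact: pf.
have spl (x y z : R) : x <= y <= z -> (\int[leb]_(s in `[x, z[) f s =
    \int[leb]_(s in `[x, y[) f s + \int[leb]_(s in `[y, z[) f s)%E.
  move=> /andP[xy yz].
  have dis : [disjoint `[x, y[%classic & `[y, z[%classic].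
    apply/disj_setPS => s [] /=; rewrite !in_itv/= => /andP[_ h1] /andP[h2 _].
    by have := lt_le_trans h1 h2; rewrite ltxx.
  rewrite -(@ge0_integral_setU _ _ _ leb)//; last exact: mfD.
  congr (integral _ _ _); apply/seteqP; split => s /=; rewrite !in_itv/=.
    by move=> /andP[h1 h2]; have [h|h] := ltP s y; [left|right]; rewrite ?h1 ?h2 ?h.
  move=> [] /andP[h1 h2]; apply/andP; split => //; first exact: lt_le_trans yz.
  exact: le_trans h1.
rewrite -[LHS]integral_itv_bndo_bndc; last first.
  by apply: measurable_funTS; apply: (measurableT_comp mf); exact: measurable_shift.
rewrite -[RHS]integral_itv_bndo_bndc//.
transitivity (\int[leb]_(s in `[a, (a + 1)%R[) f s)%E.
  rewrite [RHS](ge0_integral_shift a)//; congr (integral _ _ _).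
  by apply/seteqP; split => s /=; rewrite !in_itv/= => /andP[? ?]; apply/andP; split; lra.
rewrite (spl a 1 (a + 1)); last by lra.
rewrite (spl 0 a 1); last by lra.
by rewrite addeC (sh 1) subrr addrK.
Qed.

End TranslationLine.

(** * Integrals over the torus, one coordinate at a time *)

Section TorusIntegral.
Context {R : realType}.
Local Notation leb := (@lebesgue_measure R).

Lemma ge0_integral_torusS (m : nat) (f : 'rV[R]_m.+1 -> \bar R) :
  measurable_fun setT f -> (forall x, 0 <= f x)%E ->
  (\int[torus R m.+1]_x f x =
   \int[leb]_(a in `[0%R, 1%R]) \int[torus R m]_z f (row_cons (a, z)))%E.
Proof.
move=> mf f0 /=.
rewrite ge0_integral_distribution//.
have mfr : measurable_fun setT (f \o @row_cons R m).
  by apply: measurableT_comp => //; exact: measurable_row_cons.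
rewrite (@fubini_tonelli1 _ _ _ _ _ (uniform_prob (@ltr01 R)) (torus R m) (f \o @row_cons R m))//.
rewrite integral_uniform//.
- by rewrite subr0 invr1 mul1e.
- by apply: (measurable_fun_fubini_tonelli_F (f \o @row_cons R m)) => // z; exact: f0.
- by move=> a; apply: integral_ge0 => z _; exact: f0.
- by move=> z; exact: f0.
Qed.

Definition rV_tail (n : nat) (h : 'rV[R]_n.+1) : 'rV[R]_n := \row_j h 0 (lift ord0 j).

Lemma row_cons0 n (a : R) (z : 'rV[R]_n) : row_cons (a, z) 0 ord0 = a.
Proof.
have -> : ord0 = lshift n (ord0 : 'I_1) :> 'I_(1 + n) by exact/val_inj.
by apply: (etrans (row_mxEl _ _ _ _)); rewrite mxE eqxx.
Qed.

Lemma row_consS n (a : R) (z : 'rV[R]_n) j : row_cons (a, z) 0 (lift ord0 j) = z 0 j.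
Proof.
have -> : lift ord0 j = rshift 1 j :> 'I_(1 + n) by exact/val_inj.
exact: row_mxEr.
Qed.

Lemma rV_consP n (x y : 'rV[R]_n.+1) : x 0 ord0 = y 0 ord0 ->
  (forall j, x 0 (lift ord0 j) = y 0 (lift ord0 j)) -> x = y.
Proof.
move=> xy0 xyS; apply/rowP => i; case: (unliftP ord0 i) => [j|] -> //.
Qed.

Lemma row_consD n (a : R) (z : 'rV[R]_n) (h : 'rV[R]_n.+1) :
  row_cons (a, z) + h = row_cons (a + h 0 ord0, z + rV_tail h).
Proof.
by apply: rV_consP => [|j]; rewrite mxE ?row_cons0// !row_consS !mxE.
Qed.

Lemma torus_function_cons0 n (A : Type) (f : 'rV[R]_n.+1 -> A) : torus_function f ->
  forall a z, f (row_cons (a + 1, z)) = f (row_cons (a, z)).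
Proof.
move=> pf a z; rewrite -[RHS](pf _ ord0) row_consD !mxE eqxx /=; congr (f (row_cons (_, _))).
by apply/rowP => j; rewrite !mxE /= addr0.
Qed.

Lemma torus_function_consS n (A : Type) (f : 'rV[R]_n.+1 -> A) : torus_function f ->
  forall a, torus_function (fun z => f (row_cons (a, z))).
Proof.
move=> pf a z k; rewrite -[RHS](pf _ (lift ord0 k)) row_consD !mxE /= addr0.
congr (f (row_cons (_, _))).
by apply/rowP => j; rewrite !mxE /= (inj_eq lift_inj).
Qed.

Lemma measurable_addr n (h : 'rV[R]_n) : measurable_fun setT (fun x : 'rV[R]_n => x + h).
Proof.
apply: measurable_fun_mx => i j; under eq_fun do rewrite mxE.
by apply: measurable_funD => //; exact: measurable_mx_entry.
Qed.

Lemma measurable_add n :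
  measurable_fun setT (fun z : 'rV[R]_n * 'rV[R]_n => z.1 + z.2).
Proof.
apply: measurable_fun_mx => i j; under eq_fun do rewrite mxE.
apply: measurable_funD; apply: (measurableT_comp (@measurable_mx_entry R 1 n i j)).
  exact: measurable_fst.
exact: measurable_snd.
Qed.

(** Induction on the dimension: the tail of the shift is absorbed slice by slice, then the first
    coordinate by periodicity on the line. *)
Lemma ge0_integral_torus_shift n (h : 'rV[R]_n) (f : 'rV[R]_n -> \bar R) :
  measurable_fun setT f -> (forall x, 0 <= f x)%E -> torus_function f ->
  (\int[torus R n]_x f (x + h)%R = \int[torus R n]_x f x)%E.
Proof.
elim: n h f => [|n IH] h f mf f0 pf.
  by congr (integral _ _ _); apply/funext => x; congr f; apply/rowP => -[].
have mfh : measurable_fun setT (fun x : 'rV[R]_n.+1 => f (x + h)).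
  by apply: (measurableT_comp mf); exact: measurable_addr.
rewrite (ge0_integral_torusS mfh (fun x => f0 _)) (ge0_integral_torusS mf f0).
have mfr : measurable_fun setT (f \o @row_cons R n).
  by apply: measurableT_comp => //; exact: measurable_row_cons.
pose g a := (\int[torus R n]_z f (row_cons (a, z)))%E.
transitivity (\int[leb]_(a in `[0%R, 1%R]) g (a + h 0 ord0)%R)%E.
  apply: eq_integral => a _; rewrite /g -[RHS](IH (rV_tail h))//.
  - by apply: eq_integral => z _; rewrite row_consD.
  - exact: (measurableT_comp mfr (measurable_pair1 _)).
  - exact: torus_function_consS.
rewrite ge0_integral_periodic//.
- by apply: (measurable_fun_fubini_tonelli_F (f \o @row_cons R n)) => // z; exact: f0.
- by move=> s; apply: integral_ge0 => z _; exact: f0.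
- by move=> s; apply: eq_integral => z _; rewrite torus_function_cons0.
Qed.

End TorusIntegral.

Lemma ege0_cvg0 {R : realType} (u : nat -> \bar R) : (forall n, 0 <= u n)%E ->
  (forall e : R, 0 < e -> \forall n \near \oo, (u n <= e%:E)%E) -> u n @[n --> \oo] --> 0%E.
Proof.
move=> u0 ue; apply/fine_cvgP; split.
  by apply: filterS (ue 1 ltr01) => n un; rewrite ge0_fin_numE// (le_lt_trans un) ?ltry.
apply/cvgr0Pnorm_le => e e0; apply: filterS (ue e e0) => n un /=.
rewrite ger0_norm ?fine_ge0// -lee_fin fineK// ge0_fin_numE//.
by rewrite (le_lt_trans un) ?ltry.
Qed.

Lemma edominated_cvg0 {d} {T : measurableType d} {R : realType}
    (mu : {measure set T -> \bar R}) (u_ : nat -> T -> \bar R) (g : T -> \bar R) :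
  (forall n, measurable_fun setT (u_ n)) -> measurable_fun setT g ->
  (forall n x, 0 <= u_ n x)%E -> (forall n x, u_ n x <= g x)%E ->
  (\int[mu]_x g x < +oo)%E ->
  (forall x, (g x < +oo)%E -> u_ n x @[n --> \oo] --> 0%E) ->
  (\int[mu]_x u_ n x)%E @[n --> \oo] --> 0%E.
Proof.
move=> mu_ mg u0 ug gi u_0.
have g0 x : (0 <= g x)%E by exact: le_trans (u0 0 x) (ug 0 x).
have ig : mu.-integrable setT g.
  by apply/integrableP; split => //; under eq_integral do rewrite gee0_abs//.
have [||_ _] := @dominated_convergence _ _ _ mu setT measurableT u_ (cst 0%E) g
    mu_ (measurable_cst _) _ ig _.
- by apply: filterS (integrable_ae measurableT ig) => x /(_ I) gx _; apply: u_0; rewrite -ge0_fin_numE.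
- by apply/nearW => x n _; rewrite gee0_abs.
by rewrite integral0.
Qed.

Lemma ge0_le_integral_setU {d} {T : measurableType d} {R : realType}
    (mu : {measure set T -> \bar R}) (A B : set T) (f : T -> \bar R) :
  measurable A -> measurable B -> measurable_fun setT f -> (forall x, 0 <= f x)%E ->
  (\int[mu]_(x in A `|` B) f x <= \int[mu]_(x in A) f x + \int[mu]_(x in B) f x)%E.
Proof.
move=> mA mB mf f0; have mfD D : measurable_fun D f by exact: measurable_funTS.
have -> : A `|` B = A `|` (B `\` A).
  by apply/seteqP; split => x /=; have [] := pselect (A x); tauto.
have dis : [disjoint A & B `\` A] by apply/disj_setPS => x [] /= ? [].
rewrite ge0_integral_setU//; last exact: measurableD.
rewrite leeD2l// ge0_subset_integral//; by [exact: measurableD|move=> x []].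
Qed.

(** * Continuity of translations in L^1 *)

Section LineShift.
Context {R : realType}.
Local Notation leb := (@lebesgue_measure R).

(** Lebesgue measure on the unit interval in the form in which it is a factor of [torus], as a
    probability on the whole line. *)
Definition U01 : probability (measurableTypeR R) R := uniform_prob (@ltr01 R).

Lemma ge0_integral_U01 (f : R -> \bar R) : measurable_fun setT f ->
  (forall x, 0 <= f x)%E -> (\int[U01]_s f s = \int[leb]_(s in `[0%R, 1%R]) f s)%E.
Proof. by move=> mf f0; rewrite integral_uniform// subr0 invr1 mul1e. Qed.

Lemma U01_shift (a : R) (f : R -> \bar R) : measurable_fun setT f ->
  (forall s, 0 <= f s)%E -> (forall s, f (s + 1) = f s) ->
  (\int[U01]_s f (s + a)%R = \int[U01]_s f s)%E.
Proof.
move=> mf f0 pf; rewrite !ge0_integral_U01//; first exact: ge0_integral_periodic.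
by apply: (measurableT_comp mf); exact: measurable_shift.
Qed.

(** [f] is approximated in L^1 by a continuous function, for which dominated convergence applies;
    the two approximation errors and the continuous increment take [e / 4] each. *)
Lemma line_shift_cvg (f : R -> R) (h : nat -> R) :
  measurable_fun setT f -> (forall s, f (s + 1) = f s) ->
  (\int[U01]_s `|f s|%:E < +oo)%E ->
  h n @[n --> \oo] --> 0 -> (forall n, `|h n| <= 1) ->
  (\int[U01]_s `|f (s + h n) - f s|%:E)%E @[n --> \oo] --> 0%E.
Proof.
move=> mf pf fi h0 h1.
have mA (F : R -> R) : measurable_fun setT F -> measurable_fun setT (fun s => `|F s|%:E).
  by move=> mF; apply/measurable_EFinP; exact: measurableT_comp.
have mfs a : measurable_fun setT (fun s : R => f (s + a)).
  by apply: (measurableT_comp mf); exact: measurable_shift.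
have mfD (D : set R) (F : R -> \bar R) : measurable_fun setT F -> measurable_fun D F.
  exact: measurable_funTS.
rewrite ge0_integral_U01 in fi; last 2 first.
- exact: mA.
- by [].
(* The interval [[-1, 2]] contains every shift of [[0, 1]] by some [h n]; it is covered by three
   unit cells, on each of which periodicity gives the same integral. *)
have fiD : leb.-integrable `[-1, 2] (EFin \o f).
  apply/integrableP; split; first by apply: mfD; exact/measurable_EFinP.
  pose g s := `|f s|%:E.
  have mg : measurable_fun setT g by exact: mA.
  have g0 s : (0 <= g s)%E by rewrite lee_fin.
  have sh (a : R) : (\int[leb]_(s in `[a, (a + 1)%R]) g s = \int[leb]_(s in `[0%R, 1%R]) g s)%E.
    rewrite [LHS](@ge0_integral_shift _ a _ g (measurable_itv _) (mfD _ _ mg) (fun s _ => g0 s)).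
    rewrite -[RHS](ge0_integral_periodic a mg g0).
      congr (integral _ _ _); apply/seteqP; split => s /=; rewrite !in_itv/=.
        by move=> /andP[? ?]; apply/andP; split; lra.
      by move=> /andP[? ?]; apply/andP; split; lra.
    by move=> s; rewrite /g pf.
  apply: (@le_lt_trans _ _ (\int[leb]_(s in `[(-1)%R, (-1 + 1)%R] `|` `[0%R, (0 + 1)%R] `|` `[1%R, (1 + 1)%R]) g s)%E).
    apply: ge0_subset_integral => //.
    - by apply: measurableU => //; apply: measurableU.
    - exact: mfD.
    - move=> s /=; rewrite !in_itv/= => /andP[s1 s2].
      have [s0|s0] := leP s 0; first by left; left; apply/andP; split; lra.
      have [s3|s3] := leP s 1; first by left; right; apply/andP; split; lra.
      by right; apply/andP; split; lra.
  apply: (@le_lt_trans _ _ (\int[leb]_(s in `[(-1)%R, (-1 + 1)%R]) g s +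
      \int[leb]_(s in `[0%R, (0 + 1)%R]) g s + \int[leb]_(s in `[1%R, (1 + 1)%R]) g s)%E).
    apply: le_trans (ge0_le_integral_setU _ _ _ _ _) _ => //.
      by apply: measurableU.
    by rewrite leeD2r// ge0_le_integral_setU.
  by rewrite !sh; apply: lte_add_pinfty => //; apply: lte_add_pinfty.
apply: ege0_cvg0 => [n|e e0]; first exact: integral_ge0.
have [|g_ [cg_ gi_ gcvg]] := @approximation_continuous_integrable R _ f
  (measurable_itv `[(-1)%R, 2%R]) _ fiD.
  have := @lebesgue_measure_itv R `[(-1), 2]; rewrite /= => ->.
  by case: ifP => _; rewrite ?ltry.
have e4 : 0 < e / 4 by rewrite divr_gt0.
have [n0 gn0] : exists n0, (\int[leb]_(s in `[(-1)%R, 2%R]) `|(f s - g_ n0 s)%:E| <= (e / 4)%:E)%E.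
  move/fine_cvgP : gcvg => [fin gcvg].
  have /cvgr0Pnorm_le/(_ _ e4) gc := gcvg.
  near \oo => n0; exists n0.
  have h2 : `|fine (\int[leb]_(s in `[(-1)%R, 2%R]) `|(f s - g_ n0 s)%:E|)%E| <= e / 4 by near: n0.
  have h3 : (\int[leb]_(s in `[(-1)%R, 2%R]) `|(f s - g_ n0 s)%:E|)%E \is a fin_num by near: n0.
  by rewrite -(fineK h3) lee_fin (le_trans (ler_norm _)).
set g := g_ n0 in gn0; have cg : continuous g by exact: cg_.
have mg : measurable_fun setT g by exact: measurable_realfun.continuous_measurable_fun.
have mgs a : measurable_fun setT (fun s : R => g (s + a)).
  by apply: (measurableT_comp mg); exact: measurable_shift.
have [M gM] : exists M, forall s, -1 <= s <= 2 -> `|g s| <= M.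
  have [||c _ cM] := @EVT_max R (fun s => `|g s|) (-1) 2.
  - by lra.
  - by apply: continuous_subspaceT => x; apply: cvg_norm; exact: cg.
  - by exists `|g c| => s h2; apply: cM; rewrite in_itv.
have gcv : (\int[leb]_(s in `[0%R, 1%R]) `|g (s + h n) - g s|%:E)%E @[n --> \oo] --> 0%E.
  have [|||||_ _] := @dominated_convergence _ _ _ leb `[0%R, 1%R] (measurable_itv _)
    (fun n s => `|g (s + h n) - g s|%:E) (cst 0%E) (fun=> (M + M)%:E).
  - by move=> n; apply: mfD; apply: mA; apply: measurable_funB.
  - exact: measurable_cst.
  - apply/nearW => s _; apply: cvg_EFin; first exact: nearW.
    have <- : `|g s - g s| = 0 :> R by rewrite subrr normr0.
    apply: cvg_norm; apply: cvgB; last exact: cvg_cst.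
    apply: (@cvg_comp _ _ _ (fun n => s + h n) g _ (nbhs s)); last exact: cg.
    have hs : (s : R) + h n @[n --> \oo] --> (s : R) + 0.
      by apply: cvgD => //; exact: cvg_cst.
    by rewrite addr0 in hs; exact: hs.
  - apply/integrableP; split; first exact: measurable_cst.
    by rewrite integral_cst//= lebesgue_measure_itv/= lte_fin ltr01 -EFinD -EFinM ltry.
  - apply/nearW => s n /=; rewrite in_itv/= => /andP[s0 s1].
    have := h1 n; rewrite ler_norml => /andP[h2 h3].
    rewrite lee_fin normr_id (le_trans (ler_normB _ _))// lerD// gM//; apply/andP; split; lra.
  by rewrite integral0.
move/fine_cvgP : gcv => [gfin /cvgr0Pnorm_le/(_ _ e4) gcv].
near=> n.
have G1 : (\int[leb]_(s in `[0%R, 1%R]) `|g (s + h n) - g s|%:E <= (e / 4)%:E)%E.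
  have h2 : `|fine (\int[leb]_(s in `[0%R, 1%R]) `|g (s + h n) - g s|%:E)%E| <= e / 4 by near: n.
  have h3 : (\int[leb]_(s in `[0%R, 1%R]) `|g (s + h n) - g s|%:E)%E \is a fin_num by near: n.
  by rewrite -(fineK h3) lee_fin (le_trans (ler_norm _)).
have G2 : (\int[leb]_(s in `[0%R, 1%R]) `|g s - f s|%:E <= (e / 4)%:E)%E.
  apply: le_trans gn0; under eq_integral do rewrite distrC.
  apply: ge0_subset_integral => //.
  - by apply: mfD; apply: mA; exact: measurable_funB.
  - by move=> s /=; rewrite !in_itv/= => /andP[? ?]; apply/andP; split; lra.
have G3 : (\int[leb]_(s in `[0%R, 1%R]) `|f (s + h n) - g (s + h n)|%:E <= (e / 4)%:E)%E.
  apply: le_trans gn0.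
  rewrite [leRHS](ge0_integral_shift (h n))//; last first.
    by apply: mfD; apply: mA; exact: measurable_funB.
  apply: ge0_subset_integral => //.
  - by rewrite -[X in measurable X]setTI; exact: measurable_shift.
  - by apply: mfD; apply: mA; exact: measurable_funB.
  - have := h1 n; rewrite ler_norml => /andP[h2 h3].
    by move=> s /=; rewrite !in_itv/= => /andP[? ?]; apply/andP; split; lra.
rewrite ge0_integral_U01//; last by apply: mA; exact: measurable_funB.
pose F1 (s : R) : \bar R := `|f (s + h n) - g (s + h n)|%:E.
pose F2 (s : R) : \bar R := `|g (s + h n) - g s|%:E.
pose F3 (s : R) : \bar R := `|g s - f s|%:E.
apply: (@le_trans _ _ (\int[leb]_(s in `[0%R, 1%R]) (F1 s + F2 s + F3 s))%E).
  apply: ge0_le_integral => //.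
  - by apply: mfD; apply: mA; exact: measurable_funB.
  - apply: mfD; apply: emeasurable_funD; first apply: emeasurable_funD; apply: mA; exact: measurable_funB.
  - move=> s _; rewrite -!EFinD lee_fin.
    have -> : f (s + h n) - f s = f (s + h n) - g (s + h n) + (g (s + h n) - g s) + (g s - f s) by ring.
    by rewrite (le_trans (ler_normD _ _))// lerD2r ler_normD.
have mF1 : measurable_fun (`[0%R, 1%R]%classic : set R) F1 by apply: mfD; apply: mA; exact: measurable_funB.
have mF2 : measurable_fun (`[0%R, 1%R]%classic : set R) F2 by apply: mfD; apply: mA; exact: measurable_funB.
have mF3 : measurable_fun (`[0%R, 1%R]%classic : set R) F3 by apply: mfD; apply: mA; exact: measurable_funB.
have F1p s : (0 <= F1 s)%E by rewrite lee_fin.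
have F2p s : (0 <= F2 s)%E by rewrite lee_fin.
have F3p s : (0 <= F3 s)%E by rewrite lee_fin.
have F12 s : (0 <= F1 s + F2 s)%E by apply: adde_ge0; rewrite lee_fin.
rewrite (@ge0_integralD _ _ _ leb _ (measurable_itv _) (fun s => F1 s + F2 s)%E F3)//; last exact: emeasurable_funD.
rewrite (@ge0_integralD _ _ _ leb _ (measurable_itv _) F1 F2)//.
apply: (@le_trans _ _ ((e / 4)%:E + (e / 4)%:E + (e / 4)%:E)%E).
  by rewrite leeD// leeD.
by rewrite -!EFinD lee_fin; lra.
Unshelve. all: by end_near. Qed.

End LineShift.

Section TorusShift.
Context {R : realType}.

Lemma ge0_integral_torusU (m : nat) (f : 'rV[R]_m.+1 -> \bar R) :
  measurable_fun setT f -> (forall x, 0 <= f x)%E ->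
  (\int[torus R m.+1]_x f x =
   \int[U01]_a \int[torus R m]_z f (row_cons (a, z)))%E.
Proof.
move=> mf f0; rewrite ge0_integral_torusS// ge0_integral_U01//.
- apply: (measurable_fun_fubini_tonelli_F (f \o @row_cons R m)) => //.
    by apply: measurableT_comp => //; exact: measurable_row_cons.
  by move=> z; exact: f0.
- by move=> a; apply: integral_ge0 => z _; exact: f0.
Qed.

Lemma measurable_normE {d} {T : measurableType d} (F : T -> R) :
  measurable_fun setT F -> measurable_fun setT (fun s => `|F s|%:E).
Proof. by move=> mF; apply/measurable_EFinP; exact: measurableT_comp. Qed.

Lemma ge0_integral_prodT1 {d} {T : measurableType d} (mu : {sigma_finite_measure set T -> \bar R})
    {d'} {T' : measurableType d'} (F : T' * T -> \bar R) :
  measurable_fun setT F -> (forall z, 0 <= F z)%E ->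
  measurable_fun setT (fun x => \int[mu]_y F (x, y))%E.
Proof. by move=> mF F0; exact: (measurable_fun_fubini_tonelli_F F). Qed.

Lemma measurable_swapE {d d'} {T : measurableType d} {T' : measurableType d'}
    (F : T' * T -> \bar R) :
  measurable_fun setT F -> measurable_fun setT (fun z : T * T' => F (z.2, z.1)).
Proof.
move=> mF; apply: (measurableT_comp mF).
by apply/measurable_fun_pairP; split => /=; [exact: measurable_snd|exact: measurable_fst].
Qed.

Lemma integral_abs_shift_le {d} {T : measurableType d} (mu : {measure set T -> \bar R})
    (f g : T -> R) : measurable_fun setT f -> measurable_fun setT g ->
  (\int[mu]_x `|g x|%:E = \int[mu]_x `|f x|%:E)%E ->
  (\int[mu]_x `|g x - f x|%:E <= \int[mu]_x `|f x|%:E + \int[mu]_x `|f x|%:E)%E.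
Proof.
move=> mf mg gf; rewrite -{1}gf -ge0_integralD//; try exact: measurable_normE.
apply: ge0_le_integral => //.
- by apply: measurable_normE; exact: measurable_funB.
- by apply: emeasurable_funD; exact: measurable_normE.
- by move=> x _; rewrite lee_fin ler_normB.
Qed.

(* Continuity of translations in L^1 of the torus, one coordinate at a time. *)
Lemma torus_shift_cvg n (f : 'rV[R]_n -> R) (h : nat -> 'rV[R]_n) :
  measurable_fun setT f -> torus_function f ->
  (\int[torus R n]_x `|f x|%:E < +oo)%E ->
  (forall j, h k 0 j @[k --> \oo] --> 0) -> (forall k j, `|h k 0 j| <= 1) ->
  (\int[torus R n]_x `|f (x + h k) - f x|%:E)%E @[k --> \oo] --> 0%E.
Proof.
elim: n f h => [|n IH] f h mf pf fi h0 h1.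
  rewrite [X in X @ _ --> _](_ : _ = cst 0%E); first exact: cvg_cst.
  apply/funext => k; rewrite -[RHS](@integral0 _ _ _ (torus R 0) setT).
  apply: eq_integral => x _.
  by rewrite (_ : x + h k = x) ?subrr ?normr0//; apply/rowP => -[].
have mfr : measurable_fun setT (f \o @row_cons R n).
  by apply: measurableT_comp => //; exact: measurable_row_cons.
pose F (z : measurableTypeR R * 'rV[R]_n) := f (row_cons z).
have mF : measurable_fun setT F by [].
pose sh k (z : measurableTypeR R * 'rV[R]_n) := F (z.1 + h k 0 ord0, z.2).
have msh k : measurable_fun setT (sh k).
  apply: (measurableT_comp mF); apply/measurable_fun_pairP; split => /=.
    by apply: measurable_funD => //; exact: measurable_fst.
  exact: measurable_snd.
pose sv k (z : measurableTypeR R * 'rV[R]_n) := F (z.1, z.2 + rV_tail (h k)).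
have msv k : measurable_fun setT (sv k).
  apply: (measurableT_comp mF); apply/measurable_fun_pairP; split => /=.
    exact: measurable_fst.
  by apply: (measurableT_comp (measurable_addr _)); exact: measurable_snd.
have fi' : (\int[U01]_a \int[torus R n]_z `|F (a, z)|%:E < +oo)%E.
  by move: fi; rewrite ge0_integral_torusU//; exact: measurable_normE.
have fi2 : (\int[torus R n]_z \int[U01]_a `|F (a, z)|%:E < +oo)%E.
  rewrite -(fubini_tonelli (m1 := U01) (m2 := torus R n) (fun z => `|F z|%:E))//.
  exact: measurable_normE.
have F1 (z : 'rV[R]_n) : measurable_fun setT (fun a => F (a, z)).
  by apply: (measurableT_comp mF); exact: measurable_pair2.
have F2 a : measurable_fun setT (fun z => F (a, z)).
  by apply: (measurableT_comp mF); exact: measurable_pair1.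
have pF1 z s : F (s + 1, z) = F (s, z) by rewrite /F torus_function_cons0.
have pF2 a : torus_function (fun z => F (a, z)) by exact: torus_function_consS.
pose A k := (\int[torus R n]_z \int[U01]_a `|F (a + h k 0 ord0, z) - F (a, z)|%:E)%E.
pose B k := (\int[U01]_a \int[torus R n]_z `|F (a, z + rV_tail (h k))%R - F (a, z)|%:E)%E.
have mAk k : measurable_fun setT (fun z => `|sh k z - F z|%:E).
  by apply: measurable_normE; exact: measurable_funB.
have mBk k : measurable_fun setT (fun z => `|sv k z - F z|%:E).
  by apply: measurable_normE; exact: measurable_funB.
have A0 : A k @[k --> \oo] --> 0%E.
  apply: (@edominated_cvg0 _ _ _ _ _ (fun z => \int[U01]_a `|F (a, z)|%:E + \int[U01]_a `|F (a, z)|%:E)%E).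
  - move=> k; have := ge0_integral_prodT1 U01 (measurable_swapE (mAk k)); exact.
  - have h2 : measurable_fun setT (fun z : 'rV[R]_n => \int[U01]_a `|F (a, z)|%:E)%E.
      have := ge0_integral_prodT1 U01 (measurable_swapE (measurable_normE mF)); exact.
    exact: emeasurable_funD.
  - by move=> k z; exact: integral_ge0.
  - move=> k z; apply: integral_abs_shift_le => //.
      by apply: (measurableT_comp (F1 z)); exact: measurable_shift.
    rewrite (U01_shift (h k 0 ord0) (f := fun a => `|F (a, z)|%:E))//.
      exact: (measurable_normE (F1 z)).
    by move=> s; rewrite pF1.
  - have h2 : measurable_fun setT (fun z : 'rV[R]_n => \int[U01]_a `|F (a, z)|%:E)%E.
      have := ge0_integral_prodT1 U01 (measurable_swapE (measurable_normE mF)); exact.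
    rewrite ge0_integralD//; last 2 first.
    - by move=> z _; exact: integral_ge0.
    - by move=> z _; exact: integral_ge0.
    by apply: lte_add_pinfty.
  - move=> z gz; apply: (line_shift_cvg (F1 z) (pF1 z)) => //.
    by apply: le_lt_trans gz; rewrite leeDl//; exact: integral_ge0.
have B0 : B k @[k --> \oo] --> 0%E.
  apply: (@edominated_cvg0 _ _ _ _ _ (fun a => \int[torus R n]_z `|F (a, z)|%:E + \int[torus R n]_z `|F (a, z)|%:E)%E).
  - by move=> k; have := ge0_integral_prodT1 (torus R n) (mBk k); exact.
  - have h2 : measurable_fun setT (fun a => \int[torus R n]_z `|F (a, z)|%:E)%E.
      have := ge0_integral_prodT1 (torus R n) (measurable_normE mF); exact.
    exact: emeasurable_funD.
  - by move=> k z; exact: integral_ge0.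
  - move=> k a; apply: integral_abs_shift_le => //.
      by apply: (measurableT_comp (F2 a)); exact: measurable_addr.
    rewrite (ge0_integral_torus_shift (rV_tail (h k)) (f := fun z => `|F (a, z)|%:E))//.
      exact: (measurable_normE (F2 a)).
    by move=> s j; rewrite pF2.
  - have h2 : measurable_fun setT (fun a => \int[torus R n]_z `|F (a, z)|%:E)%E.
      have := ge0_integral_prodT1 (torus R n) (measurable_normE mF); exact.
    rewrite ge0_integralD//; last 2 first.
    - by move=> z _; exact: integral_ge0.
    - by move=> z _; exact: integral_ge0.
    by apply: lte_add_pinfty.
  - move=> a ga; apply: (IH (fun z => F (a, z)) (fun k => rV_tail (h k)) (F2 a) (pF2 a)) => //.
    + by apply: le_lt_trans ga; rewrite leeDl//; exact: integral_ge0.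
    + by move=> j; under eq_fun do rewrite mxE; exact: h0.
    + by move=> k j; rewrite mxE.
have AB0 : (A k + B k)%E @[k --> \oo] --> 0%E.
  by rewrite -[0%E]adde0; apply: cvgeD.
apply: (squeeze_cvge _ (cvg_cst 0%E) AB0); apply/nearW => k.
rewrite integral_ge0//=.
pose shv (z : measurableTypeR R * 'rV[R]_n) := F (z.1 + h k 0 ord0, z.2 + rV_tail (h k)).
have mshv : measurable_fun setT shv.
  apply: (measurableT_comp mF); apply/measurable_fun_pairP; split => /=.
    by apply: measurable_funD => //; exact: measurable_fst.
  by apply: (measurableT_comp (measurable_addr _)); exact: measurable_snd.
pose G1 z := `|shv z - sv k z|%:E; pose G2 z := `|sv k z - F z|%:E.
pose G3 z := `|shv z - F z|%:E.
have mG1 : measurable_fun setT G1 by apply: measurable_normE; exact: measurable_funB.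
have mG2 : measurable_fun setT G2 by exact: (mBk k).
have mG3 : measurable_fun setT G3 by apply: measurable_normE; exact: measurable_funB.
have G1p z : (0 <= G1 z)%E by rewrite lee_fin.
have G2p z : (0 <= G2 z)%E by rewrite lee_fin.
have G3p z : (0 <= G3 z)%E by rewrite lee_fin.
(* [shv - sv k] is the increment in the first coordinate, translated by the tail of [h k] in the
   others; that translation does not change the integral. *)
have -> : A k = (\int[(U01 \x torus R n)%E]_z G1 z)%E.
  rewrite [RHS](fubini_tonelli1 (m1 := U01) (m2 := torus R n) G1)//.
  transitivity (\int[U01]_a \int[torus R n]_z `|sh k (a, z) - F (a, z)|%:E)%E.
    apply/esym; apply: (fubini_tonelli (m1 := U01) (m2 := torus R n) (fun z => `|sh k z - F z|%:E)) => //.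
  apply: eq_integral => a _; rewrite /fubini_F.
  rewrite -[LHS](ge0_integral_torus_shift (rV_tail (h k)) (f := fun z => `|sh k (a, z) - F (a, z)|%:E))//.
    apply: measurable_normE; exact: (measurable_funB (F2 (a + h k 0 ord0)) (F2 a)).
  by move=> z j; rewrite /sh/= !pF2.
have -> : B k = (\int[(U01 \x torus R n)%E]_z G2 z)%E.
  exact: (etrans _ (esym (fubini_tonelli1 (m1 := U01) (m2 := torus R n) G2 mG2 G2p))).
rewrite ge0_integral_torusU//; last first.
  apply: measurable_normE; apply: measurable_funB => //.
  by apply: (measurableT_comp mf); exact: measurable_addr.
have -> : (\int[U01]_a \int[torus R n]_z `|f (row_cons (a, z) + h k) - f (row_cons (a, z))|%:E =
    \int[(U01 \x torus R n)%E]_z G3 z)%E.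
  apply: (etrans _ (esym (fubini_tonelli1 (m1 := U01) (m2 := torus R n) G3 mG3 G3p))).
  apply: eq_integral => a _; apply: eq_integral => z _.
  by rewrite row_consD.
rewrite -(@ge0_integralD _ _ _ (U01 \x torus R n)%E _ measurableT G1 G2)//.
apply: ge0_le_integral => //.
- exact: emeasurable_funD.
- move=> z _; rewrite -EFinD lee_fin.
  have -> : shv z - F z = shv z - sv k z + (sv k z - F z) by ring.
  exact: ler_normD.
Qed.

End TorusShift.

(** * Convolution with a periodic kernel *)

Section TorusReal.
Context {R : realType} {d : nat}.
Local Notation mu := (torus R d).
Implicit Types (f g k : 'rV[R]_d -> R) (x y h : 'rV[R]_d).

Lemma measurable_shiftr f h : measurable_fun setT f ->
  measurable_fun setT (fun x : 'rV[R]_d => f (x + h)).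
Proof. by move=> mf; apply: (measurableT_comp mf); exact: measurable_addr. Qed.

Lemma measurable_addl f h : measurable_fun setT f ->
  measurable_fun setT (fun x : 'rV[R]_d => f (h + x)).
Proof. by move=> mf; under eq_fun do rewrite addrC; exact: measurable_shiftr. Qed.

Lemma L1_shift f h : torus_function f -> L1 mu f -> L1 mu (fun x => f (x + h)).
Proof.
move=> pf /L1P[mf fi]; apply/L1P; split; first exact: measurable_shiftr.
rewrite (ge0_integral_torus_shift h (f := fun x => `|f x|%:E))//.
- exact: measurable_normE.
- by move=> x j; rewrite pf.
Qed.

Lemma I_shift f h : torus_function f -> measurable_fun setT f ->
  \int[mu]_x f (x + h) = \int[mu]_x f x.
Proof.
move=> pf mf; rewrite /Rintegral; congr fine; rewrite integralE [RHS]integralE.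
have mfE : measurable_fun setT (EFin \o f) by exact/measurable_EFinP.
congr (_ - _)%E.
- rewrite -[RHS](ge0_integral_torus_shift h (f := fun x => ((EFin \o f)^\+ x)%E)).
  + by apply: eq_integral => x _; rewrite !funeposE.
  + exact: measurable_funepos.
  + by move=> x; rewrite funepos_ge0.
  + by move=> x j; rewrite !funeposE /= pf.
- rewrite -[RHS](ge0_integral_torus_shift h (f := fun x => ((EFin \o f)^\- x)%E)).
  + by apply: eq_integral => x _; rewrite !funenegE.
  + exact: measurable_funeneg.
  + by move=> x; rewrite funeneg_ge0.
  + by move=> x j; rewrite !funenegE /= pf.
Qed.

Lemma measurable_subC :
  measurable_fun setT (fun z : 'rV[R]_d * 'rV[R]_d => z.2 - z.1).
Proof.
apply: measurable_fun_mx => i j; under eq_fun do rewrite !mxE.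
apply: measurable_funB; apply: (measurableT_comp (@measurable_mx_entry R 1 d i j)).
  exact: measurable_snd.
exact: measurable_fst.
Qed.

(** Convolution with the reflected kernel. The argument [y - x] makes [cv f k x] the pairing of [f]
    with a translate of [k], as in the weak formulations, and by [cvE] the average of [f (x + h)]
    with weight [k h]. The price is a minus sign in each derivative. *)
Definition cv f k x : R := \int[mu]_y (f y * k (y - x)).

Lemma measurable_subr k x : measurable_fun setT k ->
  measurable_fun setT (fun y : 'rV[R]_d => k (y - x)).
Proof. exact: measurable_shiftr. Qed.

Lemma L1_cv f k M x : L1 mu f -> measurable_fun setT k -> (forall y, `|k y| <= M) ->
  L1 mu (fun y => f y * k (y - x)).
Proof.
move=> fi mk kM; apply: (L1_mulb (M := M) fi); first exact: measurable_subr.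
by move=> y; exact: kM.
Qed.

Lemma L1_cvl f k M x : torus_function f -> L1 mu f -> measurable_fun setT k ->
  (forall y, `|k y| <= M) -> L1 mu (fun y => f (x + y) * k y).
Proof.
move=> pf fi mk kM; apply: (L1_mulb (M := M) _ mk kM).
by under eq_fun do rewrite addrC; exact: L1_shift.
Qed.

Lemma cvE f k x : torus_function f -> torus_function k ->
  measurable_fun setT f -> measurable_fun setT k ->
  cv f k x = \int[mu]_h (f (x + h) * k h).
Proof.
move=> pf pk mf mk; rewrite /cv -[LHS](I_shift x); last 2 first.
- move=> y j; rewrite pf; congr (_ * _).
  by rewrite addrAC pk.
- by apply: measurable_funM => //; exact: measurable_subr.
by apply: eq_Rintegral => y _; rewrite addrK addrC.
Qed.

Lemma periodic_cv f k : torus_function k -> torus_function (cv f k).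
Proof.
move=> pk x j; apply: eq_Rintegral => y _; congr (_ * _).
by rewrite -[LHS](pk _ j) opprD addrA subrK.
Qed.

Lemma measurable_cv f k : measurable_fun setT f -> measurable_fun setT k ->
  measurable_fun setT (cv f k).
Proof.
move=> mf mk.
apply: (measurable_param mu (f := fun z : 'rV[R]_d * 'rV[R]_d => f z.2 * k (z.2 - z.1))).
apply: measurable_funM; first by apply: (measurableT_comp mf); exact: measurable_snd.
apply: (measurableT_comp mk).
exact: measurable_subC.
Qed.

Lemma bounded_cv f k M x : L1 mu f -> measurable_fun setT k -> (forall y, `|k y| <= M) ->
  `|cv f k x| <= M * \int[mu]_y `|f y|.
Proof.
move=> fi mk kM; rewrite -IZ; last exact: L1_norm.
apply: Idom => //.
- by apply: measurable_funM; [exact: L1_meas fi|exact: measurable_subr].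
- by apply: L1Z; exact: L1_norm.
- by move=> y; rewrite normrM mulrC ler_wpM2r.
Qed.

(** Differentiation under the integral, dominated by [M * |f y|]. The direction [- e] in the
    hypothesis reflects that [x] occurs in [k (y - x)] with a minus sign. *)
Lemma is_derive_cv f k (kd : 'rV[R]_d -> R) M x (e : 'rV[R]_d) : L1 mu f -> measurable_fun setT k ->
  measurable_fun setT kd -> (forall z : 'rV[R]_d, is_derive z (- e) k (- kd z)) ->
  (forall y, `|k y| <= M) -> (forall y, `|kd y| <= M) ->
  is_derive x e (cv f k) (- cv f kd x).
Proof.
move=> fi mk mkd dk kM kdM.
have M0 : 0 <= M := le_trans (normr_ge0 _) (kM 0).
pose F (s : R) (y : 'rV[R]_d) := f y * k (y - (s *: e + x)).
have aff y : affine_with (fun s : R => y - (s *: e + x)) (fun s : R => - (s *: e)).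
  split; last by move=> a b s; apply/rowP => i; rewrite !mxE /GRing.scale/=; ring.
  move=> s; apply: (@continuousB R 'rV[R]_d R (cst y) (fun s => s *: e + x)).
    exact: cst_continuous.
  apply: (@continuousD R 'rV[R]_d R (fun s => s *: e) (cst x)).
    by apply: cvgZr_tmp; exact: cvg_id.
  exact: cst_continuous.
have dF s y : is_derive s (1 : R) (F ^~ y) (- (f y * kd (y - (s *: e + x)))).
  have [e1 e2] := affine_derive k s 1 (aff y).
  rewrite scale1r in e1 e2; have [d1 d2] := dk (y - (s *: e + x)).
  have dks : is_derive s (1 : R) (fun s => k (y - (s *: e + x))) (- kd (y - (s *: e + x))).
    by apply: DeriveDef; [exact: e2|rewrite -d2; exact: e1].
  by have := is_deriveZ (f y) dks; rewrite /GRing.scale/= mulrN.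
have I0 : (`]-1, 1[%classic : set R) 0 by rewrite /= in_itv/=; lra.
have := @cvg_differentiation_under_integral R _ _ mu F setT measurableT 0 (-1) 1 I0
  (fun s _ => L1_cv (s *: e + x) fi mk kM) (fun s y _ _ => @ex_derive _ _ _ _ _ _ _ (dF s y))
  (fun y => M * `|f y|) _ (L1Z M (L1_norm fi)) _.
have -> : (fun h : R => h^-1 *: (\int[mu]_y F (h + 0) y - \int[mu]_y F 0 y)) =
    (fun h : R => h^-1 *: (cv f k (h *: e + x) - cv f k x)).
  by apply/funext => h; rewrite addr0 /F scale0r add0r.
have -> : \int[mu]_y partial1of2 F 0 y = - cv f kd x.
  rewrite -IN; last exact: (L1_cv x fi mkd kdM).
  apply: eq_Rintegral => y _; rewrite partial1of2E.
  by have [_ ->] := dF 0 y; rewrite scale0r add0r.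
move=> H.
have {}H : h^-1 *: (cv f k (h *: e + x) - cv f k x) @[h --> (0 : R)^'] --> - cv f kd x.
  apply: H => [y|s y _ _]; first by rewrite mulr_ge0.
  rewrite partial1of2E; have [_ ->] := dF s y.
  by rewrite normrN normrM mulrC ler_wpM2r.
by apply: DeriveDef; [apply/cvg_ex; exists (- cv f kd x)|exact/cvg_lim].
Qed.

(* Difference quotients have mean zero by translation invariance. *)
Lemma I_derive0 (F DF : 'rV[R]_d -> R) M (e : 'rV[R]_d) : torus_function F -> measurable_fun setT F ->
  measurable_fun setT DF -> (forall x : 'rV[R]_d, is_derive x e F (DF x)) ->
  (forall x, `|F x| <= M) -> (forall x, `|DF x| <= M) -> \int[mu]_x DF x = 0.
Proof.
move=> pF mF mDF dF FM DFM.
pose hn (n : nat) : R := n.+1%:R^-1.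
have hn0 n : 0 < hn n by rewrite invr_gt0.
pose q n x := (hn n)^-1 * (F (x + hn n *: e) - F x).
have iF : L1 mu F by exact: (L1_bdd mu mF FM).
have q0 n : \int[mu]_x q n x = 0.
  rewrite /q IZ; last by apply: L1B => //; exact: L1_shift.
  by rewrite IB ?I_shift ?subrr ?mulr0//; exact: L1_shift.
have qcv x : q n x @[n --> \oo] --> DF x.
  have [/cvg_ex[l dl] dD] := dF x.
  have lD : l = DF x by rewrite -dD; apply/esym/cvg_lim.
  move/cvgr_dnbhsP : dl => /(_ hn); rewrite lD.
  have -> : (fun n => q n x) = (fun n => (hn n)^-1 *: ((F \o shift x) (hn n *: e) - F x)).
    by apply/funext => n; rewrite /q /= (addrC x).
  apply; split; last exact: cvg_harmonic.
  by move=> n; rewrite gt_eqF.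
(* By the mean value theorem along the segment, a difference quotient is a value of [DF]; the
   constant [M] then dominates all of them. *)
have qM n x : `|q n x| <= M.
  have dG s : is_derive s (1 : R) (fun s => F (x + s *: e)) (DF (x + s *: e)).
    have [e1 e2] := affine_derive F s 1 (affine_line x e).
    rewrite scale1r in e1 e2; have [d1 d2] := dF (x + s *: e).
    by apply: DeriveDef; [exact: e2|rewrite -d2; exact: e1].
  have [|c _] := @MVT_segment _ (fun s => F (x + s *: e)) _ 0 (hn n) (ltW (hn0 n)) (fun s _ => dG s).
    apply: continuous_subspaceT => s.
    by apply/differentiable_continuous/derivable1_diffP; have [] := dG s.
  rewrite scale0r addr0 subr0 => h; rewrite /q h mulrCA mulVf ?mulr1//.
  by rewrite gt_eqF.
have [|||_] := @IDCT _ _ _ mu q DF (fun=> M) _ mDF _ (L1_cst mu M) _.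
- move=> n; apply: measurable_funM => //; apply: measurable_funB => //.
  exact: measurable_shiftr.
- exact: nearW.
- by move=> n; exact: nearW.
under eq_fun do rewrite q0.
by move=> h; apply/esym; apply: (cvg_unique _ (cvg_cst 0) h).
Qed.

End TorusReal.

Section TorusProduct.
Context {R : realType}.

Lemma ge0_integral_torus_prod n (g : 'I_n -> R -> R) (c : 'I_n -> R) :
  (forall i, measurable_fun setT (g i)) -> (forall i s, 0 <= g i s) ->
  (forall i, \int[U01]_s (g i s)%:E = (c i)%:E)%E ->
  (\int[torus R n]_y (\prod_i g i (y 0 i))%:E = (\prod_i c i)%:E)%E.
Proof.
elim: n g c => [|n IH] g c mg g0 gc.
  rewrite big_ord0; transitivity (\int[torus R 0]_y (cst 1%E y))%E.
    by apply: eq_integral => y _; rewrite big_ord0.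
  by rewrite integral_cst// mul1e; exact: probability_setT.
have mp (J : finType) (j : J -> 'I_n.+1) : measurable_fun setT
    (fun y : 'rV[R]_n.+1 => \prod_i g (j i) (y 0 (j i))).
  apply: measurable_prod => i _; apply: (measurableT_comp (mg _)).
  exact: measurable_coord.
rewrite ge0_integral_torusU; last 2 first.
- by apply/measurable_EFinP; exact: (mp _ id).
- by move=> y; rewrite lee_fin prodr_ge0.
have mpn : measurable_fun setT
    (fun y : 'rV[R]_n => \prod_i g (lift ord0 i) (y 0 i)).
  apply: measurable_prod => i _; apply: (measurableT_comp (mg _)).
  exact: measurable_coord.
rewrite big_ord_recl mulrC EFinM.
transitivity (\int[U01]_a ((\prod_i c (lift ord0 i))%:E * (g ord0 a)%:E))%E; last first.
  rewrite ge0_integralZl//.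
  - by rewrite gc.
  - by apply/measurable_EFinP; exact: (mg ord0).
  - by move=> a _; rewrite lee_fin.
  - by rewrite -(IH _ _ (fun i => mg _) (fun i => g0 _) (fun i => gc _));
      apply: integral_ge0 => y _; rewrite lee_fin prodr_ge0.
apply: eq_integral => a _.
rewrite -(IH _ _ (fun i => mg _) (fun i => g0 _) (fun i => gc _)) muleC.
rewrite -ge0_integralZl//.
- by apply: eq_integral => z _; rewrite big_ord_recl row_cons0 EFinM; congr (_ * (_)%:E)%E;
    apply: eq_bigr => i _; rewrite row_consS.
- exact/measurable_EFinP.
- by move=> z _; rewrite lee_fin prodr_ge0.
- by rewrite lee_fin.
Qed.

(** The kernels are periodic, so their supports are described on the unit cell only; this brings
    such a description under the integral. *)
Lemma torus_cell n : {ae torus R n, forall y : 'rV[R]_n, forall i, 0 <= y 0 i <= 1}.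
Proof.
suff H i : {ae torus R n, forall y : 'rV[R]_n, 0 <= y 0 i <= 1} by exact: filter_forall H.
pose N := (fun y : 'rV[R]_n => y 0 i) @^-1` ~` `[0, 1].
have mN : measurable N.
  rewrite -[N]setTI; apply: (measurable_coord i) => //.
  by apply: measurableC; exact: measurable_itv.
exists N; split => //.
pose g (j : 'I_n) (s : R) : R := if j == i then \1_(~` `[0, 1]) s else 1.
pose c (j : 'I_n) : R := if j == i then 0 else 1.
have mg j : measurable_fun setT (g j).
  rewrite /g; case: eqP => _; last exact: measurable_cst.
  by apply: measurable_indic; apply: measurableC; exact: measurable_itv.
have g0 j s : 0 <= g j s by rewrite /g; case: eqP.
have gc j : (\int[U01]_s (g j s)%:E = (c j)%:E)%E.
  rewrite ge0_integral_U01; last 2 first.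
  - by apply/measurable_EFinP; exact: mg.
  - by move=> s; rewrite lee_fin.
  rewrite /g /c; case: eqP => _.
    by apply: integral0_eq => s /= s01; rewrite indicE memNset//= => /(_ s01).
  by rewrite integral_cst//= lebesgue_measure_itv/= lte_fin ltr01 oppr0 adde0 mul1e.
have := ge0_integral_torus_prod mg g0 gc.
have -> : \prod_j c j = 0 by rewrite (bigD1 i)//= /c eqxx mul0r.
move=> e0; apply: etrans e0; rewrite -[N]setIT -integral_indic//.
apply: eq_integral => y _; rewrite (bigD1 i)//= big1 ?mulr1; last first.
  by move=> j ji; rewrite /g (negbTE ji).
by rewrite /g eqxx.
Qed.

End TorusProduct.

(** * Mollifiers and oscillation estimates *)

Section PowR.
Context {R : realType}.
Implicit Types (a b c r x y : R).

Lemma powR_le a b r : 0 <= r -> 0 <= a -> a <= b -> a `^ r <= b `^ r.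
Proof.
move=> r0 a0 ab; apply: ge0_ler_powR => //; rewrite nnegrE//.
exact: le_trans ab.
Qed.

Lemma powR_superadd x y r : 1 <= r -> 0 <= x -> 0 <= y -> x `^ r + y `^ r <= (x + y) `^ r.
Proof.
move=> r1 x0 y0; have r0 : 0 < r by lra.
rewrite -!(mulr_powRB1 _ r0)// ?addr_ge0// mulrDl.
by apply: lerD; apply: ler_wpM2l => //; apply: powR_le; lra.
Qed.

(** Superadditivity of the power. It reduces continuity of translations in L^r to the case of L^1,
    applied to the powers themselves. *)
Lemma powR_sub_le x y r : 1 <= r -> 0 <= x -> 0 <= y -> `|x - y| `^ r <= `|x `^ r - y `^ r|.
Proof.
move=> r1; wlog yx : x y / y <= x.
  move=> h x0 y0; have [/h|/ltW xy] := leP y x; first exact.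
  by rewrite distrC (distrC (x `^ r)); exact: h.
move=> x0 y0; rewrite ger0_norm ?subr_ge0// (le_trans _ (ler_norm _))// lerBrDr.
by rewrite (le_trans (powR_superadd r1 _ y0)) ?subr_ge0// subrK.
Qed.

Lemma powR_add_le x y r : 0 <= r -> 0 <= x -> 0 <= y ->
  (x + y) `^ r <= 2 `^ r * (x `^ r + y `^ r).
Proof.
move=> r0; wlog yx : x y / y <= x.
  move=> h x0 y0; have [/h|/ltW xy] := leP y x; first exact.
  by rewrite addrC (addrC (x `^ r)); exact: h.
move=> x0 y0; apply: (@le_trans _ _ ((2 * x) `^ r)).
  by apply: powR_le => //; [rewrite addr_ge0|lra].
by rewrite powRM// ler_wpM2l ?powR_ge0// lerDl powR_ge0.
Qed.

(** The graph of the convex function [x]^ r[lies above its tangent at]c[. For]r >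
    1[this is Young's inequality for]a[and]c [^ (r - 1)] with exponents [r] and [r / (r - 1)]. *)
Lemma powR_tangent a c r : 1 <= r -> 0 <= a -> 0 <= c ->
  c `^ r + r * c `^ (r - 1) * (a - c) <= a `^ r.
Proof.
move=> r1 a0 c0; have r0 : 0 < r by lra.
have cr : c * c `^ (r - 1) = c `^ r by exact: mulr_powRB1.
have [->|rn1] := eqVneq r 1.
  by rewrite subrr powRr0 !powRr1// mulr1 mul1r; lra.
have r1' : 0 < r - 1 by rewrite subr_gt0 lt_neqAle eq_sym rn1.
pose q := r / (r - 1); have q0 : 0 < q by rewrite divr_gt0.
have rq : r^-1 + q^-1 = 1.
  by rewrite /q; field; rewrite (gt_eqF r0) (gt_eqF r1').
have := conjugate_powR a0 (powR_ge0 c (r - 1)) r0 q0 rq.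
have -> : (c `^ (r - 1)) `^ q = c `^ r.
  by rewrite -powRrM /q mulrC -mulrA mulVf ?mulr1// gt_eqF.
have -> : q^-1 = 1 - r^-1 by rewrite -rq addrC addKr.
rewrite -(ler_pM2l r0) mulrDr => h.
have e1 : r * (a `^ r / r) = a `^ r by rewrite mulrCA divff ?mulr1// gt_eqF.
have e2 : r * (c `^ r / q) = r * c `^ r - c `^ r.
  have -> : q^-1 = 1 - r^-1 by rewrite -rq addrC addKr.
  by rewrite mulrBr mulr1 mulrBr mulrCA divff ?mulr1// gt_eqF.
have e3 : r * (c `^ r * (1 - r^-1)) = r * c `^ r - c `^ r.
  by rewrite mulrBr mulr1 mulrBr mulrCA divff ?mulr1// gt_eqF.
rewrite e1 e3 in h.
have -> : r * c `^ (r - 1) * (a - c) = r * (a * c `^ (r - 1)) - r * c `^ r.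
  by rewrite -cr; ring.
lra.
Qed.

Lemma measurable_powRf {d} {T : measurableType d} (f : T -> R) r :
  measurable_fun setT f -> measurable_fun setT (fun z => f z `^ r).
Proof. by move=> mf; exact: (measurableT_comp (@measurable_powR R r) mf). Qed.

End PowR.

Lemma ge0_le_integralR {d} {T : measurableType d} {R : realType}
    (mu : {measure set T -> \bar R}) (f g : T -> R) :
  measurable_fun setT f -> measurable_fun setT g ->
  (forall x, 0 <= f x) -> (forall x, f x <= g x) ->
  (\int[mu]_x (f x)%:E <= \int[mu]_x (g x)%:E)%E.
Proof.
move=> mf mg f0 fg; apply: ge0_le_integral => //.
- by move=> x _; rewrite lee_fin.
- exact/measurable_EFinP.
- exact/measurable_EFinP.
- by move=> x _; rewrite lee_fin.
Qed.

Lemma L1_ge0 {d} {T : measurableType d} {R : realType}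
    (mu : {measure set T -> \bar R}) (f : T -> R) :
  measurable_fun setT f -> (forall x, 0 <= f x) -> (\int[mu]_x (f x)%:E < +oo)%E -> L1 mu f.
Proof.
move=> mf f0 fi; apply/L1P; split => //.
by rewrite (eq_integral (fun x => (f x)%:E))// => x _; rewrite ger0_norm.
Qed.

(** The tangent inequality at the mean [c] is integrated against the probability density [k], which
    cancels its linear term. If the right-hand side is infinite there is nothing to prove. *)
Lemma jensen_powR {d} {T : measurableType d} {R : realType}
    (mu : {measure set T -> \bar R}) (f k : T -> R) (r : R) : 1 <= r ->
  (forall x, 0 <= f x) -> (forall x, 0 <= k x) -> measurable_fun setT f ->
  L1 mu k -> \int[mu]_x k x = 1 -> L1 mu (fun x => f x * k x) ->
  (((\int[mu]_x (f x * k x)) `^ r)%:E <= \int[mu]_x (f x `^ r * k x)%:E)%E.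
Proof.
move=> r1 f0 k0 mf ki k1 fki; have mk := L1_meas ki.
set c := \int[mu]_x (f x * k x).
have c0 : 0 <= c by apply: I_ge0 => x; rewrite mulr_ge0.
have mfr : measurable_fun setT (fun x => f x `^ r * k x).
  by apply: measurable_funM => //; exact: measurable_powRf.
have frk0 x : 0 <= f x `^ r * k x by rewrite mulr_ge0 ?powR_ge0.
have [fin|] := ltP (\int[mu]_x (f x `^ r * k x)%:E)%E +oo%E; last first.
  by rewrite leye_eq => /eqP ->; rewrite leey.
have frki : L1 mu (fun x => f x `^ r * k x) by exact: L1_ge0.
rewrite -EFinI// lee_fin.
pose a := r * c `^ (r - 1).
apply: (@le_trans _ _ (\int[mu]_x ((c `^ r - a * c) * k x + a * (f x * k x)))).
  by rewrite ID ?IZ ?k1 ?mulr1 -/c ?subrK//; exact: L1Z.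
apply: Ile => //; first by apply: L1D; exact: L1Z.
move=> x; have := powR_tangent r1 (f0 x) c0; rewrite -/a => h.
have -> : (c `^ r - a * c) * k x + a * (f x * k x) = (c `^ r + a * (f x - c)) * k x by ring.
by rewrite ler_wpM2r.
Qed.

(* [K] is a mollifier on the torus with support in [0, 1/(n + 2)]^d modulo 1
   and partial derivatives [dK j]. *)
Record moll (R : realType) (d : nat) (A : R) (n : nat) (K : 'rV[R]_d -> R)
    (dK : 'I_d -> 'rV[R]_d -> R) : Prop := {
  mo_test : torus_test K ;
  mo_derive : forall z h : 'rV[R]_d, is_derive z h K (\sum_i h 0 i * dK i z) ;
  mo_meas : measurable_fun setT K ;
  mo_measd : forall j, measurable_fun setT (dK j) ;
  mo_perd : forall j, torus_function (dK j) ;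
  mo_ge0 : forall y, 0 <= K y ;
  mo_bdd : exists M, forall y, `|K y| <= M /\ forall j, `|dK j y| <= M ;
  mo_int : \int[torus R d]_y K y = 1 ;
  mo_intd : forall j, \int[torus R d]_y `|dK j y| <= A * n.+2%:R ;
  mo_supp : forall y : 'rV[R]_d, (forall i, 0 <= y 0 i <= 1) ->
    (exists i, n.+2%:R^-1 < y 0 i) -> K y = 0 /\ forall j, dK j y = 0
}.

Lemma moll_exists (R : realType) (d : nat) :
  exists2 A : R, 0 < A & forall n, exists K dK, @moll R d A n K dK.
Proof.
have [C C0 kex] := @kernel1_exists R; exists C => // n.
have [k [kd [sk dk ckd pk pkd k0 kC kdC ksupp kdsupp kint]]] := kex n.
set N : R := n.+2%:R in kC kdC ksupp kdsupp.
have N0 : 0 < N by rewrite ltr0n.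
have ck : continuous k by exact: smooth_continuous.
have mk : measurable_fun setT k by exact: measurable_realfun.continuous_measurable_fun.
have mkd : measurable_fun setT kd by exact: measurable_realfun.continuous_measurable_fun.
have mM : measurable_fun setT (@prodk R d k) by exact: measurable_prodk.
have mMd j : measurable_fun setT (@dprodk R d k kd j) by exact: measurable_dprodk.
have kn s : `|k s| <= C * N by rewrite ger0_norm.
pose M := C * N + 1; pose Md := C * N ^+ 2.
have M1 : 1 <= M by rewrite /M lerDr mulr_ge0// ltW.
have Md0 : 0 <= Md by rewrite mulr_ge0 ?exprn_ge0// ltW.
have kM s : `|k s| <= M by rewrite (le_trans (kn s))// lerDl.
have B1 y := @bounded_prodk R d k M (le_trans ler01 M1) kM y.
have B2 j y := @bounded_dprodk R d k kd M Md j M1 Md0 kM kdC y.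
have kU : (\int[U01]_s (k s)%:E = 1%:E)%E.
  by rewrite ge0_integral_U01//; exact/measurable_EFinP.
have prod0 y : 0 <= @prodk R d k y by apply: prodr_ge0.
exists (prodk k), (dprodk k kd); split.
- exact: torus_test_prodk.
- by move=> z h; exact: is_derive_prodk.
- exact: mM.
- exact: mMd.
- by move=> j; exact: periodic_dprodk.
- exact: prod0.
- exists (M ^+ d + Md * M ^+ d) => y; split.
    by rewrite (le_trans (B1 y))// lerDl mulr_ge0// exprn_ge0// (le_trans ler01).
  by move=> j; rewrite (le_trans (B2 j y))// lerDr exprn_ge0// (le_trans ler01).
- have := @ge0_integral_torus_prod R d (fun=> k) (fun=> 1) (fun=> mk) (fun=> k0) (fun=> kU).
  by rewrite /Rintegral /prodk => ->; rewrite big1.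
- move=> j.
  pose g (i : 'I_d) (s : R) := if i == j then `|kd s| else k s.
  have mg i : measurable_fun setT (g i).
    by rewrite /g; case: eqP => // _; exact: measurableT_comp.
  have g0 i s : 0 <= g i s by rewrite /g; case: eqP.
  (* [|kd|] is at most [C * N ^+ 2] and on the unit interval lives on a set of length at most
     [1 / N]. In the product only one factor is differentiated, the other ones have mass 1. *)
  have bd : (\int[U01]_s `|kd s|%:E <= (C * N)%:E)%E.
    rewrite ge0_integral_U01//; last exact: measurable_normE.
    apply: (@le_trans _ _ (\int[lebesgue_measure]_(s in `[0%R, (N^-1)%R]) Md%:E)%E); last first.
      rewrite integral_cst//= lebesgue_measure_itv/= lte_fin invr_gt0 N0 oppr0 adde0.
      by rewrite -EFinM lee_fin /Md expr2 mulrA -[leLHS]mulrA divff ?mulr1// gt_eqF.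
    have N1 : N^-1 <= 1 by rewrite invf_le1// ler1n.
    apply: (@le_trans _ _ (\int[lebesgue_measure]_(s in `[0%R, (N^-1)%R]) `|kd s|%:E)%E).
      rewrite [leRHS]integral_mkcond [leLHS]integral_mkcond.
      rewrite le_eqVlt; apply/orP; left; apply/eqP; apply: eq_integral => s _.
      rewrite !patchE; case: ifPn => [|sn]; last first.
        case: ifPn => // h; suff h' : s \in `[0%R, 1%R]%classic by rewrite h' in sn.
        move: h; rewrite !inE/= !in_itv/= => /andP[s0 h].
        by apply/andP; split => //; exact: le_trans h _.
      rewrite inE/= in_itv/= => /andP[s0 s1]; case: ifPn => // h.
      rewrite kdsupp ?normr0// s1 andbT.
      move: h; rewrite notin_setE/= in_itv/= s0/= => /negP; rewrite -ltNge => /ltW//.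
    apply: ge0_le_integral => //.
    - by apply: measurable_funTS; exact: measurable_normE.
    - by move=> s _; rewrite lee_fin.
  have bf : (\int[U01]_s `|kd s|%:E)%E \is a fin_num.
    rewrite ge0_fin_numE; first by rewrite (le_lt_trans bd)// ltry.
    by apply: integral_ge0.
  pose c (i : 'I_d) : R := if i == j then fine (\int[U01]_s `|kd s|%:E)%E else 1.
  have gc i : (\int[U01]_s (g i s)%:E = (c i)%:E)%E.
    by rewrite /g /c; case: eqP => // _; rewrite fineK.
  have -> : \int[torus R d]_y `|dprodk k kd j y| = \prod_i c i.
    have := ge0_integral_torus_prod mg g0 gc.
    rewrite /Rintegral => h; rewrite -[RHS]/(fine (_)%:E) -h.
    congr fine; apply: eq_integral => y _; congr EFin.
    rewrite [LHS]normrM [RHS](bigD1 j)//= {1}/g eqxx; congr (_ * _).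
    by rewrite normr_prod; apply: eq_bigr => i /negbTE ij; rewrite /g ij ger0_norm.
  rewrite (bigD1 j)//= /c eqxx big1 ?mulr1; last by move=> i /negbTE ->.
  by rewrite -lee_fin fineK.
- move=> y y01 [i yi].
  have yi' : N^-1 <= y 0 i <= 1.
    by have /andP[_ ->] := y01 i; rewrite (ltW yi).
  split; first by rewrite /prodk (bigD1 i)//= ksupp// mul0r.
  move=> j; rewrite /dprodk; have [<-|ij] := eqVneq i j; first by rewrite kdsupp// mul0r.
  by rewrite (bigD1 i)//= ksupp// mul0r mulr0.
Qed.

Lemma cvge0D (R : realType) (a b : nat -> \bar R) : a @ \oo --> 0%E -> b @ \oo --> 0%E ->
  (a k + b k)%E @[k --> \oo] --> 0%E.
Proof. by move=> ca cb; rewrite -[0%E]adde0; apply: cvgeD. Qed.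

(** * Moduli of continuity in L^r and their averages over a kernel *)

Section Oscillation.
Context {R : realType} {d : nat}.
Local Notation mu := (torus R d).
Implicit Types (f g u kap : 'rV[R]_d -> R) (x y h : 'rV[R]_d) (r : R).

(** The r-th power of the L^r modulus of continuity. Below, [osc] is its average over the shifts
    with weight [kap], and [dl] the pointwise average of the increments; Jensen's inequality relates
    the two. *)
Definition om r f h : \bar R := (\int[mu]_x (`|f (x + h)%R - f x| `^ r)%:E)%E.

Definition osc r kap f : \bar R := (\int[mu]_h ((kap h)%:E * om r f h))%E.

Definition dl kap f x : R := \int[mu]_h (`|f (x + h) - f x| * kap h).

Definition small (n : nat) h : Prop := forall i, 0 <= h 0 i <= n.+2%:R^-1.

Definition suppK (n : nat) kap : Prop := forall y, (forall i, 0 <= y 0 i <= 1) ->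
  (exists i, n.+2%:R^-1 < y 0 i) -> kap y = 0.

Lemma measurable_diff f : measurable_fun setT f ->
  measurable_fun setT (fun z : 'rV[R]_d * 'rV[R]_d => `|f (z.1 + z.2) - f z.1|).
Proof.
move=> mf; apply: measurableT_comp => //; apply: measurable_funB.
  by apply: (measurableT_comp mf); exact: measurable_add.
by apply: (measurableT_comp mf); exact: measurable_fst.
Qed.

Lemma measurable_diff1 f h : measurable_fun setT f ->
  measurable_fun setT (fun x : 'rV[R]_d => `|f (x + h) - f x|).
Proof.
move=> mf; apply: measurableT_comp => //; apply: measurable_funB => //.
exact: measurable_shiftr.
Qed.

Lemma measurable_diff2 f x : measurable_fun setT f ->
  measurable_fun setT (fun h : 'rV[R]_d => `|f (x + h) - f x|).
Proof.
move=> mf; apply: measurableT_comp => //; apply: measurable_funB => //.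
exact: measurable_addl.
Qed.

Lemma measurable_om r f : measurable_fun setT f -> measurable_fun setT (om r f).
Proof.
move=> mf.
pose F (z : 'rV[R]_d * 'rV[R]_d) : \bar R := (`|f (z.1 + z.2)%R - f z.1| `^ r)%:E.
have mF : measurable_fun setT F.
  by apply/measurable_EFinP; apply: measurable_powRf; exact: measurable_diff.
exact: (ge0_integral_prodT1 mu (measurable_swapE mF) (fun z => powR_ge0 _ _)).
Qed.

Lemma om_ge0 r f h : (0 <= om r f h)%E.
Proof. by apply: integral_ge0 => x _; rewrite lee_fin powR_ge0. Qed.

Lemma measurable_powRnE r f : measurable_fun setT f ->
  measurable_fun setT (fun x => (`|f x| `^ r)%:E).
Proof.
by move=> mf; apply/measurable_EFinP; apply: measurable_powRf; exact: measurableT_comp.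
Qed.

Lemma om_le r f h : 1 <= r -> measurable_fun setT f -> torus_function f ->
  (om r f h <= (2 `^ r)%:E * (\int[mu]_x (`|f x| `^ r)%:E + \int[mu]_x (`|f x| `^ r)%:E))%E.
Proof.
move=> r1 mf pf.
have mfh : measurable_fun setT (fun x : 'rV[R]_d => f (x + h)) by exact: measurable_shiftr.
rewrite -{1}(ge0_integral_torus_shift h (f := fun x => (`|f x| `^ r)%:E)); last 3 first.
- exact: measurable_powRnE.
- by move=> x; rewrite lee_fin powR_ge0.
- by move=> x j; rewrite pf.
rewrite -ge0_integralD//; last 2 first.
- exact: (measurable_powRnE r mfh).
- exact: measurable_powRnE.
rewrite -ge0_integralZl//; last 2 first.
- by apply: emeasurable_funD; [exact: (measurable_powRnE r mfh)|exact: measurable_powRnE].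
- by move=> x _; apply: adde_ge0; rewrite lee_fin powR_ge0.
apply: ge0_le_integral => //.
- by apply/measurable_EFinP; apply: measurable_powRf; exact: measurable_diff1.
- apply: emeasurable_funM => //.
  by apply: emeasurable_funD; [exact: (measurable_powRnE r mfh)|exact: measurable_powRnE].
- move=> x _; rewrite -EFinD -EFinM lee_fin (le_trans _ (powR_add_le _ _ _))//; last lra.
  by apply: powR_le => //; [lra|exact: ler_normB].
Qed.

(** The r-th powers [P] and [Q] of the positive and negative parts of [f] are in L^1, where
    translations are continuous; [powR_sub_le] then controls the r-th powers of the increments. *)
Lemma om_seq r f (h : nat -> 'rV[R]_d) : 1 <= r -> measurable_fun setT f ->
  torus_function f -> (\int[mu]_x (`|f x| `^ r)%:E < +oo)%E ->
  (forall j, h k 0 j @[k --> \oo] --> 0) -> (forall k j, `|h k 0 j| <= 1) ->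
  om r f (h k) @[k --> \oo] --> 0%E.
Proof.
move=> r1 mf pf fi h0 h1.
pose P x := Num.max (f x) 0 `^ r; pose Q x := Num.max (- f x) 0 `^ r.
have mm (u : 'rV[R]_d -> R) : measurable_fun setT u -> measurable_fun setT (fun x => Num.max (u x) 0).
  by move=> mu'; apply: measurable_maxr => //; exact: measurable_cst.
have mP : measurable_fun setT P by apply: measurable_powRf; exact: mm.
have mQ : measurable_fun setT Q.
  by apply: measurable_powRf; apply: mm; exact: measurableT_comp.
have pP : torus_function P by move=> x j; rewrite /P pf.
have pQ : torus_function Q by move=> x j; rewrite /Q pf.
have bP x : `|P x| <= `|f x| `^ r.
  rewrite ger0_norm ?powR_ge0//; apply: powR_le; [lra|by rewrite le_max lexx orbT|].
  by rewrite ge_max ler_norm normr_ge0.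
have bQ x : `|Q x| <= `|f x| `^ r.
  rewrite ger0_norm ?powR_ge0//; apply: powR_le; [lra|by rewrite le_max lexx orbT|].
  by rewrite ge_max -normrN ler_norm normr_ge0.
have mfr := measurable_powRnE r mf.
have iP : (\int[mu]_x `|P x|%:E < +oo)%E.
  apply: le_lt_trans fi; apply: ge0_le_integralR => //.
  - exact: measurableT_comp.
  - exact/measurable_EFinP.
have iQ : (\int[mu]_x `|Q x|%:E < +oo)%E.
  apply: le_lt_trans fi; apply: ge0_le_integralR => //.
  - exact: measurableT_comp.
  - exact/measurable_EFinP.
have cP := torus_shift_cvg mP pP iP h0 h1.
have cQ := torus_shift_cvg mQ pQ iQ h0 h1.
pose a k := (\int[mu]_x `|P (x + h k)%R - P x|%:E)%E.
pose b k := (\int[mu]_x `|Q (x + h k)%R - Q x|%:E)%E.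
have c0 : ((2 `^ r)%:E * (a k + b k))%E @[k --> \oo] --> 0%E.
  rewrite -[0%E](mule0 (2 `^ r)%:E); apply: cvgeZl => //.
  exact: cvge0D cP cQ.
apply: (squeeze_cvge _ (cvg_cst 0%E) c0); apply/nearW => k.
rewrite om_ge0 /a /b /=.
have mPk : measurable_fun setT (fun x => `|P (x + h k) - P x|) by exact: measurable_diff1.
have mQk : measurable_fun setT (fun x => `|Q (x + h k) - Q x|) by exact: measurable_diff1.
rewrite -ge0_integralD//; last 2 first.
- exact/measurable_EFinP.
- exact/measurable_EFinP.
rewrite -ge0_integralZl//; last 2 first.
- by apply: emeasurable_funD; exact/measurable_EFinP.
- by move=> x _; apply: adde_ge0; rewrite lee_fin normr_ge0.
apply: ge0_le_integral => //.
- by apply/measurable_EFinP; apply: measurable_powRf; exact: measurable_diff1.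
- by apply: emeasurable_funM => //; apply: emeasurable_funD; exact/measurable_EFinP.
- move=> x _; rewrite -EFinD -EFinM lee_fin.
  clear c0 a b; set a := f (x + h k); set b := f x.
  have ab : `|a - b| <= `|Num.max a 0 - Num.max b 0| + `|Num.max (- a) 0 - Num.max (- b) 0|.
    have -> : a - b = (Num.max a 0 - Num.max b 0) - (Num.max (- a) 0 - Num.max (- b) 0).
      have H z : z = Num.max z 0 - Num.max (- z) 0 :> R.
        by have [z0|z0] := leP z 0; [rewrite max_l ?oppr_ge0//; lra|rewrite max_r ?oppr_le0 ?ltW//; lra].
      by rewrite {1}(H a) {1}(H b); ring.
    exact: ler_normB.
  have r0 : 0 <= r by lra.
  apply: (le_trans (powR_le r0 (normr_ge0 _) ab)).
  apply: (le_trans (powR_add_le r0 (normr_ge0 _) (normr_ge0 _))).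
  rewrite ler_wpM2l ?powR_ge0// lerD// powR_sub_le// le_max lexx orbT//.
Qed.

(** Uniformity in the shift follows by contradiction: otherwise a bad shift can be chosen at each
    scale, and these shifts form a sequence that contradicts [om_seq]. *)
Lemma om_cvg r f : 1 <= r -> measurable_fun setT f ->
  torus_function f -> (\int[mu]_x (`|f x| `^ r)%:E < +oo)%E ->
  forall e : R, 0 < e -> exists n0, forall n h, (n0 <= n)%N -> small n h -> (om r f h <= e%:E)%E.
Proof.
move=> r1 mf pf fi e e0; apply: contrapT => nex.
have H n : exists h, small n h /\ (e%:E < om r f h)%E.
  apply: contrapT => nh; apply: nex; exists n => m h nm sh.
  rewrite leNgt; apply/negP => om_gt; apply: nh; exists h; split => //.
  move=> i; have /andP[-> h2] := sh i; rewrite (le_trans h2)// lef_pV2 ?posrE ?ltr0n//.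
  by rewrite ler_nat !ltnS.
have [h hP] := choice H.
have h01 k j : 0 <= h k 0 j <= k.+2%:R^-1 by have [] := hP k.
have := @om_seq r f h r1 mf pf fi _ _.
case/(_ _ _)/fine_cvgP => [j|k j|fin /cvgr0Pnorm_lt/(_ e e0) hc].
- apply: (squeeze_cvgr (f := cst 0) (h := fun k => k.+1%:R^-1)); last 2 first.
  + exact: cvg_cst.
  + exact: cvg_harmonic.
  apply/nearW => k; have /andP[-> h2] := h01 k j.
  by rewrite (le_trans h2)// lef_pV2 ?posrE ?ltr0n// ler_nat.
- have /andP[h1 h2] := h01 k j; rewrite ger0_norm// (le_trans h2)//.
  by rewrite invf_le1 ?ltr0n// ler1n.
have [k _ /(_ k (leqnn k)) [h1 h2]] : \forall k \near \oo,
    om r f (h k) \is a fin_num /\ `|fine (om r f (h k))| < e.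
  by near=> k; split; near: k.
have [_] := hP k; rewrite -(fineK h1) lte_fin ltNge => /negP; apply.
by rewrite ltW// (le_lt_trans (ler_norm _)).
Unshelve. all: by end_near. Qed.

Lemma osc_le r kap f n B m : measurable_fun setT f -> L1 mu kap -> (forall y, 0 <= kap y) ->
  suppK n kap -> 0 <= B -> (forall h, small n h -> (om r f h <= B%:E)%E) ->
  \int[mu]_y kap y <= m -> (osc r kap f <= (B * m)%:E)%E.
Proof.
move=> mf ki k0 sk B0 omB km; have mk := L1_meas ki.
apply: (@le_trans _ _ (\int[mu]_h (B%:E * (kap h)%:E))%E); last first.
  rewrite ge0_integralZl//.
  - by rewrite -EFinI// -EFinM lee_fin ler_wpM2l.
  - exact/measurable_EFinP.
  - by move=> x _; rewrite lee_fin.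
apply: ae_ge0_le_integral => //.
- by move=> x _; rewrite mule_ge0// ?lee_fin// om_ge0.
- by apply: emeasurable_funM; [exact/measurable_EFinP|exact: measurable_om].
- by move=> x _; rewrite mule_ge0// lee_fin.
- by apply: emeasurable_funM; [exact: measurable_cst|exact/measurable_EFinP].
apply: filterS (@torus_cell R d) => h h01 _.
have [[i hi]|nh] := pselect (exists i, n.+2%:R^-1 < h 0 i).
  by rewrite sk// ?mul0e ?mule0//; exists i.
rewrite muleC lee_wpmul2r ?lee_fin//; apply: omB => i.
have /andP[-> _] := h01 i; rewrite leNgt; apply/negP => hi.
by apply: nh; exists i.
Qed.

Lemma osc_ge0 r kap f : (forall y, 0 <= kap y) -> (0 <= osc r kap f)%E.
Proof. by move=> k0; apply: integral_ge0 => h _; rewrite mule_ge0// ?lee_fin// om_ge0. Qed.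

Lemma osc_cvg r f (kap : nat -> 'rV[R]_d -> R) : 1 <= r -> measurable_fun setT f ->
  torus_function f -> (\int[mu]_x (`|f x| `^ r)%:E < +oo)%E ->
  (forall n, L1 mu (kap n)) -> (forall n y, 0 <= kap n y) -> (forall n, suppK n (kap n)) ->
  (forall n, \int[mu]_y kap n y <= 1) ->
  osc r (kap n) f @[n --> \oo] --> 0%E.
Proof.
move=> r1 mf pf fi ki k0 sk k1; apply: ege0_cvg0 => [n|e e0]; first exact: osc_ge0.
have [n0 H] := om_cvg r1 mf pf fi e0.
exists n0 => // n /= n0n; rewrite -[e]mulr1; apply: osc_le => //; first exact: ltW.
by move=> h; exact: H.
Qed.

Lemma oscE r kap f : measurable_fun setT f -> measurable_fun setT kap ->
  (forall y, 0 <= kap y) ->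
  osc r kap f = (\int[mu]_x \int[mu]_h (`|f (x + h)%R - f x| `^ r * kap h)%:E)%E.
Proof.
move=> mf mk k0.
pose F (z : 'rV[R]_d * 'rV[R]_d) : \bar R := (`|f (z.1 + z.2)%R - f z.1| `^ r * kap z.2)%:E.
have mF : measurable_fun setT F.
  apply/measurable_EFinP; apply: measurable_funM.
    by apply: measurable_powRf; exact: measurable_diff.
  by apply: (measurableT_comp mk); exact: measurable_snd.
have F0 z : (0 <= F z)%E by rewrite lee_fin mulr_ge0 ?powR_ge0.
have := fubini_tonelli (m1 := mu) (m2 := mu) F mF F0.
rewrite /fubini_F /fubini_G => ->; apply: eq_integral => h _.
rewrite /om -ge0_integralZl//.
- by apply: eq_integral => x _; rewrite -EFinM mulrC.
- by apply/measurable_EFinP; apply: measurable_powRf; exact: measurable_diff1.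
- by rewrite lee_fin.
Qed.

Lemma dl_powR r kap f m : 1 <= r -> measurable_fun setT f -> torus_function f -> L1 mu f ->
  L1 mu kap -> (forall y, 0 <= kap y) -> (exists M, forall y, `|kap y| <= M) ->
  1 <= \int[mu]_y kap y <= m ->
  (\int[mu]_x (dl kap f x `^ r)%:E <= (m `^ r)%:E * osc r kap f)%E.
Proof.
move=> r1 mf pf fi ki k0 [M kM] /andP[m1 mm]; have mk := L1_meas ki.
set m0 := \int[mu]_y kap y in m1 mm.
have m00 : 0 < m0 by lra.
have mdl : measurable_fun setT (dl kap f).
  apply: (measurable_param mu (f := fun z : 'rV[R]_d * 'rV[R]_d => `|f (z.1 + z.2) - f z.1| * kap z.2)).
  apply: measurable_funM; first exact: measurable_diff.
  by apply: (measurableT_comp mk); exact: measurable_snd.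
rewrite oscE// -ge0_integralZl//; last 3 first.
- apply: (ge0_integral_prodT1 mu (F := fun z : 'rV[R]_d * 'rV[R]_d => (`|f (z.1 + z.2)%R - f z.1| `^ r * kap z.2)%:E)).
    apply/measurable_EFinP; apply: measurable_funM.
      by apply: measurable_powRf; exact: measurable_diff.
    by apply: (measurableT_comp mk); exact: measurable_snd.
  by move=> z; rewrite lee_fin mulr_ge0 ?powR_ge0.
- by move=> x _; apply: integral_ge0 => h _; rewrite lee_fin mulr_ge0 ?powR_ge0.
- by rewrite lee_fin powR_ge0.
apply: ge0_le_integral => //.
- by move=> x _; rewrite lee_fin powR_ge0.
- by apply/measurable_EFinP; exact: measurable_powRf.
- apply: emeasurable_funM => //.
  apply: (ge0_integral_prodT1 mu (F := fun z : 'rV[R]_d * 'rV[R]_d => (`|f (z.1 + z.2)%R - f z.1| `^ r * kap z.2)%:E)).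
    apply/measurable_EFinP; apply: measurable_funM.
      by apply: measurable_powRf; exact: measurable_diff.
    by apply: (measurableT_comp mk); exact: measurable_snd.
  by move=> z; rewrite lee_fin mulr_ge0 ?powR_ge0.
move=> x _.
pose k1 y := m0^-1 * kap y.
have k1i : L1 mu k1 by exact: L1Z.
have k10 y : 0 <= k1 y by rewrite mulr_ge0// invr_ge0 ltW.
have k11 : \int[mu]_y k1 y = 1 by rewrite IZ// mulVf// gt_eqF.
have dfi : L1 mu (fun h => `|f (x + h) - f x|).
  apply: L1_norm; apply: L1B; last exact: L1_cst.
  by under eq_fun do rewrite addrC; exact: L1_shift.
have dfk : L1 mu (fun h => `|f (x + h) - f x| * kap h) by exact: (L1_mulb dfi mk kM).
have dfk1 : L1 mu (fun h => `|f (x + h) - f x| * k1 h).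
  by rewrite /k1; under eq_fun do rewrite mulrCA; exact: L1Z.
have := jensen_powR r1 (fun h => normr_ge0 (f (x + h) - f x)) k10 (measurable_diff2 x mf) k1i k11 dfk1.
have -> : \int[mu]_h (`|f (x + h) - f x| * k1 h) = m0^-1 * dl kap f x.
  by rewrite -IZ//; apply: eq_Rintegral => h _; rewrite mulrCA.
move=> J.
have dl0 : 0 <= dl kap f x by apply: I_ge0 => h; rewrite mulr_ge0.
have -> : dl kap f x `^ r = m0 `^ r * (m0^-1 * dl kap f x) `^ r.
  rewrite -powRM ?(ltW m00)//; last by rewrite mulr_ge0// invr_ge0 ltW.
  by rewrite mulrA divff ?mul1r// gt_eqF.
have m0m : (m0 `^ r <= m `^ r)%R by apply: powR_le; lra.
rewrite EFinM; apply: lee_pmul.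
- by rewrite lee_fin powR_ge0.
- by rewrite lee_fin powR_ge0.
- by rewrite lee_fin.
apply: (le_trans J); apply: ge0_le_integralR => //.
- apply: measurable_funM; last exact: L1_meas k1i.
  by apply: measurable_powRf; exact: measurable_diff2.
- apply: measurable_funM => //.
  by apply: measurable_powRf; exact: measurable_diff2.
- by move=> h; rewrite mulr_ge0 ?powR_ge0.
- move=> h; rewrite ler_wpM2l ?powR_ge0// /k1 ler_piMl//.
  by rewrite invf_le1.
Qed.

End Oscillation.

Lemma continuous_sumr (R : realType) (V : topologicalType) (I : Type) (s : seq I) (F : I -> V -> R) :
  (forall i, continuous (F i)) -> continuous (fun x => \sum_(i <- s) F i x).
Proof.
move=> cF; elim: s => [|i s IH].
  by under eq_fun do rewrite big_nil; move=> x; exact: cvg_cst.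
by under eq_fun do rewrite big_cons; move=> x; apply: cvgD; [exact: cF|exact: IH].
Qed.

Section LineIntegral.
Context {R : realType}.
Local Notation leb := (@lebesgue_measure R).

Lemma eftc (F f : R -> R) (a b : R) : a < b -> (forall s : R, is_derive s 1 F (f s)) ->
  continuous f -> (\int[leb]_(s in `[a, b]) (f s)%:E = (F b - F a)%:E)%E.
Proof.
move=> ab dF cf.
have cF : continuous F.
  by move=> s; apply/differentiable_continuous/derivable1_diffP; have [] := dF s.
rewrite (continuous_FTC2 (F := F) ab)//.
- exact: continuous_subspaceT.
- split.
  + by move=> s _; have [] := dF s.
  + exact/cvg_at_right_filter/cF.
  + exact/cvg_at_left_filter/cF.
- by move=> s _; rewrite derive1E; have [] := dF s.
Qed.

Lemma ftc (F f : R -> R) (a b : R) : a <= b -> (forall s : R, is_derive s 1 F (f s)) ->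
  continuous f -> \int[leb]_(s in `[a, b]) f s = F b - F a.
Proof.
rewrite le_eqVlt => /orP[/eqP <-|ab] dF cf.
  by rewrite set_itv1 Rintegral_set1 subrr.
by rewrite /Rintegral (eftc ab dF).
Qed.

Lemma ftc_U01_le (F f : R -> R) : (forall s : R, is_derive s 1 F (f s)) -> continuous f ->
  (`|F 1 - F 0|%:E <= \int[U01]_s `|f s|%:E)%E.
Proof.
move=> dF cf.
have mf : measurable_fun setT f by exact: measurable_realfun.continuous_measurable_fun.
rewrite ge0_integral_U01//; last exact: measurable_normE.
rewrite -[leLHS]/(`|(F 1 - F 0)%:E|)%E -(eftc ltr01 dF cf).
by apply: le_abse_integral => //; apply/measurable_EFinP; exact: measurable_funTS.
Qed.

End LineIntegral.

(* Lower semicontinuity of the [L^r] norm under [L^1] convergence: the convex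
   function [x `^ r] lies above its tangent at the truncation of [F x]. *)
Lemma powR_lsc {d} {T : measurableType d} {R : realType} (mu : probability T R)
    (F_ : nat -> T -> R) (F : T -> R) (r B : R) : 1 <= r ->
  (forall n, L1 mu (F_ n)) -> L1 mu F -> (forall n x, 0 <= F_ n x) -> (forall x, 0 <= F x) ->
  \int[mu]_x `|F_ n x - F x| @[n --> \oo] --> 0 ->
  (forall n, (\int[mu]_x (F_ n x `^ r)%:E <= B%:E)%E) ->
  (\int[mu]_x (F x `^ r)%:E <= B%:E)%E.
Proof.
move=> r1 Fni Fi Fn0 F0 FnF FnB.
pose c (L : nat) x := Num.min (F x) L%:R.
have mF := L1_meas Fi.
have mc L : measurable_fun setT (c L).
  by apply: measurable_minr => //; exact: measurable_cst.
have c0 L x : 0 <= c L x by rewrite /c le_min F0/=.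
have cL L x : c L x <= L%:R by rewrite /c ge_min lexx orbT.
have cF L x : c L x <= F x by rewrite /c ge_min lexx.
have mcr L : measurable_fun setT (fun x => c L x `^ r) by exact: measurable_powRf.
have cri L : L1 mu (fun x => c L x `^ r).
  apply: (@L1_bdd _ _ _ mu (L%:R `^ r)) => // x.
  by rewrite ger0_norm ?powR_ge0//; apply: powR_le => //; lra.
have Fri n : L1 mu (fun x => F_ n x `^ r).
  apply: L1_ge0.
  - exact: measurable_powRf (L1_meas (Fni n)).
  - by move=> x; exact: powR_ge0.
  - by rewrite (le_lt_trans (FnB n))// ltry.
have HL L : \int[mu]_x (c L x `^ r) <= B.
  pose a := r * L%:R `^ (r - 1).
  have a0 : 0 <= a by rewrite /a mulr_ge0 ?powR_ge0//; lra.
  have di n : L1 mu (fun x => `|F_ n x - F x|) by apply: L1_norm; exact: L1B.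
  have H n : \int[mu]_x (c L x `^ r) <= B + a * \int[mu]_x `|F_ n x - F x|.
    apply: (@le_trans _ _ (\int[mu]_x (F_ n x `^ r + a * `|F_ n x - F x|))).
      apply: Ile => //; first by apply: L1D => //; exact: L1Z.
      move=> x; have := powR_tangent r1 (Fn0 n x) (c0 L x).
      set b := r * c L x `^ (r - 1) => h.
      have ba : 0 <= b <= a.
        rewrite /b /a mulr_ge0 ?powR_ge0//=; last lra.
        by rewrite ler_wpM2l//; [lra|apply: powR_le => //; lra].
      (* The truncation satisfies [c L x <= F x], so the distance below the tangent point is at most
         the distance to [F x]; truncating also bounds the slope [b] by [a]. *)
      have h1 : - (b * (F_ n x - c L x)) <= b * `|F_ n x - F x|.
        rewrite -mulrN ler_wpM2l//; first by case/andP: ba.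
        by rewrite opprB distrC (le_trans _ (ler_norm _))// lerB.
      have h2 : b * `|F_ n x - F x| <= a * `|F_ n x - F x|.
        by rewrite ler_wpM2r//; case/andP: ba.
      lra.
    rewrite ID//; last exact: L1Z.
    by rewrite IZ// lerD2r -lee_fin EFinI.
  have cv : B + a * \int[mu]_x `|F_ n x - F x| @[n --> \oo] --> B + a * 0.
    by apply: cvgD; [exact: cvg_cst|apply: cvgMl_tmp].
  by rewrite mulr0 addr0 in cv; apply: (cvgr_to_ge cv); apply/nearW.
have cvF : (\int[mu]_x (c L x `^ r)%:E)%E @[L --> \oo] --> (\int[mu]_x (F x `^ r)%:E)%E.
  have -> : (\int[mu]_x (F x `^ r)%:E = \int[mu]_x (limn (fun L => (c L x `^ r)%:E)))%E.
    apply: eq_integral => x _; apply/esym/cvg_lim => //.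
    apply: cvg_near_cst; have [n0 _ Hn0] := nbhs_infty_ger (F x).
    exists n0 => // n /= n0n; rewrite /c min_l//; exact: Hn0.
  apply: cvg_monotone_convergence => //.
  - by move=> n; exact/measurable_EFinP.
  - by move=> n x _; rewrite lee_fin powR_ge0.
  - by move=> x _ n m nm; rewrite lee_fin powR_le//; [lra|rewrite /c le_min !ge_min lexx/= ler_nat nm orbT].
rewrite -(cvg_lim _ cvF)//; apply: lime_le; first by apply/cvg_ex; eexists; exact: cvF.
by apply/nearW => L; rewrite -EFinI// lee_fin.
Qed.


(** * Increments controlled by the weak gradient *)

Section Sobolev.
Context {R : realType} {d : nat}.
Local Notation mu := (torus R d).
Implicit Types (f u : 'rV[R]_d -> R) (g : 'I_d -> 'rV[R]_d -> R) (x y h : 'rV[R]_d) (r : R).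

(** As the kernel has mass 1, the error is an average of increments, and its L^1 norm is at most
    [osc 1 (K n) u]. *)
Lemma cv_cvg A (K : nat -> 'rV[R]_d -> R) (dK : nat -> 'I_d -> 'rV[R]_d -> R) u :
  (forall n, moll A n (K n) (dK n)) -> L1 mu u -> torus_function u ->
  \int[mu]_x `|cv u (K n) x - u x| @[n --> \oo] --> 0.
Proof.
move=> mo ui pu; have mf := L1_meas ui.
have KL n : L1 mu (K n) by have [M HM] := mo_bdd (mo n); apply: (L1_bdd mu (mo_meas (mo n)) (fun y => (HM y).1)).
have sK n : suppK n (K n) by move=> y y01 ey; have [] := mo_supp (mo n) y01 ey.
have fi : (\int[mu]_x (`|u x| `^ 1)%:E < +oo)%E.
  have [_] := (L1P mu u).1 ui; congr (_ < _)%E; apply: eq_integral => x _.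
  by rewrite powRr1.
have k1 n : \int[mu]_y K n y <= 1 by rewrite (mo_int (mo n)).
have := osc_cvg (lexx 1) mf pu fi KL (fun n => mo_ge0 (mo n)) sK k1.
move=> /fine_cvgP[fin /=] h0.
have cvi n : L1 mu (cv u (K n)).
  have [M HM] := mo_bdd (mo n).
  apply: (@L1_bdd _ _ _ mu (M * \int[mu]_y `|u y|)); first exact: measurable_cv (mo_meas (mo n)).
  by move=> x; apply: bounded_cv (mo_meas (mo n)) _ => // y; have [] := HM y.
apply: (squeeze_cvgr _ (cvg_cst 0) h0); near=> n.
have fn : osc 1 (K n) u \is a fin_num by near: n.
apply/andP; split; first exact: I_ge0.
rewrite -[leRHS]/(fine (osc 1 (K n) u)) -lee_fin (EFinI (L1_norm (L1B (cvi n) ui))) (fineK fn).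
have [M HM] := mo_bdd (mo n); have [tK pK] := mo_test (mo n).
rewrite oscE//; [|exact: mo_meas (mo n)|exact: mo_ge0 (mo n)].
apply: ge0_le_integral => //.
- exact: measurable_normE (measurable_funB (L1_meas (cvi n)) mf).
- apply: (ge0_integral_prodT1 mu (F := fun z : 'rV[R]_d * 'rV[R]_d => (`|u (z.1 + z.2)%R - u z.1| `^ 1 * K n z.2)%:E)).
    apply/measurable_EFinP; apply: measurable_funM.
      by apply: measurable_powRf; exact: measurable_diff.
    by apply: (measurableT_comp (mo_meas (mo n))); exact: measurable_snd.
  by move=> z; rewrite lee_fin mulr_ge0 ?powR_ge0// (mo_ge0 (mo n)).
move=> x _.
have i1 : L1 mu (fun h => u (x + h) * K n h) := L1_cvl x pu ui (mo_meas (mo n)) (fun y => (HM y).1).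
have i2 : L1 mu (fun h => u x * K n h) by exact: L1Z.
have -> : cv u (K n) x - u x = \int[mu]_h ((u (x + h) - u x) * K n h).
  rewrite cvE//; last exact: mo_meas (mo n).
  under [RHS]eq_Rintegral do rewrite mulrBl.
  by rewrite IB// IZ// (mo_int (mo n)) mulr1.
have i3 : L1 mu (fun h => (u (x + h) - u x) * K n h).
  by under eq_fun do rewrite mulrBl; exact: L1B.
have e h : `|u (x + h) - u x| `^ 1 * K n h = `|(u (x + h) - u x) * K n h|.
  by rewrite powRr1// normrM (ger0_norm (mo_ge0 (mo n) h)).
under eq_integral do rewrite e.
by rewrite -EFinI ?lee_fin ?Iabs//; exact: L1_norm.
Unshelve. all: by end_near. Qed.

Lemma measurable_line h : measurable_fun setT
  (fun z : 'rV[R]_d * measurableTypeR R => z.1 + (z.2 : R) *: h).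
Proof.
apply: measurable_fun_mx => i j; under eq_fun do rewrite !mxE.
have mc := @measurable_mx_entry R 1 d i j.
apply: measurable_funD; first by apply: (measurableT_comp mc); exact: measurable_fst.
by apply: measurable_funM; [exact: measurable_snd|exact: measurable_cst].
Qed.

(** Averaging over a probability kernel contracts L^r: Jensen's inequality at each [x], then
    Tonelli's theorem and translation invariance. *)
Lemma cv_powR_le (K : 'rV[R]_d -> R) f r : 1 <= r -> torus_function f -> torus_function K ->
  L1 mu f -> (forall x, 0 <= f x) -> (forall x, 0 <= K x) -> measurable_fun setT K ->
  (exists M, forall y, `|K y| <= M) -> \int[mu]_y K y = 1 ->
  (\int[mu]_x (cv f K x `^ r)%:E <= \int[mu]_x (f x `^ r)%:E)%E.
Proof.
move=> r1 pf pK fi f0 K0 mK [M KM] K1; have mf := L1_meas fi.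
have Ki : L1 mu K := L1_bdd mu mK KM.
pose F (z : 'rV[R]_d * 'rV[R]_d) : \bar R := (f (z.1 + z.2)%R `^ r * K z.2)%:E.
have mF : measurable_fun setT F.
  apply/measurable_EFinP; apply: measurable_funM.
    apply: measurable_powRf; apply: (measurableT_comp mf); exact: measurable_add.
  by apply: (measurableT_comp mK); exact: measurable_snd.
have F0 z : (0 <= F z)%E by rewrite lee_fin mulr_ge0 ?powR_ge0.
have cv0 x : 0 <= cv f K x by apply: I_ge0 => y; rewrite mulr_ge0.
have mfr : measurable_fun setT (fun x => f x `^ r) by exact: measurable_powRf.
apply: (@le_trans _ _ (\int[mu]_x \int[mu]_h F (x, h))%E).
  apply: ge0_le_integral => //.
  - by move=> x _; rewrite lee_fin powR_ge0.
  - by apply/measurable_EFinP; apply: measurable_powRf; exact: measurable_cv.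
  - exact: (ge0_integral_prodT1 mu mF F0).
  move=> x _; rewrite cvE//.
  apply: jensen_powR => //; first exact: measurable_addl.
  exact: L1_cvl KM.
have := fubini_tonelli (m1 := mu) (m2 := mu) F mF F0; rewrite /fubini_F /fubini_G => ->.
have -> : (\int[mu]_h \int[mu]_x F (x, h) = \int[mu]_h (\int[mu]_x (f x `^ r)%:E * (K h)%:E))%E.
  apply: eq_integral => h _; rewrite /F /=.
  under eq_integral do rewrite mulrC EFinM.
  rewrite ge0_integralZl//.
  - rewrite muleC (ge0_integral_torus_shift h (f := fun x => (f x `^ r)%:E))//.
    + exact/measurable_EFinP.
    + by move=> x; rewrite lee_fin powR_ge0.
    + by move=> x j; rewrite pf.
  - by apply/measurable_EFinP; apply: measurable_powRf; exact: measurable_shiftr.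
  - by move=> x _; rewrite lee_fin powR_ge0.
  - by rewrite lee_fin.
rewrite ge0_integralZl//.
- by rewrite -EFinI// K1 mule1.
- exact/measurable_EFinP.
- by move=> x _; rewrite lee_fin.
- by apply: integral_ge0 => x _; rewrite lee_fin powR_ge0.
Qed.

(* The weak gradient in convolution form is integrated along the segment from
   [x] to [x + h]. *)
Lemma cv_diff_om A n K dK u g h (eta r B : R) : moll A n K dK -> 1 <= r ->
  L1 mu u -> torus_function u -> (forall j, L1 mu (g j)) -> (forall j, torus_function (g j)) ->
  (forall j x, cv u (dK j) x = - cv (g j) K x) -> (forall j, `|h 0 j| <= eta) -> 0 <= eta ->
  (\int[mu]_x ((\sum_j `|g j x|) `^ r)%:E <= B%:E)%E ->
  (om r (cv u K) h <= (eta `^ r * B)%:E)%E.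
Proof.
move=> mo r1 ui pu gi pg wg he eta0 gB.
have [M HM] := mo_bdd mo; have [tK pK] := mo_test mo.
have KM y := (HM y).1; have mK := mo_meas mo; have mdK := mo_measd mo.
pose gam x := \sum_j `|g j x|; pose Gam := cv gam K.
have gami : L1 mu gam by apply: L1_sum => j; exact: L1_norm.
have gam0 x : 0 <= gam x by apply: sumr_ge0.
have pgam : torus_function gam by move=> x k; apply: eq_bigr => j _; rewrite pg.
have mGam : measurable_fun setT Gam by exact: measurable_cv (L1_meas gami) mK.
have Gam0 x : 0 <= Gam x by apply: I_ge0 => y; rewrite mulr_ge0// (mo_ge0 mo).
have pGam : torus_function Gam by exact: periodic_cv.
have GamM x : `|Gam x| <= M * \int[mu]_y `|gam y| by exact: bounded_cv.
have M0 : 0 <= M by rewrite (le_trans _ (KM 0)).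
have dcv f x (e : 'rV[R]_d) : L1 mu f -> is_derive x e (cv f K) (- cv f (fun y => \sum_i e 0 i * dK i y) x).
  move=> fi; apply: (@is_derive_cv _ _ f K _ (M + (\sum_i `|e 0 i|) * M)) => //.
  - by apply: measurable_sum => i; apply: measurable_funM => //; exact: measurable_cst.
  - move=> z; have := mo_derive mo z (- e).
    by under eq_bigr do rewrite mxE mulNr; rewrite sumrN.
  - by move=> y; rewrite (le_trans (KM y))// lerDl mulr_ge0// sumr_ge0.
  - move=> y; apply: le_trans (ler_norm_sum _ _ _) _.
    rewrite mulr_suml (@le_trans _ _ (\sum_i `|e 0 i| * M))// ?lerDr//.
    by apply: ler_sum => i _; rewrite normrM ler_wpM2l// (HM y).2.
pose psi x (s : R) := \sum_j h 0 j * cv (g j) K (x + s *: h).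
have cvsum f x (e : 'I_d -> R) : L1 mu f -> cv f (fun y => \sum_i e i * dK i y) x = \sum_i e i * cv f (dK i) x.
  move=> fi; rewrite /cv.
  have fk i : L1 mu (fun y => f y * dK i (y - x)) := L1_cv x fi (mdK i) (fun y => (HM y).2 i).
  under [RHS]eq_bigr do rewrite -IZ//.
  rewrite -Isum; last by move=> i; exact: L1Z.
  by apply: eq_Rintegral => y _; rewrite mulr_sumr; apply: eq_bigr => i _; rewrite mulrCA.
have dU x (s : R) : is_derive s 1 (fun s' : R => cv u K (x + s' *: h)) (psi x s).
  have [D1 D2] := affine_derive (cv u K) s 1 (affine_line x h).
  have [E1 E2] := dcv u (x + s *: h) h ui.
  split; first by apply: D2; rewrite scale1r.
  apply: (etrans D1); rewrite scale1r E2 (cvsum _ _ _ ui) -sumrN; apply: eq_bigr => j _.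
  by rewrite wg mulrN opprK.
have cpsi x : continuous (psi x).
  have cj j : continuous (fun s : R => cv (g j) K (x + s *: h)).
    move=> s; apply/differentiable_continuous/derivable1_diffP.
    apply: (affine_derive (cv (g j) K) s 1 (affine_line x h)).2.
    by have [] := dcv (g j) (x + s *: h) (1 *: h) (gi j).
  by apply: continuous_sumr => j s; apply: cvgM; [exact: cvg_cst|exact: cj].
have psiG x s : `|psi x s| <= eta * Gam (x + s *: h).
  apply: le_trans (ler_norm_sum _ _ _) _.
  apply: (@le_trans _ _ (\sum_j eta * cv (fun y => `|g j y|) K (x + s *: h))).
    apply: ler_sum => j _; rewrite normrM ler_pM//.
    apply: le_trans (Iabs (L1_cv _ (gi j) mK KM)) _.
    rewrite le_eqVlt; apply/orP; left; apply/eqP; apply: eq_Rintegral => y _.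
    by rewrite normrM (ger0_norm (mo_ge0 mo _)).
  rewrite -mulr_sumr ler_wpM2l// /cv -Isum; last by move=> j; apply: L1_cv KM => //; exact: L1_norm.
  rewrite le_eqVlt; apply/orP; left; apply/eqP; apply: eq_Rintegral => y _.
  by rewrite mulr_suml.
pose G (z : 'rV[R]_d * measurableTypeR R) : \bar R := (Gam (z.1 + (z.2 : R) *: h) `^ r)%:E.
have mline := measurable_line h.
have mG : measurable_fun setT G.
  by apply/measurable_EFinP; apply: measurable_powRf; exact: measurableT_comp mGam mline.
have G0 z : (0 <= G z)%E by rewrite lee_fin powR_ge0.
have ptw x : ((`|cv u K (x + h) - cv u K x| `^ r)%:E <= (eta `^ r)%:E * \int[U01]_s G (x, s))%E.
  have mGx : measurable_fun setT (fun s : measurableTypeR R => Gam (x + (s : R) *: h)).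
    by have := measurable_fun_pair2 x (measurableT_comp mGam mline); exact.
  have Gxi : L1 U01 (fun s : measurableTypeR R => Gam (x + (s : R) *: h)).
    exact: L1_bdd mGx (fun s => GamM _).
  have Gxi1 : L1 U01 (fun s : measurableTypeR R => Gam (x + (s : R) *: h) * 1).
    by under eq_fun do rewrite mulr1.
  have := jensen_powR r1 (fun s : measurableTypeR R => Gam0 (x + (s : R) *: h)) (fun=> ler01) mGx (L1_cst U01 1) (I_cst U01 1) Gxi1.
  under eq_Rintegral do rewrite mulr1; under eq_integral do rewrite mulr1.
  move=> J; apply: (@le_trans _ _ ((eta `^ r)%:E * ((\int[U01]_s Gam (x + s *: h)) `^ r)%:E)%E); last first.
    by apply: lee_wpmul2l => //; rewrite lee_fin powR_ge0.
  rewrite -EFinM lee_fin -powRM//; last by apply: I_ge0.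
  apply: powR_le => //; first lra.
  rewrite -lee_fin; have := ftc_U01_le (dU x) (cpsi x); rewrite scale1r scale0r addr0.
  move=> /le_trans; apply; rewrite -IZ// EFinI; last exact: L1Z.
  apply: ge0_le_integralR => //.
  - apply: measurableT_comp => //; exact: measurable_realfun.continuous_measurable_fun.
  - by apply: measurable_funM => //; exact: measurable_cst.
apply: (@le_trans _ _ (\int[mu]_x ((eta `^ r)%:E * \int[U01]_s G (x, s)))%E).
  apply: ge0_le_integral => //.
  - apply/measurable_EFinP; apply: measurable_powRf; apply: measurable_diff1.
    exact: measurable_cv (L1_meas ui) mK.
  - by apply: emeasurable_funM => //; exact: (ge0_integral_prodT1 U01 mG G0).
rewrite ge0_integralZl//; last 3 first.
- exact: (ge0_integral_prodT1 U01 mG G0).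
- by move=> x _; apply: integral_ge0.
- by rewrite lee_fin powR_ge0.
rewrite EFinM; apply: lee_wpmul2l; first by rewrite lee_fin powR_ge0.
have := fubini_tonelli (m1 := mu) (m2 := U01) G mG G0; rewrite /fubini_F /fubini_G => ->.
have -> : (\int[U01]_s \int[mu]_x G (x, s) = \int[U01]_s \int[mu]_x (Gam x `^ r)%:E)%E.
  apply: eq_integral => s _; rewrite /G /=.
  apply: (ge0_integral_torus_shift ((s : R) *: h) (f := fun x => (Gam x `^ r)%:E)).
  - by apply/measurable_EFinP; exact: measurable_powRf.
  - by move=> x; rewrite lee_fin powR_ge0.
  - by move=> x j; rewrite pGam.
rewrite integral_cst//= probability_setT mule1.
apply: le_trans gB; apply: cv_powR_le => //; first exact: mo_ge0 mo.
- by exists M.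
- exact: mo_int mo.
Qed.

(** The bound of [cv_diff_om] for the smooth functions [cv u (K n)] does not depend on [n], and
    passes to their L^1 limit [u] by lower semicontinuity. *)
Lemma om_sobolev A (K : nat -> 'rV[R]_d -> R) (dK : nat -> 'I_d -> 'rV[R]_d -> R) u g h (eta r B : R) :
  (forall n, moll A n (K n) (dK n)) -> 1 <= r ->
  L1 mu u -> torus_function u -> (forall j, L1 mu (g j)) -> (forall j, torus_function (g j)) ->
  (forall n j x, cv u (dK n j) x = - cv (g j) (K n) x) -> (forall j, `|h 0 j| <= eta) -> 0 <= eta ->
  (\int[mu]_x ((\sum_j `|g j x|) `^ r)%:E <= B%:E)%E ->
  (om r u h <= (eta `^ r * B)%:E)%E.
Proof.
move=> mo r1 ui pu gi pg wg he eta0 gB; have mu' := L1_meas ui.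
have cvi n : L1 mu (cv u (K n)).
  have [M HM] := mo_bdd (mo n).
  apply: (@L1_bdd _ _ _ mu (M * \int[mu]_y `|u y|)); first exact: measurable_cv (mo_meas (mo n)).
  by move=> x; apply: bounded_cv (mo_meas (mo n)) _ => // y; have [] := HM y.
have pcv n : torus_function (cv u (K n)) by apply: periodic_cv; have [] := mo_test (mo n).
have di f : torus_function f -> L1 mu f -> L1 mu (fun x => `|f (x + h) - f x|).
  by move=> pf fi; apply: L1_norm; apply: L1B => //; exact: L1_shift.
pose F_ n x := `|cv u (K n) (x + h) - cv u (K n) x|.
apply: (@powR_lsc _ _ _ mu F_) => //.
- by move=> n; exact: di.
- exact: di.
- by move=> n x; exact: normr_ge0.
- have c0 := cv_cvg mo ui pu.
  (* The factor 2 counts the mollification error at [x] and at [x + h], which have the same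
     integral. *)
  apply: (squeeze_cvgr (f := cst 0) (h := fun n => 2 * \int[mu]_x `|cv u (K n) x - u x|)).
  + apply/nearW => n; rewrite I_ge0//=.
    have e1 : L1 mu (fun x => `|cv u (K n) x - u x|) by apply: L1_norm; exact: L1B.
    have pe : torus_function (fun x => `|cv u (K n) x - u x|) by move=> x k; rewrite pcv pu.
    have e2 := L1_shift h pe e1.
    rewrite mulr2n mulrDl mul1r -[X in _ <= X + _](I_shift h pe (L1_meas e1)) -ID//.
    apply: Ile.
    * by apply: L1_norm; apply: L1B; exact: di.
    * exact: L1D.
    move=> x; rewrite /F_ (le_trans (ler_dist_dist _ _))//.
    rewrite (le_trans _ (ler_normB _ _))// le_eqVlt; apply/orP; left; apply/eqP; congr `|_|; ring.
  + exact: cvg_cst.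
  + by rewrite -[0](mulr0 2); apply: cvgMl_tmp.
- by move=> n; exact: cv_diff_om.
Qed.

End Sobolev.

(** * Balance of the mollified energy *)

Lemma is_derive_to (R : realType) (V : normedModType R) (f : V -> R) (x e : V) (l l' : R) :
  is_derive x e f l -> l = l' -> is_derive x e f l'.
Proof. by move=> h <-. Qed.

(** Only directional derivatives are at hand, so the chain rule is obtained by restriction to a
    line, where the one-variable rule applies. *)
Lemma is_derive_line (R : realType) (V : normedModType R) (f : V -> R) (x e : V) (l : R) :
  is_derive (0 : R) 1 (fun s : R => f (x + s *: e)) l -> is_derive x e f l.
Proof.
have E : (fun s : R => s^-1 *: ((f \o shift x) (s *: e) - f x)) =
    (fun s : R => s^-1 *: (((fun s : R => f (x + s *: e)) \o shift 0) (s *: 1) - f (x + 0 *: e))).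
  apply/funext => s /=; rewrite addr0 scale0r addr0 [s *: e + x]addrC; congr (_ *: (f (x + _ *: e) - _)).
  by rewrite /GRing.scale/= mulr1.
move=> [h1 h2]; split; first by rewrite /derivable E; exact: h1.
by rewrite /derive E; exact: h2.
Qed.

Lemma is_derive_scomp (R : realType) (V : normedModType R) (P : R -> R) (f : V -> R) (x e : V) (dP df : R) :
  is_derive (f x) 1 P dP -> is_derive x e f df -> is_derive x e (fun y => P (f y)) (dP * df).
Proof.
move=> hP hf; apply: is_derive_line.
have := @is_derive1_comp R P (fun s : R => f (x + s *: e)) 0 dP df; apply.
  by rewrite scale0r addr0.
have AL : affine_with (fun s : R => x + s *: e) (fun s : R => s *: e).
  split; last by move=> a b s; rewrite scalerDl addrCA scalerA.
  by move=> s; apply: cvgD; [exact: cvg_cst|apply: cvgZr_tmp; exact: cvg_id].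
have [D1 D2] := affine_derive f (0 : R) 1 AL.
have [h1 h2] := hf; split; first by apply: D2; rewrite scale1r scale0r addr0.
by apply: (etrans D1); rewrite scale1r scale0r addr0.
Qed.

Lemma is_derive_mul (R : realType) (V : normedModType R) (f g : V -> R) (x e : V) (df dg : R) :
  is_derive x e f df -> is_derive x e g dg ->
  is_derive x e (fun y => f y * g y) (f x * dg + g x * df).
Proof. exact: is_deriveM. Qed.

Lemma is_derive_div (R : realType) (V : normedModType R) (f g : V -> R) (x e : V) (df dg : R) : g x != 0 ->
  is_derive x e f df -> is_derive x e g dg ->
  is_derive x e (fun y => f y / g y) ((df - f x / g x * dg) / g x).
Proof.
move=> g0 hf [g1 g2].
have hV : is_derive x e (fun y => (g y)^-1) (- (g x) ^- 2 * dg).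
  by split; [exact: derivableV|rewrite deriveV// g2].
apply: (is_derive_to (is_derive_mul hf hV)).
by field.
Qed.

(** * Functions on the torus at a frozen time *)

Section Static.
Context {R : realType} {d : nat}.
Local Notation mu := (torus R d).
Implicit Types (f g k u w rho : 'rV[R]_d -> R) (x y h : 'rV[R]_d) (r : R).

(** Bounded measurable periodic functions form an algebra that contains the kernels and all
    mollified fields. Integrability of each product in the energy balance is thereby a matter of
    closure properties. *)
Definition kern k : Prop :=
  [/\ measurable_fun setT k, torus_function k & exists M, forall y, `|k y| <= M].

Definition pL1 f : Prop := torus_function f /\ L1 mu f.

Lemma kern_L1 k : kern k -> L1 mu k.
Proof. by move=> [mk _ [M kM]]; exact: L1_bdd mk kM. Qed.

Lemma kern_norm k : kern k -> kern (fun y => `|k y|).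
Proof.
move=> [mk pk [M kM]]; split; first exact: measurableT_comp.
  by move=> x j; rewrite pk.
by exists M => y; rewrite normr_id.
Qed.

Lemma pL1_cvl f k x : pL1 f -> kern k -> L1 mu (fun h => f (x + h) * k h).
Proof. by move=> [pf fi] [mk _ [M kM]]; exact: L1_cvl kM. Qed.

Lemma pL1_cvE f k x : pL1 f -> kern k -> cv f k x = \int[mu]_h (f (x + h) * k h).
Proof. by move=> [pf fi] [mk pk _]; apply: cvE => //; exact: L1_meas fi. Qed.

Lemma pL1_shift f x : pL1 f -> L1 mu (fun h => f (x + h)).
Proof. by move=> [pf fi]; under eq_fun do rewrite addrC; exact: L1_shift. Qed.

Lemma pL1M f g (M : R) : pL1 f -> torus_function g -> measurable_fun setT g -> (forall x, `|g x| <= M) ->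
  pL1 (fun x => f x * g x).
Proof.
move=> [pf fi] pg mg gM; split; first by move=> x j; rewrite pf pg.
exact: L1_mulb gM.
Qed.

Lemma dl_L1 k u x : pL1 u -> kern k -> L1 mu (fun h => `|u (x + h) - u x| * k h).
Proof.
move=> pu [mk _ [M kM]]; apply: (L1_mulb _ mk kM).
by apply: L1_norm; apply: L1B; [exact: pL1_shift|exact: L1_cst].
Qed.

Lemma dl_ge0 k u x : (forall y, 0 <= k y) -> 0 <= dl k u x.
Proof. by move=> k0; apply: I_ge0 => h; rewrite mulr_ge0. Qed.

Lemma measurable_dl k u : measurable_fun setT u -> measurable_fun setT k ->
  measurable_fun setT (dl k u).
Proof.
move=> mf mk.
apply: (measurable_param mu (f := fun z : 'rV[R]_d * 'rV[R]_d => `|u (z.1 + z.2) - u z.1| * k z.2)).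
apply: measurable_funM; first exact: measurable_diff.
by apply: (measurableT_comp mk); exact: measurable_snd.
Qed.

Lemma L1_mul2 f g : measurable_fun setT f -> measurable_fun setT g ->
  L1 mu (fun x => f x ^+ 2) -> L1 mu (fun x => g x ^+ 2) -> L1 mu (fun x => f x * g x).
Proof.
move=> mf mg f2 g2; apply: L1_dom (L1D f2 g2) _; first exact: measurable_funM.
by move=> x; rewrite ler_norml; move: (f x) (g x) => a b; apply/andP; split; nra.
Qed.

Lemma L2_L1 f : measurable_fun setT f -> L1 mu (fun x => f x ^+ 2) -> L1 mu f.
Proof.
move=> mf f2; apply: L1_dom (L1D (L1_cst mu 1) f2) _ => // x.
by rewrite ler_norml; move: (f x) => a; apply/andP; split; nra.
Qed.

Lemma measurable_invf f : measurable_fun setT f -> (forall x, 0 <= f x) ->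
  measurable_fun setT (fun x => (f x)^-1).
Proof. by move=> mf f0; under eq_fun do rewrite -powR_inv1//; exact: measurable_powRf. Qed.

Lemma kern_cst c : kern (fun=> c).
Proof. by split => //; exists `|c|. Qed.

Lemma kernM f g : kern f -> kern g -> kern (fun x => f x * g x).
Proof.
move=> [mf pf [M fM]] [mg pg [M' gM]]; split; first exact: measurable_funM.
  by move=> x j; rewrite pf pg.
by exists (M * M') => y; rewrite normrM ler_pM.
Qed.

Lemma kernD f g : kern f -> kern g -> kern (fun x => f x + g x).
Proof.
move=> [mf pf [M fM]] [mg pg [M' gM]]; split; first exact: measurable_funD.
  by move=> x j; rewrite pf pg.
by exists (M + M') => y; rewrite (le_trans (ler_normD _ _))// lerD.
Qed.

Lemma kernZ c f : kern f -> kern (fun x => c * f x).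
Proof. exact: kernM (kern_cst c). Qed.

Lemma kernN f : kern f -> kern (fun x => - f x).
Proof. by move=> kf; under eq_fun do rewrite -mulN1r; exact: kernZ. Qed.

Lemma kernB f g : kern f -> kern g -> kern (fun x => f x - g x).
Proof. by move=> kf kg; apply: kernD => //; exact: kernN. Qed.

Lemma kern_sum (I : Type) (s : seq I) (F : I -> 'rV[R]_d -> R) :
  (forall i, kern (F i)) -> kern (fun x => \sum_(i <- s) F i x).
Proof.
move=> kF; elim: s => [|i s IH]; first by under eq_fun do rewrite big_nil; exact: kern_cst.
by under eq_fun do rewrite big_cons; exact: kernD.
Qed.

Lemma kern_cv f k : L1 mu f -> kern k -> kern (cv f k).
Proof.
move=> fi [mk pk [M kM]]; split; [exact: measurable_cv (L1_meas fi) mk|exact: periodic_cv|].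
by exists (M * \int[mu]_y `|f y|) => x; exact: bounded_cv.
Qed.

Lemma L1_conv2 f g k : L1 mu f -> L1 mu g -> kern k ->
  L1 (mu \x mu)%E (fun z => f z.1 * g z.2 * k (z.2 - z.1)).
Proof.
move=> fi gi [mk _ [M kM]].
have Lx x : L1 mu (fun y => f x * g y * k (y - x)).
  by under eq_fun do rewrite -mulrA; apply: L1Z; exact: L1_cv kM.
apply: (@L1_prod_bound _ _ _ _ _ mu mu _ (fun x => (M * \int[mu]_y `|g y|) * `|f x|)) => //.
- apply: measurable_funM.
    apply: measurable_funM; first exact: (measurableT_comp (L1_meas fi) measurable_fst).
    exact: (measurableT_comp (L1_meas gi) measurable_snd).
  exact: (measurableT_comp mk measurable_subC).
- by apply: L1Z; exact: L1_norm.
have gn := L1_norm gi.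
move=> x /=; apply: (@le_trans _ _ (\int[mu]_y ((M * `|f x|) * `|g y|))); last by rewrite IZ// mulrAC.
apply: Ile; [apply: L1_norm; exact: Lx|exact: L1Z|] => y.
by rewrite !normrM mulrC mulrA ler_wpM2r// ler_wpM2r.
Qed.

(** Fubini's theorem moves the mollification to the other factor, where the kernel appears
    reflected. This serves the weak limit of the viscous term. *)
Lemma I_cv_dual f g k : L1 mu f -> L1 mu g -> kern k ->
  \int[mu]_x (f x * cv g k x) = \int[mu]_y (g y * \int[mu]_x (f x * k (y - x))).
Proof.
move=> fi gi kk; have fgk := L1_conv2 fi gi kk; have [mk _ [M kM]] := kk.
transitivity (\int[mu]_x \int[mu]_y (f x * g y * k (y - x))).
  apply: eq_Rintegral => x _; rewrite /cv -IZ; last exact: L1_cv kM.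
  by apply: eq_Rintegral => y _; rewrite mulrA.
rewrite (I_fubini fgk); apply: eq_Rintegral => y _ /=.
rewrite -IZ; last first.
  apply: (L1_mulb (M := M) fi) => // ; apply: (measurableT_comp mk).
  exact: (measurable_fun_pair1 y measurable_subC).
by apply: eq_Rintegral => x _; rewrite mulrCA mulrA.
Qed.

Lemma I_cv f k : pL1 f -> kern k -> \int[mu]_x cv f k x = \int[mu]_x f x * \int[mu]_y k y.
Proof.
move=> pf kk; have [mk pk [M kM]] := kk; have mf := L1_meas pf.2.
have fn := L1_norm pf.2.
have pfn : torus_function (fun x => `|f x|) by move=> x j; rewrite pf.1.
have fi h : L1 mu (fun x => k h * f (x + h)) by apply: L1Z; apply: L1_shift => //; [exact: pf.1|exact: pf.2].
have F : L1 (mu \x mu)%E (fun z => k z.1 * f (z.2 + z.1)).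
  apply: (@L1_prod_bound _ _ _ _ _ mu mu _ (fun h => (\int[mu]_x `|f x|) * `|k h|)) => //.
  - apply: measurable_funM; first exact: (measurableT_comp mk measurable_fst).
    by apply: (measurableT_comp mf); under eq_fun do rewrite addrC; exact: measurable_add.
  - by apply: L1Z; exact: kern_L1 (kern_norm kk).
  move=> h /=; under eq_Rintegral do rewrite normrM.
  rewrite IZ; last by exact: (L1_shift h pfn fn).
  by rewrite (I_shift h pfn (L1_meas fn)) mulrC.
transitivity (\int[mu]_x \int[mu]_h (k h * f (x + h))).
  by apply: eq_Rintegral => x _; rewrite pL1_cvE//; apply: eq_Rintegral => h _; rewrite mulrC.
rewrite -(I_fubini F) /= -IZ; last exact: kern_L1.
apply: eq_Rintegral => h _; rewrite IZ; last exact: L1_shift pf.1 pf.2.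
by rewrite (I_shift h pf.1 mf) mulrC.
Qed.

Variables (rho : 'rV[R]_d -> R) (c1 c2 : R).
Hypotheses (c10 : 0 < c1) (rhop : torus_function rho) (mrho : measurable_fun setT rho)
  (rhoB : forall x, c1 <= rho x <= c2).

Let c12 : c1 <= c2.
Proof. by have /andP[h] := rhoB 0; exact: le_trans. Qed.

Let c20 : 0 < c2. Proof. exact: lt_le_trans c12. Qed.

Let rho0 x : 0 <= rho x.
Proof. by have /andP[h _] := rhoB x; rewrite (le_trans _ h)// ltW. Qed.

Let rhoN x : `|rho x| <= c2.
Proof. by rewrite ger0_norm//; have /andP[] := rhoB x. Qed.

Lemma rho_pL1 : pL1 rho.
Proof. by split => //; exact: L1_bdd rhoN. Qed.

Lemma rhoM_pL1 u : pL1 u -> pL1 (fun y => rho y * u y).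
Proof. by move=> pu; under eq_fun do rewrite mulrC; exact: pL1M rhoN. Qed.

Lemma cv_sub k u x a : pL1 u -> kern k -> cv (fun y => rho y * u y) k x - a * cv rho k x =
  \int[mu]_h (rho (x + h) * (u (x + h) - a) * k h).
Proof.
move=> pu kk; have pru := rhoM_pL1 pu.
rewrite (pL1_cvE x pru kk) (pL1_cvE x rho_pL1 kk) -IZ; last exact: pL1_cvl rho_pL1 kk.
rewrite -IB; [|exact: pL1_cvl pru kk|by apply: L1Z; exact: pL1_cvl rho_pL1 kk].
by apply: eq_Rintegral => h _; ring.
Qed.

Lemma cv_sub_le k u x : pL1 u -> kern k ->
  `|cv (fun y => rho y * u y) k x - u x * cv rho k x| <= c2 * dl (fun y => `|k y|) u x.
Proof.
move=> pu kk; rewrite cv_sub// -IZ; last exact: dl_L1 (kern_norm kk).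
have [mk _ [M kM]] := kk; have mu' := L1_meas pu.2.
apply: Idom.
- apply: measurable_funM => //; apply: measurable_funM; first exact: measurable_addl.
  by apply: measurable_funB => //; exact: measurable_addl.
- by apply: L1Z; exact: dl_L1 (kern_norm kk).
- by move=> h; rewrite !normrM -mulrA ler_wpM2r// mulr_ge0.
Qed.

(** * The Favre average and the commutator at one scale *)

Section Mollified.
Variables (A : R) (n : nat) (K : 'rV[R]_d -> R) (dK : 'I_d -> 'rV[R]_d -> R).
Hypotheses (A0 : 0 < A) (mo : moll A n K dK).
Let N : R := n.+2%:R.
Let N0 : 0 < N. Proof. by rewrite ltr0n. Qed.

Lemma moll_kern : kern K.
Proof.
split; [exact: mo_meas mo|by have [] := mo_test mo|].
by have [M HM] := mo_bdd mo; exists M => y; have [] := HM y.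
Qed.

Lemma moll_kernd j : kern (dK j).
Proof.
split; [exact: mo_measd mo j|exact: mo_perd mo j|].
by have [M HM] := mo_bdd mo; exists M => y; have [] := HM y.
Qed.

Let kK := moll_kern.
Let kdK := moll_kernd.
Let K0 := mo_ge0 mo.

Lemma is_derive_cvj f x j : L1 mu f ->
  is_derive x (delta_mx 0 j : 'rV[R]_d) (cv f K) (- cv f (dK j) x).
Proof.
move=> fi; have [M HM] := mo_bdd mo.
apply: (@is_derive_cv _ _ f K (dK j) M) => //.
- exact: mo_meas mo.
- exact: mo_measd mo j.
- move=> z; have := mo_derive mo z (- delta_mx 0 j).
  under eq_bigr do rewrite !mxE eqxx/= mulNr; rewrite sumrN (bigD1 j)//= eqxx mul1r big1 ?addr0//.
  by move=> i /negbTE ij; rewrite ij mul0r.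
- by move=> y; have [] := HM y.
- by move=> y; have [] := HM y.
Qed.

Lemma cv_rho_bd x : c1 <= cv rho K x <= c2.
Proof.
have KL := kern_L1 kK; have rk := pL1_cvl x rho_pL1 kK.
rewrite (pL1_cvE x rho_pL1 kK); apply/andP; split.
  rewrite -[leLHS]mulr1 -(mo_int mo) -IZ//; apply: Ile => //; first exact: L1Z.
  by move=> h; rewrite ler_wpM2r//; have /andP[] := rhoB (x + h).
rewrite -[leRHS]mulr1 -(mo_int mo) -IZ//; apply: Ile => //; first exact: L1Z.
by move=> h; rewrite ler_wpM2r//; have /andP[] := rhoB (x + h).
Qed.

Lemma cv_rho_gt0 x : 0 < cv rho K x.
Proof. by have /andP[h _] := cv_rho_bd x; exact: lt_le_trans h. Qed.

Lemma cv_rhod_le j x : `|cv rho (dK j) x| <= c2 * (A * N).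
Proof.
rewrite (pL1_cvE x rho_pL1 (kdK j)).
apply: (@le_trans _ _ (c2 * \int[mu]_y `|dK j y|)); last by rewrite ler_wpM2l ?(ltW c20)// (mo_intd mo).
have di := kern_L1 (kern_norm (kdK j)).
rewrite -IZ//; apply: Idom; [|exact: L1Z|].
  by apply: measurable_funM; [exact: measurable_addl|exact: mo_measd mo j].
by move=> h; rewrite normrM ler_wpM2r.
Qed.

Definition Wm u x : R := cv (fun y => rho y * u y) K x / cv rho K x.

(* [dK j] enters with the opposite sign because [x] occurs in [K (y - x)]. *)
Definition dWm u j x : R :=
  (Wm u x * cv rho (dK j) x - cv (fun y => rho y * u y) (dK j) x) / cv rho K x.

(** One kernel for the two averages that bound the gradient of the Favre average. The first summand
    has mass at most [A]; the second raises the total mass to at least 1, as [dl_powR] requires. *)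
Definition kap j y : R := `|dK j y| / N + K y.

Lemma kern_kap j : kern (kap j).
Proof.
have [mk pk [M kM]] := kern_norm (kdK j); have [mK pK [M' KM]] := kK.
split.
- by apply: measurable_funD => //; apply: measurable_funM => //; exact: measurable_cst.
- by move=> x i; rewrite /kap pK (mo_perd mo).
- exists (M / N + M') => y; rewrite /kap (le_trans (ler_normD _ _))// lerD//.
  rewrite normrM (ger0_norm (_ : 0 <= N^-1)) ?invr_ge0 ?(ltW N0)//.
  by rewrite ler_wpM2r// invr_ge0 ltW.
Qed.

Lemma kap_ge0 j y : 0 <= kap j y.
Proof. by rewrite addr_ge0// mulr_ge0// invr_ge0 ltW. Qed.

Lemma kap_int j : 1 <= \int[mu]_y kap j y <= A + 1.
Proof.
have di := kern_L1 (kern_norm (kdK j)); have KL := kern_L1 kK.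
have -> : \int[mu]_y kap j y = N^-1 * \int[mu]_y `|dK j y| + 1.
  rewrite -(mo_int mo) -IZ// -ID//; last exact: L1Z.
  by apply: eq_Rintegral => y _; rewrite mulrC.
rewrite lerDr mulr_ge0 ?I_ge0 ?invr_ge0 ?(ltW N0)//= lerD2r.
by rewrite ler_pdivrMl// mulrC (mo_intd mo).
Qed.

Lemma suppK_kap j : suppK n (kap j).
Proof.
by move=> y y01 ey; have [h1 h2] := mo_supp mo y01 ey; rewrite /kap h1 h2 normr0 mul0r addr0.
Qed.

Lemma suppK_K : suppK n K.
Proof. by move=> y y01 ey; have [] := mo_supp mo y01 ey. Qed.

Lemma Wm_sub_le u x : pL1 u -> `|Wm u x - u x| <= c2 / c1 * dl K u x.
Proof.
move=> pu; have Rx := cv_rho_gt0 x; have /andP[R1 _] := cv_rho_bd x.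
have -> : Wm u x - u x = (cv (fun y => rho y * u y) K x - u x * cv rho K x) / cv rho K x.
  by rewrite /Wm mulrBl mulfK// gt_eqF.
have e : (fun y => `|K y|) = K by apply/funext => y; rewrite ger0_norm.
have h := cv_sub_le x pu kK; rewrite e in h.
rewrite normrM (gtr0_norm (_ : 0 < (cv rho K x)^-1)) ?invr_gt0//.
rewrite ler_pdivrMr// (le_trans h)//.
have D0 : 0 <= dl K u x by exact: dl_ge0.
have -> : c2 * dl K u x = c2 / c1 * dl K u x * c1 by field; rewrite gt_eqF.
by rewrite ler_wpM2l// !(mulr_ge0, invr_ge0)// ltW.
Qed.

(** The constant of [dWm_le]: [c2 / c1] comes from the increments of the momentum, and the further
    factor [c2 * A / c1] from [Wm u - u] multiplied by the derivative of the mollified density. *)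
Definition Cd : R := c2 / c1 * (1 + c2 * A / c1).

Lemma Cd_ge0 : 0 <= Cd.
Proof. by rewrite /Cd !(mulr_ge0, addr_ge0, invr_ge0)// ltW. Qed.

Lemma dl_kap u j x : pL1 u -> dl (kap j) u x = N^-1 * dl (fun y => `|dK j y|) u x + dl K u x.
Proof.
move=> pu; have i1 := dl_L1 x pu (kern_norm (kdK j)); have i2 := dl_L1 x pu kK.
rewrite /dl -IZ// -ID//; last exact: L1Z.
by apply: eq_Rintegral => h _; rewrite /kap; ring.
Qed.

(** The Favre average of a constant is that constant, so [u x] can be subtracted from [u] without
    changing the gradient; both terms of the quotient rule then become averages of increments of
    [u]. *)
Lemma dWm_le u j x : pL1 u -> `|dWm u j x| <= N * Cd * dl (kap j) u x.
Proof.
move=> pu; have Rx := cv_rho_gt0 x; have /andP[R1 _] := cv_rho_bd x.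
have h1 := Wm_sub_le x pu; have h2 := cv_sub_le x pu (kdK j); have h3 := cv_rhod_le j x.
have a0 : 0 <= dl (fun y => `|dK j y|) u x by exact: dl_ge0.
have b0 : 0 <= dl K u x by exact: dl_ge0.
rewrite dl_kap//.
set a := dl _ u x in a0 h2 *; set b := dl K u x in b0 h1 *.
have -> : dWm u j x = ((Wm u x - u x) * cv rho (dK j) x -
    (cv (fun y => rho y * u y) (dK j) x - u x * cv rho (dK j) x)) / cv rho K x.
  by rewrite /dWm; congr (_ / _); ring.
rewrite normrM (gtr0_norm (_ : 0 < (cv rho K x)^-1)) ?invr_gt0// ler_pdivrMr//.
apply: le_trans (ler_normB _ _) _; rewrite normrM.
apply: (@le_trans _ _ ((c2 / c1 * b) * (c2 * (A * N)) + c2 * a)).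
  by apply: lerD => //; apply: ler_pM.
apply: (@le_trans _ _ (N * Cd * (N^-1 * a + b) * c1)); last first.
  by rewrite ler_wpM2l// !(mulr_ge0, addr_ge0, invr_ge0) ?Cd_ge0// ltW.
have -> : N * Cd * (N^-1 * a + b) * c1 =
    (c2 / c1 * b) * (c2 * (A * N)) + c2 * a + (c2 * N * b + c2 * A / c1 * c2 * a).
  by rewrite /Cd; field; rewrite !gt_eqF.
by rewrite lerDl !(mulr_ge0, addr_ge0, invr_ge0)// ltW.
Qed.

Lemma measurable_Wm u : measurable_fun setT u -> measurable_fun setT (Wm u).
Proof.
move=> mu'; apply: measurable_funM.
  by apply: measurable_cv (mo_meas mo); exact: measurable_funM.
by apply: measurable_invf => [|x]; [exact: measurable_cv (mo_meas mo)|rewrite ltW ?cv_rho_gt0].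
Qed.

Lemma measurable_dWm u j : measurable_fun setT u -> measurable_fun setT (dWm u j).
Proof.
move=> mu'; apply: measurable_funM; last first.
  by apply: measurable_invf => [|x]; [exact: measurable_cv (mo_meas mo)|rewrite ltW ?cv_rho_gt0].
apply: measurable_funB.
  by apply: measurable_funM; [exact: measurable_Wm|exact: measurable_cv (mo_measd mo j)].
by apply: measurable_cv (mo_measd mo j); exact: measurable_funM.
Qed.

Lemma int_Wm_sub u r : 1 <= r -> pL1 u ->
  (\int[mu]_x (`|Wm u x - u x| `^ r)%:E <= ((c2 / c1) `^ r)%:E * osc r K u)%E.
Proof.
move=> r1 pu; have mu' := L1_meas pu.2; have [_ _ KM] := kK.
have mdl := measurable_dl mu' (mo_meas mo).
have m1 : 1 <= \int[mu]_y K y <= 1 by rewrite (mo_int mo) lexx.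
have := dl_powR r1 mu' pu.1 pu.2 (kern_L1 kK) K0 KM m1.
rewrite powR1 mul1e => h; apply: (@le_trans _ _ (((c2 / c1) `^ r)%:E * \int[mu]_x (dl K u x `^ r)%:E)%E); last first.
  by apply: lee_wpmul2l => //; rewrite lee_fin powR_ge0.
have c21 : 0 <= c2 / c1 by rewrite mulr_ge0 ?invr_ge0// ltW.
rewrite -ge0_integralZl//; last 3 first.
- by apply/measurable_EFinP; exact: measurable_powRf.
- by move=> x _; rewrite lee_fin powR_ge0.
- by rewrite lee_fin powR_ge0.
apply: ge0_le_integralR.
- by apply: measurable_powRf; apply: measurableT_comp => //; apply: measurable_funB => //; exact: measurable_Wm.
- by apply: measurable_funM; [exact: measurable_cst|exact: measurable_powRf].
- by move=> x; exact: powR_ge0.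
move=> x; rewrite -powRM ?dl_ge0//; apply: powR_le => //; first lra.
exact: Wm_sub_le.
Qed.

(** The factor [N]^ r[from]dWm_le[cancels against]N^-1 [^ r] in the hypothesis on shifts of size
    [1 / N], so the bound is the same at every scale. *)
Lemma int_dWm u j r B : 1 <= r -> 0 <= B -> pL1 u ->
  (forall h, small n h -> (om r u h <= (N^-1 `^ r * B)%:E)%E) ->
  (\int[mu]_x (`|dWm u j x| `^ r)%:E <= (Cd `^ r * (A + 1) `^ r * (A + 1) * B)%:E)%E.
Proof.
move=> r1 B0 pu omB; have mu' := L1_meas pu.2; have [mkap _ kM] := kern_kap j.
have mdl := measurable_dl mu' mkap.
have h1 := dl_powR r1 mu' pu.1 pu.2 (kern_L1 (kern_kap j)) (kap_ge0 j) kM (kap_int j).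
have /andP[_ k2] := kap_int j.
have NB0 : 0 <= N^-1 `^ r * B by rewrite mulr_ge0 ?powR_ge0.
have h2 := osc_le mu' (kern_L1 (kern_kap j)) (kap_ge0 j) (@suppK_kap j) NB0 omB k2.
have NC : 0 <= N * Cd by rewrite mulr_ge0 ?Cd_ge0// ltW.
have h3 : (\int[mu]_x (`|dWm u j x| `^ r)%:E <= ((N * Cd) `^ r)%:E * \int[mu]_x (dl (kap j) u x `^ r)%:E)%E.
  rewrite -ge0_integralZl//; last 3 first.
  - by apply/measurable_EFinP; exact: measurable_powRf.
  - by move=> x _; rewrite lee_fin powR_ge0.
  - by rewrite lee_fin powR_ge0.
  apply: ge0_le_integralR.
  - by apply: measurable_powRf; apply: measurableT_comp => //; exact: measurable_dWm.
  - by apply: measurable_funM; [exact: measurable_cst|exact: measurable_powRf].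
  - by move=> x; exact: powR_ge0.
  move=> x; rewrite -powRM//; last by apply: dl_ge0; exact: kap_ge0.
  by apply: powR_le => //; [lra|exact: dWm_le].
apply: (le_trans h3).
apply: (@le_trans _ _ (((N * Cd) `^ r)%:E * (((A + 1) `^ r)%:E * (N^-1 `^ r * B * (A + 1))%:E))%E).
  apply: lee_wpmul2l; first by rewrite lee_fin powR_ge0.
  apply: (le_trans h1); apply: lee_wpmul2l => //; by rewrite lee_fin powR_ge0.
rewrite -!EFinM lee_fin powRM ?Cd_ge0 ?(ltW N0)// le_eqVlt; apply/orP; left; apply/eqP.
have NN : N `^ r * N^-1 `^ r = 1 by rewrite -powRM ?invr_ge0 ?(ltW N0)// divff ?gt_eqF// powR1.
transitivity ((N `^ r * N^-1 `^ r) * (Cd `^ r * (A + 1) `^ r * (A + 1) * B)); last by rewrite NN mul1r.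
ring.
Qed.

(** The commutator of the convective term is the unnormalised covariance of [u] and [w] under the
    weight [rho (x + h) * K h]; constants may be subtracted from [u] and [w]. *)
Definition Cov u w x : R := cv (fun y => rho y * u y * w y) K x -
  cv (fun y => rho y * u y) K x * cv (fun y => rho y * w y) K x / cv rho K x.

Definition dq u x : R := \int[mu]_h (`|u (x + h) - u x| ^+ 2 * K h).

Let rhoM2 u w : pL1 (fun y => u y * w y) -> pL1 (fun y => rho y * u y * w y).
Proof. by move=> p; under eq_fun do rewrite -mulrA; exact: rhoM_pL1. Qed.

Lemma cov_expand u w x a b : pL1 u -> pL1 w -> pL1 (fun y => u y * w y) ->
  L1 mu (fun h => rho (x + h) * (u (x + h) - a) * (w (x + h) - b) * K h) /\
  \int[mu]_h (rho (x + h) * (u (x + h) - a) * (w (x + h) - b) * K h) =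
  cv (fun y => rho y * u y * w y) K x - a * cv (fun y => rho y * w y) K x -
  b * cv (fun y => rho y * u y) K x + a * b * cv rho K x.
Proof.
move=> pu pw puw; have p1 := pL1_cvl x (rhoM2 puw) kK; have p2 := pL1_cvl x (rhoM_pL1 pw) kK.
have p3 := pL1_cvl x (rhoM_pL1 pu) kK; have p4 := pL1_cvl x rho_pL1 kK.
have e h : rho (x + h) * (u (x + h) - a) * (w (x + h) - b) * K h =
  rho (x + h) * u (x + h) * w (x + h) * K h - a * (rho (x + h) * w (x + h) * K h)
  - b * (rho (x + h) * u (x + h) * K h) + a * b * (rho (x + h) * K h) by ring.
have q1 := L1B p1 (L1Z a p2); have q2 := L1B q1 (L1Z b p3).
split; first by under eq_fun do rewrite e; exact: L1D q2 (L1Z (a * b) p4).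
under eq_Rintegral do rewrite e.
rewrite (ID q2 (L1Z (a * b) p4)) (IB q1 (L1Z b p3)) (IB p1 (L1Z a p2)) !IZ//.
by rewrite (pL1_cvE x (rhoM2 puw) kK) (pL1_cvE x (rhoM_pL1 pw) kK) (pL1_cvE x (rhoM_pL1 pu) kK)
  (pL1_cvE x rho_pL1 kK).
Qed.

Lemma dq_L1 u x : pL1 u -> pL1 (fun y => u y * u y) ->
  L1 mu (fun h => `|u (x + h) - u x| ^+ 2 * K h).
Proof.
move=> pu pu2.
have -> : (fun h => `|u (x + h) - u x| ^+ 2 * K h) =
    (fun h => u (x + h) * u (x + h) * K h - 2 * u x * (u (x + h) * K h) + u x ^+ 2 * K h).
  by apply/funext => h; rewrite real_normK ?num_real//; ring.
have p1 := pL1_cvl x pu2 kK; have p2 := pL1_cvl x pu kK.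
by apply: L1D; [apply: L1B => //; exact: L1Z|apply: L1Z; exact: kern_L1].
Qed.

(* [Wm u x] minimizes the weighted second moment of [u] around [x]. *)
Lemma var_le u x : pL1 u -> pL1 (fun y => u y * u y) ->
  \int[mu]_h (rho (x + h) * (u (x + h) - Wm u x) * (u (x + h) - Wm u x) * K h) <= c2 * dq u x.
Proof.
move=> pu pu2; have Rx := cv_rho_gt0 x.
have [i1 e1] := cov_expand x (Wm u x) (Wm u x) pu pu pu2.
have [i2 e2] := cov_expand x (u x) (u x) pu pu pu2.
apply: (@le_trans _ _ (\int[mu]_h (rho (x + h) * (u (x + h) - u x) * (u (x + h) - u x) * K h))).
  rewrite e1 e2; set M := cv (fun y => rho y * u y) K x.
  have -> : M = Wm u x * cv rho K x by rewrite /Wm divfK// gt_eqF.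
  have := mulr_ge0 (sqr_ge0 (Wm u x - u x)) (ltW Rx); move: (Wm u x) (u x) (cv rho K x) => a b c.
  rewrite expr2; nra.
have i3 := dq_L1 x pu pu2.
rewrite -IZ//; apply: Ile => //; first exact: L1Z.
move=> h; rewrite mulrA ler_wpM2r// real_normK ?num_real// -mulrA ler_wpM2r ?sqr_ge0//.
by have /andP[] := rhoB (x + h).
Qed.

Lemma dq_ge0 u x : 0 <= dq u x.
Proof. by apply: I_ge0 => h; rewrite mulr_ge0// exprn_ge0. Qed.

(** The product of the two deviations is at most the sum of their squares, which leaves two
    variances; [var_le] recentres these at [u x] and [w x]. *)
Lemma Cov_le u w x : pL1 u -> pL1 w -> pL1 (fun y => u y * u y) -> pL1 (fun y => w y * w y) ->
  pL1 (fun y => u y * w y) -> `|Cov u w x| <= c2 * (dq u x + dq w x).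
Proof.
move=> pu pw pu2 pw2 puw; have Rx := cv_rho_gt0 x.
have [i1 e1] := cov_expand x (Wm u x) (Wm w x) pu pw puw.
have [i2 _] := cov_expand x (Wm u x) (Wm u x) pu pu pu2.
have [i3 _] := cov_expand x (Wm w x) (Wm w x) pw pw pw2.
have -> : Cov u w x = \int[mu]_h (rho (x + h) * (u (x + h) - Wm u x) * (w (x + h) - Wm w x) * K h).
  by rewrite e1 /Cov /Wm; field; rewrite gt_eqF.
rewrite mulrDr; apply: le_trans (lerD (var_le x pu pu2) (var_le x pw pw2)).
rewrite -ID//; apply: Idom; [exact: L1_meas i1|exact: L1D|].
move=> h; rewrite -mulrDl normrM (ger0_norm (K0 h)) ler_wpM2r//.
rewrite -!mulrA -mulrDr normrM (ger0_norm (rho0 _)) ler_wpM2l//.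
move: (u (x + h) - Wm u x) (w (x + h) - Wm w x) => a b.
by rewrite ler_norml; apply/andP; split; nra.
Qed.

Lemma measurable_dq u : measurable_fun setT u -> measurable_fun setT (dq u).
Proof.
move=> mu'; apply: (measurable_param mu (f := fun z : 'rV[R]_d * 'rV[R]_d => `|u (z.1 + z.2) - u z.1| ^+ 2 * K z.2)).
apply: measurable_funM; first by apply: measurable_funX; exact: measurable_diff.
by apply: (measurableT_comp (mo_meas mo)); exact: measurable_snd.
Qed.

(** Jensen's inequality with exponent [s] applied to squared increments: this is where the spatial
    exponent [2 * s] of the velocity comes from. *)
Lemma int_dq u s : 1 <= s -> pL1 u -> pL1 (fun y => u y * u y) ->
  (\int[mu]_x (dq u x `^ s)%:E <= osc (2 * s) K u)%E.
Proof.
move=> s1 pu pu2; have mu' := L1_meas pu.2.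
rewrite oscE//; last exact: mo_meas mo.
apply: ge0_le_integral => //.
- by move=> x _; rewrite lee_fin powR_ge0.
- by apply/measurable_EFinP; apply: measurable_powRf; exact: measurable_dq.
- apply: (ge0_integral_prodT1 mu (F := fun z : 'rV[R]_d * 'rV[R]_d => (`|u (z.1 + z.2)%R - u z.1| `^ (2 * s) * K z.2)%:E)).
    apply/measurable_EFinP; apply: measurable_funM.
      by apply: measurable_powRf; exact: measurable_diff.
    by apply: (measurableT_comp (mo_meas mo)); exact: measurable_snd.
  by move=> z; rewrite lee_fin mulr_ge0 ?powR_ge0.
move=> x _; rewrite /dq.
have e h : `|u (x + h) - u x| `^ (2 * s) = (`|u (x + h) - u x| ^+ 2) `^ s.
  by rewrite powRrM -powR_mulrn.
under [leRHS]eq_integral do rewrite e.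
apply: jensen_powR => //.
- by apply: measurable_funX; exact: measurable_diff2.
- exact: kern_L1.
- exact: mo_int mo.
- exact: dq_L1.
Qed.
Lemma int_Cov u w s : 1 <= s -> pL1 u -> pL1 w -> pL1 (fun y => u y * u y) ->
  pL1 (fun y => w y * w y) -> pL1 (fun y => u y * w y) ->
  (\int[mu]_x (`|Cov u w x| `^ s)%:E <=
    ((2 * c2) `^ s)%:E * (osc (2 * s) K u + osc (2 * s) K w))%E.
Proof.
move=> s1 pu pw pu2 pw2 puw.
have mu1 := L1_meas pu.2; have mw := L1_meas pw.2.
have m1 := measurable_dq mu1; have m2 := measurable_dq mw.
have mC : measurable_fun setT (Cov u w).
  have mK := mo_meas mo.
  apply: measurable_funB; first by apply: measurable_cv => //; exact: L1_meas (rhoM2 puw).2.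
  apply: measurable_funM; last first.
    by apply: measurable_invf => [|x]; [exact: measurable_cv|rewrite ltW ?cv_rho_gt0].
  by apply: measurable_funM; apply: measurable_cv => //; apply: L1_meas (rhoM_pL1 _).2.
have h1 := int_dq s1 pu pu2; have h2 := int_dq s1 pw pw2.
apply: (@le_trans _ _ (((2 * c2) `^ s)%:E * (\int[mu]_x (dq u x `^ s)%:E + \int[mu]_x (dq w x `^ s)%:E))%E); last first.
  by apply: lee_wpmul2l; [rewrite lee_fin powR_ge0|exact: (leeD h1 h2)].
have n1 x : [set: 'rV[R]_d] x -> (0 <= (dq u x `^ s)%:E)%E by rewrite lee_fin powR_ge0.
have n2 x : [set: 'rV[R]_d] x -> (0 <= (dq w x `^ s)%:E)%E by rewrite lee_fin powR_ge0.
have e1 : measurable_fun setT (fun x => (dq u x `^ s)%:E).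
  by apply/measurable_EFinP; exact: measurable_powRf.
have e2 : measurable_fun setT (fun x => (dq w x `^ s)%:E).
  by apply/measurable_EFinP; exact: measurable_powRf.
rewrite -(ge0_integralD mu measurableT n1 e1 n2 e2).
have n3 x : [set: 'rV[R]_d] x -> (0 <= (dq u x `^ s)%:E + (dq w x `^ s)%:E)%E.
  by move=> _; rewrite adde_ge0 ?lee_fin ?powR_ge0.
rewrite -(ge0_integralZl mu measurableT (emeasurable_funD e1 e2) n3); last by rewrite lee_fin powR_ge0.
apply: ge0_le_integralR.
- by apply: measurable_powRf; exact: measurableT_comp.
- apply: measurable_funM; first exact: measurable_cst.
  by apply: measurable_funD; exact: measurable_powRf.
- by move=> x; exact: powR_ge0.
move=> x; have s0 : 0 <= s by lra.
apply: (le_trans (powR_le s0 (normr_ge0 _) (Cov_le x pu pw pu2 pw2 puw))).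
rewrite powRM ?addr_ge0 ?dq_ge0 ?(ltW c20)// [(2 * c2) `^ s]powRM ?(ltW c20)// [2 `^ s * _]mulrC -mulrA.
by rewrite ler_wpM2l ?powR_ge0// powR_add_le ?dq_ge0.
Qed.

(** The kinetic energy lost by mollification is the integral of a variance. It has a sign and is
    governed by the same estimates as the commutator. *)
Lemma energy_gap u : pL1 u -> pL1 (fun y => u y * u y) ->
  \int[mu]_x (rho x * u x * u x) - \int[mu]_x (Wm u x * cv (fun y => rho y * u y) K x) =
    \int[mu]_x Cov u u x /\
  (forall x, 0 <= Cov u u x).
Proof.
move=> pu pu2; have p2 := rhoM2 pu2; have p1 := rhoM_pL1 pu; have p0 := rho_pL1.
split.
  have -> : \int[mu]_x (rho x * u x * u x) = \int[mu]_x cv (fun y => rho y * u y * u y) K x.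
    by rewrite I_cv// (mo_int mo) mulr1.
  have k1 := kern_cv p2.2 kK; have k2 := kern_cv p1.2 kK.
  have mW : measurable_fun setT (Wm u) by apply: measurable_Wm; exact: L1_meas pu.2.
  rewrite -IB; [|exact: kern_L1|].
    by apply: eq_Rintegral => x _; rewrite /Cov /Wm; ring.
  apply: (@L1_dom _ _ _ _ (cv (fun y => rho y * u y * u y) K)).
  - by apply: measurable_funM => //; case: k2.
  - exact: kern_L1.
  move=> x; have Rx := cv_rho_gt0 x.
  have [i1 e1] := cov_expand x (Wm u x) (Wm u x) pu pu pu2.
  have h : 0 <= \int[mu]_h (rho (x + h) * (u (x + h) - Wm u x) * (u (x + h) - Wm u x) * K h).
    by apply: I_ge0 => h; rewrite mulr_ge0// -mulrA mulr_ge0// -expr2 sqr_ge0.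
  have E : cv (fun y => rho y * u y) K x = Wm u x * cv rho K x by rewrite /Wm divfK// gt_eqF.
  rewrite e1 E in h; rewrite E ger0_norm; last by rewrite mulrA mulr_ge0 ?(ltW Rx)// -expr2 sqr_ge0.
  by move: h; move: (Wm u x) (cv rho K x) => a b; nra.
move=> x; have Rx := cv_rho_gt0 x.
have [i1 e1] := cov_expand x (Wm u x) (Wm u x) pu pu pu2.
have h : 0 <= \int[mu]_h (rho (x + h) * (u (x + h) - Wm u x) * (u (x + h) - Wm u x) * K h).
  by apply: I_ge0 => h; rewrite mulr_ge0// -mulrA mulr_ge0// -expr2 sqr_ge0.
have E : cv (fun y => rho y * u y) K x = Wm u x * cv rho K x by rewrite /Wm divfK// gt_eqF.
rewrite e1 E in h; rewrite /Cov E.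
have -> : Wm u x * cv rho K x * (Wm u x * cv rho K x) / cv rho K x = Wm u x * Wm u x * cv rho K x.
  by field; rewrite gt_eqF.
by move: h; move: (Wm u x) (cv rho K x) => a b; nra.
Qed.

Lemma kern_cvrho : kern (cv rho K).
Proof. exact: kern_cv rho_pL1.2 kK. Qed.

Lemma kern_rcomp (P : R -> R) (B : R) : measurable_fun setT (fun x => P (cv rho K x)) ->
  (forall r, c1 <= r <= c2 -> `|P r| <= B) -> kern (fun x => P (cv rho K x)).
Proof.
move=> mP PB; split => //; last by exists B => x; apply: PB; exact: cv_rho_bd.
by have [_ pR _] := kern_cvrho; move=> x j; rewrite pR.
Qed.

Lemma kern_inv : kern (fun x => (cv rho K x)^-1).
Proof.
apply: (@kern_rcomp (fun r => r^-1) c1^-1).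
  by apply: measurable_invf => [|x]; [exact: measurable_cv (mo_meas mo)|rewrite ltW ?cv_rho_gt0].
move=> r /andP[r1 _]; have r0 : 0 < r by exact: lt_le_trans r1.
by rewrite gtr0_norm ?invr_gt0// lef_pV2.
Qed.

Lemma kern_Wm u : pL1 u -> kern (Wm u).
Proof. by move=> pu; apply: kernM kern_inv; exact: kern_cv (rhoM_pL1 pu).2 kK. Qed.

Lemma kern_dWm u j : pL1 u -> kern (dWm u j).
Proof.
move=> pu; apply: kernM kern_inv; apply: kernB.
  by apply: kernM; [exact: kern_Wm|exact: kern_cv rho_pL1.2 (kdK j)].
exact: kern_cv (rhoM_pL1 pu).2 (kdK j).
Qed.

Lemma is_derive_Wm u j x : pL1 u -> is_derive x (delta_mx 0 j : 'rV[R]_d) (Wm u) (dWm u j x).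
Proof.
move=> pu; have Rx : cv rho K x != 0 by rewrite gt_eqF// cv_rho_gt0.
apply: (is_derive_to (is_derive_div Rx (is_derive_cvj x j (rhoM_pL1 pu).2) (is_derive_cvj x j rho_pL1.2))).
by rewrite /dWm /Wm mulrN opprK addrC.
Qed.

Lemma I_derive0_kern f df j : kern f -> kern df ->
  (forall x, is_derive x (delta_mx 0 j : 'rV[R]_d) f (df x)) -> \int[mu]_x df x = 0.
Proof.
move=> [mf pf [M fM]] [mdf _ [M' dfM]] dfd.
by apply: (I_derive0 (M := Num.max M M') pf mf mdf dfd) => x; rewrite le_max ?fM ?dfM ?orbT.
Qed.

(** No minus sign appears, because the derivative of [cv f K] is [- cv f (dK j)]; the integral of
    the derivative of [a * cv f K] is 0. *)
Lemma ibp a da f j : kern a -> kern da -> L1 mu f ->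
  (forall x, is_derive x (delta_mx 0 j : 'rV[R]_d) a (da x)) ->
  \int[mu]_x (a x * cv f (dK j) x) = \int[mu]_x (da x * cv f K x).
Proof.
move=> ka kda fi dad; have k1 := kern_cv fi kK; have k2 := kern_cv fi (kdK j).
have kk1 := kernM ka k2; have kk2 := kernM kda k1.
apply/esym/eqP; rewrite -subr_eq0 -IB; [|exact: kern_L1|exact: kern_L1].
apply/eqP; apply: (I_derive0_kern (j := j) (kernM ka k1) (kernB kk2 kk1)) => x.
by apply: (is_derive_to (is_derive_mul (dad x) (is_derive_cvj x j fi))); ring.
Qed.

Lemma kern_Cov u w : pL1 u -> pL1 w -> pL1 (fun y => u y * w y) -> kern (Cov u w).
Proof.
move=> pu pw puw; apply: kernB; first exact: kern_cv (rhoM2 puw).2 kK.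
apply: kernM kern_inv; apply: kernM; [exact: kern_cv (rhoM_pL1 pu).2 kK|exact: kern_cv (rhoM_pL1 pw).2 kK].
Qed.

(** * The integrated energy balance *)

Section Balance.
Variables (v : 'I_d -> 'rV[R]_d -> R) (pf : 'rV[R]_d -> R) (S : 'I_d -> 'I_d -> 'rV[R]_d -> R).
Variables (p dp P1 : R -> R) (B : R).
Hypotheses (pv : forall i, pL1 (v i)) (pvv : forall i j, pL1 (fun y => v i y * v j y))
  (ppf : pL1 pf) (pS : forall i j, pL1 (S i j)).
Hypotheses (mp : measurable_fun setT p) (mdp : measurable_fun setT dp)
  (mP1 : measurable_fun setT P1).
Hypotheses (dpE : forall r, c1 <= r <= c2 -> is_derive r 1 p (dp r))
  (dP1E : forall r, c1 <= r <= c2 -> is_derive r 1 P1 (dp r / r))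
  (pB : forall r, c1 <= r <= c2 -> [/\ `|p r| <= B, `|dp r| <= B & `|P1 r| <= B]).

(** [drho] and [dmom] are the time derivatives that the mollified equations assign to the density
    and the momentum, and [denergy] is the one that the chain rule assigns to the energy density,
    with [P1] as derivative of the potential. Derivatives of kernels absorb the minus signs of the
    divergences. *)
Definition drho x : R := \sum_j cv (fun y => rho y * v j y) (dK j) x.

Definition dmom i x : R := \sum_j cv (fun y => rho y * v i y * v j y) (dK j) x +
  cv pf (dK i) x - \sum_j cv (S i j) (dK j) x.

Definition denergy x : R := \sum_i Wm (v i) x * dmom i x -
  2^-1 * (\sum_i Wm (v i) x ^+ 2) * drho x + P1 (cv rho K x) * drho x.

Definition flux x : R := \sum_i \sum_j Cov (v i) (v j) x * dWm (v i) j x +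
  (cv pf K x - p (cv rho K x)) * (\sum_i dWm (v i) i x) -
  \sum_i \sum_j cv (S i j) K x * dWm (v i) j x.

Let kernP (P : R -> R) : measurable_fun setT P -> (forall r, c1 <= r <= c2 -> `|P r| <= B) ->
  kern (fun x => P (cv rho K x)).
Proof.
move=> mP PB; apply: kern_rcomp PB; apply: (measurableT_comp mP).
by case: kern_cvrho.
Qed.

Let kp : kern (fun x => p (cv rho K x)).
Proof. by apply: kernP => // r /pB[]. Qed.

Let kdp : kern (fun x => dp (cv rho K x)).
Proof. by apply: kernP => // r /pB[]. Qed.

Let kP1 : kern (fun x => P1 (cv rho K x)).
Proof. by apply: kernP => // r /pB[]. Qed.

Let cvrE u x : cv (fun y => rho y * u y) K x = Wm u x * cv rho K x.
Proof. by rewrite /Wm divfK// gt_eqF// cv_rho_gt0. Qed.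

(** Integration by parts puts all derivatives on [Wm (v i)]. The term from [Wm (v i) x ^+ 2] then
    contributes the product of the two mollified momenta divided by the density, which is what the
    convective term lacks to be [Cov]. *)
Lemma balance_ij i j :
  \int[mu]_x (Wm (v i) x * cv (fun y => rho y * v i y * v j y) (dK j) x -
    Wm (v i) x * cv (S i j) (dK j) x -
    2^-1 * (Wm (v i) x ^+ 2 * cv (fun y => rho y * v j y) (dK j) x)) =
  \int[mu]_x (Cov (v i) (v j) x * dWm (v i) j x - cv (S i j) K x * dWm (v i) j x).
Proof.
have kW := kern_Wm (pv i); have kdW := kern_dWm j (pv i).
have L1a := (rhoM2 (pvv i j)).2; have L1r := (rhoM_pL1 (pv j)).2; have L1s := (pS i j).2.
have e1 := ibp kW kdW L1a (fun x => is_derive_Wm j x (pv i)).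
have e2 := ibp kW kdW L1s (fun x => is_derive_Wm j x (pv i)).
have kW2 := kernM kW kW; have kdW2 := kernD (kernM kW kdW) (kernM kW kdW).
have e3 := ibp kW2 kdW2 L1r (fun x => is_derive_mul (is_derive_Wm j x (pv i)) (is_derive_Wm j x (pv i))).
have ka := kern_cv L1a (kdK j); have kr := kern_cv L1r (kdK j); have ks := kern_cv L1s (kdK j).
have ka' := kern_cv L1a kK; have kr' := kern_cv L1r kK; have ks' := kern_cv L1s kK.
under eq_Rintegral do rewrite expr2.
have t1 := kernM kW ka; have t2 := kernM kW ks; have t3 := kernZ 2^-1 (kernM kW2 kr).
rewrite IB; [|exact: kern_L1 (kernB t1 t2)|exact: kern_L1].
rewrite IB; [|exact: kern_L1|exact: kern_L1].
rewrite IZ; last exact: kern_L1 (kernM kW2 kr).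
rewrite e1 e2 e3 -IZ; last exact: kern_L1 (kernM kdW2 kr').
rewrite -IB; [|exact: kern_L1 (kernM kdW ka')|exact: kern_L1 (kernM kdW ks')].
rewrite -IB; [|exact: kern_L1 (kernB (kernM kdW ka') (kernM kdW ks'))|exact: kern_L1 (kernZ _ (kernM kdW2 kr'))].
apply: eq_Rintegral => x _; rewrite /Cov !cvrE; field.
by rewrite gt_eqF// cv_rho_gt0.
Qed.

(** Since [P1] has derivative [dp r / r], parts turn the internal energy term into [dp] at the
    mollified density times its derivative times [Wm]. The derivative of the product of [p] of the
    mollified density and [Wm] has mean 0, so this equals minus that pressure times [dWm]. *)
Lemma balance_i i :
  \int[mu]_x (Wm (v i) x * cv pf (dK i) x + P1 (cv rho K x) * cv (fun y => rho y * v i y) (dK i) x) =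
  \int[mu]_x ((cv pf K x - p (cv rho K x)) * dWm (v i) i x).
Proof.
have kW := kern_Wm (pv i); have kdW := kern_dWm i (pv i).
have L1r := (rhoM_pL1 (pv i)).2; have L1p := ppf.2.
have e1 := ibp kW kdW L1p (fun x => is_derive_Wm i x (pv i)).
have kR := kern_cvrho; have kdR := kern_cv rho_pL1.2 (kdK i).
have dR x := is_derive_cvj x i rho_pL1.2.
have kdPR := kernM (kernM kdp kern_inv) (kernN kdR).
have e2 := ibp kP1 kdPR L1r (fun x => is_derive_scomp (dP1E (cv_rho_bd x)) (dR x)).
have kpW := kernD (kernM kp kdW) (kernM kW (kernM kdp (kernN kdR))).
have e3 := I_derive0_kern (kernM kp kW) kpW
  (fun x => is_derive_mul (is_derive_scomp (dpE (cv_rho_bd x)) (dR x)) (is_derive_Wm i x (pv i))).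
have kr := kern_cv L1r (kdK i); have kq := kern_cv L1p (kdK i).
have kr' := kern_cv L1r kK; have kq' := kern_cv L1p kK.
rewrite ID; [|exact: kern_L1 (kernM kW kq)|exact: kern_L1 (kernM kP1 kr)].
rewrite e1 e2 -[LHS]subr0 -e3.
rewrite -ID; [|exact: kern_L1 (kernM kdW kq')|exact: kern_L1 (kernM kdPR kr')].
rewrite -IB; [|exact: kern_L1 (kernD (kernM kdW kq') (kernM kdPR kr'))|exact: kern_L1 kpW].
apply: eq_Rintegral => x _; rewrite !cvrE; field.
by rewrite gt_eqF// cv_rho_gt0.
Qed.

Lemma balance : \int[mu]_x denergy x = \int[mu]_x flux x.
Proof.
pose a i j x := Wm (v i) x * cv (fun y => rho y * v i y * v j y) (dK j) x -
    Wm (v i) x * cv (S i j) (dK j) x -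
    2^-1 * (Wm (v i) x ^+ 2 * cv (fun y => rho y * v j y) (dK j) x).
pose b i x := Wm (v i) x * cv pf (dK i) x + P1 (cv rho K x) * cv (fun y => rho y * v i y) (dK i) x.
pose a' i j x := Cov (v i) (v j) x * dWm (v i) j x - cv (S i j) K x * dWm (v i) j x.
pose b' i x := (cv pf K x - p (cv rho K x)) * dWm (v i) i x.
have kW i := kern_Wm (pv i); have kdW i j := kern_dWm j (pv i).
have La i j := (rhoM2 (pvv i j)).2; have Lr j := (rhoM_pL1 (pv j)).2; have Ls i j := (pS i j).2.
have ka i j : kern (a i j).
  apply: kernB; last by apply: kernZ; apply: kernM; [exact: kernM (kW i) (kW i)|exact: kern_cv (Lr j) (kdK j)].
  by apply: kernB; apply: kernM => //; exact: kern_cv (kdK j).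
have kb i : kern (b i).
  apply: kernD; apply: kernM => //; first exact: kern_cv ppf.2 (kdK i).
  exact: kern_cv (Lr i) (kdK i).
have ka' i j : kern (a' i j).
  apply: kernB; apply: kernM => //; first exact: kern_Cov.
  exact: kern_cv (Ls i j) kK.
have kb' i : kern (b' i) by apply: kernM => //; apply: kernB => //; exact: kern_cv ppf.2 kK.
transitivity (\int[mu]_x (\sum_i (\sum_j a i j x + b i x))).
  apply: eq_Rintegral => x _; rewrite /denergy /drho /dmom big_split/=.
  have -> : \sum_i \sum_j a i j x = \sum_i Wm (v i) x * (\sum_j cv (fun y => rho y * v i y * v j y) (dK j) x - \sum_j cv (S i j) (dK j) x) - 2^-1 * (\sum_i Wm (v i) x ^+ 2) * (\sum_j cv (fun y => rho y * v j y) (dK j) x).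
    rewrite -[2^-1 * _ * _]mulrA mulr_suml mulr_sumr -sumrB.
    by apply: eq_bigr => i _; rewrite mulrBr !mulr_sumr -!sumrB.
  have -> : \sum_i b i x = \sum_i Wm (v i) x * cv pf (dK i) x + P1 (cv rho K x) * (\sum_j cv (fun y => rho y * v j y) (dK j) x).
    by rewrite mulr_sumr -big_split.
  rewrite addrA; congr (_ + _); rewrite addrAC; congr (_ - _).
  by rewrite -big_split/=; apply: eq_bigr => i _; rewrite -mulrDr; congr (_ * _); ring.
transitivity (\int[mu]_x (\sum_i (\sum_j a' i j x + b' i x))); last first.
  apply: eq_Rintegral => x _; rewrite /flux big_split/=.
  have -> : \sum_i \sum_j a' i j x = \sum_i \sum_j Cov (v i) (v j) x * dWm (v i) j x - \sum_i \sum_j cv (S i j) K x * dWm (v i) j x.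
    by rewrite -sumrB; apply: eq_bigr => i _; rewrite -sumrB.
  have -> : \sum_i b' i x = (cv pf K x - p (cv rho K x)) * (\sum_i dWm (v i) i x) by rewrite mulr_sumr.
  by rewrite addrAC.
have kab i : kern (fun x => \sum_j a i j x) by exact: kern_sum.
have kab' i : kern (fun x => \sum_j a' i j x) by exact: kern_sum.
rewrite Isum; last by move=> i; exact: kern_L1 (kernD (kab i) (kb i)).
rewrite Isum; last by move=> i; exact: kern_L1 (kernD (kab' i) (kb' i)).
apply: eq_bigr => i _.
rewrite (ID (kern_L1 (kab i)) (kern_L1 (kb i))) (ID (kern_L1 (kab' i)) (kern_L1 (kb' i))).
rewrite (Isum _ (fun j => kern_L1 (ka i j))) (Isum _ (fun j => kern_L1 (ka' i j))).
congr (_ + _); last exact: balance_i.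
by apply: eq_bigr => j _; exact: balance_ij.
Qed.

End Balance.

End Mollified.
End Static.

(** * Limit of the energy flux at a fixed time *)

Section Holder.
Context {dd : measure_display} {T : measurableType dd} {R : realType}.
Variable mu : {measure set T -> \bar R}.
Implicit Types (f g : T -> R).

Lemma holder_abs f g (s q a b : R) : measurable_fun setT f -> measurable_fun setT g ->
  0 < s -> 0 < q -> s^-1 + q^-1 = 1 -> 0 <= a -> 0 <= b ->
  (\int[mu]_x (`|f x| `^ s)%:E <= a%:E)%E -> (\int[mu]_x (`|g x| `^ q)%:E <= b%:E)%E ->
  L1 mu (fun x => f x * g x) /\ `|\int[mu]_x (f x * g x)| <= a `^ s^-1 * b `^ q^-1.
Proof.
move=> mf mg s0 q0 sq a0 b0 fa gb.
have H := @hoelder _ _ _ mu f g s q mf mg s0 q0 sq.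
have N (h : T -> R) (r c : R) : 0 < r -> 0 <= c -> measurable_fun setT h -> (\int[mu]_x (`|h x| `^ r)%:E <= c%:E)%E ->
    ('N[mu]_r%:E[EFin \o h] <= (c `^ r^-1)%:E)%E.
  move=> r0 c0 mh hc; rewrite unlock -poweR_EFin; apply: gt0_ler_poweR; rewrite ?invr_ge0 ?(ltW r0)//.
  - by rewrite in_itv/= leey andbT integral_ge0// => x _; rewrite poweR_ge0.
  - by rewrite in_itv/= leey andbT lee_fin.
have le1 : (\int[mu]_x `|f x * g x|%:E <= (a `^ s^-1 * b `^ q^-1)%:E)%E.
  rewrite Lnorm1 in H; apply: (le_trans H); rewrite EFinM.
  by apply: lee_pmul; rewrite ?Lnorm_ge0 ?N.
have fgi : L1 mu (fun x => f x * g x).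
  by apply/L1P; split; [exact: measurable_funM|rewrite (le_lt_trans le1)// ltry].
split => //; rewrite (le_trans (Iabs fgi))// -lee_fin EFinI//; exact: L1_norm.
Qed.

(** The rank is chosen before [g], so that [g] may itself vary along a sequence bounded in L^q, as
    in [viscous_cvg]. *)
Lemma holder_unif (f_ : nat -> T -> R) (s q b : R) :
  (forall n, measurable_fun setT (f_ n)) -> 0 < s -> 0 < q -> s^-1 + q^-1 = 1 -> 0 <= b ->
  (\int[mu]_x (`|f_ n x| `^ s)%:E)%E @[n --> \oo] --> 0%E ->
  forall e : R, 0 < e -> exists N, forall n g, (N <= n)%N -> measurable_fun setT g ->
  (\int[mu]_x (`|g x| `^ q)%:E <= b%:E)%E ->
  L1 mu (fun x => f_ n x * g x) /\ `|\int[mu]_x (f_ n x * g x)| <= e.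
Proof.
move=> mf s0 q0 sq b0 f0 e e0.
pose c := b `^ q^-1 + 1; have c0 : 0 < c by rewrite ltr_wpDl ?powR_ge0.
pose a := (e / c) `^ s; have a0 : 0 < a by apply: powR_gt0; exact: divr_gt0.
move/fine_cvgP : f0 => [fin /cvgr0Pnorm_lt/(_ a a0) hc].
have [N _ HN] : \forall n \near \oo, (\int[mu]_x (`|f_ n x| `^ s)%:E)%E \is a fin_num /\
    `|fine (\int[mu]_x (`|f_ n x| `^ s)%:E)%E| < a.
  by near=> n; split; near: n.
exists N => n g Nn mg gb; have [fn ha] := HN n Nn.
have fa : (\int[mu]_x (`|f_ n x| `^ s)%:E <= a%:E)%E.
  by rewrite -(fineK fn) lee_fin ltW// (le_lt_trans (ler_norm _)).
have [h1 h2] := holder_abs (mf n) mg s0 q0 sq (ltW a0) b0 fa gb.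
split => //; apply: (le_trans h2).
rewrite /a -powRrM divff ?gt_eqF// powRr1; last by rewrite divr_ge0 ?ltW.
by rewrite mulrAC ler_pdivrMr// ler_wpM2l ?(ltW e0)// lerDl.
Unshelve. all: by end_near. Qed.

Lemma holder_cvg0 (f_ g_ : nat -> T -> R) (s q b : R) :
  (forall n, measurable_fun setT (f_ n)) -> (forall n, measurable_fun setT (g_ n)) ->
  0 < s -> 0 < q -> s^-1 + q^-1 = 1 -> 0 <= b ->
  (\int[mu]_x (`|f_ n x| `^ s)%:E)%E @[n --> \oo] --> 0%E ->
  (forall n, (\int[mu]_x (`|g_ n x| `^ q)%:E <= b%:E)%E) ->
  \int[mu]_x (f_ n x * g_ n x) @[n --> \oo] --> 0.
Proof.
move=> mf mg s0 q0 sq b0 f0 gb; apply/cvgr0Pnorm_le => e e0.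
have [N HN] := holder_unif mf s0 q0 sq b0 f0 e0.
by exists N => // n /= Nn; have [] := HN n _ Nn (mg n) (gb n).
Qed.

End Holder.

Lemma eq_leR (R : realType) (a b : R) : a = b -> a <= b.
Proof. by move=> ->. Qed.

Lemma cvg_ext (R : realType) (u w : nat -> R) (l : R) : (forall n, u n = w n) ->
  w n @[n --> \oo] --> l -> u n @[n --> \oo] --> l.
Proof. by move=> uw; have -> : u = w by exact/funext. Qed.

Lemma dist4 (R : realType) (a b c g x e : R) : `|a| <= e / 4 -> `|b| <= e / 4 -> `|c| <= e / 4 ->
  `|g - x| <= e / 4 -> `|(g - c) - (x + a - b)| <= e.
Proof.
by rewrite !ler_norml => /andP[? ?] /andP[? ?] /andP[? ?] /andP[? ?]; apply/andP; split; lra.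
Qed.

Lemma cvg_sumr (R : realType) (I : Type) (r : seq I) (F : nat -> I -> R) (l : I -> R) :
  (forall i, F n i @[n --> \oo] --> l i) ->
  \sum_(i <- r) F n i @[n --> \oo] --> \sum_(i <- r) l i.
Proof.
move=> Fl; elim: r => [|i r IH].
  by under eq_cvg do rewrite big_nil; rewrite big_nil; exact: cvg_cst.
by under eq_cvg do rewrite big_cons; rewrite big_cons; apply: cvgD.
Qed.

(** * Convective, pressure and viscous terms as the scale tends to 0 *)

Section Limit.
Context {R : realType} {d : nat}.
Local Notation mu := (torus R d).
Implicit Types (f u w : 'rV[R]_d -> R) (x y h : 'rV[R]_d) (r : R).
Variables (A : R) (K : nat -> 'rV[R]_d -> R) (dK : nat -> 'I_d -> 'rV[R]_d -> R).
Hypotheses (A0 : 0 < A) (mo : forall n, moll A n (K n) (dK n)).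
Variables (rho : 'rV[R]_d -> R) (c1 c2 : R).
Hypotheses (c10 : 0 < c1) (rhop : torus_function rho) (mrho : measurable_fun setT rho)
  (rhoB : forall x, c1 <= rho x <= c2).
Variables (v : 'I_d -> 'rV[R]_d -> R) (S g : 'I_d -> 'I_d -> 'rV[R]_d -> R).
Hypotheses (pv : forall i, pL1 (v i)) (v2 : forall i, L1 mu (fun x => v i x ^+ 2))
  (pS : forall i j, pL1 (S i j)) (pg : forall i j, pL1 (g i j)).
Hypotheses (wg : forall n i j x, cv (v i) (dK n j) x = - cv (g i j) (K n) x)
  (wgr : forall n i j y, \int[mu]_x (v i x * dK n j (y - x)) = \int[mu]_x (g i j x * K n (y - x))).
Variables (p : R -> R) (B : R).
Hypotheses (B0 : 0 <= B) (mp : measurable_fun setT p) (pB : forall r, c1 <= r <= c2 -> `|p r| <= B)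
  (pL : forall a b, c1 <= a <= c2 -> c1 <= b <= c2 -> `|p a - p b| <= B * `|a - b|).
Variables (s q V Gq G2 S2 : R).
Hypotheses (s1 : 1 <= s) (q1 : 1 <= q) (sq : s^-1 + q^-1 = 1).
Hypotheses (V0 : 0 <= V) (Gq0 : 0 <= Gq) (G20 : 0 <= G2) (S20 : 0 <= S2).
Hypotheses (hV : forall i, (\int[mu]_x (`|v i x| `^ (2 * s))%:E <= V%:E)%E)
  (hGq : (\int[mu]_x ((\sum_i \sum_j `|g i j x|) `^ q)%:E <= Gq%:E)%E)
  (hG2 : (\int[mu]_x ((\sum_i \sum_j `|g i j x|) `^ 2)%:E <= G2%:E)%E)
  (hS : forall i j, (\int[mu]_x (`|S i j x| `^ 2)%:E <= S2%:E)%E).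

Let pvv i j : pL1 (fun y => v i y * v j y).
Proof.
split; first by move=> x k; rewrite (pv i).1 (pv j).1.
by apply: L1_mul2 => //; exact: L1_meas (pv _).2.
Qed.

Let kK n := moll_kern (mo n).
Let kdK n := moll_kernd (mo n).
Let kW n i := kern_Wm c10 rhop mrho rhoB (mo n) (pv i).
Let kdW n i j := kern_dWm c10 rhop mrho rhoB (mo n) j (pv i).
Let kC n i j := kern_Cov c10 rhop mrho rhoB (mo n) (pv i) (pv j) (pvv i j).
Let pf x := p (rho x).
Let prho := rho_pL1 c10 rhop mrho rhoB.

Let ppf : pL1 pf.
Proof.
split; first by move=> x j; rewrite /pf rhop.
by apply: (@L1_bdd _ _ _ mu B) => [|x]; [exact: measurableT_comp mp mrho|exact: pB].
Qed.

Definition Dr r : R := Cd c1 c2 A `^ r * (A + 1) `^ r * (A + 1).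

Lemma Dr_ge0 r : 0 <= Dr r.
Proof. by rewrite /Dr !mulr_ge0 ?powR_ge0//; rewrite addr_ge0// ltW. Qed.

Lemma grad_row_le r G i : 0 <= r ->
  (\int[mu]_x ((\sum_i \sum_j `|g i j x|) `^ r)%:E <= G%:E)%E ->
  (\int[mu]_x ((\sum_j `|g i j x|) `^ r)%:E <= G%:E)%E.
Proof.
move=> r0; apply: le_trans.
have mg i' j : measurable_fun setT (g i' j) := L1_meas (pg i' j).2.
apply: ge0_le_integralR.
- by apply: measurable_powRf; apply: measurable_sum => j; exact: measurableT_comp.
- by apply: measurable_powRf; apply: measurable_sum => k; apply: measurable_sum => j; exact: measurableT_comp.
- by move=> x; exact: powR_ge0.
move=> x; apply: powR_le => //; first exact: sumr_ge0.
by rewrite [leRHS](bigD1 i)//= lerDl sumr_ge0// => k _; exact: sumr_ge0.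
Qed.

Lemma int_dWm_le r G n i j : 1 <= r -> 0 <= G ->
  (\int[mu]_x ((\sum_i \sum_j `|g i j x|) `^ r)%:E <= G%:E)%E ->
  (\int[mu]_x (`|dWm rho (K n) (dK n) (v i) j x| `^ r)%:E <= (Dr r * G)%:E)%E.
Proof.
move=> r1 G0 hG; have r0 : 0 <= r by lra.
apply: (int_dWm c10 rhop mrho rhoB A0 (mo n) j r1 G0 (pv i)) => h sh.
apply: (om_sobolev mo r1 (pv i).2 (pv i).1 (fun j => (pg i j).2) (fun j => (pg i j).1)
  (fun n j x => wg n i j x) _ _ (grad_row_le i r0 hG)); last by rewrite invr_ge0.
by move=> k; have /andP[h1 h2] := sh k; rewrite ger0_norm.
Qed.

Let s21 : 1 <= 2 * s.
Proof. by rewrite (le_trans s1)// ler_peMl ?ler1n// (le_trans ler01 s1). Qed.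

Let osc_V n i : (osc (2 * s) (K n) (v i) <= (2 `^ (2 * s) * (V + V))%:E)%E.
Proof.
have mv := L1_meas (pv i).2.
rewrite -[X in X%:E]mulr1; apply: (osc_le mv (kern_L1 (kK n)) (mo_ge0 (mo n)) (suppK_K (mo n))).
- by rewrite mulr_ge0 ?powR_ge0// addr_ge0.
- move=> h _; apply: (le_trans (om_le h s21 mv (pv i).1)); rewrite EFinM EFinD.
  apply: lee_wpmul2l; first by rewrite lee_fin powR_ge0.
  exact: (leeD (hV i) (hV i)).
- by rewrite (mo_int (mo n)).
Qed.

Let Cov_V n i j : (\int[mu]_x (`|Cov rho (K n) (v i) (v j) x| `^ s)%:E <=
  ((2 * c2) `^ s * (4 * 2 `^ (2 * s) * V))%:E)%E.
Proof.
apply: (le_trans (int_Cov c10 rhop mrho rhoB (mo n) s1 (pv i) (pv j) (pvv i i) (pvv j j) (pvv i j))).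
rewrite EFinM; apply: lee_wpmul2l; first by rewrite lee_fin powR_ge0.
apply: (le_trans (leeD (osc_V n i) (osc_V n j))).
by rewrite -EFinD lee_fin le_eqVlt; apply/orP; left; apply/eqP; ring.
Qed.

Let Cov0 i j : (\int[mu]_x (`|Cov rho (K n) (v i) (v j) x| `^ s)%:E)%E @[n --> \oo] --> 0%E.
Proof.
have o i' : osc (2 * s) (K n) (v i') @[n --> \oo] --> 0%E.
  apply: (osc_cvg s21 (L1_meas (pv i').2) (pv i').1).
  - by rewrite (le_lt_trans (hV i'))// ltry.
  - by move=> n; exact: kern_L1.
  - by move=> n; exact: mo_ge0 (mo n).
  - by move=> n; exact: suppK_K (mo n).
  - by move=> n; rewrite (mo_int (mo n)).
have c0 : (((2 * c2) `^ s)%:E * (osc (2 * s) (K n) (v i) + osc (2 * s) (K n) (v j)))%E @[n --> \oo] --> 0%E.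
  by rewrite -[0%E](mule0 ((2 * c2) `^ s)%:E); apply: cvgeZl => //; exact: cvge0D (o i) (o j).
apply: (squeeze_cvge _ (cvg_cst 0%E) c0); apply/nearW => n; apply/andP; split.
  by apply: integral_ge0 => x _; rewrite lee_fin powR_ge0.
exact: (int_Cov c10 rhop mrho rhoB (mo n) s1 (pv i) (pv j) (pvv i i) (pvv j j) (pvv i j)).
Qed.

Lemma convective_cvg i j :
  \int[mu]_x (Cov rho (K n) (v i) (v j) x * dWm rho (K n) (dK n) (v i) j x) @[n --> \oo] --> 0.
Proof.
have bG : 0 <= Dr q * Gq by rewrite mulr_ge0 ?Dr_ge0.
have mC n : measurable_fun setT (Cov rho (K n) (v i) (v j)) by case: (kC n i j).
have mW n : measurable_fun setT (dWm rho (K n) (dK n) (v i) j) by case: (kdW n i j).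
have s0 : 0 < s := lt_le_trans ltr01 s1.
have q0 : 0 < q := lt_le_trans ltr01 q1.
apply: (holder_cvg0 mC mW s0 q0 sq bG (Cov0 i j)) => n.
exact: int_dWm_le.
Qed.

Lemma convective_bd n i j :
  `|\int[mu]_x (Cov rho (K n) (v i) (v j) x * dWm rho (K n) (dK n) (v i) j x)| <=
  ((2 * c2) `^ s * (4 * 2 `^ (2 * s) * V)) `^ s^-1 * (Dr q * Gq) `^ q^-1.
Proof.
have bG : 0 <= Dr q * Gq by rewrite mulr_ge0 ?Dr_ge0.
have mC : measurable_fun setT (Cov rho (K n) (v i) (v j)) by case: (kC n i j).
have mW : measurable_fun setT (dWm rho (K n) (dK n) (v i) j) by case: (kdW n i j).
have s0 : 0 < s := lt_le_trans ltr01 s1.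
have q0 : 0 < q := lt_le_trans ltr01 q1.
have a0 : 0 <= (2 * c2) `^ s * (4 * 2 `^ (2 * s) * V) by rewrite !mulr_ge0 ?powR_ge0.
by have [] := holder_abs mC mW s0 q0 sq a0 bG (Cov_V n i j) (int_dWm_le n i j q1 Gq0 hGq).
Qed.

Let sq2 : (2 : R)^-1 + 2^-1 = 1. Proof. by field. Qed.

Let powR2 (a : R) : `|a| `^ 2 = a ^+ 2.
Proof. by rewrite (powR_mulrn 2 (normr_ge0 a)) real_normK ?num_real. Qed.

Let cvpB n x : `|cv pf (K n) x| <= B.
Proof.
have KL := kern_L1 (kK n).
rewrite (pL1_cvE x ppf (kK n)) -[leRHS]mulr1 -(mo_int (mo n)) -IZ//; apply: Idom.
- apply: measurable_funM; last exact: mo_meas (mo n).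
  by apply: measurable_addl; exact: L1_meas ppf.2.
- exact: L1Z.
- by move=> h; rewrite normrM (ger0_norm (mo_ge0 (mo n) h)) ler_wpM2r ?(mo_ge0 (mo n))// pB.
Qed.

Lemma pressure_cvg i :
  \int[mu]_x ((cv pf (K n) x - p (cv rho (K n) x)) * dWm rho (K n) (dK n) (v i) i x)
    @[n --> \oo] --> 0.
Proof.
have bG : 0 <= Dr 2 * G2 by rewrite mulr_ge0 ?Dr_ge0.
have mW n : measurable_fun setT (dWm rho (K n) (dK n) (v i) i) by case: (kdW n i i).
have kc n : kern (cv pf (K n)) := kern_cv ppf.2 (kK n).
have kR n : kern (cv rho (K n)) := kern_cvrho c10 rhop mrho rhoB (mo n).
have Rbd n x := cv_rho_bd c10 rhop mrho rhoB (mo n) x.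
have mE n : measurable_fun setT (fun x => cv pf (K n) x - p (cv rho (K n) x)).
  by apply: measurable_funB; [case: (kc n)|apply: (measurableT_comp mp); case: (kR n)].
have c1' := cv_cvg mo ppf.2 ppf.1; have c2' := cv_cvg mo prho.2 prho.1.
apply: (holder_cvg0 mE mW (ltr0n _ 2) (ltr0n _ 2) sq2 bG); last first.
  by move=> n; apply: int_dWm_le => //; rewrite ler1n.
(* The pressure difference is bounded by [2 * B], so its square is at most [2 * B] times its
   modulus, and the modulus tends to 0 in L^1 since [p] is Lipschitz with constant [B]. *)
have cc : ((2 * B * (\int[mu]_x `|cv pf (K n) x - pf x| + B * \int[mu]_x `|cv rho (K n) x - rho x|))%:E)%E
    @[n --> \oo] --> 0%E.
  apply: cvg_EFin; first exact/nearW.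
  rewrite -[0](mulr0 (2 * B)); apply: cvgMl_tmp; rewrite -[0]addr0; apply: cvgD => //.
  by rewrite -[0](mulr0 B); exact: cvgMl_tmp.
apply: (squeeze_cvge _ (cvg_cst 0%E) cc); apply/nearW => n; apply/andP; split.
  by apply: integral_ge0 => x _; rewrite lee_fin powR_ge0.
have i1 : L1 mu (fun x => `|cv pf (K n) x - pf x|).
  by apply: L1_norm; apply: L1B; [exact: kern_L1|exact: ppf.2].
have i2 : L1 mu (fun x => `|cv rho (K n) x - rho x|).
  by apply: L1_norm; apply: L1B; [exact: kern_L1|exact: prho.2].
rewrite -IZ// -ID//; last exact: L1Z.
have i3 := L1D i1 (L1Z B i2).
rewrite -IZ// (EFinI (L1Z (2 * B) i3)); apply: ge0_le_integralR.
- by apply: measurable_powRf; exact: measurableT_comp.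
- exact: L1_meas (L1Z (2 * B) i3).
- by move=> x; exact: powR_ge0.
move=> x; rewrite powR2 -real_normK ?num_real// expr2; apply: ler_pM => //.
  rewrite mulr_natl mulr2n; apply: le_trans (ler_normB _ _) _; apply: lerD => //.
  exact: pB.
have -> : cv pf (K n) x - p (cv rho (K n) x) =
    (cv pf (K n) x - pf x) - (p (cv rho (K n) x) - p (rho x)) by rewrite /pf; ring.
by apply: le_trans (ler_normB _ _) _; rewrite lerD2l; exact: pL.
Qed.

Lemma pressure_bd n i :
  `|\int[mu]_x ((cv pf (K n) x - p (cv rho (K n) x)) * dWm rho (K n) (dK n) (v i) i x)| <=
  (2 * B * (2 * B)) `^ 2^-1 * (Dr 2 * G2) `^ 2^-1.
Proof.
have bG : 0 <= Dr 2 * G2 by rewrite mulr_ge0 ?Dr_ge0.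
have mW : measurable_fun setT (dWm rho (K n) (dK n) (v i) i) by case: (kdW n i i).
have mE : measurable_fun setT (fun x => cv pf (K n) x - p (cv rho (K n) x)).
  apply: measurable_funB; first by case: (kern_cv ppf.2 (kK n)).
  by apply: (measurableT_comp mp); case: (kern_cvrho c10 rhop mrho rhoB (mo n)).
have BB0 : 0 <= 2 * B * (2 * B) by rewrite !mulr_ge0.
have hE : (\int[mu]_x (`|cv pf (K n) x - p (cv rho (K n) x)| `^ 2)%:E <= (2 * B * (2 * B))%:E)%E.
  have -> : (2 * B * (2 * B))%:E = (\int[mu]_x (2 * B * (2 * B))%:E)%E.
    by rewrite integral_cst//= probability_setT mule1.
  apply: ge0_le_integralR.
  - by apply: measurable_powRf; exact: measurableT_comp.
  - exact: measurable_cst.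
  - by move=> x; exact: powR_ge0.
  move=> x; rewrite powR2 -real_normK ?num_real// expr2.
  have h : `|cv pf (K n) x - p (cv rho (K n) x)| <= 2 * B.
    rewrite mulr_natl mulr2n; apply: le_trans (ler_normB _ _) _; apply: lerD; first exact: cvpB.
    exact: (pB (cv_rho_bd c10 rhop mrho rhoB (mo n) x)).
  exact: ler_pM.
by have [] := holder_abs mE mW (ltr0n _ 2) (ltr0n _ 2) sq2 BB0 bG hE (int_dWm_le n i i (ler1n _ 2) G20 hG2).
Qed.

(* The viscous term converges weakly: [S] is approximated in [L^2] by its own
   mollifications, against which [dWm] can be integrated by parts. *)
Let cvS_sub n i j : (\int[mu]_x (`|cv (S i j) (K n) x - S i j x| `^ 2)%:E <= osc 2 (K n) (S i j))%E.
Proof.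
have mS := L1_meas (pS i j).2; have [_ _ KM] := kK n; have [mK _ _] := kK n.
have m1 : 1 <= \int[mu]_y K n y <= 1 by rewrite (mo_int (mo n)) lexx.
have := dl_powR (ler1n _ 2) mS (pS i j).1 (pS i j).2 (kern_L1 (kK n)) (mo_ge0 (mo n)) KM m1.
rewrite powR1 mul1e; apply: le_trans; apply: ge0_le_integralR.
- apply: measurable_powRf; apply: measurableT_comp => //; apply: measurable_funB => //.
  exact: measurable_cv.
- by apply: measurable_powRf; exact: measurable_dl.
- by move=> x; exact: powR_ge0.
move=> x; apply: powR_le => //.
have i1 := pL1_cvl x (pS i j) (kK n); have i2 := L1Z (S i j x) (kern_L1 (kK n)).
have -> : cv (S i j) (K n) x - S i j x = \int[mu]_h ((S i j (x + h) - S i j x) * K n h).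
  rewrite (pL1_cvE x (pS i j) (kK n)) -[in LHS](mulr1 (S i j x)) -(mo_int (mo n)) -IZ; last exact: kern_L1.
  by rewrite -IB//; apply: eq_Rintegral => h _; rewrite mulrBl.
apply: Idom; [|exact: dl_L1|].
- by apply: L1_meas; under eq_fun do rewrite mulrBl; exact: L1B i1 i2.
- by move=> h; rewrite normrM (ger0_norm (mo_ge0 (mo n) h)).
Qed.

Let cvS0 i j : (\int[mu]_x (`|cv (S i j) (K n) x - S i j x| `^ 2)%:E)%E @[n --> \oo] --> 0%E.
Proof.
apply: (squeeze_cvge _ (cvg_cst 0%E)); last first.
  apply: (osc_cvg (ler1n _ 2) (L1_meas (pS i j).2) (pS i j).1).
  - by rewrite (le_lt_trans (hS i j))// ltry.
  - by move=> n; exact: kern_L1 (kK n).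
  - by move=> n; exact: mo_ge0 (mo n).
  - by move=> n; exact: suppK_K (mo n).
  - by move=> n; rewrite (mo_int (mo n)).
apply/nearW => n; rewrite cvS_sub andbT.
by apply: integral_ge0 => x _; rewrite lee_fin powR_ge0.
Qed.

Lemma viscous_bd n i j :
  `|\int[mu]_x (cv (S i j) (K n) x * dWm rho (K n) (dK n) (v i) j x)| <=
  S2 `^ 2^-1 * (Dr 2 * G2) `^ 2^-1.
Proof.
have bG : 0 <= Dr 2 * G2 by rewrite mulr_ge0 ?Dr_ge0.
have mW : measurable_fun setT (dWm rho (K n) (dK n) (v i) j) by case: (kdW n i j).
have kc := kern_cv (pS i j).2 (kK n); have mS := L1_meas (pS i j).2.
have [mK pK KM] := kK n.
have mc : measurable_fun setT (cv (S i j) (K n)) by case: kc.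
have hc : (\int[mu]_x (`|cv (S i j) (K n) x| `^ 2)%:E <= S2%:E)%E.
  apply: le_trans (hS i j).
  have pSn : torus_function (fun x => `|S i j x|) by move=> x k; rewrite (pS i j).1.
  apply: le_trans (cv_powR_le (ler1n _ 2) pSn pK (L1_norm (pS i j).2) _ (mo_ge0 (mo n)) mK KM (mo_int (mo n))) => //.
  apply: ge0_le_integralR.
  - by apply: measurable_powRf; exact: measurableT_comp.
  - by apply: measurable_powRf; apply: measurable_cv => //; exact: measurableT_comp.
  - by move=> x; exact: powR_ge0.
  move=> x; apply: powR_le => //.
  have [M KM'] := KM; have i1 := L1_cv x (pS i j).2 mK KM'.
  apply: Idom; [exact: L1_meas i1|exact: L1_cv x (L1_norm (pS i j).2) mK KM'|].
  by move=> y; rewrite normrM (ger0_norm (mo_ge0 (mo n) _)).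
by have [] := holder_abs mc mW (ltr0n _ 2) (ltr0n _ 2) sq2 S20 bG hc (int_dWm_le n i j (ler1n _ 2) G20 hG2).
Qed.

Let W_cvg i : \int[mu]_x `|Wm rho (K n) (v i) x - v i x| @[n --> \oo] --> 0.
Proof.
have i1 n : L1 mu (fun x => `|Wm rho (K n) (v i) x - v i x|).
  by apply: L1_norm; apply: L1B; [exact: kern_L1 (kW n i)|exact: (pv i).2].
have mv := L1_meas (pv i).2.
have fi : (\int[mu]_x (`|v i x| `^ 1)%:E < +oo)%E.
  have [_] := (L1P mu (v i)).1 (pv i).2; congr (_ < _)%E; apply: eq_integral => x _.
  by rewrite powRr1.
have o := osc_cvg (lexx 1) mv (pv i).1 fi (fun n => kern_L1 (kK n)) (fun n => mo_ge0 (mo n))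
  (fun n => suppK_K (mo n)) (fun n => eq_leR (mo_int (mo n))).
have c0 : (((c2 / c1) `^ 1)%:E * osc 1 (K n) (v i))%E @[n --> \oo] --> 0%E.
  by rewrite -[0%E](mule0 ((c2 / c1) `^ 1)%:E); apply: cvgeZl.
have c3 : (\int[mu]_x (`|Wm rho (K n) (v i) x - v i x| `^ 1)%:E)%E @[n --> \oo] --> 0%E.
  apply: (squeeze_cvge _ (cvg_cst 0%E) c0); apply/nearW => n.
  rewrite (int_Wm_sub c10 rhop mrho rhoB (mo n) (lexx 1) (pv i)) andbT.
  by apply: integral_ge0 => x _; rewrite lee_fin powR_ge0.
have -> : (fun n => \int[mu]_x `|Wm rho (K n) (v i) x - v i x|) =
    fine \o (fun n => (\int[mu]_x (`|Wm rho (K n) (v i) x - v i x| `^ 1)%:E)%E).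
  apply/funext => n /=; rewrite /Rintegral; congr fine.
  by apply: eq_integral => x _; rewrite powRr1.
exact: fine_cvg c3.
Qed.

(** With [S] mollified at the fixed scale [M], the derivative is moved from the Favre average to the
    kernel; the Favre average tends to [v] in L^1, and the weak gradient identity for reflected
    kernels, [wgr], moves the derivative back onto [v]. *)
Let visc_M M i j :
  \int[mu]_x (cv (S i j) (K M) x * dWm rho (K n) (dK n) (v i) j x) @[n --> \oo] -->
  \int[mu]_x (cv (S i j) (K M) x * g i j x).
Proof.
have kd := kern_cv (pS i j).2 (kdK M j); have kc := kern_cv (pS i j).2 (kK M).
have [mk _ [C kC']] := kd.
have -> : \int[mu]_x (cv (S i j) (K M) x * g i j x) = \int[mu]_x (v i x * cv (S i j) (dK M j) x).
  under [LHS]eq_Rintegral do rewrite mulrC.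
  rewrite (I_cv_dual (pg i j).2 (pS i j).2 (kK M)) (I_cv_dual (pv i).2 (pS i j).2 (kdK M j)).
  by apply: eq_Rintegral => y _; rewrite wgr.
have e n : \int[mu]_x (cv (S i j) (K M) x * dWm rho (K n) (dK n) (v i) j x) =
    \int[mu]_x (Wm rho (K n) (v i) x * cv (S i j) (dK M j) x).
  rewrite (ibp (mo M) (kW n i) (kdW n i j) (pS i j).2 (fun x => is_derive_Wm c10 rhop mrho rhoB (mo n) j x (pv i))).
  by apply: eq_Rintegral => x _; rewrite mulrC.
have C0 : 0 <= C by rewrite (le_trans _ (kC' 0)).
under eq_cvg do rewrite e.
apply/subr_cvg0.
have cc : C * \int[mu]_x `|Wm rho (K n) (v i) x - v i x| @[n --> \oo] --> 0.
  by rewrite -[0](mulr0 C); apply: cvgMl_tmp; exact: W_cvg.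
apply: norm_cvg0; apply: (squeeze_cvgr _ (cvg_cst 0) cc); apply/nearW => n.
rewrite normr_ge0/=.
have i1 : L1 mu (fun x => Wm rho (K n) (v i) x * cv (S i j) (dK M j) x) := kern_L1 (kernM (kW n i) kd).
have i2 : L1 mu (fun x => v i x * cv (S i j) (dK M j) x) := L1_mulb (pv i).2 mk kC'.
have i3 : L1 mu (fun x => `|Wm rho (K n) (v i) x - v i x|).
  by apply: L1_norm; apply: L1B; [exact: kern_L1 (kW n i)|exact: (pv i).2].
rewrite -IB// -IZ//; apply: Idom; [exact: L1_meas (L1B i1 i2)|exact: L1Z|].
by move=> x; rewrite -mulrBl normrM mulrC ler_wpM2r.
Qed.

Lemma viscous_cvg i j :
  \int[mu]_x (cv (S i j) (K n) x * dWm rho (K n) (dK n) (v i) j x) @[n --> \oo] -->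
  \int[mu]_x (S i j x * g i j x).
Proof.
(* A common L^2 bound for the functions [X n] and for [g i j], so that a single rank [N] makes the
   error of mollifying [S] small against all of them. *)
have D2 := Dr_ge0 2; have bG : 0 <= Dr 2 * G2 + G2 by rewrite addr_ge0// mulr_ge0.
have kc n := kern_cv (pS i j).2 (kK n); have mS := L1_meas (pS i j).2.
have mg := L1_meas (pg i j).2.
have mD n : measurable_fun setT (fun x => cv (S i j) (K n) x - S i j x).
  by apply: measurable_funB => //; case: (kc n).
pose X n := dWm rho (K n) (dK n) (v i) j.
have kX n : kern (X n) := kdW n i j.
have mX n : measurable_fun setT (X n) by case: (kX n).
have XB n : (\int[mu]_x (`|X n x| `^ 2)%:E <= (Dr 2 * G2 + G2)%:E)%E.
  by apply: (le_trans (int_dWm_le n i j (ler1n _ 2) G20 hG2)); rewrite lee_fin lerDl.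
have gB : (\int[mu]_x (`|g i j x| `^ 2)%:E <= (Dr 2 * G2 + G2)%:E)%E.
  apply: (@le_trans _ _ G2%:E); last by rewrite lee_fin lerDr mulr_ge0.
  apply: le_trans hG2; apply: ge0_le_integralR.
  - by apply: measurable_powRf; exact: measurableT_comp.
  - apply: measurable_powRf; apply: measurable_sum => k; apply: measurable_sum => l.
    by apply: measurableT_comp => //; exact: L1_meas (pg k l).2.
  - by move=> x; exact: powR_ge0.
  move=> x; apply: powR_le => //; rewrite (bigD1 i)//= (bigD1 j)//= -addrA lerDl.
  by rewrite addr_ge0// sumr_ge0// => k _; rewrite sumr_ge0.
apply/cvgrPdist_le => e e0; have e40 : 0 < e / 4 by rewrite divr_gt0.
have [N HN] := holder_unif mD (ltr0n _ 2) (ltr0n _ 2) sq2 bG (cvS0 i j) e40.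
have := @visc_M N i j; move/cvgrPdist_le/(_ _ e40) => [N' _ HN'].
exists (maxn N N') => // n; rewrite /= geq_max => /andP[Nn N'n].
have [i1 h1] := HN n _ Nn (mX n) (XB n).
have [i2 h2] := HN N _ (leqnn N) (mX n) (XB n).
have [i3 h3] := HN N _ (leqnn N) mg gB.
have h4 := HN' n N'n; rewrite /= in h4.
have i4 : L1 mu (fun x => cv (S i j) (K N) x * X n x) := kern_L1 (kernM (kc N) (kX n)).
have i5 : L1 mu (fun x => cv (S i j) (K N) x * g i j x).
  have [mk _ [C kC']] := kc N; under eq_fun do rewrite mulrC.
  exact: L1_mulb (pg i j).2 mk kC'.
have i6 : L1 mu (fun x => cv (S i j) (K n) x * X n x) := kern_L1 (kernM (kc n) (kX n)).
have E1 : \int[mu]_x (S i j x * g i j x) = \int[mu]_x (cv (S i j) (K N) x * g i j x) -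
    \int[mu]_x ((cv (S i j) (K N) x - S i j x) * g i j x).
  by rewrite -IB//; apply: eq_Rintegral => x _; ring.
have E2 : \int[mu]_x (cv (S i j) (K n) x * X n x) = \int[mu]_x (cv (S i j) (K N) x * X n x) +
    \int[mu]_x ((cv (S i j) (K n) x - S i j x) * X n x) -
    \int[mu]_x ((cv (S i j) (K N) x - S i j x) * X n x).
  rewrite -ID// -IB//; last exact: L1D.
  by apply: eq_Rintegral => x _; ring.
rewrite E1 -/(X n) E2.
exact: dist4 h1 h2 h3 h4.
Qed.

Lemma I_flux n : \int[mu]_x flux rho (K n) (dK n) v pf S p x =
  \sum_i \sum_j \int[mu]_x (Cov rho (K n) (v i) (v j) x * dWm rho (K n) (dK n) (v i) j x) +
  \sum_i \int[mu]_x ((cv pf (K n) x - p (cv rho (K n) x)) * dWm rho (K n) (dK n) (v i) i x) -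
  \sum_i \sum_j \int[mu]_x (cv (S i j) (K n) x * dWm rho (K n) (dK n) (v i) j x).
Proof.
have kp : kern (fun x => p (cv rho (K n) x)).
  apply: (kern_rcomp c10 rhop mrho rhoB (mo n)) pB; apply: (measurableT_comp mp).
  by case: (kern_cvrho c10 rhop mrho rhoB (mo n)).
have k1 i j : kern (fun x => Cov rho (K n) (v i) (v j) x * dWm rho (K n) (dK n) (v i) j x).
  exact: kernM (kC n i j) (kdW n i j).
have k2 i : kern (fun x => (cv pf (K n) x - p (cv rho (K n) x)) * dWm rho (K n) (dK n) (v i) i x).
  exact: kernM (kernB (kern_cv ppf.2 (kK n)) kp) (kdW n i i).
have k3 i j : kern (fun x => cv (S i j) (K n) x * dWm rho (K n) (dK n) (v i) j x).
  exact: kernM (kern_cv (pS i j).2 (kK n)) (kdW n i j).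
have s1' i := kern_sum (index_enum 'I_d) (k1 i); have s3' i := kern_sum (index_enum 'I_d) (k3 i).
have S1 := kern_sum (index_enum 'I_d) s1'; have S3 := kern_sum (index_enum 'I_d) s3'.
have S2' := kern_sum (index_enum 'I_d) k2.
transitivity (\int[mu]_x (\sum_i \sum_j (Cov rho (K n) (v i) (v j) x * dWm rho (K n) (dK n) (v i) j x) +
  \sum_i ((cv pf (K n) x - p (cv rho (K n) x)) * dWm rho (K n) (dK n) (v i) i x) -
  \sum_i \sum_j (cv (S i j) (K n) x * dWm rho (K n) (dK n) (v i) j x))).
  by apply: eq_Rintegral => x _; rewrite /flux -mulr_sumr.
rewrite (IB (kern_L1 (kernD S1 S2')) (kern_L1 S3)) (ID (kern_L1 S1) (kern_L1 S2')).
rewrite (Isum _ (fun i => kern_L1 (s1' i))) (Isum _ (fun i => kern_L1 (s3' i))) (Isum _ (fun i => kern_L1 (k2 i))).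
congr (_ + _ - _); apply: eq_bigr => i _.
  exact: (Isum _ (fun j => kern_L1 (k1 i j))).
exact: (Isum _ (fun j => kern_L1 (k3 i j))).
Qed.

Lemma flux_cvg : \int[mu]_x flux rho (K n) (dK n) v pf S p x @[n --> \oo] -->
  - \sum_i \sum_j \int[mu]_x (S i j x * g i j x).
Proof.
apply: (cvg_ext I_flux); rewrite -[- _]add0r; apply: cvgB; last first.
  by apply: cvg_sumr => i; apply: cvg_sumr => j; exact: viscous_cvg.
have E1 : \sum_(i < d) (0 : R) = 0 by rewrite big1.
pose F n i j := \int[mu]_x (Cov rho (K n) (v i) (v j) x * dWm rho (K n) (dK n) (v i) j x).
have h1 := @cvg_sumr R _ (index_enum 'I_d) (fun n i => \sum_j F n i j) (fun=> \sum_(j < d) 0)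
  (fun i => @cvg_sumr R _ (index_enum 'I_d) (fun n j => F n i j) (fun=> 0) (fun j => convective_cvg i j)).
pose F' n i := \int[mu]_x ((cv pf (K n) x - p (cv rho (K n) x)) * dWm rho (K n) (dK n) (v i) i x).
have h2 := @cvg_sumr R _ (index_enum 'I_d) F' (fun=> 0) pressure_cvg.
by have h3 := cvgD h1 h2; rewrite !E1 addr0 in h3; exact: h3.
Qed.

Lemma flux_bd n : `|\int[mu]_x flux rho (K n) (dK n) v pf S p x| <=
  \sum_(i < d) \sum_(j < d) ((2 * c2) `^ s * (4 * 2 `^ (2 * s) * V)) `^ s^-1 * (Dr q * Gq) `^ q^-1 +
  \sum_(i < d) (2 * B * (2 * B)) `^ 2^-1 * (Dr 2 * G2) `^ 2^-1 +
  \sum_(i < d) \sum_(j < d) S2 `^ 2^-1 * (Dr 2 * G2) `^ 2^-1.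
Proof.
rewrite I_flux; apply: le_trans (ler_normB _ _) _; apply: lerD.
  apply: le_trans (ler_normD _ _) _; apply: lerD.
    apply: le_trans (ler_norm_sum _ _ _) _; apply: ler_sum => i _.
    by apply: le_trans (ler_norm_sum _ _ _) _; apply: ler_sum => j _; exact: convective_bd.
  by apply: le_trans (ler_norm_sum _ _ _) _; apply: ler_sum => i _; exact: pressure_bd.
apply: le_trans (ler_norm_sum _ _ _) _; apply: ler_sum => i _.
by apply: le_trans (ler_norm_sum _ _ _) _; apply: ler_sum => j _; exact: viscous_bd.
Qed.

End Limit.

(** * Primitives in time *)

Section TimePrimitive.
Context {R : realType}.
Local Notation leb := (@lebesgue_measure R).
Implicit Types (F G f g : R -> R) (s t x y c : R).

(** The indicator of [[s, t[] as a weight: integrals stay on the whole line, and the half-open form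
    makes them exactly additive in the interval. *)
Definition itv s t x : R := ((s <= x) && (x < t))%:R.

Lemma itv_bd s t x : `|itv s t x| <= 1.
Proof. by rewrite /itv; case: (_ && _); rewrite ?normr1 ?normr0. Qed.

Lemma itv_ge0 s t x : 0 <= itv s t x.
Proof. by rewrite /itv; case: (_ && _). Qed.

Lemma itv_indic s t x : itv s t x = \1_(`[s, t[%classic) x.
Proof. by rewrite /itv indicE; congr ((nat_of_bool _)%:R); apply/idP/idP; rewrite inE/= in_itv. Qed.

Lemma measurable_itvf s t : measurable_fun setT (itv s t : measurableTypeR R -> R).
Proof.
have -> : itv s t = \1_(`[s, t[%classic) by apply/funext => x; exact: itv_indic.
exact: measurable_indic.
Qed.

Lemma itvD s t x y : s <= t -> t <= y -> itv s y x = itv s t x + itv t y x.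
Proof.
rewrite /itv => st ty; have [xt|tx] := ltP x t; rewrite ?andbT ?andbF ?addr0 ?add0r/=.
  by rewrite (lt_le_trans xt ty) andbT.
by rewrite (le_trans st tx).
Qed.

Lemma L1_itv F s t : L1 leb F -> L1 leb (fun x => F x * itv s t x).
Proof. by move=> Fi; exact: L1_mulb Fi (measurable_itvf s t) (itv_bd s t). Qed.

Lemma I_itvD F s t y : L1 leb F -> s <= t -> t <= y ->
  \int[leb]_x (F x * itv s y x) = \int[leb]_x (F x * itv s t x) + \int[leb]_x (F x * itv t y x).
Proof.
move=> Fi st ty; rewrite -(ID (L1_itv s t Fi) (L1_itv t y Fi)).
by apply: eq_Rintegral => x _; rewrite (itvD x st ty) mulrDr.
Qed.

(** Continuous induction: the supremum of the times reached from [a] is itself reached, and the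
    local hypothesis there allows one to go past it unless it is [b]. *)
Lemma local_global (P : R -> R -> Prop) a b : a <= b ->
  (forall x y z, a <= x -> x <= y -> y <= z -> z <= b -> P x y -> P y z -> P x z) ->
  (forall c, a <= c <= b -> exists2 e, 0 < e & forall x y, a <= x -> x <= y -> y <= b ->
    `|x - c| < e -> `|y - c| < e -> P x y) -> P a b.
Proof.
move=> ab tr loc; pose S := [set t | a <= t <= b /\ P a t].
have Sa : S a.
  have [|e e0 he] := loc a; first by rewrite lexx.
  by split; [rewrite lexx|apply: he; rewrite ?subrr ?normr0].
have Sub : ubound S b by move=> t [/andP[]].
have hS : has_sup S by split; [exists a|exists b].
set c := sup S.
have ac : a <= c by apply: ub_le_sup => //; exists b.
have cb : c <= b by apply: ge_sup => //; exists a.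
have [|e e0 he] := loc c; first by rewrite ac.
have [t [/andP[at' tb] Pat] ct] := sup_adherent e0 hS.
have tc : t <= c by apply: ub_le_sup; [exists b|split => //; rewrite at'].
pose y := Num.min b (c + e / 2).
have e20 : 0 < e / 2 by rewrite divr_gt0.
have cy : c <= y by rewrite /y le_min cb lerDl ltW.
have yb : y <= b by rewrite /y ge_min lexx.
have Pay : P a y.
  apply: (tr a t y) => //; first exact: le_trans cy.
  apply: he => //; first exact: le_trans cy.
    by rewrite ler0_norm ?subr_le0// opprB ltrBlDr -ltrBlDl.
  rewrite ger0_norm ?subr_ge0// ltrBlDl (@le_lt_trans _ _ (c + e / 2))//.
    by rewrite /y ge_min lexx orbT.
  by rewrite ltrD2l ltr_pdivrMr// ltr_pMr// ltr1n.
have yc : y <= c.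
  by apply: ub_le_sup; [exists b|split => //; rewrite yb (le_trans ac cy)].
suff -> : b = y by [].
apply/eqP; rewrite eq_le yb andbT /y le_min lexx/= leNgt; apply/negP => bc.
have : c + e / 2 <= c by have := yc; rewrite {1}/y min_r// ltW.
lra.
Qed.

(** Absolute continuity of [g] on [[0, T]] with density [F], in integrated form. Continuity and
    boundedness on the whole line keep the products of [g] with L^1 densities integrable. *)
Definition prim (T : R) g F : Prop := [/\ L1 leb F, continuous g, exists M, forall x, `|g x| <= M &
  forall s t, 0 <= s -> s <= t -> t <= T -> g t - g s = \int[leb]_x (F x * itv s t x)].

Lemma prim_meas T g F : prim T g F -> measurable_fun setT (g : measurableTypeR R -> R).
Proof. by move=> [_ cg _ _]; exact: measurable_realfun.continuous_measurable_fun. Qed.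

(* An interval function that is locally bounded by every small multiple of an
   integrable density vanishes. *)
Lemma prim_local T e E B : L1 leb E -> L1 leb B -> (forall x, 0 <= B x) ->
  (forall eps c, 0 < eps -> 0 <= c <= T -> exists2 d, 0 < d & forall x y, 0 <= x -> x <= y -> y <= T ->
    `|x - c| < d -> `|y - c| < d ->
    `|e y - e x - \int[leb]_z (E z * itv x y z)| <= eps * \int[leb]_z (B z * itv x y z)) ->
  forall s t, 0 <= s -> s <= t -> t <= T -> e t - e s = \int[leb]_x (E x * itv s t x).
Proof.
move=> Ei Bi B0 loc s t s0 st tT.
have H eps : 0 < eps -> `|e t - e s - \int[leb]_z (E z * itv s t z)| <= eps * \int[leb]_z (B z * itv s t z).
  move=> eps0.
  apply: (@local_global (fun x y => `|e y - e x - \int[leb]_z (E z * itv x y z)| <= eps * \int[leb]_z (B z * itv x y z)) s t st).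
    move=> x y z sx xy yz zt h1 h2; rewrite (I_itvD Ei xy yz) (I_itvD Bi xy yz) mulrDr.
    apply: le_trans (lerD h1 h2); apply: le_trans (ler_normD _ _).
    by rewrite le_eqVlt; apply/orP; left; apply/eqP; congr `|_|; ring.
  move=> c /andP[sc ct]; have [|d d0 hd] := loc eps c eps0.
    by rewrite (le_trans s0 sc) (le_trans ct tT).
  by exists d => // x y sx xy yt; apply: hd => //; [exact: le_trans sx|exact: le_trans tT].
have IB0 : 0 <= \int[leb]_z (B z * itv s t z) by apply: I_ge0 => z; rewrite mulr_ge0// itv_ge0.
apply/eqP; rewrite -subr_eq0 -normr_le0; apply/ler_addgt0Pr => eps eps0; rewrite add0r.
have c0 : 0 < \int[leb]_z (B z * itv s t z) + 1 by rewrite ltr_wpDl.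
apply: (le_trans (H (eps / (\int[leb]_z (B z * itv s t z) + 1)) (divr_gt0 eps0 c0))).
by rewrite mulrAC ler_pdivrMr// ler_wpM2l ?(ltW eps0)// lerDl.
Qed.

Lemma I_itv_le F B s t (eps : R) : L1 leb F -> L1 leb B ->
  (forall x, s <= x < t -> `|F x| <= eps * B x) ->
  `|\int[leb]_x (F x * itv s t x)| <= eps * \int[leb]_x (B x * itv s t x).
Proof.
move=> Fi Bi FB; rewrite -(IZ eps (L1_itv s t Bi)).
apply: Idom; [exact: L1_meas (L1_itv s t Fi)|exact: L1Z (L1_itv s t Bi)|] => x.
by have := FB x; rewrite /itv; case: (_ && _) => [/(_ isT)|_]; rewrite ?mulr1 ?mulr0 ?normr0.
Qed.

Lemma near_cont (g : R -> R) c (eps : R) : {for c, continuous g} -> 0 < eps ->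
  exists2 d, 0 < d & forall x, `|x - c| < d -> `|g x - g c| <= eps.
Proof.
move=> cg e0; have := cg; move/cvgrPdist_le/(_ _ e0) => [d d0 hd].
by exists d => // x xc; rewrite distrC; apply: hd; rewrite /= distrC.
Qed.

(** On [[x, y]] the defect of the product rule has density [F z * (g y - g z) + (f x - f z) * G z],
    whose coefficients are small by continuity when the interval is short; [prim_local]
    concludes. *)
Lemma prim_mul T f F g G : prim T f F -> prim T g G ->
  prim T (fun x => f x * g x) (fun x => F x * g x + f x * G x).
Proof.
move=> pf pg; have [Fi cf [M fM] fE] := pf; have [Gi cg [N gN] gE] := pg.
have mf := prim_meas pf; have mg := prim_meas pg.
have Fgi : L1 leb (fun x => F x * g x) := L1_mulb Fi mg gN.
have fGi : L1 leb (fun x => f x * G x).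
  by under eq_fun do rewrite mulrC; exact: L1_mulb Gi mf fM.
have Ei := L1D Fgi fGi.
split => //.
- by move=> x; apply: cvgM; [exact: cf|exact: cg].
- by exists (M * N) => x; rewrite normrM ler_pM.
have Bi := L1D (L1_norm Fi) (L1_norm Gi).
apply: (prim_local Ei Bi) => [x|eps c eps0 c0T]; first exact: addr_ge0.
have e20 : 0 < eps / 2 by rewrite divr_gt0.
have [d1 d10 h1] := near_cont (cf c) e20; have [d2 d20 h2] := near_cont (cg c) e20.
exists (Num.min d1 d2); first by rewrite lt_min d10.
move=> x y x0 xy yT; rewrite !lt_min => /andP[x1 x2] /andP[y1 y2].
pose D z := F z * (g y - g z) + (f x - f z) * G z.
have Di : L1 leb D.
  have -> : D = (fun z => (g y * F z + f x * G z) - (F z * g z + f z * G z)) by apply/funext => z; rewrite /D; ring.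
  by apply: L1B => //; apply: L1D; exact: L1Z.
have -> : f y * g y - f x * g x - \int[leb]_z ((F z * g z + f z * G z) * itv x y z) = \int[leb]_z (D z * itv x y z).
  have -> : f y * g y - f x * g x = g y * (f y - f x) + f x * (g y - g x) by ring.
  rewrite fE// gE// -(IZ (g y) (L1_itv x y Fi)) -(IZ (f x) (L1_itv x y Gi)).
  have i1 := L1Z (g y) (L1_itv x y Fi); have i2 := L1Z (f x) (L1_itv x y Gi).
  rewrite -(ID i1 i2) -(IB (L1D i1 i2) (L1_itv x y Ei)).
  by apply: eq_Rintegral => z _; rewrite /D; ring.
apply: I_itv_le => // z /andP[xz zy]; rewrite /D [leRHS]mulrDr.
have zc d : `|x - c| < d -> `|y - c| < d -> `|z - c| < d.
  rewrite !ltr_norml => /andP[? ?] /andP[? ?]; apply/andP; split; lra.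
have osc (h : R -> R) a b : `|h a - h c| <= eps / 2 -> `|h b - h c| <= eps / 2 -> `|h a - h b| <= eps.
  by rewrite !ler_norml => /andP[? ?] /andP[? ?]; apply/andP; split; lra.
apply: le_trans (ler_normD _ _) _; apply: lerD; rewrite normrM.
  by rewrite mulrC ler_wpM2r// osc// h2//; exact: zc.
by rewrite ler_wpM2r// osc// h1//; exact: zc.
Qed.

(** On a short interval near [c] the increment of [P] is [k] times that of [g], with [k] close to
    [dP (g c)] by the mean value theorem; the defect then has the small density
    [(k - dP (g z)) * F z]. *)
Lemma prim_comp T g F (P dP : R -> R) (a b B : R) : prim T g F -> (forall x, a <= g x <= b) ->
  (forall r, a <= r <= b -> is_derive r 1 P (dP r) /\ {for r, continuous dP}) ->
  (forall r, a <= r <= b -> `|P r| <= B) -> (forall r, a <= r <= b -> `|dP r| <= B) ->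
  prim T (fun x => P (g x)) (fun x => dP (g x) * F x).
Proof.
move=> pg gab dPr PB dPB; have [Fi cg _ gE] := pg; have mg := prim_meas pg.
have cdP : continuous (fun x => dP (g x)).
  by move=> x; apply: continuous_comp; [exact: cg|exact: (dPr _ (gab x)).2].
have mdP : measurable_fun setT ((fun x => dP (g x)) : measurableTypeR R -> R).
  exact: measurable_realfun.continuous_measurable_fun.
have cP r : a <= r <= b -> {for r, continuous P}.
  by move=> /dPr[[h _] _]; apply/differentiable_continuous/derivable1_diffP.
have Ei : L1 leb (fun x => dP (g x) * F x).
  by under eq_fun do rewrite mulrC; apply: (L1_mulb Fi mdP (M := B)) => x; exact: dPB.
split => //.
- by move=> x; apply: continuous_comp; [exact: cg|exact: cP].
- by exists B => x; exact: PB.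
apply: (prim_local Ei (L1_norm Fi)) => [x|eps c eps0 c0T]; first exact: normr_ge0.
have e20 : 0 < eps / 2 by rewrite divr_gt0.
have [eta eta0 he] := near_cont (dPr _ (gab c)).2 e20.
have [d d0 hd] := near_cont (cg c) (divr_gt0 eta0 (ltr0n R 2)).
exists d => // x y x0 xy yT xc yc.
have gclose z : `|z - c| < d -> `|g z - g c| < eta.
  by move=> /hd h; rewrite (le_lt_trans h)// ltr_pdivrMr// ltr_pMr// ltr1n.
have [k kc kE] : exists2 k, `|k - dP (g c)| <= eps / 2 & P (g y) - P (g x) = k * (g y - g x).
  have mvt u w : u < w -> a <= u <= b -> a <= w <= b -> `|u - g c| < eta -> `|w - g c| < eta ->
      exists2 k, `|k - dP (g c)| <= eps / 2 & P w - P u = k * (w - u).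
    move=> uw /andP[au ub] /andP[aw wb] hu hw.
    have inab r : u <= r <= w -> a <= r <= b.
      by move=> /andP[h1 h2]; rewrite (le_trans au h1) (le_trans h2 wb).
    have [| |xi xiuw ->] := @MVT R P dP u w uw.
    - by move=> r; rewrite in_itv/= => /andP[h1 h2]; apply: (dPr _ _).1; apply: inab; rewrite !ltW.
    - apply: continuous_in_subspaceT => r; rewrite inE/= in_itv/= => h; apply: cP; exact: inab.
    exists (dP xi) => //; apply: he; move: xiuw hu hw; rewrite in_itv/= => /andP[? ?].
    by rewrite !ltr_norml => /andP[? ?] /andP[? ?]; apply/andP; split; lra.
  have [gxy|gxy|gxy] := ltgtP (g x) (g y).
  - by apply: mvt => //; exact: gclose.
  - have [||k k1 k2] := mvt _ _ gxy (gab y) (gab x); [exact: gclose|exact: gclose|].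
    by exists k => //; rewrite -opprB k2; ring.
  - by exists (dP (g c)); rewrite ?subrr ?normr0 ?(ltW e20)// gxy !subrr mulr0.
pose D z := (k - dP (g z)) * F z.
have Di : L1 leb D.
  have -> : D = (fun z => k * F z - dP (g z) * F z) by apply/funext => z; rewrite /D; ring.
  by apply: L1B => //; exact: L1Z.
rewrite kE gE//.
have -> : k * \int[leb]_z (F z * itv x y z) - \int[leb]_z (dP (g z) * F z * itv x y z) = \int[leb]_z (D z * itv x y z).
  rewrite -(IZ k (L1_itv x y Fi)) -(IB (L1Z k (L1_itv x y Fi)) (L1_itv x y Ei)).
  by apply: eq_Rintegral => z _; rewrite /D; ring.
apply: I_itv_le => //; first exact: L1_norm.
move=> z /andP[xz zy]; rewrite /D normrM ler_wpM2r//.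
have zc : `|z - c| < d.
  by move: xc yc; rewrite !ltr_norml => /andP[? ?] /andP[? ?]; apply/andP; split; lra.
have := he _ (gclose z zc).
by move: kc; rewrite !ler_norml => /andP[? ?] /andP[? ?]; apply/andP; split; lra.
Qed.

Lemma prim_lin T f F g G (k : R) : prim T f F -> prim T g G ->
  prim T (fun x => f x + k * g x) (fun x => F x + k * G x).
Proof.
move=> [Fi cf [M fM] fE] [Gi cg [N gN] gE]; have kGi := L1Z k Gi; split.
- exact: L1D.
- by move=> x; apply: cvgD; [exact: cf|apply: cvgMl_tmp; exact: cg].
- exists (M + `|k| * N) => x; rewrite (le_trans (ler_normD _ _))// lerD// normrM ler_wpM2l//.
move=> s t s0 st tT.
have -> : f t + k * g t - (f s + k * g s) = (f t - f s) + k * (g t - g s) by ring.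
rewrite fE// gE// -(IZ k (L1_itv s t Gi)) -(ID (L1_itv s t Fi) (L1Z k (L1_itv s t Gi))).
by apply: eq_Rintegral => z _; ring.
Qed.

Lemma prim_cst T (a : R) : prim T (fun=> a) (fun=> 0).
Proof.
split; [exact: L1_0|by move=> x; exact: cvg_cst|by exists `|a| |].
by move=> s t _ _ _; under eq_Rintegral do rewrite mul0r; rewrite subrr I0.
Qed.

Lemma prim_sum T (I : Type) (r : seq I) (f F : I -> R -> R) : (forall i, prim T (f i) (F i)) ->
  prim T (fun x => \sum_(i <- r) f i x) (fun x => \sum_(i <- r) F i x).
Proof.
move=> pf; elim: r => [|i r IH].
  under eq_fun do rewrite big_nil; under [X in prim _ _ X]eq_fun do rewrite big_nil.
  exact: prim_cst.
have := prim_lin 1 (pf i) IH; congr (prim _ _ _); apply/funext => x; by rewrite big_cons mul1r.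
Qed.

End TimePrimitive.

(** * From weak derivatives in time to primitives *)

Section WeakPrimitive.
Context {R : realType}.
Local Notation leb := (@lebesgue_measure R).
Implicit Types (F g : R -> R) (s t x c : R).

Lemma L1_itvE F s t : \int[leb]_x (F x * itv s t x) = \int[leb]_(x in `[s, t[) F x.
Proof.
rewrite [RHS]Rintegral_mkcond; apply: eq_Rintegral => x _; rewrite patchE itv_indic indicE.
by case: ifP; rewrite ?mulr1 ?mulr0.
Qed.

Lemma itvss s x : itv s s x = 0.
Proof. by rewrite /itv; have [sx|xs] := leP s x. Qed.

Lemma cont_supp_L1 (f : R -> R) (a b : R) : a <= b -> continuous f ->
  (forall x, ~~ (a <= x <= b) -> f x = 0) -> L1 leb f /\ \int[leb]_x f x = \int[leb]_(x in `[a, b]) f x.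
Proof.
move=> ab cf f0.
have E : (f \_ `[a, b]) = f.
  apply/funext => x; rewrite patchE; case: ifPn => // xab; rewrite f0//.
  by apply: contra xab => h; rewrite inE/= in_itv.
split; last by rewrite [RHS]Rintegral_mkcond E.
have fi : leb.-integrable `[a, b] (EFin \o f).
  by apply: continuous_compact_integrable; [exact: segment_compact|exact: continuous_subspaceT].
have mI : measurable (`[a, b]%classic : set (measurableTypeR R)) by exact: measurable_itv.
by have := (@integrable_mkcond _ _ _ leb _ (EFin \o f) mI).1 fi; rewrite restrict_EFin E.
Qed.

Lemma affine_scale (k b0 : R) : affine_with (fun s : R => k * s + b0) (fun e : R => k * e).
Proof.
split; first by move=> s; apply: cvgD; [apply: cvgMl_tmp; exact: cvg_id|exact: cvg_cst].
by move=> h e x; rewrite mulrDr addrA [k * (h *: e)]mulrCA.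
Qed.

Section Step.
Variables (H b : R -> R).
Hypotheses (sH : smooth H) (sb : smooth b) (dH : forall x : R, is_derive x 1 H (b x))
  (b0 : forall x, 0 <= b x) (bl : forall x, x <= 0 -> b x = 0) (br : forall x, 1 <= x -> b x = 0)
  (Hl : forall x, x <= 0 -> H x = 0) (Hr : forall x, 1 <= x -> H x = 1).

(** A smooth step that rises from 0 to 1 on [[c - 1/(n+1), c]]. Its derivative [bu n c] has mass 1
    and approximates the Dirac mass at [c]. *)
Let st (n : nat) c x : R := H (n.+1%:R * x + (1 - n.+1%:R * c)).
Let bu (n : nat) c x : R := n.+1%:R * b (n.+1%:R * x + (1 - n.+1%:R * c)).

Let k0 n : 0 < n.+1%:R :> R. Proof. by rewrite ltr0n. Qed.

Let st_derive n c x : is_derive x 1 (st n c) (bu n c x).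
Proof.
apply: (is_derive_to (is_derive1_comp (dH _) (is_derive_affine n.+1%:R (1 - n.+1%:R * c) x))).
by rewrite mulrC.
Qed.

Let smooth_st n c : smooth (st n c).
Proof. exact: (smooth_affine (affine_scale _ _) sH). Qed.

Let cont_bu n c : continuous (bu n c).
Proof.
have := smooth_continuous (smooth_affine (affine_scale n.+1%:R (1 - n.+1%:R * c)) sb).
by move=> h x; apply: cvgMl_tmp; exact: h.
Qed.

Let st1 n c x : c <= x -> st n c x = 1.
Proof.
move=> cx; rewrite /st Hr//; have := ler_wpM2l (ltW (k0 n)) cx; lra.
Qed.

Let st0 n c x : x <= c - n.+1%:R^-1 -> st n c x = 0.
Proof.
move=> cx; rewrite /st Hl//; have := ler_wpM2l (ltW (k0 n)) cx.
by rewrite mulrBr divff ?gt_eqF//; lra.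
Qed.

Let bu0 n c x : ~~ (c - n.+1%:R^-1 <= x <= c) -> bu n c x = 0.
Proof.
rewrite negb_and -!ltNge => /orP[h|h]; have := ltW h => {}h; have := ler_wpM2l (ltW (k0 n)) h.
  by rewrite mulrBr divff ?gt_eqF// => h'; rewrite /bu bl ?mulr0//; lra.
by move=> h'; rewrite /bu br ?mulr0//; lra.
Qed.

Let bu_ge0 n c x : 0 <= bu n c x.
Proof. by rewrite mulr_ge0. Qed.

Let bu_L1 n c : L1 leb (bu n c) /\ \int[leb]_x bu n c x = 1.
Proof.
have cc : c - n.+1%:R^-1 <= c by rewrite gerBl invr_ge0 ltW.
have [h1 h2] := cont_supp_L1 cc (@cont_bu n c) (@bu0 n c); split => //.
by rewrite h2 (ftc cc (@st_derive n c) (@cont_bu n c)) st1// st0// subr0.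
Qed.

Lemma bump_cvg g c M : continuous g -> (forall x, `|g x| <= M) ->
  \int[leb]_x (g x * bu n c x) @[n --> \oo] --> g c.
Proof.
move=> cg gM; apply/cvgrPdist_le => e e0.
have [d d0 hd] := near_cont (cg c) e0.
have [n0 _ hn0] : \forall n \near \oo, n.+1%:R^-1 < d.
  by have := @cvg_harmonic R; move/cvgr0Pnorm_lt/(_ _ d0); apply: filterS => n; rewrite ger0_norm// invr_ge0.
exists n0 => // n /= n0n; have nd := hn0 n n0n.
have [bi bI] := bu_L1 n c.
have mg : measurable_fun setT (g : measurableTypeR R -> R).
  exact: measurable_realfun.continuous_measurable_fun.
have gbi : L1 leb (fun x => g x * bu n c x).
  by under eq_fun do rewrite mulrC; exact: L1_mulb bi mg gM.
have -> : g c - \int[leb]_x (g x * bu n c x) = \int[leb]_x (g c * bu n c x - g x * bu n c x).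
  by rewrite (IB (L1Z (g c) bi) gbi) (IZ (g c) bi) bI mulr1.
have -> : e = \int[leb]_x (e * bu n c x) by rewrite (IZ e bi) bI mulr1.
apply: Idom; [exact: L1_meas (L1B (L1Z (g c) bi) gbi)|exact: L1Z|] => x.
rewrite -mulrBl normrM (ger0_norm (bu_ge0 _ _ _)).
have [xc|/bu0 ->] := boolP (c - n.+1%:R^-1 <= x <= c); last by rewrite !mulr0.
rewrite ler_wpM2r// distrC; apply: hd; move: xc => /andP[x1 x2].
by rewrite ler0_norm ?subr_le0// opprB (le_lt_trans _ nd)// lerBlDr -lerBlDl.
Qed.

(** The test function is a difference of two steps. It tends to the indicator of [[s, t[], while its
    derivative tends to the difference of the Dirac masses at [s] and [t]. *)
Lemma weak_primitive_int T g F M : continuous g -> (forall x, `|g x| <= M) -> L1 leb F ->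
  (forall th dth a b, 0 < a -> b < T -> smooth th -> (forall x : R, is_derive x 1 th (dth x)) ->
    (forall x, ~~ (a <= x <= b) -> th x = 0) ->
    \int[leb]_x (g x * dth x) + \int[leb]_x (F x * th x) = 0) ->
  forall s t, 0 < s -> s < t -> t < T -> g t - g s = \int[leb]_x (F x * itv s t x).
Proof.
move=> cg gM Fi wk s t s0 lt_st tT.
pose th n x := st n s x - st n t x.
pose dth n x := bu n s x - bu n t x.
have sth n : smooth (th n).
  move=> k; have -> : th n = (fun x => st n s x + (-1) * st n t x).
    by apply/funext => x; rewrite mulN1r.
  by apply: CkD; [exact: smooth_st|apply: CkZ; exact: smooth_st].
have mst n c : measurable_fun setT (st n c : measurableTypeR R -> R).
  by apply: measurable_realfun.continuous_measurable_fun; exact: smooth_continuous.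
have Hbd : exists C, forall n c x, `|st n c x| <= C.
  have [C hC] : exists C, forall x, 0 <= x <= 1 -> `|H x| <= C.
    have cH : {within `[0, 1], continuous H} by apply: continuous_subspaceT; exact: smooth_continuous.
    have cN : {within `[0, 1], continuous (fun x => `|H x|)}.
      by move=> x; apply: (cvg_norm (cH x)).
    have [c _ hc] := EVT_max ler01 cN.
    by exists `|H c| => x x01; apply: hc; rewrite in_itv.
  exists (C + 1) => n c x; rewrite /st; set y := _ + _.
  have C0 : 0 <= C by rewrite (le_trans _ (hC 0 _)) ?lexx ?ler01.
  have [y0|y0] := leP y 0; first by rewrite Hl// normr0 addr_ge0.
  have [y1|y1] := leP 1 y; first by rewrite Hr// normr1 lerDr.
  by rewrite (le_trans (hC y _)) ?(ltW y0) ?(ltW y1)// lerDl.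
have [C hC] := Hbd.
have cv1 : \int[leb]_x (g x * dth n x) @[n --> \oo] --> g s - g t.
  have E n : \int[leb]_x (g x * dth n x) = \int[leb]_x (g x * bu n s x) - \int[leb]_x (g x * bu n t x).
    have mg : measurable_fun setT (g : measurableTypeR R -> R).
      exact: measurable_realfun.continuous_measurable_fun.
    have gbi c : L1 leb (fun x => g x * bu n c x).
      by under eq_fun do rewrite mulrC; exact: L1_mulb (bu_L1 n c).1 mg gM.
    by rewrite -(IB (gbi s) (gbi t)); apply: eq_Rintegral => x _; rewrite mulrBr.
  under eq_cvg do rewrite E.
  by apply: cvgB; exact: bump_cvg gM.
have st_cvg c x : st n c x @[n --> \oo] --> ((c <= x)%R%:R : R).
  have [cx|xc] := leP c x.
    by under eq_cvg do rewrite st1//; exact: cvg_cst.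
  have xc0 : 0 < c - x by rewrite subr_gt0.
  apply: cvg_near_cst.
  have := @cvg_harmonic R; move/cvgr0Pnorm_lt/(_ _ xc0); apply: filterS => n.
  rewrite ger0_norm ?invr_ge0// => h; apply: st0; rewrite lerBrDr addrC -lerBrDr; exact: ltW.
have [_ cv2] : L1 leb (fun x => F x * itv s t x) /\
    \int[leb]_x (F x * th n x) @[n --> \oo] --> \int[leb]_x (F x * itv s t x).
  apply: (@IDCT _ _ _ leb _ _ (fun x => (2 * C) * `|F x|)).
  - move=> n; apply: measurable_funM; first exact: (L1_meas Fi).
    by apply: measurable_funB; exact: mst.
  - exact: L1_meas (L1_itv s t Fi).
  - apply: aeW => x; apply: cvgM; first exact: cvg_cst.
    have -> : itv s t x = (s <= x)%R%:R - (t <= x)%R%:R.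
      rewrite /itv; have [tx|xt] := leP t x; last by rewrite andbT subr0.
      by rewrite andbF (le_trans (ltW lt_st) tx) subrr.
    by apply: cvgB; exact: st_cvg.
  - by apply: L1Z; exact: L1_norm.
  - move=> n; apply: aeW => x; rewrite normrM mulrC ler_wpM2r//.
    by rewrite mulr_natl mulr2n (le_trans (ler_normB _ _))// lerD.
have cv3 : \int[leb]_x (g x * dth n x) + \int[leb]_x (F x * th n x) @[n --> \oo] -->
    g s - g t + \int[leb]_x (F x * itv s t x) by exact: cvgD.
(* The support [[s - 1/(n+1), t]] of the test function lies in []0, T[] only once [1/(n+1) < s],
   hence the equation holds from some rank on. *)
have cv4 : \int[leb]_x (g x * dth n x) + \int[leb]_x (F x * th n x) @[n --> \oo] --> (0 : R).
  apply: cvg_near_cst; have := @cvg_harmonic R; move/cvgr0Pnorm_lt/(_ _ s0); apply: filterS => n.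
  rewrite ger0_norm ?invr_ge0// => h; apply: (wk _ _ (s - n.+1%:R^-1) t) => //.
  - by rewrite subr_gt0.
  - move=> x; have := is_deriveB (st_derive n s x) (st_derive n t x); exact.
  - move=> x; rewrite negb_and -!ltNge => /orP[/ltW xs|/ltW tx]; last by rewrite /th !st1 ?subrr// (le_trans (ltW lt_st)).
    by rewrite /th !st0 ?subrr// (le_trans xs)// lerD2r ltW.
have : g s - g t + \int[leb]_x (F x * itv s t x) = 0 by apply: (cvg_unique (@Rhausdorff R) cv3 cv4).
lra.
Qed.

End Step.

Lemma weak_primitive T g F M : 0 < T -> continuous g -> (forall x, `|g x| <= M) -> L1 leb F ->
  (forall th dth a b, 0 < a -> b < T -> smooth th -> (forall x : R, is_derive x 1 th (dth x)) ->
    (forall x, ~~ (a <= x <= b) -> th x = 0) ->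
    \int[leb]_x (g x * dth x) + \int[leb]_x (F x * th x) = 0) ->
  prim T g F.
Proof.
move=> T0 cg gM Fi wk.
have [H [b [[sH sb dH b0] [bl br Hl Hr]]]] := @step_exists R.
have int := weak_primitive_int sH sb dH b0 bl br Hl Hr cg gM Fi wk.
split => //; first by exists M.
move=> s t s0; rewrite le_eqVlt => /orP[/eqP <- _|st tT].
  rewrite subrr; under eq_Rintegral do rewrite itvss mulr0.
  by rewrite I0.
(* The end points 0 and T are reached from inside. A divisor of at least 3 keeps
   [s + a_ n < t - a_ n]. *)
pose a_ n : R := (t - s) * n.+3%:R^-1.
have ts0 : 0 < t - s by rewrite subr_gt0.
have a0 n : 0 < a_ n by rewrite mulr_gt0.
have a3 n : a_ n <= (t - s) / 3 by rewrite ler_wpM2l ?(ltW ts0)// lef_pV2 ?posrE// ler_nat.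
have ac : a_ n @[n --> \oo] --> (0 : R).
  rewrite -[0](mulr0 (t - s)); apply: cvgMl_tmp.
  apply: (squeeze_cvgr (f := cst 0) (h := fun k => k.+1%:R^-1)); [|exact: cvg_cst|exact: cvg_harmonic].
  apply/nearW => k; rewrite /cst invr_ge0 ler0n/= lef_pV2 ?posrE ?ltr0n// ler_nat.
  exact: leqW (leqnSn _).
have E n : g (t - a_ n) - g (s + a_ n) = \int[leb]_x (F x * itv (s + a_ n) (t - a_ n) x).
  have := a0 n; have := a3 n => h3 h0; apply: int; [exact: ltr_wpDl|lra|].
  by rewrite (lt_le_trans _ tT)// gtrBl.
have c1 : g (t - a_ n) - g (s + a_ n) @[n --> \oo] --> g t - g s.
  apply: cvgB.
    apply: (cvg_comp (fun n => t - a_ n) g _ (cg t)).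
    have cc : t - a_ n @[n --> \oo] --> t - 0 by apply: cvgB => //; exact: cvg_cst.
    by rewrite subr0 in cc.
  apply: (cvg_comp (fun n => s + a_ n) g _ (cg s)).
  have cc : s + a_ n @[n --> \oo] --> s + 0 by apply: cvgD => //; exact: cvg_cst.
  by rewrite addr0 in cc.
have [_ c2] : L1 leb (fun x => F x * itv s t x) /\
    \int[leb]_x (F x * itv (s + a_ n) (t - a_ n) x) @[n --> \oo] --> \int[leb]_x (F x * itv s t x).
  apply: (@IDCT _ _ _ leb _ _ (fun x => `|F x|)).
  - by move=> n; exact: L1_meas (L1_itv _ _ Fi).
  - exact: L1_meas (L1_itv s t Fi).
  (* Pointwise convergence fails at [s] only: it belongs to [[s, t[] but to none of the shrunken
     intervals. *)
  - exists [set s]; split; [exact: measurable_set1|exact: lebesgue_measure_set1|].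
    move=> x /= h; apply: contrapT => /eqP xs; apply: h; apply: cvgM; first exact: cvg_cst.
    rewrite /itv; have [xt|tx] := ltP x t; last first.
      apply: cvg_near_cst; apply/nearW => n; have h := a0 n; rewrite andbF.
      have -> : (x < t - a_ n) = false by apply/negbTE; rewrite -leNgt; lra.
      by rewrite andbF.
    have [sx|xs'] := leP s x; last first.
      apply: cvg_near_cst; apply/nearW => n; have h := a0 n.
      by have -> : (s + a_ n <= x) = false by apply/negbTE; rewrite -ltNge; lra.
    have xs0 : 0 < x - s by rewrite subr_gt0 lt_neqAle eq_sym xs.
    have tx0 : 0 < t - x by rewrite subr_gt0.
    have m0 : 0 < Num.min (x - s) (t - x) by rewrite lt_min xs0.
    apply: cvg_near_cst; move/cvgr0Pnorm_lt/(_ _ m0) : ac; apply: filterS => n.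
    rewrite gtr0_norm// lt_min => /andP[h1 h2].
    have -> : s + a_ n <= x by lra.
    by have -> : x < t - a_ n by lra.
  - exact: L1_norm.
  - by move=> n; apply: aeW => x; rewrite normrM ler_piMr// itv_bd.
by apply: (cvg_unique (@Rhausdorff R) c1); apply: (cvg_ext E).
Qed.

(** The hypothesis says that the constant 0 has weak derivative [F], so all integrals of [F] over
    [[0, t[] vanish, and Lebesgue's differentiation theorem recovers [F]. *)
Lemma weak_zero T F : 0 < T -> L1 leb F ->
  (forall th a b, 0 < a -> b < T -> smooth th ->
    (forall x, ~~ (a <= x <= b) -> th x = 0) -> \int[leb]_x (F x * th x) = 0) ->
  {ae leb, forall t, 0 < t < T -> F t = 0}.
Proof.
move=> T0 Fi wk.
have [_ _ _ pr] : prim T (fun=> 0) F.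
  apply: (weak_primitive T0 (M := 0)) => //.
  - by move=> x; exact: cvg_cst.
  - by rewrite normr0.
  - move=> th dth a b a0 bT sth _ th0; rewrite (wk th a b)// addr0.
    by under eq_Rintegral do rewrite mul0r; rewrite I0.
have Fint (i : interval R) : leb.-integrable [set` i] (EFin \o F).
  exact: (integrableS measurableT).
have FL : locally_integrable [set: R] F.
  split; [exact: L1_meas Fi|exact: openT|].
  move=> A _ cA; have mA : measurable (A : set (measurableTypeR R)) by exact: compact_measurable.
  have := (integrableS measurableT mA (@subsetT _ A) Fi).
  by move=> /integrableP[].
have := @FTC1 R F (BLeft 0) (fun y => Fint _) FL.
apply: filterS; first exact: (ae_filter_ringOfSetsType leb).
move=> t ht /andP[t0 tT].
have [|h1 <-] := ht; first by rewrite /= lte_fin.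
rewrite derive1E.
have nt : \forall y \near t, \int[leb]_(x in `[0, y]) F x = 0.
  have : \forall y \near t, 0 < y /\ y < T.
    by near=> y; split; near: y; [exact: lt_nbhsr|exact: lt_nbhsl].
  apply: filterS => y [y0 yT].
  rewrite -Rintegral_itv_bndo_bndc -?L1_itvE; last exact: Fint.
  by rewrite -pr ?subrr// ltW.
rewrite (near_eq_derive _ nt); exact: derive_cst.
Unshelve. all: by end_near. Qed.

End WeakPrimitive.

(** * The energy identity for representatives defined everywhere *)

Lemma measurable_inv_ge0 {dd} {X : measurableType dd} {R : realType} (f : X -> R) :
  measurable_fun setT f -> (forall x, 0 <= f x) -> measurable_fun setT (fun x => (f x)^-1).
Proof. by move=> mf f0; under eq_fun do rewrite -powR_inv1//; exact: measurable_powRf. Qed.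

Section JointMeasurability.
Context {R : realType} {d : nat}.
Local Notation mu := (torus R d).
Local Notation TX := (measurableTypeR R * 'rV[R]_d)%type.

Lemma measurable_slice (u : TX -> R) t : measurable_fun setT u ->
  measurable_fun setT (fun x : 'rV[R]_d => u (t, x)).
Proof. by move=> mf; have := measurable_fun_pair2 t mf; exact. Qed.

Lemma measurable_cvt (u : TX -> R) (k : 'rV[R]_d -> R) : measurable_fun setT u ->
  measurable_fun setT k -> measurable_fun setT (fun z : TX => cv (fun y => u (z.1, y)) k z.2).
Proof.
move=> mu' mk.
apply: (measurable_param mu (f := fun w : TX * 'rV[R]_d => u (w.1.1, w.2) * k (w.2 - w.1.2))).
apply: measurable_funM.
  apply: (measurableT_comp mu'); apply/measurable_fun_pairP; split => /=; last exact: measurable_snd.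
  exact: (measurableT_comp measurable_fst measurable_fst).
apply: (measurableT_comp mk); apply: measurable_fun_mx => i j; under eq_fun do rewrite !mxE.
have mc := @measurable_mx_entry R 1 d i j.
apply: measurable_funB; apply: (measurableT_comp mc); first exact: measurable_snd.
exact: (measurableT_comp measurable_snd measurable_fst).
Qed.

End JointMeasurability.

(** * Evolution of the mollified energy *)

Section Core.
Context {R : realType} {d : nat}.
Local Notation mu := (torus R d).
Local Notation leb := (@lebesgue_measure R).
Local Notation TX := (measurableTypeR R * 'rV[R]_d)%type.
Variables (A : R) (K : nat -> 'rV[R]_d -> R) (dK : nat -> 'I_d -> 'rV[R]_d -> R).
Hypotheses (A0 : 0 < A) (mo : forall n, moll A n (K n) (dK n)).
Variables (T c1 c2 : R) (rho : TX -> R) (v : 'I_d -> TX -> R) (g S : 'I_d -> 'I_d -> TX -> R).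
Hypotheses (T0 : 0 < T) (c10 : 0 < c1).
Hypotheses (mrho : measurable_fun setT rho) (mv : forall i, measurable_fun setT (v i))
  (mg : forall i j, measurable_fun setT (g i j)) (mS : forall i j, measurable_fun setT (S i j)).
Hypotheses (rhoB : forall z, c1 <= rho z <= c2)
  (rhop : forall t, torus_function (fun x => rho (t, x)))
  (vp : forall i t, torus_function (fun x => v i (t, x)))
  (gp : forall i j t, torus_function (fun x => g i j (t, x)))
  (Sp : forall i j t, torus_function (fun x => S i j (t, x))).
Variable V2 : R.
Hypotheses (V20 : 0 <= V2) (v2 : forall i t, L1 mu (fun x => v i (t, x) ^+ 2))
  (v2B : forall i t, \int[mu]_x (v i (t, x) ^+ 2) <= V2).
Variables (p dp P1 P : R -> R) (B : R).
Hypotheses (B0 : 0 <= B) (mp : measurable_fun setT p) (mdp : measurable_fun setT dp)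
  (mP1 : measurable_fun setT P1) (mP : measurable_fun setT P).
Hypotheses (dpE : forall r, c1 <= r <= c2 -> is_derive r 1 p (dp r))
  (dP1E : forall r, c1 <= r <= c2 -> is_derive r 1 P1 (dp r / r))
  (dPE : forall r, c1 <= r <= c2 -> is_derive r 1 P (P1 r) /\ {for r, continuous P1})
  (pB : forall r, c1 <= r <= c2 -> [/\ `|p r| <= B, `|dp r| <= B, `|P1 r| <= B & `|P r| <= B]).
Variables (G2 : R -> R) (CS : R).
Hypotheses (CS0 : 0 <= CS) (G20 : forall t, 0 <= G2 t) (G2i : L1 leb G2).
Hypotheses
  (gG2 : forall t, (\int[mu]_x ((\sum_i \sum_j `|g i j (t, x)|) `^ 2)%:E <= (G2 t)%:E)%E)
  (SG2 : forall i j t, (\int[mu]_x (`|S i j (t, x)| `^ 2)%:E <= (CS * G2 t)%:E)%E).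

Let chi (t : R) : R := ((0 < t) && (t < T))%:R.
Let sl (u : TX -> R) t := fun x => u (t, x).
Let vs t i := sl (v i) t.
Let Ss t i j := sl (S i j) t.
Let pf t := fun x => p (rho (t, x)).

Let mrhot t := measurable_slice t mrho.

Let pv t i : pL1 (vs t i).
Proof. by split; [exact: vp|apply: L2_L1; [exact: measurable_slice|exact: v2]]. Qed.

Let pvv t i j : pL1 (fun y => vs t i y * vs t j y).
Proof.
split; first by move=> x k; rewrite /vs /sl (vp i t) (vp j t).
by apply: L1_mul2; [exact: measurable_slice|exact: measurable_slice|exact: v2|exact: v2].
Qed.

Let powR2 (a : R) : `|a| `^ 2 = a ^+ 2.
Proof. by rewrite (powR_mulrn 2 (normr_ge0 a)) real_normK ?num_real. Qed.

Let L2of (f : 'rV[R]_d -> R) (b : R) : measurable_fun setT f ->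
  (\int[mu]_x (`|f x| `^ 2)%:E <= b%:E)%E -> L1 mu (fun x => f x ^+ 2).
Proof.
move=> mf fb; apply: L1_ge0; [exact: measurable_funX|by move=> x; exact: sqr_ge0|].
by apply: le_lt_trans (ltry b); apply: le_trans fb; under [leRHS]eq_integral do rewrite powR2.
Qed.

Let pS t i j : pL1 (Ss t i j).
Proof.
split; first exact: Sp.
by apply: L2_L1; [exact: measurable_slice|apply: L2of (SG2 i j t); exact: measurable_slice].
Qed.

Let pg t i j : pL1 (sl (g i j) t).
Proof.
split; first exact: gp.
apply: L2_L1; first exact: measurable_slice.
apply: (L2of (b := G2 t)); first exact: measurable_slice.
apply: le_trans (gG2 t); apply: ge0_le_integralR.
- by apply: measurable_powRf; apply: measurableT_comp => //; exact: measurable_slice.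
- apply: measurable_powRf; apply: measurable_sum => k; apply: measurable_sum => l.
  by apply: measurableT_comp => //; exact: measurable_slice.
- by move=> x; exact: powR_ge0.
move=> x; apply: powR_le => //; rewrite (bigD1 i)//= (bigD1 j)//= -addrA lerDl.
by rewrite addr_ge0// sumr_ge0// => k _; rewrite sumr_ge0.
Qed.

Let ppf t : pL1 (pf t).
Proof.
split; first by move=> x j; rewrite /pf (rhop t).
by apply: (@L1_bdd _ _ _ mu B) => [|x]; [exact: measurableT_comp mp (mrhot t)|have [] := pB (rhoB (t, x))].
Qed.

Let den n t x := denergy (sl rho t) (K n) (dK n) (vs t) (pf t) (Ss t) P1 x.
Let Rn n t x := cv (sl rho t) (K n) x.
Let Mn n t i x := cv (fun y => rho (t, y) * v i (t, y)) (K n) x.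
(** The kinetic part is written with the mollified momentum and the inverse density, the quantities
    that are primitives in time, rather than with the Favre average. *)
Let en n t x := P (Rn n t x) + 2^-1 * \sum_i (Mn n t i x * Mn n t i x * (Rn n t x)^-1).

Hypotheses
  (mass : forall n x, prim T (fun t => Rn n t x)
     (fun t => chi t * drho (sl rho t) (dK n) (vs t) x))
  (momentum : forall n i x, prim T (fun t => Mn n t i x)
     (fun t => chi t * dmom (sl rho t) (dK n) (vs t) (pf t) (Ss t) i x)).

Let Rbd n t x : c1 <= Rn n t x <= c2.
Proof. exact: (cv_rho_bd c10 (rhop t) (mrhot t) (fun y => rhoB (t, y)) (mo n)). Qed.

Let Rgt0 n t x : 0 < Rn n t x.
Proof. by have /andP[h _] := Rbd n t x; exact: lt_le_trans h. Qed.

Lemma prim_en n x : prim T (fun t => en n t x) (fun t => chi t * den n t x).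
Proof.
have R0 := mass n x.
have Pp := prim_comp R0 (fun t => Rbd n t x) dPE (fun r h => let: And4 _ _ _ h4 := pB h in h4)
  (fun r h => let: And4 _ _ h3 _ := pB h in h3).
have c12 : c1 <= c2 by have /andP[h] := rhoB (0, 0); exact: le_trans.
have Ip : prim T (fun t => (Rn n t x)^-1) (fun t => - (Rn n t x) ^- 2 * (chi t * drho (sl rho t) (dK n) (vs t) x)).
  apply: (prim_comp (P := fun r => r^-1) (dP := fun r => - r ^- 2) (B := c1^-1 + c1 ^- 2) R0 (fun t => Rbd n t x)).
  - move=> r /andP[r1 _]; have r0 : r != 0 by rewrite gt_eqF// (lt_le_trans c10).
    split.
      have h := is_derive_id r (1 : R).
      split; first exact: derivableV.
      by rewrite deriveV// derive_id /GRing.scale/= mulr1.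
    apply: cvgN; apply: (@cvgV _ _ (nbhs r) _ (fun x : R => x ^+ 2)); first by rewrite expf_neq0.
    exact: exprn_continuous.
  - move=> r /andP[r1 _]; have r0 := lt_le_trans c10 r1.
    rewrite gtr0_norm ?invr_gt0// (@le_trans _ _ c1^-1)//; first by rewrite lef_pV2.
    by rewrite lerDl invr_ge0 exprn_ge0// ltW.
  - move=> r /andP[r1 _]; have r0 := lt_le_trans c10 r1.
    rewrite normrN gtr0_norm ?invr_gt0 ?exprn_gt0// (@le_trans _ _ (c1 ^- 2))//.
      by rewrite lef_pV2 ?posrE ?exprn_gt0// lerXn2r ?nnegrE// ltW.
    by rewrite lerDr invr_ge0 ltW.
have Mp i := prim_mul (prim_mul (momentum n i x) (momentum n i x)) Ip.
have := prim_lin 2^-1 Pp (prim_sum (index_enum 'I_d) Mp); congr (prim _ _ _).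
apply/funext => t; rewrite /den /denergy /=.
move: (drho (sl rho t) (dK n) (vs t) x) => r; pose m i := dmom (sl rho t) (dK n) (vs t) (pf t) (Ss t) i x.
have Rn0 : Rn n t x != 0 by rewrite gt_eqF.
have WE i : Wm (sl rho t) (K n) (vs t i) x = Mn n t i x / Rn n t x by [].
rewrite [RHS]mulrDr mulrBr addrC; congr (_ + _); last by rewrite mulrCA.
rewrite -mulrA !mulr_suml !mulr_sumr -sumrB; apply: eq_bigr => i _.
rewrite WE -/(m i) -/(Rn n t x); field; exact: Rn0.
Qed.

Let fl n t x := flux (sl rho t) (K n) (dK n) (vs t) (pf t) (Ss t) p x.
Let Y n t := \int[mu]_x fl n t x.

Let chi_bd t : 0 <= chi t <= 1.
Proof. by rewrite /chi; case: ((0 < t) && (t < T)); rewrite ?lexx ?ler01. Qed.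

Let chi_itv t : chi t = \1_(`]0, T[%classic) t.
Proof. by rewrite /chi indicE; congr ((nat_of_bool _)%:R); apply/idP/idP; rewrite inE/= in_itv. Qed.

Let chi_L1 : L1 leb chi.
Proof.
have -> : chi = \1_(`]0, T[%classic) by apply/funext => t; exact: chi_itv.
apply/L1P; split; first exact: measurable_indic.
under eq_integral do rewrite ger0_norm//.
by rewrite integral_indic//= setIT lebesgue_measure_itv/= lte_fin T0 ltry.
Qed.

Lemma Y_den n t : \int[mu]_x den n t x = Y n t.
Proof.
have pB3 r : c1 <= r <= c2 -> [/\ `|p r| <= B, `|dp r| <= B & `|P1 r| <= B] by move=> /pB[].
apply: (balance c10 (rhop t) (mrhot t) (fun x => rhoB (t, x)) (mo n) (pv t) (pvv t) (ppf t) (pS t) mp mdp mP1 dpE dP1E pB3).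
Qed.

Let mcv (u : TX -> R) n : measurable_fun setT u -> measurable_fun setT (fun z : TX => cv (fun y => u (z.1, y)) (K n) z.2).
Proof. by move=> mu'; apply: measurable_cvt => //; exact: mo_meas (mo n). Qed.

Let mcvd (u : TX -> R) n j : measurable_fun setT u -> measurable_fun setT (fun z : TX => cv (fun y => u (z.1, y)) (dK n j) z.2).
Proof. by move=> mu'; apply: measurable_cvt => //; exact: mo_measd (mo n) j. Qed.

Let mRV n : measurable_fun setT (fun z : TX => (Rn n z.1 z.2)^-1).
Proof. by apply: measurable_inv_ge0 => [|z]; [exact: mcv|rewrite ltW ?Rgt0]. Qed.

Let mM n i : measurable_fun setT (fun z : TX => Mn n z.1 i z.2).
Proof. by apply: (mcv (u := fun z => rho z * v i z)); exact: measurable_funM. Qed.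

Let mden n : measurable_fun setT (fun z : TX => den n z.1 z.2).
Proof.
have mW i : measurable_fun setT (fun z : TX => Wm (sl rho z.1) (K n) (vs z.1 i) z.2).
  exact: measurable_funM (mM n i) (mRV n).
have mdr : measurable_fun setT (fun z : TX => drho (sl rho z.1) (dK n) (vs z.1) z.2).
  apply: measurable_sum => j; apply: (mcvd (u := fun z => rho z * v j z)); exact: measurable_funM.
have mdm i : measurable_fun setT (fun z : TX => dmom (sl rho z.1) (dK n) (vs z.1) (pf z.1) (Ss z.1) i z.2).
  apply: measurable_funB; last by apply: measurable_sum => j; exact: (mcvd (u := S i j)).
  apply: measurable_funD; last by apply: (mcvd (u := fun z => p (rho z))); exact: measurableT_comp.
  apply: measurable_sum => j; apply: (mcvd (u := fun z => rho z * v i z * v j z)).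
  by apply: measurable_funM => //; exact: measurable_funM.
apply: measurable_funD; last by apply: measurable_funM => //; apply: (measurableT_comp mP1); exact: mcv.
apply: measurable_funB; first by apply: measurable_sum => i; exact: measurable_funM.
apply: measurable_funM => //; apply: measurable_funM; first exact: measurable_cst.
by apply: measurable_sum => i; exact: measurable_funX.
Qed.

Let c20 : 0 < c2.
Proof. by have /andP[h1 h2] := rhoB (0, 0); exact: lt_le_trans (le_trans h1 h2). Qed.

Let rho_norm z : `|rho z| <= c2.
Proof. by have /andP[h1 h2] := rhoB z; rewrite ger0_norm// (le_trans _ h1)// ltW. Qed.

Let norm_le_sqr (a : R) : `|a| <= 1 + a ^+ 2.
Proof. by rewrite ler_norml; apply/andP; split; nra. Qed.

Definition nb (u : 'rV[R]_d -> R) : R := \int[mu]_x `|u x|.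

Let rv_nb t i : nb (fun y => rho (t, y) * v i (t, y)) <= c2 * (1 + V2).
Proof.
have rvi : L1 mu (fun y => rho (t, y) * v i (t, y)).
  by have [_] := rhoM_pL1 c10 (rhop t) (mrhot t) (fun x => rhoB (t, x)) (pv t i).
apply: (@le_trans _ _ (\int[mu]_x (c2 * (1 + v i (t, x) ^+ 2)))).
  apply: Ile; [exact: L1_norm|by apply: L1Z; apply: L1D; [exact: L1_cst|exact: v2]|].
  by move=> x; rewrite normrM ler_pM.
rewrite IZ; last by apply: L1D; [exact: L1_cst|exact: v2].
by rewrite ler_wpM2l ?(ltW c20)// ID ?I_cst ?lerD2l//; exact: L1_cst.
Qed.

Let rvv_L1 t i j : L1 mu (fun y => rho (t, y) * v i (t, y) * v j (t, y)).
Proof.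
under eq_fun do rewrite -mulrA.
by have [_] := rhoM_pL1 c10 (rhop t) (mrhot t) (fun x => rhoB (t, x)) (pvv t i j).
Qed.

Let rvv_nb t i j : nb (fun y => rho (t, y) * v i (t, y) * v j (t, y)) <= c2 * (V2 + V2).
Proof.
apply: (@le_trans _ _ (\int[mu]_x (c2 * (v i (t, x) ^+ 2 + v j (t, x) ^+ 2)))).
  apply: Ile; [exact: L1_norm (rvv_L1 t i j)|by apply: L1Z; apply: L1D; exact: v2|].
  move=> x; rewrite -mulrA normrM ler_pM// ler_norml.
  by move: (v i (t, x)) (v j (t, x)) => a b; apply/andP; split; nra.
rewrite IZ; last by apply: L1D; exact: v2.
by rewrite ler_wpM2l ?(ltW c20)// ID// lerD.
Qed.

Let pf_nb t : nb (pf t) <= B.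
Proof.
rewrite -(I_cst mu B); apply: Ile; [exact: L1_norm (ppf t).2|exact: L1_cst|].
by move=> x; have [] := pB (rhoB (t, x)).
Qed.

Let S_nb t i j : nb (Ss t i j) <= 1 + CS * G2 t.
Proof.
have S2i : L1 mu (fun x => Ss t i j x ^+ 2).
  by apply: L2of (SG2 i j t); exact: measurable_slice.
apply: (@le_trans _ _ (\int[mu]_x (1 + Ss t i j x ^+ 2))).
  by apply: Ile; [exact: L1_norm (pS t i j).2|apply: L1D => //; exact: L1_cst|].
rewrite ID ?I_cst ?lerD2l//; last exact: L1_cst.
rewrite -lee_fin (EFinI S2i); apply: le_trans (SG2 i j t).
by under [leRHS]eq_integral do rewrite powR2.
Qed.

Let cv_nb u (k : 'rV[R]_d -> R) (M : R) x : L1 mu u -> measurable_fun setT k -> (forall y, `|k y| <= M) ->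
  `|cv u k x| <= M * nb u.
Proof. exact: bounded_cv. Qed.

(** The constant depends on [n]: the bound is pointwise in [x] and serves integrability and Fubini's
    theorem. Bounds uniform in [n] are available only after integration in space. *)
Lemma den_bound n : exists C, 0 <= C /\ forall t x, `|den n t x| <= C * (1 + G2 t).
Proof.
have [M HM] := mo_bdd (mo n).
have M0 : 0 <= M by have [h _] := HM 0; rewrite (le_trans _ h).
have KM y : `|K n y| <= M by have [] := HM y.
have dKM j y : `|dK n j y| <= M by have [] := HM y.
have mK := mo_meas (mo n); have mdK := mo_measd (mo n).
pose m := M * (c2 * (1 + V2)); pose w := m / c1.
pose r := \sum_(j < d) m.
pose mm := \sum_(j < d) M * (c2 * (V2 + V2)) + M * B + \sum_(j < d) M * (1 + CS).
have m0 : 0 <= m by rewrite /m !mulr_ge0// ?addr_ge0// ltW.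
have w0 : 0 <= w by rewrite mulr_ge0// invr_ge0 ltW.
have r0 : 0 <= r by apply: sumr_ge0.
have mm0 : 0 <= mm.
  by rewrite /mm !addr_ge0 ?sumr_ge0// => *; rewrite ?mulr_ge0// ?addr_ge0// ltW.
have rvi t i : L1 mu (fun y => rho (t, y) * v i (t, y)).
  by have [_] := rhoM_pL1 c10 (rhop t) (mrhot t) (fun x => rhoB (t, x)) (pv t i).
have hW t i x : `|Wm (sl rho t) (K n) (vs t i) x| <= w.
  have /andP[R1 _] := Rbd n t x; have Rx := Rgt0 n t x.
  rewrite /Wm normrM [X in _ * X]gtr0_norm ?invr_gt0// /w.
  apply: ler_pM => //; first by rewrite invr_ge0 ltW.
    by apply: le_trans (cv_nb x (rvi t i) mK KM) _; rewrite /m ler_wpM2l.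
  by rewrite lef_pV2.
have hr t x : `|drho (sl rho t) (dK n) (vs t) x| <= r.
  apply: le_trans (ler_norm_sum _ _ _) _; apply: ler_sum => j _.
  by apply: le_trans (cv_nb x (rvi t j) (mdK j) (dKM j)) _; rewrite /m ler_wpM2l.
have G1 t : 1 <= 1 + G2 t by rewrite lerDl.
have hm t i x : `|dmom (sl rho t) (dK n) (vs t) (pf t) (Ss t) i x| <= mm * (1 + G2 t).
  apply: le_trans (ler_normB _ _) _; rewrite /mm mulrDl; apply: lerD.
    apply: le_trans (ler_normD _ _) _; rewrite mulrDl; apply: lerD.
      apply: (@le_trans _ _ (\sum_(j < d) M * (c2 * (V2 + V2)))); last first.
        by rewrite ler_peMr// sumr_ge0// => *; rewrite !mulr_ge0// ?addr_ge0// ltW.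
      apply: le_trans (ler_norm_sum _ _ _) _; apply: ler_sum => j _.
      by apply: le_trans (cv_nb x (rvv_L1 t i j) (mdK j) (dKM j)) _; rewrite ler_wpM2l.
    apply: (@le_trans _ _ (M * B)); last by rewrite ler_peMr// mulr_ge0.
    by apply: le_trans (cv_nb x (ppf t).2 (mdK i) (dKM i)) _; rewrite ler_wpM2l.
  rewrite mulr_suml; apply: le_trans (ler_norm_sum _ _ _) _; apply: ler_sum => j _.
  apply: le_trans (cv_nb x (pS t i j).2 (mdK j) (dKM j)) _; rewrite -mulrA ler_wpM2l//.
  apply: le_trans (S_nb t i j) _; have := mulr_ge0 CS0 (G20 t); have := G20 t; move: CS0; nra.
pose C := \sum_(i < d) w * mm + 2^-1 * (\sum_(i < d) w ^+ 2) * r + B * r.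
exists C; split.
  have h1 : 0 <= \sum_(i < d) w * mm by apply: sumr_ge0 => *; exact: mulr_ge0.
  have h2 : 0 <= \sum_(i < d) w ^+ 2 by apply: sumr_ge0 => *; exact: sqr_ge0.
  by rewrite /C !addr_ge0// !mulr_ge0// invr_ge0.
move=> t x; rewrite /C mulrDl; apply: le_trans (ler_normD _ _) _; apply: lerD; last first.
  rewrite normrM; apply: (@le_trans _ _ (B * r)); last by rewrite ler_peMr// mulr_ge0.
  by apply: ler_pM => //; have [] := pB (Rbd n t x).
rewrite mulrDl; apply: le_trans (ler_normB _ _) _; apply: lerD.
  rewrite mulr_suml; apply: le_trans (ler_norm_sum _ _ _) _; apply: ler_sum => i _.
  by rewrite normrM -mulrA; apply: ler_pM.
apply: (@le_trans _ _ (2^-1 * (\sum_(i < d) w ^+ 2) * r)); last first.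
  by rewrite ler_peMr// !mulr_ge0// sumr_ge0// => *; exact: exprn_ge0.
rewrite normrM; apply: ler_pM => //; rewrite normrM ger0_norm ?invr_ge0// ler_wpM2l ?invr_ge0//.
apply: le_trans (ler_norm_sum _ _ _) _; apply: ler_sum => i _.
by rewrite normrX lerXn2r ?nnegrE.
Qed.

Let den_L1 n t : L1 mu (den n t).
Proof.
have [C [_ hC]] := den_bound n.
by apply: (@L1_bdd _ _ _ mu (C * (1 + G2 t))) => [|x]; [exact: measurable_slice (mden n)|exact: hC].
Qed.

Let en_L1 n t : L1 mu (en n t).
Proof.
have k1 : kern (Rn n t) := kern_cvrho c10 (rhop t) (mrhot t) (fun x => rhoB (t, x)) (mo n).
have kI : kern (fun x => (Rn n t x)^-1) := kern_inv c10 (rhop t) (mrhot t) (fun x => rhoB (t, x)) (mo n).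
have kM i : kern (fun x => Mn n t i x).
  apply: kern_cv (moll_kern (mo n)).
  by have [_] := rhoM_pL1 c10 (rhop t) (mrhot t) (fun x => rhoB (t, x)) (pv t i).
apply: L1D.
  apply: (@L1_bdd _ _ _ mu B) => [|x]; last by have [] := pB (Rbd n t x).
  by apply: (measurableT_comp mP); case: k1.
by apply/kern_L1/kernZ/kern_sum => i; apply: kernM => //; exact: kernM.
Qed.

Let fub n s : L1 (leb \x mu)%E (fun z : TX => chi z.1 * den n z.1 z.2 * itv 0 s z.1).
Proof.
have [C [C0 hC]] := den_bound n.
have mchi : measurable_fun setT (chi : measurableTypeR R -> R) := L1_meas chi_L1.
apply: (@L1_prod_bound _ _ _ _ _ leb mu _ (fun t => C * (chi t + G2 t))).
- apply: measurable_funM; last exact: (measurableT_comp (measurable_itvf 0 s) measurable_fst).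
  by apply: measurable_funM => //; exact: (measurableT_comp mchi measurable_fst).
- by apply: L1Z; exact: L1D.
- move=> t /=; have -> : (fun x => chi t * den n t x * itv 0 s t) = (fun x => (chi t * itv 0 s t) * den n t x).
    by apply/funext => x; rewrite mulrAC.
  exact: L1Z.
move=> t /=; rewrite -(I_cst mu (C * (chi t + G2 t))); apply: Ile.
- have -> : (fun x => `|chi t * den n t x * itv 0 s t|) = (fun x => `|(chi t * itv 0 s t) * den n t x|).
    by apply/funext => x; rewrite mulrAC.
  by apply: L1_norm; exact: L1Z.
- exact: L1_cst.
move=> x; rewrite !normrM; have /andP[h0 h1] := chi_bd t.
have hi := itv_bd 0 s t; have hd := hC t x; have G0 := G20 t.
apply: (@le_trans _ _ (`|chi t| * `|den n t x|)); first by rewrite ler_piMr// mulr_ge0.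
rewrite (ger0_norm h0); apply: (@le_trans _ _ (chi t * (C * (1 + G2 t)))); first by rewrite ler_wpM2l.
rewrite mulrCA ler_wpM2l// mulrDr mulr1 lerD2l ler_piMl//.
Qed.

Definition En n t : R := \int[mu]_x en n t x.

(** The identity in time holds at each fixed [x]; it is integrated in [x] by Fubini's theorem, and
    [balance] replaces the integrated derivative by the integrated flux. *)
Lemma En_diff n s : 0 <= s -> s <= T ->
  En n s - En n 0 = \int[leb]_t (chi t * Y n t * itv 0 s t).
Proof.
move=> s0 sT; rewrite /En -(IB (en_L1 n s) (en_L1 n 0)).
transitivity (\int[mu]_x \int[leb]_t (chi t * den n t x * itv 0 s t)).
  by apply: eq_Rintegral => x _; have [_ _ _ h] := prim_en n x; rewrite h.
rewrite -(I_fubini (fub n s)) /=; apply: eq_Rintegral => t _.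
have -> : (fun x => chi t * den n t x * itv 0 s t) = (fun x => (chi t * itv 0 s t) * den n t x).
  by apply/funext => x; rewrite mulrAC.
by rewrite IZ// Y_den mulrAC.
Qed.


(** * Limit of the energy identity as the scale tends to 0 *)

Section TimeLimit.
Variables (s q : R) (V Gq : R -> R).
Hypotheses (s1 : 1 <= s) (q1 : 1 <= q) (sq : s^-1 + q^-1 = 1).
Hypotheses (V0 : forall t, 0 <= V t) (Gq0 : forall t, 0 <= Gq t)
  (VGi : L1 leb (fun t => chi t * (V t `^ s^-1 * Gq t `^ q^-1))).
Hypothesis good : {ae leb, forall t, 0 < t < T ->
  [/\ forall i, (\int[mu]_x (`|v i (t, x)| `^ (2 * s))%:E <= (V t)%:E)%E,
      (\int[mu]_x ((\sum_i \sum_j `|g i j (t, x)|) `^ q)%:E <= (Gq t)%:E)%E,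
      forall n i j x, cv (vs t i) (dK n j) x = - cv (sl (g i j) t) (K n) x &
      forall n i j y, \int[mu]_x (vs t i x * dK n j (y - x)) = \int[mu]_x (sl (g i j) t x * K n (y - x))]}.

Let lip (f df : R -> R) : (forall r, c1 <= r <= c2 -> is_derive r 1 f (df r)) ->
  (forall r, c1 <= r <= c2 -> `|df r| <= B) ->
  forall a b, c1 <= a <= c2 -> c1 <= b <= c2 -> `|f a - f b| <= B * `|a - b|.
Proof.
move=> dff dfB.
suff H a b : c1 <= a <= c2 -> c1 <= b <= c2 -> a < b -> `|f a - f b| <= B * `|a - b|.
  move=> a b ha hb; have [ab|ba|->] := ltgtP a b; first exact: H.
    by rewrite distrC [`|a - b|]distrC; exact: H.
  by rewrite !subrr normr0 mulr0.
move=> /andP[a1 a2] /andP[b1 b2] ab.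
have inab r : a <= r <= b -> c1 <= r <= c2.
  by move=> /andP[h1 h2]; rewrite (le_trans a1 h1) (le_trans h2 b2).
have [| |xi xiab] := @MVT R f df a b ab.
- by move=> r; rewrite in_itv/= => /andP[h1 h2]; apply: dff; apply: inab; rewrite !ltW.
- apply: continuous_in_subspaceT => r; rewrite inE/= in_itv/= => /inab/dff[h _].
  exact/differentiable_continuous/derivable1_diffP.
rewrite distrC [`|a - b|]distrC => ->; rewrite normrM ler_wpM2r//; apply: dfB; apply: inab.
by move: xiab; rewrite in_itv/= => /andP[h1 h2]; rewrite !ltW.
Qed.

Let pL a b : c1 <= a <= c2 -> c1 <= b <= c2 -> `|p a - p b| <= B * `|a - b|.
Proof. by apply: (lip dpE) => r /pB[]. Qed.

Let PL a b : c1 <= a <= c2 -> c1 <= b <= c2 -> `|P a - P b| <= B * `|a - b|.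
Proof. by apply: (lip (fun r h => (dPE h).1)) => r /pB[]. Qed.

Definition work t : R := \sum_i \sum_j \int[mu]_x (S i j (t, x) * g i j (t, x)).

Let mY n : measurable_fun setT (Y n : measurableTypeR R -> R).
Proof.
have := measurable_param mu (mden n) => /=; congr (measurable_fun _ _).
by apply/funext => t; rewrite Y_den.
Qed.

Let mchi : measurable_fun setT (chi : measurableTypeR R -> R) := L1_meas chi_L1.

Let mwork : measurable_fun setT (work : measurableTypeR R -> R).
Proof.
apply: measurable_sum => i; apply: measurable_sum => j.
by apply: (measurable_param mu (f := fun z => S i j z * g i j z)); exact: measurable_funM.
Qed.

Let half_mul (a b : R) : 0 <= a -> 0 <= b -> a `^ 2^-1 * b `^ 2^-1 <= a + b.
Proof.
move=> a0 b0; have ha := powR_ge0 a 2^-1; have hb := powR_ge0 b 2^-1.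
have sqa (c : R) : 0 <= c -> c = c `^ 2^-1 * c `^ 2^-1.
  move=> c0; have [->|cn0] := eqVneq c 0; first by rewrite powR0 ?mul0r// invr_eq0.
  have h : 2^-1 + 2^-1 = 1 :> R by field.
  by rewrite -powRD ?cn0 ?implybT// h powRr1.
rewrite [in leRHS](sqa a a0) [in leRHS](sqa b b0); nra.
Qed.

Let a1 : R := ((2 * c2) `^ s * (4 * 2 `^ (2 * s))) `^ s^-1 * (Dr A c1 c2 q) `^ q^-1.
(** The bound [flux_bd] made integrable in time. The convective part keeps the product of the norms
    of velocity and gradient, whose integrability is the hypothesis [VGi]; in the other parts square
    roots are removed by [half_mul], which leaves terms linear in [G2]. *)
Let dom t : R := \sum_(i < d) \sum_(j < d) a1 * (V t `^ s^-1 * Gq t `^ q^-1) +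
  \sum_(i < d) (2 * B * (2 * B) + Dr A c1 c2 2 * G2 t) +
  \sum_(i < d) \sum_(j < d) (CS * G2 t + Dr A c1 c2 2 * G2 t).

Let Dr0 r : 0 <= Dr A c1 c2 r.
Proof. exact: Dr_ge0. Qed.

Let Y_bd : {ae leb, forall t, 0 < t < T -> forall n, `|Y n t| <= dom t}.
Proof.
move: good; apply: (@filterS _ _ (ae_filter_ringOfSetsType leb)) => t gt /gt[hV hG wg wgr] n.
have := flux_bd A0 mo c10 (rhop t) (mrhot t) (fun x => rhoB (t, x)) (pv t) (fun i => v2 i t) (pS t) (pg t) wg
  B0 mp (fun r h => let: And4 h1 _ _ _ := pB h in h1) s1 q1 sq (V0 t) (Gq0 t) (G20 t) (mulr_ge0 CS0 (G20 t)) hV hG (gG2 t) (fun i j => SG2 i j t) n.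
move/le_trans; apply; rewrite /dom; apply: lerD; first apply: lerD.
- apply: ler_sum => i _; apply: ler_sum => j _; rewrite le_eqVlt; apply/orP; left; apply/eqP.
  have cc0 : 0 <= (2 * c2) `^ s * (4 * 2 `^ (2 * s)) by rewrite !mulr_ge0 ?powR_ge0.
  rewrite [X in X `^ s^-1]mulrA (powRM _ cc0 (V0 t)) (powRM _ (Dr0 q) (Gq0 t)).
  by rewrite mulrACA.
- have BB0 : 0 <= 2 * B * (2 * B) by rewrite !mulr_ge0.
  by apply: ler_sum => i _; exact: (half_mul BB0 (mulr_ge0 (Dr0 2) (G20 t))).
- apply: ler_sum => i _; apply: ler_sum => j _.
  exact: (half_mul (mulr_ge0 CS0 (G20 t)) (mulr_ge0 (Dr0 2) (G20 t))).
Qed.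

Let Y_cvg : {ae leb, forall t, 0 < t < T -> Y n t @[n --> \oo] --> - work t}.
Proof.
move: good; apply: (@filterS _ _ (ae_filter_ringOfSetsType leb)) => t gt /gt[hV hG wg wgr].
exact: (flux_cvg A0 mo c10 (rhop t) (mrhot t) (fun x => rhoB (t, x)) (pv t) (fun i => v2 i t) (pS t) (pg t) wg wgr
  mp (fun r h => let: And4 h1 _ _ _ := pB h in h1) pL s1 q1 sq (Gq0 t) (G20 t) hV hG (gG2 t) (fun i j => SG2 i j t)).
Qed.

Let dom_L1 : L1 leb (fun t => chi t * dom t).
Proof.
have cG : L1 leb (fun t => chi t * G2 t).
  by under eq_fun do rewrite mulrC; apply: (L1_mulb G2i mchi (M := 1)) => t;
    have /andP[h0 h1] := chi_bd t; rewrite ger0_norm.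
have -> : (fun t => chi t * dom t) = (fun t => (\sum_(i < d) \sum_(j < d) a1) * (chi t * (V t `^ s^-1 * Gq t `^ q^-1)) +
  ((\sum_(i < d) 2 * B * (2 * B)) * chi t + (\sum_(i < d) Dr A c1 c2 2) * (chi t * G2 t)) +
  (\sum_(i < d) \sum_(j < d) (CS + Dr A c1 c2 2)) * (chi t * G2 t)).
  apply/funext => t; rewrite /dom !mulrDr; congr (_ + _ + _).
  - rewrite [RHS]mulrCA mulr_suml; congr (_ * _); apply: eq_bigr => i _; by rewrite mulr_suml.
  - have e : \sum_(i < d) Dr A c1 c2 2 * G2 t = (\sum_(i < d) Dr A c1 c2 2) * G2 t by rewrite mulr_suml.
    rewrite big_split/= e; ring.
  - rewrite [RHS]mulrCA mulr_suml; congr (_ * _); apply: eq_bigr => i _; rewrite mulr_suml.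
    by apply: eq_bigr => j _; rewrite mulrDl.
by apply: L1D; [apply: L1D; [exact: L1Z|apply: L1D; exact: L1Z]|exact: L1Z].
Qed.

Lemma En_diff_cvg r : 0 <= r -> r <= T ->
  L1 leb (fun t => chi t * work t * itv 0 r t) /\
  En n r - En n 0 @[n --> \oo] --> - \int[leb]_t (chi t * work t * itv 0 r t).
Proof.
move=> r0 rT.
have [h1 h2] : L1 leb (fun t => chi t * - work t * itv 0 r t) /\
    \int[leb]_t (chi t * Y n t * itv 0 r t) @[n --> \oo] --> \int[leb]_t (chi t * - work t * itv 0 r t).
  apply: (@IDCT _ _ _ leb _ _ (fun t => chi t * dom t)).
  - move=> n; apply: measurable_funM (measurable_itvf 0 r); exact: measurable_funM.
  - apply: measurable_funM (measurable_itvf 0 r); apply: measurable_funM => //.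
    exact: measurableT_comp.
  - move: Y_cvg; apply: (@filterS _ _ (ae_filter_ringOfSetsType leb)) => t ht; rewrite /chi; case: (boolP (_ && _)) => [/ht h|_].
      by apply: cvgMr_tmp; apply: cvgMl_tmp.
    by apply: cvg_near_cst; apply/nearW => n; rewrite !mul0r.
  - exact: dom_L1.
  - move=> n; move: Y_bd; apply: (@filterS _ _ (ae_filter_ringOfSetsType leb)) => t ht.
    rewrite !normrM (@le_trans _ _ (`|chi t| * `|Y n t|))//.
      by rewrite ler_piMr ?mulr_ge0// itv_bd.
    rewrite /chi; case: (boolP (_ && _)) => [/ht h|_]; last by rewrite normr0 !mul0r.
    by rewrite normr1 !mul1r.
have e t : chi t * work t * itv 0 r t = - (chi t * - work t * itv 0 r t) by rewrite mulrN mulNr opprK.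
split; first by under eq_fun do rewrite e; exact: L1N.
under [X in _ --> - X]eq_Rintegral do rewrite e.
rewrite IN// opprK; apply: (cvg_ext _ h2) => n; exact: En_diff.
Qed.

Definition E0 t : R := \int[mu]_x (2^-1 * \sum_i (rho (t, x) * v i (t, x) * v i (t, x)) + P (rho (t, x))).

(** The potential part converges because [P] is Lipschitz on the range of the density. The kinetic
    part differs from its limit by the integral of [Cov], estimated with exponent 1, that is from
    [v] in L^2 at this very time. *)
Lemma En_cvg t : En n t @[n --> \oo] --> E0 t.
Proof.
have prho : pL1 (fun x => rho (t, x)) := rho_pL1 c10 (rhop t) (mrhot t) (fun x => rhoB (t, x)).
have iP : L1 mu (fun x => P (rho (t, x))).
  apply: (@L1_bdd _ _ _ mu B) => [|x]; last by have [] := pB (rhoB (t, x)).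
  exact: measurableT_comp mP (mrhot t).
have kR n : kern (Rn n t) := kern_cvrho c10 (rhop t) (mrhot t) (fun x => rhoB (t, x)) (mo n).
have iPn n : L1 mu (fun x => P (Rn n t x)).
  apply: (@L1_bdd _ _ _ mu B) => [|x]; last by have [] := pB (Rbd n t x).
  by apply: (measurableT_comp mP); case: (kR n).
have c1' : \int[mu]_x P (Rn n t x) @[n --> \oo] --> \int[mu]_x P (rho (t, x)).
  have cc : B * \int[mu]_x `|Rn n t x - rho (t, x)| @[n --> \oo] --> 0.
    by rewrite -[0](mulr0 B); apply: cvgMl_tmp; exact: (cv_cvg mo prho.2 prho.1).
  apply/subr_cvg0; apply: norm_cvg0.
  apply: (squeeze_cvgr _ (cvg_cst 0) cc); apply/nearW => n.
  rewrite normr_ge0/= -IB//.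
  have i3 : L1 mu (fun x => `|Rn n t x - rho (t, x)|).
    by apply: L1_norm; apply: L1B; [exact: kern_L1|exact: prho.2].
  rewrite -IZ//; apply: Idom; [exact: L1_meas (L1B (iPn n) iP)|exact: L1Z|].
  by move=> x; exact: PL (Rbd n t x) (rhoB (t, x)).
have c3 i : \int[mu]_x (Mn n t i x * Mn n t i x * (Rn n t x)^-1) @[n --> \oo] -->
    \int[mu]_x (rho (t, x) * v i (t, x) * v i (t, x)).
  have s21 : 1 <= 2 * 1 :> R by lra.
  have o : osc (2 * 1) (K n) (vs t i) @[n --> \oo] --> 0%E.
    apply: (osc_cvg s21 (L1_meas (pv t i).2) (pv t i).1).
    - rewrite mulr1; under eq_integral do rewrite powR2.
      by rewrite -(EFinI (v2 i t)) ltry.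
    - by move=> n; exact: kern_L1 (moll_kern (mo n)).
    - by move=> n; exact: mo_ge0 (mo n).
    - by move=> n; exact: suppK_K (mo n).
    - by move=> n; rewrite (mo_int (mo n)).
  have kC n : kern (Cov (sl rho t) (K n) (vs t i) (vs t i)).
    exact: (kern_Cov c10 (rhop t) (mrhot t) (fun x => rhoB (t, x)) (mo n) (pv t i) (pv t i) (pvv t i i)).
  have cC : \int[mu]_x Cov (sl rho t) (K n) (vs t i) (vs t i) x @[n --> \oo] --> 0.
    have cc : (((2 * c2) `^ 1)%:E * (osc (2 * 1) (K n) (vs t i) + osc (2 * 1) (K n) (vs t i)))%E @[n --> \oo] --> 0%E.
      by rewrite -[0%E](mule0 ((2 * c2) `^ 1)%:E); apply: cvgeZl => //; exact: (cvge0D o o).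
    have c4 : (\int[mu]_x Cov (sl rho t) (K n) (vs t i) (vs t i) x)%:E @[n --> \oo] --> 0%E.
      apply: (squeeze_cvge _ (cvg_cst 0%E) cc); apply/nearW => n.
      have [_ C0] := energy_gap c10 (rhop t) (mrhot t) (fun x => rhoB (t, x)) (mo n) (pv t i) (pvv t i i).
      apply/andP; split; first by rewrite lee_fin; exact: I_ge0.
      apply: le_trans (int_Cov c10 (rhop t) (mrhot t) (fun x => rhoB (t, x)) (mo n) (lexx 1) (pv t i) (pv t i) (pvv t i i) (pvv t i i) (pvv t i i)).
      rewrite (EFinI (kern_L1 (kC n))) le_eqVlt; apply/orP; left; apply/eqP.
      by apply: eq_integral => x _; rewrite powRr1// ger0_norm// C0.
    exact: (fine_cvg c4).
  have E n : \int[mu]_x (Mn n t i x * Mn n t i x * (Rn n t x)^-1) =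
      \int[mu]_x (rho (t, x) * v i (t, x) * v i (t, x)) - \int[mu]_x Cov (sl rho t) (K n) (vs t i) (vs t i) x.
    have [<- _] := energy_gap c10 (rhop t) (mrhot t) (fun x => rhoB (t, x)) (mo n) (pv t i) (pvv t i i).
    rewrite subKr; apply: eq_Rintegral => x _; rewrite /Wm -/(Mn n t i x) -/(Rn n t x); ring.
  apply: (cvg_ext E); rewrite -[X in _ --> X]subr0; apply: cvgB => //; exact: cvg_cst.
have kI n : kern (fun x => (Rn n t x)^-1) := kern_inv c10 (rhop t) (mrhot t) (fun x => rhoB (t, x)) (mo n).
have kM n i : kern (fun x => Mn n t i x).
  by apply: kern_cv (moll_kern (mo n)); have [_] := rhoM_pL1 c10 (rhop t) (mrhot t) (fun x => rhoB (t, x)) (pv t i).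
have kMM n i : kern (fun x => Mn n t i x * Mn n t i x * (Rn n t x)^-1).
  by apply: kernM => //; exact: kernM.
have E n : En n t = \int[mu]_x P (Rn n t x) + 2^-1 * \sum_i \int[mu]_x (Mn n t i x * Mn n t i x * (Rn n t x)^-1).
  have kS := kern_sum (index_enum 'I_d) (kMM n).
  rewrite /En /en ID//; last by apply: L1Z; exact: kern_L1 kS.
  by rewrite (IZ 2^-1 (kern_L1 kS)) (Isum _ (fun i => kern_L1 (kMM n i))).
have E' : E0 t = \int[mu]_x P (rho (t, x)) + 2^-1 * \sum_i \int[mu]_x (rho (t, x) * v i (t, x) * v i (t, x)).
  have i4 := L1_sum (index_enum 'I_d) (fun i => rvv_L1 t i i).
  rewrite /E0 ID//; last exact: L1Z.
  by rewrite (IZ 2^-1 i4) (Isum _ (fun i => rvv_L1 t i i)) addrC.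
apply: (cvg_ext E); rewrite E'; apply: cvgD => //; apply: cvgMl_tmp.
exact: cvg_sumr.
Qed.

Theorem core_identity r : 0 <= r -> r <= T ->
  L1 leb (fun t => chi t * work t * itv 0 r t) /\
  E0 r + \int[leb]_t (chi t * work t * itv 0 r t) = E0 0.
Proof.
move=> r0 rT; have [h1 h2] := En_diff_cvg r0 rT; split => //.
have h3 : En n r - En n 0 @[n --> \oo] --> E0 r - E0 0 by apply: cvgB; exact: En_cvg.
have h4 : E0 r - E0 0 = - \int[leb]_t (chi t * work t * itv 0 r t).
  exact: (cvg_unique (@Rhausdorff R) h3 h2).
lra.
Qed.

End TimeLimit.
End Core.

(** * Weak formulations with tensor test functions *)

Lemma cont_supp_bdd {R : realType} (f : R -> R) (a b : R) : continuous f ->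
  (forall x, ~~ (a <= x <= b) -> f x = 0) -> exists M, forall x, `|f x| <= M.
Proof.
move=> cf f0; have [ab|ba] := leP a b; last first.
  by exists 0 => x; rewrite f0 ?normr0//; apply/negP => /andP[h1 h2]; have := lt_le_trans ba (le_trans h1 h2); rewrite ltxx.
have cn : {within `[a, b], continuous (fun x => `|f x|)}.
  by apply: continuous_subspaceT => x; apply: cvg_norm; exact: cf.
have [c _ h] := EVT_max ab cn; exists `|f c| => x.
have [xab|xab] := boolP (a <= x <= b); last by rewrite f0 ?normr0.
by apply: h; rewrite in_itv.
Qed.

Lemma deriv_supp {R : realType} (f : R -> R) (a b : R) : (forall x, ~~ (a <= x <= b) -> f x = 0) ->
  forall x, ~~ (a <= x <= b) -> 'D_1 f x = 0.
Proof.
move=> f0 x xab.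
have op : open [set y : R | ~~ (a <= y <= b)].
  rewrite (_ : [set _ | _] = ~` `[a, b]%classic); first exact/closed_openC/itv_closed.
  by apply/seteqP; split => y /=; rewrite in_itv/= => /negP.
have h : \forall y \near x, f y = cst 0 y.
  by apply: filterS (open_nbhs_nbhs (conj op xab)) => y /f0.
have /nbhs_singleton := near_eq_derive_near (1 : R) h.
by move=> ->; rewrite derive_cst.
Qed.

Lemma ae_countable {d} {X : measurableType d} {R : realType} (mu : {measure set X -> \bar R})
    (I : countType) (P : I -> X -> Prop) :
  (forall i, {ae mu, forall x, P i x}) -> {ae mu, forall x, forall i, P i x}.
Proof.
move=> h; have : {ae mu, forall x, forall n : nat, if unpickle n is Some i then P i x else True}.
  by apply/ae_foralln => n; case: (unpickle n) => [i|]; [exact: h|exact: aeW].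
by apply: (@filterS _ _ (ae_filter_ringOfSetsType mu)) => x H i; have := H (pickle i); rewrite pickleK.
Qed.

Lemma rat_dense {R : realType} (n : nat) (x : 'rV[R]_n) :
  exists q : nat -> 'rV[rat]_n, map_mx ratr (q m) @[m --> \oo] --> x.
Proof.
have H (mj : nat * 'I_n) : exists q : rat, x 0 mj.2 < ratr q < x 0 mj.2 + mj.1.+1%:R^-1.
  have lt : x 0 mj.2 < x 0 mj.2 + mj.1.+1%:R^-1 by rewrite ltrDl invr_gt0.
  by have [q] := rat_in_itvoo lt; rewrite in_itv/= => h; exists q.
have [q qP] := choice H.
exists (fun m => \row_j q (m, j)).
have -> : (fun m => map_mx ratr (\row_j q (m, j))) =
    (fun m => \sum_j (ratr (q (m, j)) : R) *: delta_mx 0 j) :> (nat -> 'rV[R]_n).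
  by apply/funext => m; rewrite [LHS]row_sum_delta; apply: eq_bigr => j _; rewrite !mxE.
rewrite [X in _ --> X](row_sum_delta x); elim: (index_enum 'I_n) => [|j s IH].
  by under eq_fun do rewrite big_nil; rewrite big_nil; exact: cvg_cst.
under eq_fun do rewrite big_cons; rewrite big_cons; apply: cvgD => //; apply: cvgZr_tmp.
apply: (@squeeze_cvgr _ _ _ _ (fun=> x 0 j) (fun m : nat => x 0 j + m.+1%:R^-1)).
- by near=> m; have /andP[h1 h2] := qP (m, j); rewrite !ltW.
- exact: cvg_cst.
rewrite -[X in _ --> X]addr0; apply: cvgD; first exact: cvg_cst.
exact: cvg_harmonic.
Unshelve. all: by end_near.
Qed.

Section Fields.
Context {R : realType} {d : nat}.
Local Notation mu := (torus R d).
Local Notation leb := (@lebesgue_measure R).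
Local Notation TX := (measurableTypeR R * 'rV[R]_d)%type.
Variable T : R.

Definition chi (t : R) : R := ((0 < t) && (t < T))%:R.

(* [u'] is a version of [u] on the cylinder, defined and measurable everywhere. *)
Record fld (u u' : TX -> R) : Prop := {
  fld_loc : L1loc T u ;
  fld_meas : measurable_fun setT u' ;
  fld_ae : {ae spacetime R d, forall z, cylinder T z -> u z = u' z} ;
  fld_slice : forall t, L1 mu (fun x => u' (t, x)) ;
  fld_int : L1 (leb \x mu)%E (fun z => chi z.1 * u' z)
}.

(** Everything happens on [[a, b]], inside []0, T[]: there the local integrability of [u] applies,
    [u] may be replaced by [u'], and [chi] is 1; elsewhere both integrands vanish. *)
Lemma pair_fld u u' (th : R -> R) (psi : 'rV[R]_d -> R) a b M M' : fld u u' ->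
  0 < a -> b < T -> measurable_fun setT (th : measurableTypeR R -> R) -> (forall t, `|th t| <= M) ->
  (forall t, ~~ (a <= t <= b) -> th t = 0) -> measurable_fun setT psi -> (forall x, `|psi x| <= M') ->
  L1 leb (fun t => chi t * (\int[mu]_x (u' (t, x) * psi x)) * th t) /\
  pairing T u (fun z => th z.1 * psi z.2) =
    \int[leb]_t (chi t * (\int[mu]_x (u' (t, x) * psi x)) * th t).
Proof.
move=> [uloc mu' ae_u us ci] a0 bT mth thM th0 mpsi psiM.
pose w (z : TX) : R := th z.1 * psi z.2.
have mw : measurable_fun setT w.
  by apply: measurable_funM; [exact: (measurableT_comp mth measurable_fst)|exact: (measurableT_comp mpsi measurable_snd)].
have wM z : `|w z| <= M * M' by rewrite normrM ler_pM.
have fi : L1 (leb \x mu)%E (fun z => chi z.1 * u' z * w z) := L1_mulb ci mw wM.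
have slice t : \int[mu]_x (chi t * u' (t, x) * w (t, x)) = chi t * (\int[mu]_x (u' (t, x) * psi x)) * th t.
  transitivity (\int[mu]_x ((chi t * th t) * (u' (t, x) * psi x))).
    by apply: eq_Rintegral => x _; rewrite /w/=; ring.
  by rewrite IZ; [ring|exact: L1_mulb (us t) mpsi psiM].
have F1 := L1_fubini1 fi; have F2 := I_prod fi.
split.
  by move: F1; congr (L1 _ _); apply/funext => t; exact: slice.
transitivity (\int[(leb \x mu)%E]_z (chi z.1 * u' z * w z)); last first.
  by rewrite F2; apply: eq_Rintegral => t _; exact: slice.
clear F2.
pose D : set TX := `[a, b] `*` setT.
have mD : measurable D by apply: measurableX => //; exact: measurable_itv.
have DE z : (z \in D) = (a <= z.1 <= b).
  by apply/idP/idP; rewrite inE /D /= in_itv/=; [move=> []|].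
have wD z : z \notin D -> w z = 0 by rewrite DE => h; rewrite /w th0// mul0r.
have Dc z : D z -> cylinder T z.
  move=> /mem_set; rewrite DE => /andP[h1 h2]; split => //=.
  by rewrite in_itv/= (lt_le_trans a0 h1) (le_lt_trans h2 bT).
have chi1 z : z \in D -> chi z.1 = 1.
  by move=> /set_mem /Dc [/=]; rewrite in_itv/= /chi => -> _.
have mu_ : measurable_fun D (u : TX -> R).
  by have /measurable_int/measurable_EFinP := uloc a b a0 bT.
transitivity (\int[spacetime R d]_(z in D) (u z * w z)).
  rewrite /pairing Rintegral_mkcond [RHS]Rintegral_mkcond; congr Rintegral; apply/funext => z; rewrite !patchE.
  have [zD|zD] := boolP (z \in D).
    by rewrite ifT// inE; apply: Dc; exact: set_mem.
  by rewrite -/(w z) wD// mulr0 if_same.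
transitivity (\int[spacetime R d]_(z in D) (u' z * w z)).
  rewrite /Rintegral; congr fine; apply: ae_eq_integral => //.
  - apply/measurable_EFinP; apply: measurable_funM => //; exact: measurable_funTS.
  - by apply/measurable_EFinP; apply: measurable_funM; exact: measurable_funTS.
  by apply: (@filterS _ _ (ae_filter_ringOfSetsType (spacetime R d))) ae_u => z h /Dc /h /= ->.
rewrite Rintegral_mkcond; congr Rintegral; apply/funext => z; rewrite patchE.
have [zD|zD] := boolP (z \in D); first by rewrite chi1// mul1r.
by rewrite wD// mulr0.
Qed.

Lemma measurable_smooth (th : R -> R) : smooth th -> measurable_fun setT (th : measurableTypeR R -> R).
Proof. by move=> /smooth_continuous; exact: continuous_measurable_fun. Qed.

Section Conservation.
Context {I : finType}.
Variables (A : R) (n : nat) (K : 'rV[R]_d -> R) (dK : 'I_d -> 'rV[R]_d -> R).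
Variables (u u' : TX -> R) (f f' : I -> TX -> R) (J : I -> 'I_d) (s : I -> R).
Hypotheses (T0 : 0 < T) (mo : moll A n K dK) (uu : fld u u') (ff : forall k, fld (f k) (f' k)).
Hypothesis law : forall phi, spacetime_test T phi ->
  pairing T u (d_t phi) + \sum_k s k * pairing T (f k) (d_x (J k) phi) = 0.

Lemma moll_dE j (z : 'rV[R]_d) : 'D_(delta_mx 0 j) K z = dK j z.
Proof.
rewrite (@derive_val _ _ _ _ _ _ _ (mo_derive mo z (delta_mx 0 j))) (bigD1 j)//= mxE !eqxx mul1r big1 ?addr0// => k kj.
by rewrite mxE (negbTE kj) andbF mul0r.
Qed.

(** The law is tested with [th t * K (y - x)], which turns it into a weak equation in time for
    [weak_primitive]. The index type [I], the directions [J] and the signs [s] allow one statement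
    to serve both the mass and the momentum equation. *)
Lemma conservation_prim x M : continuous (fun t : R => cv (fun y => u' (t, y)) K x) ->
  (forall t, `|cv (fun y => u' (t, y)) K x| <= M) ->
  prim T (fun t => cv (fun y => u' (t, y)) K x)
    (fun t => chi t * \sum_k s k * cv (fun y => f' k (t, y)) (dK (J k)) x).
Proof.
move=> gc gM; have [MK hMK] := mo_bdd mo.
have [sK pK] := mo_test mo.
have mKx := measurable_subr x (mo_meas mo); have mdKx j := measurable_subr x (mo_measd mo j).
have fL k : L1 leb (fun t => chi t * cv (fun y => f' k (t, y)) (dK (J k)) x).
  have i1 : L1 (leb \x mu)%E (fun z => chi z.1 * f' k z * dK (J k) (z.2 - x)).
    apply: (L1_mulb (M := MK) (fld_int (ff k))) => [|z]; last exact: (hMK _).2.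
    exact: (measurableT_comp (mdKx _) measurable_snd).
  have := L1_fubini1 i1; congr (L1 _ _); apply/funext => t /=; rewrite /cv -IZ.
    by apply: eq_Rintegral => y _; rewrite mulrA.
  exact: L1_cv (fld_slice (ff k) t) (mo_measd mo _) (fun y => (hMK y).2 _).
apply: (weak_primitive (M := M)) => //.
  have := L1_sum (index_enum I) (fun k => L1Z (s k) (fL k)); congr (L1 _ _); apply/funext => t.
  by rewrite mulr_sumr; apply: eq_bigr => k _; rewrite mulrCA.
move=> th dth a b a0 bT sth dthE th0.
have dE t : 'D_1 th t = dth t := @derive_val _ _ _ _ _ _ _ (dthE t).
pose psi := fun y : 'rV[R]_d => K (y - x).
have tpsi : torus_test psi by exact: torus_test_sub.
have tt := spacetime_test_tensor a0 bT sth th0 tpsi.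
have eqn := law tt.
have sd : smooth dth.
  by have := smooth_derive (1 : R) sth; congr smooth; apply/funext => t; exact: dE.
have dth0 t : ~~ (a <= t <= b) -> dth t = 0 by move=> h; rewrite -dE; exact: deriv_supp th0 t h.
have [Mt hMt] := cont_supp_bdd (smooth_continuous sth) th0.
have [Md hMd] := cont_supp_bdd (smooth_continuous sd) dth0.
have [_ P1] := pair_fld uu a0 bT (measurable_smooth sd) hMd dth0 mKx (fun y => (hMK (y - x)).1).
have P2 k := pair_fld (ff k) a0 bT (measurable_smooth sth) hMt th0 (mdKx (J k)) (fun y => (hMK (y - x)).2 (J k)).
have chid t : chi t * dth t = dth t.
  rewrite /chi; case: (boolP (_ && _)) => [_|h]; first by rewrite mul1r.
  rewrite dth0 ?mulr0//; apply: contra h => /andP[h1 h2].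
  by rewrite (lt_le_trans a0 h1) (le_lt_trans h2 bT).
rewrite -[RHS]eqn; congr (_ + _).
  transitivity (pairing T u (fun z => dth z.1 * K (z.2 - x))); last first.
    by congr pairing; apply/funext => z; rewrite (d_t_tensor z sth tpsi.1) dE.
  by rewrite P1; apply: eq_Rintegral => t _; rewrite mulrAC chid mulrC.
transitivity (\int[leb]_t (\sum_k s k * (chi t * cv (fun y => f' k (t, y)) (dK (J k)) x * th t))).
  by apply: eq_Rintegral => t _; rewrite mulr_sumr mulr_suml; apply: eq_bigr => k _; ring.
rewrite Isum; last by move=> k; apply: L1Z; exact: (P2 k).1.
apply: eq_bigr => k _; rewrite IZ; last exact: (P2 k).1.
congr (_ * _); rewrite -(P2 k).2; congr pairing; apply/funext => z.
by rewrite (d_x_tensor _ z sth tpsi.1) derive_subr moll_dE.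
Qed.

End Conservation.

Section WeakGrad.
Variables (j : 'I_d) (u u' f f' : TX -> R).
Hypotheses (T0 : 0 < T) (uu : fld u u') (ff : fld f f').
Hypothesis law : forall phi, spacetime_test T phi ->
  pairing T u (d_x j phi) = - pairing T f phi.

(** Separated test functions and [weak_zero] localise the identity in time. The exceptional null set
    of times depends on [psi]. *)
Lemma weak_grad_test (psi dpsi : 'rV[R]_d -> R) M : torus_test psi ->
  (forall x, 'D_(delta_mx 0 j) psi x = dpsi x) -> measurable_fun setT psi -> measurable_fun setT dpsi ->
  (forall x, `|psi x| <= M) -> (forall x, `|dpsi x| <= M) ->
  {ae leb, forall t, 0 < t < T ->
    \int[mu]_x (u' (t, x) * dpsi x) = - \int[mu]_x (f' (t, x) * psi x)}.
Proof.
move=> tpsi dE mpsi mdpsi psiM dpsiM.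
have L w w' (k : 'rV[R]_d -> R) (ww : fld w w') (mk : measurable_fun setT k) (kM : forall x : 'rV[R]_d, `|k x| <= M) :
    L1 leb (fun t => chi t * \int[mu]_x (w' (t, x) * k x)).
  have i1 : L1 (leb \x mu)%E (fun z => chi z.1 * w' z * k z.2).
    apply: (L1_mulb (M := M) (fld_int ww)) => [|z]; last exact: kM.
    exact: (measurableT_comp mk measurable_snd).
  have := L1_fubini1 i1; congr (L1 _ _); apply/funext => t /=; rewrite -IZ.
    by apply: eq_Rintegral => y _; rewrite mulrA.
  exact: L1_mulb (fld_slice ww t) mk kM.
have i1 := L _ _ _ uu mdpsi dpsiM; have i2 := L _ _ _ ff mpsi psiM.
have := weak_zero T0 (L1D i1 i2) _.
have H : forall th a b, 0 < a -> b < T -> smooth th -> (forall x, ~~ (a <= x <= b) -> th x = 0) ->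
  \int[leb]_x ((chi x * \int[mu]_x0 (u' (x, x0) * dpsi x0) + chi x * \int[mu]_x0 (f' (x, x0) * psi x0)) * th x) = 0.
  move=> th a b a0 bT sth th0.
  have [Mt hMt] := cont_supp_bdd (smooth_continuous sth) th0.
  have [J1 P1] := pair_fld uu a0 bT (measurable_smooth sth) hMt th0 mdpsi dpsiM.
  have [J2 P2] := pair_fld ff a0 bT (measurable_smooth sth) hMt th0 mpsi psiM.
  transitivity (\int[leb]_t (chi t * (\int[mu]_x (u' (t, x) * dpsi x)) * th t +
    chi t * (\int[mu]_x (f' (t, x) * psi x)) * th t)).
    by apply: eq_Rintegral => t _; rewrite mulrDl.
  rewrite (ID J1 J2) -P1 -P2.
  have := law (spacetime_test_tensor a0 bT sth th0 tpsi); rewrite /tensor.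
  move=> h; apply/eqP; rewrite addr_eq0; apply/eqP; rewrite -h.
  by congr pairing; apply/funext => z; rewrite (d_x_tensor _ z sth tpsi.1) dE.
move=> /(_ H); apply: (@filterS _ _ (ae_filter_ringOfSetsType leb)) => t h tT.
have := h tT; rewrite /chi.
by move: (tT) => /andP[-> ->] /=; rewrite !mul1r => /eqP; rewrite addr_eq0 => /eqP.
Qed.

End WeakGrad.

Lemma I_mul_cvg (f : 'rV[R]_d -> R) (k_ : nat -> 'rV[R]_d -> R) (k : 'rV[R]_d -> R) M : L1 mu f ->
  (forall m, measurable_fun setT (k_ m)) -> measurable_fun setT k -> (forall m x, `|k_ m x| <= M) ->
  (forall x, k_ m x @[m --> \oo] --> k x) ->
  \int[mu]_x (f x * k_ m x) @[m --> \oo] --> \int[mu]_x (f x * k x).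
Proof.
move=> fL mk_ mk kM kc; have mf := L1_meas fL.
have := @IDCT _ _ _ mu (fun m x => f x * k_ m x) (fun x => f x * k x) (fun x => M * `|f x|).
move=> H; apply: (H _ _ _ _ _).2.
- by move=> m; apply: measurable_funM.
- exact: measurable_funM.
- by apply: aeW => x; apply: cvgMl_tmp; exact: kc.
- exact: L1Z (L1_norm fL).
by move=> m; apply: aeW => x; rewrite normrM mulrC ler_wpM2r.
Qed.

Lemma cont_comp_subl (k : 'rV[R]_d -> R) (y : 'rV[R]_d) : continuous k -> continuous (fun z : 'rV[R]_d => k (y - z)).
Proof.
move=> ck z; have h := @cvgB R 'rV[R]_d 'rV[R]_d (nbhs z) _ (cst y) id y z (cvg_cst y) cvg_id.
exact: (cvg_comp _ _ (h _ _) (ck (y - z))).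
Qed.

Lemma cont_comp_subr (k : 'rV[R]_d -> R) (y : 'rV[R]_d) : continuous k -> continuous (fun z : 'rV[R]_d => k (z - y)).
Proof.
move=> ck z; have h := @cvgB R 'rV[R]_d 'rV[R]_d (nbhs z) _ id (cst y) z y cvg_id (cvg_cst y).
exact: (cvg_comp _ _ (h _ _) (ck (z - y))).
Qed.

Section WeakGradAll.
Variables (A : R) (K : nat -> 'rV[R]_d -> R) (dK : nat -> 'I_d -> 'rV[R]_d -> R).
Variables (u u' : 'I_d -> TX -> R) (f f' : 'I_d -> 'I_d -> TX -> R).
Hypotheses (T0 : 0 < T) (mo : forall n, moll A n (K n) (dK n))
  (uu : forall i, fld (u i) (u' i)) (ff : forall i j, fld (f i j) (f' i j)).
Hypothesis law : forall i j phi, spacetime_test T phi ->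
  pairing T (u i) (d_x j phi) = - pairing T (f i j) phi.

Lemma moll_contd n j : continuous (dK n j).
Proof.
have <- : 'D_(delta_mx 0 j) (K n) = dK n j by apply/funext => z; exact: moll_dE (mo n) j z.
exact: smooth_continuous (smooth_derive (delta_mx 0 j) (mo_test (mo n)).1).
Qed.

Lemma measurable_subl (x : 'rV[R]_d) (k : 'rV[R]_d -> R) : measurable_fun setT k ->
  measurable_fun setT (fun y : 'rV[R]_d => k (x - y)).
Proof.
move=> mk; apply: (measurableT_comp mk); apply: measurable_fun_mx => i j; under eq_fun do rewrite !mxE.
apply: measurable_funB; first exact: measurable_cst.
exact: measurable_mx_entry.
Qed.

(** One null set of times has to serve all centres [x]. Countably many null sets suffice for the
    rational centres, all scales and all indices, and continuity in the centre gives the other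
    ones. *)
Lemma weak_grad_all : {ae leb, forall t, 0 < t < T ->
  (forall n i j x, cv (fun y => u' i (t, y)) (dK n j) x = - cv (fun y => f' i j (t, y)) (K n) x) /\
  (forall n i j y, \int[mu]_x (u' i (t, x) * dK n j (y - x)) = \int[mu]_x (f' i j (t, x) * K n (y - x)))}.
Proof.
have H1 (w : (nat * 'I_d * 'I_d) * 'rV[rat]_d) : {ae leb, forall t, 0 < t < T ->
    let x := map_mx ratr w.2 : 'rV[R]_d in
    cv (fun y => u' w.1.1.2 (t, y)) (dK w.1.1.1 w.1.2) x = - cv (fun y => f' w.1.1.2 w.1.2 (t, y)) (K w.1.1.1) x}.
  case: w => -[[n i] j] q /=; have [M hM] := mo_bdd (mo n).
  apply: (weak_grad_test T0 (uu i) (ff i j) (law i j) (M := M)).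
  - exact: torus_test_sub (mo_test (mo n)).
  - by move=> x; rewrite derive_subr; exact: moll_dE (mo n) _ _.
  - exact: measurable_subr (mo_meas (mo n)).
  - exact: measurable_subr (mo_measd (mo n) j).
  - by move=> x; exact: (hM _).1.
  by move=> x; exact: (hM _).2.
(* The same for the reflected kernels [K (x - y)], whose derivative in [y] is [- dK (x - y)]. *)
have H2 (w : (nat * 'I_d * 'I_d) * 'rV[rat]_d) : {ae leb, forall t, 0 < t < T ->
    let x := map_mx ratr w.2 : 'rV[R]_d in
    \int[mu]_y (u' w.1.1.2 (t, y) * - dK w.1.1.1 w.1.2 (x - y)) = - \int[mu]_y (f' w.1.1.2 w.1.2 (t, y) * K w.1.1.1 (x - y))}.
  case: w => -[[n i] j] q /=; have [M hM] := mo_bdd (mo n).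
  apply: (weak_grad_test T0 (uu i) (ff i j) (law i j) (M := M)).
  - exact: torus_test_subl (mo_test (mo n)).
  - move=> x; rewrite derive_subl (@derive_val _ _ _ _ _ _ _ (mo_derive (mo n) _ _)) (bigD1 j)//= !mxE !eqxx mulN1r big1 ?addr0// => k kj.
    by rewrite !mxE (negbTE kj) andbF oppr0 mul0r.
  - exact: measurable_subl (mo_meas (mo n)).
  - by apply: measurable_funN; exact: measurable_subl (mo_measd (mo n) j).
  - by move=> x; exact: (hM _).1.
  by move=> x; rewrite normrN; exact: (hM _).2.
move: (ae_countable H1) (ae_countable H2); apply: (@filterS2 _ _ (ae_filter_ringOfSetsType leb)) => t h1 h2 tT.
(* Both sides depend continuously on the centre by dominated convergence, since the kernels are
   continuous and bounded by [M]. *)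
have ext i j (k dk : 'rV[R]_d -> 'rV[R]_d -> R) M x : (forall z, measurable_fun setT (k z)) ->
    (forall z, measurable_fun setT (dk z)) -> (forall z y, `|k z y| <= M) -> (forall z y, `|dk z y| <= M) ->
    (forall y, continuous (k^~ y)) -> (forall y, continuous (dk^~ y)) ->
    (forall q : 'rV[rat]_d, \int[mu]_y (u' i (t, y) * dk (map_mx ratr q) y) = - \int[mu]_y (f' i j (t, y) * k (map_mx ratr q) y)) ->
    \int[mu]_y (u' i (t, y) * dk x y) = - \int[mu]_y (f' i j (t, y) * k x y) => [mk mdk kM dkM ck cdk E|].
  have [q qx] := rat_dense x.
  have C1 := @I_mul_cvg _ (fun m => dk (map_mx ratr (q m))) (dk x) M (fld_slice (uu i) t) (fun m => mdk _) (mdk _)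
    (fun m => dkM _) (fun y => cvg_comp _ _ qx (cdk y x)).
  have C2 := @I_mul_cvg _ (fun m => k (map_mx ratr (q m))) (k x) M (fld_slice (ff i j) t) (fun m => mk _) (mk _)
    (fun m => kM _) (fun y => cvg_comp _ _ qx (ck y x)).
  have C3 : - (\int[mu]_y (f' i j (t, y) * k (map_mx ratr (q m)) y)) @[m --> \oo] -->
    - \int[mu]_y (f' i j (t, y) * k x y) by apply: cvgN C2.
  rewrite -(cvg_lim (@Rhausdorff R) C1) -(cvg_lim (@Rhausdorff R) C3); congr (lim (_ @ \oo)).
  by apply/funext => m; exact: E.
have cK n := smooth_continuous (mo_test (mo n)).1.
split => n i j x; have [M hM] := mo_bdd (mo n).
  rewrite /cv; refine (ext i j (fun z y => K n (y - z)) (fun z y => dK n j (y - z)) M x _ _ _ _ _ _ _) => [z|z|z y|z y|y|y|q].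
  - exact: measurable_subr (mo_meas (mo n)).
  - exact: measurable_subr (mo_measd (mo n) j).
  - exact: (hM _).1.
  - exact: (hM _).2.
  - exact: (cont_comp_subl (cK n)).
  - exact: (cont_comp_subl (@moll_contd n j)).
  exact: (h1 (n, i, j, q) tT).
have E : \int[mu]_y (u' i (t, y) * - dK n j (x - y)) = - \int[mu]_y (f' i j (t, y) * K n (x - y)).
  refine (ext i j (fun z y => K n (z - y)) (fun z y => - dK n j (z - y)) M x _ _ _ _ _ _ _) => [z|z|z y|z y|y|y|q].
  - exact: measurable_subl (mo_meas (mo n)).
  - by apply: measurable_funN; exact: measurable_subl (mo_measd (mo n) j).
  - exact: (hM _).1.
  - by rewrite normrN; exact: (hM _).2.
  - exact: (cont_comp_subr (cK n)).
  - have h : continuous (fun z : 'rV[R]_d => dK n j (z - y)) := cont_comp_subr (@moll_contd n j); by move=> z; have h' := h z; apply: cvg_comp h' _; exact: oppr_continuous.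
  exact: (h2 (n, i, j, q) tT).
apply: oppr_inj; rewrite -E -IN.
  by apply: eq_Rintegral => y _; rewrite mulrN.
exact: L1_mulb (fld_slice (uu i) t) (measurable_subl x (mo_measd (mo n) j)) (fun y => (hM (x - y)).2 j).
Qed.

End WeakGradAll.

End Fields.

(** * Null sets, time slices and the pressure potential *)

Section AlmostEverywhere.
Import HBNNSimple.
Context {dT : measure_display} {T : measurableType dT} {R : realType}.
Variable mu : {measure set T -> \bar R}.

(* No measurability is required: simple functions below one of the integrands
   are below the other one after removal of a null set. *)
Lemma ae_integral (f g : T -> \bar R) : {ae mu, forall x, f x = g x} ->
  (\int[mu]_x f x = \int[mu]_x g x)%E.
Proof.
move=> fg.
have H (u w : T -> \bar R) : (forall x, 0 <= u x)%E -> (forall x, 0 <= w x)%E ->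
    {ae mu, forall x, u x = w x} -> (\int[mu]_x u x <= \int[mu]_x w x)%E.
  move=> u0 w0 [N [mN N0 sN]]; rewrite (ge0_integralTE mu u0) (ge0_integralTE mu w0).
  apply: ge_ereal_sup => _ /= [h hu <-]; apply: ereal_sup_ubound => /=.
  exists (proj_nnsfun h (measurableC mN)) => [x|].
    rewrite /= mindicE; have [xN|xN] := boolP (x \in ~` N); last by rewrite mulr0.
    have -> : w x = u x by apply: contrapT => uw; move: xN; rewrite inE; apply; apply: sN => /= /esym.
    by rewrite mulr1.
  have E (k : {nnsfun T >-> R}) : sintegral mu k = (\int[mu]_x (k x)%:E)%E.
    by rewrite integral_nnsfun// patch_setT.
  rewrite !E; apply: ge0_ae_eq_integral => //.
  - by apply/measurable_EFinP.
  - by apply/measurable_EFinP.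
  - by move=> x _; rewrite lee_fin.
  - by move=> x _; rewrite lee_fin.
  exists N; split => // x /= h1; apply: contrapT => xN; apply: h1 => _.
  by rewrite mindicE mem_set// mulr1.
have E (u w : T -> \bar R) : (forall x, 0 <= u x)%E -> (forall x, 0 <= w x)%E ->
    {ae mu, forall x, u x = w x} -> (\int[mu]_x u x = \int[mu]_x w x)%E.
  move=> u0 w0 uw; apply/eqP; rewrite eq_le !H//.
  by apply: (@filterS _ _ (ae_filter_ringOfSetsType mu)) uw => x ->.
rewrite integralE [RHS]integralE; congr (_ - _)%E; apply: E.
- by move=> x; exact: funepos_ge0.
- by move=> x; exact: funepos_ge0.
- by apply: (@filterS _ _ (ae_filter_ringOfSetsType mu)) fg => x h; rewrite !funeposE h.
- by move=> x; exact: funeneg_ge0.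
- by move=> x; exact: funeneg_ge0.
by apply: (@filterS _ _ (ae_filter_ringOfSetsType mu)) fg => x h; rewrite !funenegE h.
Qed.

Lemma I_norm0_ae (f : T -> R) : L1 mu f -> \int[mu]_x `|f x| = 0 -> {ae mu, forall x, f x = 0}.
Proof.
move=> fL f0; have mf := L1_meas fL.
have h : (\int[mu]_x `|(EFin \o f) x| = 0)%E.
  by under eq_integral do rewrite /= -/(`|f _|%:E); rewrite -(EFinI (L1_norm fL)) f0.
have [] := @ae_eq_integral_abs _ _ _ mu setT measurableT (EFin \o f).
  exact/measurable_EFinP.
move=> /(_ h) H _; apply: (@filterS _ _ (ae_filter_ringOfSetsType mu)) H => x /(_ I) /= [].
by [].
Qed.

(** The lower bound makes the negative part integrable, so an extended integral below [+oo] forces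
    the positive part to be integrable too. This draws integrability from an inequality between
    extended reals. *)
Lemma L1_below (f : T -> R) (g : T -> R) : measurable_fun setT f -> L1 mu g ->
  {ae mu, forall x, g x <= f x} -> (\int[mu]_x (f x)%:E < +oo)%E -> L1 mu f.
Proof.
move=> mf gL gf fi.
have n1 : (\int[mu]_x ((EFin \o f)^\- x) < +oo)%E.
  apply: (@le_lt_trans _ _ (\int[mu]_x `|g x|%:E)%E); last by have /L1P[] := gL.
  apply: ae_ge0_le_integral => //.
  - by apply: measurable_funeneg; exact/measurable_EFinP.
  - by apply/measurable_EFinP; exact: L1_meas (L1_norm gL).
  apply: (@filterS _ _ (ae_filter_ringOfSetsType mu)) gf => x h _.
  rewrite funenegE /= -EFin_max lee_fin ge_max normr_ge0 andbT.
  by have := ler_norm (- g x); rewrite normrN; move: h; move: (f x) (g x) `|g x| => a b c; lra.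
have n2 : (\int[mu]_x ((EFin \o f)^\+ x) < +oo)%E.
  rewrite ltey; apply/eqP => h; move: fi; rewrite integralE h.
  suff : (+oo - \int[mu]_x (EFin \o f)^\- x < +oo)%E -> False by exact.
  by move: n1; case: (\int[mu]_x _)%E.
apply/integrableP; split; first exact/measurable_EFinP.
rewrite (eq_integral (fun x => (EFin \o f)^\+ x + (EFin \o f)^\- x)%E); last first.
  by move=> x _; have := congr1 (fun F => F x) (fune_abse (EFin \o f)).
rewrite ge0_integralD//.
- by rewrite lte_add_pinfty.
- by apply: measurable_funepos; exact/measurable_EFinP.
- by apply: measurable_funeneg; exact/measurable_EFinP.
Qed.

End AlmostEverywhere.

Lemma integral_mrestr {dT : measure_display} {T : measurableType dT} {R : realType}
    (mu : {measure set T -> \bar R}) (D : set T) (mD : measurable D) (f : T -> \bar R) :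
  (\int[mrestr mu mD]_x f x = \int[mu]_(x in D) f x)%E.
Proof.
transitivity (\int[mrestr mu mD]_x (f \_ D) x)%E.
  apply: ae_integral; exists (~` D); split; [exact: measurableC|by rewrite /= /mrestr setICl measure0|].
  by move=> x /= h xD; apply: h; rewrite patchE mem_set.
rewrite -integral_mkcond; apply: eq_measure_integral => A mA AD.
by rewrite /= /mrestr setIidl.
Qed.

Section AlmostEverywhereProduct.
Context {d1 d2 : measure_display} {T1 : measurableType d1} {T2 : measurableType d2}
  {R : realType}.
Variables (m1 : {sigma_finite_measure set T1 -> \bar R})
  (m2 : {sigma_finite_measure set T2 -> \bar R}).

Lemma ae_prod (P : T1 * T2 -> Prop) : {ae (m1 \x m2)%E, forall z, P z} ->
  {ae m1, forall x, {ae m2, forall y, P (x, y)}}.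
Proof.
move=> [N [mN N0 sN]].
have h : (\int[m1]_x `|m2 (xsection N x)| = 0)%E.
  by rewrite -N0; apply: eq_integral => x _; rewrite gee0_abs.
have [] := @ae_eq_integral_abs _ _ _ m1 setT measurableT (fun x => m2 (xsection N x)).
  exact: measurable_fun_xsection.
move=> /(_ h) H _; apply: (@filterS _ _ (ae_filter_ringOfSetsType m1)) H => x /(_ I) /= Nx.
exists (xsection N x); split => //; first exact: measurable_xsection.
by move=> y /= Py; rewrite /xsection /= inE; exact: sN.
Qed.

Lemma ae_prod1 (P : T1 -> Prop) : {ae m1, forall x, P x} ->
  {ae (m1 \x m2)%E, forall z : T1 * T2, P z.1}.
Proof.
move=> [N [mN N0 sN]]; exists (N `*` setT); split.
- exact: measurableX.
- by apply: etrans (product_measure1E _ _ mN measurableT) _; rewrite [X in (X * _)%E]N0 mul0e.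
by move=> z /= Pz; split => //; exact: sN.
Qed.

End AlmostEverywhereProduct.

(** * From almost every time to every time *)

Section TimeAE.
Context {R : realType}.
Local Notation leb := (@lebesgue_measure R).

Lemma ae_dense (P : R -> Prop) (a b : R) : a < b -> {ae leb, forall t, P t} ->
  exists2 t, a < t < b & P t.
Proof.
move=> ab [N [mN N0 sN]]; apply: contrapT => H.
have : (leb `]a, b[%classic <= leb N)%E.
  apply: (@le_measure _ _ _ leb); [by rewrite inE; exact: measurable_itv|by rewrite inE|].
  move=> t /=; rewrite in_itv/= => tab; apply: sN => /= Pt; apply: H; exists t => //.
by rewrite N0 lebesgue_measure_itv/= lte_fin ab -EFinB lee_fin subr_le0 leNgt ab.
Qed.

Lemma ae_le_cont (f : R -> R) (T c : R) : 0 < T -> continuous f ->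
  {ae leb, forall t, 0 < t < T -> c <= f t} -> forall t, 0 <= t <= T -> c <= f t.
Proof.
move=> T0 cf fc t /andP[t0 tT]; rewrite leNgt; apply/negP => ft.
have e0 : 0 < (c - f t) / 2 by rewrite divr_gt0 ?subr_gt0.
have [e e1 he] := near_cont (cf t) e0.
have ab : Num.max 0 (t - e) < Num.min T (t + e).
  by rewrite lt_min !gt_max T0 /= ltrBlDr; apply/and3P; split; lra.
have [s /andP[s1 s2] hs] := ae_dense ab fc.
move: s1 s2; rewrite gt_max lt_min => /andP[s0 s1] /andP[sT s2].
have ts : `|s - t| < e by rewrite ltr_norml; apply/andP; split; lra.
have := he _ ts; rewrite ler_norml => /andP[_ h].
have := hs; rewrite s0 sT => /(_ isT); lra.
Qed.

(** The retraction of the line onto [[0, T]]: composition with it extends what is known on [[0, T]]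
    to all times and preserves continuity. *)
Definition tclamp (T t : R) : R := Num.max 0 (Num.min t T).

Lemma tclamp_itv T t : 0 <= T -> 0 <= tclamp T t <= T.
Proof. by move=> T0; rewrite /tclamp le_max lexx/= ge_max T0 ge_min lexx orbT. Qed.

Lemma tclamp_id T t : 0 <= t <= T -> tclamp T t = t.
Proof. by move=> /andP[t0 tT]; rewrite /tclamp min_l// max_r. Qed.

Lemma clamp_continuous (a b : R) : continuous (fun t : R => Num.max a (Num.min t b)).
Proof.
move=> t; apply: (@continuous_max _ _ (cst a) (fun t => Num.min t b)); first exact: cst_continuous.
by apply: (@continuous_min _ _ id (cst b)); [exact: cvg_id|exact: cst_continuous].
Qed.

Lemma within_tclamp (T : R) (f : R -> R) : 0 <= T -> {within `[0, T], continuous f} ->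
  continuous (fun t => f (tclamp T t)).
Proof.
move=> T0 /subspace_continuousP cf t.
have h := cf (tclamp T t); rewrite /= in_itv/= tclamp_itv// in h; have {}h := h isT.
apply: cvg_comp h => A /=; rewrite /within/= => hA.
have := (@clamp_continuous 0 T t) _ hA; apply: (@filterS _ (nbhs t)) => s /=; apply.
by rewrite /= in_itv/= tclamp_itv.
Qed.

End TimeAE.

Lemma clamp_margin {R : realType} (c1 c2 r : R) : 0 < c1 -> c1 <= r <= c2 ->
  [/\ 0 < r, c1 / 2 < r & r < c2 + 1].
Proof. by move=> c0 /andP[h1 h2]; split; lra. Qed.

(** * The pressure and its potential *)

Section Pressure.
Context {R : realType}.
Local Notation leb := (@lebesgue_measure R).
Variables (pr : R -> R) (hpr : pressure_law pr) (c1 c2 : R) (c10 : 0 < c1).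

Lemma pressure_derive (r : R) : 0 < r -> is_derive r 1 pr (derive1 pr r).
Proof. by move=> r0; have [_ h _ _] := hpr r0; rewrite derive1E; exact: derivableP. Qed.

Lemma is_derive_continuous (f : R -> R) (r df : R) : is_derive r 1 f df -> {for r, continuous f}.
Proof. by move=> h; apply: differentiable_continuous; apply/derivable1_diffP. Qed.

Let f (z : R) : R := pr z / z ^+ 2.

Let fcont z : 0 < z -> {for z, continuous f}.
Proof.
move=> z0; apply: cvgM; first exact: is_derive_continuous (pressure_derive z0).
apply: (@cvgV _ _ (nbhs z) _ (fun x : R => x ^+ 2)); first by rewrite expf_neq0// gt_eqF.
exact: exprn_continuous.
Qed.

Let fint a b : 0 < a -> leb.-integrable `[a, b] (EFin \o f).
Proof.
move=> a0; apply: continuous_compact_integrable; first exact: segment_compact.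
apply: continuous_in_subspaceT => x; rewrite inE/= in_itv/= => /andP[ax _].
by apply: fcont; exact: lt_le_trans ax.
Qed.

Definition pressure_primitive (r : R) : R := if 1 <= r
  then \int[leb]_(z in `[1, r]) (pr z / z ^+ 2) else - \int[leb]_(z in `[r, 1]) (pr z / z ^+ 2).

Lemma pressure_primitive_derive (r : R) : 0 < r -> is_derive r 1 pressure_primitive (pr r / r ^+ 2).
Proof.
(* A base point in []0, 1[] below both [r] and 1: near [r] the two oriented cases are then the
   single expression [F x - F 1]. *)
move=> r0; set a := Num.min r 1 / 2.
have a0 : 0 < a by rewrite divr_gt0// lt_min r0 ltr01.
have ar : a < r by rewrite /a; case: (leP r 1) => h; lra.
have a1 : a < 1 by rewrite /a; case: (leP r 1) => h; lra.
pose F (x : R) := \int[leb]_(t in `[a, x]) f t.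
have rr : r < r + 1 by rewrite ltrDl.
have [dF FE] := continuous_FTC1_closed rr (@fint a (r + 1) a0) ar (fcont r0).
have dFr : is_derive r 1 F (f r).
  by split; [exact: dF|rewrite -derive1E].
have split_int x y : a < x -> x <= y -> F y - F x = \int[leb]_(t in `[x, y]) f t.
  move=> ax xy; rewrite /F Rintegral_itvB ?bnd_simp//; last exact: ltW.
    rewrite Rintegral_itv_obnd_cbnd//; apply: (integrableS _ _ _ (@fint x y (lt_trans a0 ax))); [exact: measurable_itv|exact: measurable_itv|].
    by apply: subset_itv; rewrite bnd_simp.
  exact: fint.
have h : is_derive r 1 (fun x => F x - F 1) (f r).
  have hc : is_derive r (1 : R) (cst (F 1)) 0 by exact: is_derive_cst.
  by have := is_deriveB dFr hc; rewrite subr0.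
apply: near_eq_is_derive h.
have : \forall x \near r, a < x by exact: lt_nbhsr.
apply: filterS => x ax; rewrite /pressure_primitive; case: ifPn => [h|]; first by rewrite split_int.
by rewrite -ltNge => /ltW h; rewrite -(split_int x 1)// opprB.
Qed.

(** The range is larger than [[c1, c2]] so that [clamp] is the identity in a neighbourhood of that
    interval and derivatives on it are not affected. *)
Definition clamp (r : R) : R := Num.max (c1 / 2) (Num.min r (c2 + 1)).

Lemma clamp_gt0 r : 0 < clamp r.
Proof. by rewrite /clamp lt_max divr_gt0. Qed.

Lemma clamp_id r : c1 / 2 <= r <= c2 + 1 -> clamp r = r.
Proof. by move=> /andP[h1 h2]; rewrite /clamp min_l// max_r. Qed.

Lemma clamp_id' r : c1 <= r <= c2 -> clamp r = r.
Proof. by move=> /(clamp_margin c10)[_ h1 h2]; rewrite clamp_id// !ltW. Qed.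

Lemma continuous_clamp (g : R -> R) : (forall r, 0 < r -> {for r, continuous g}) -> continuous (fun r => g (clamp r)).
Proof.
move=> cg r; apply: (@continuous_comp _ _ _ clamp g); first exact: clamp_continuous.
by apply: cg; exact: clamp_gt0.
Qed.

Lemma measurable_clamp (g : R -> R) : (forall r, 0 < r -> {for r, continuous g}) ->
  measurable_fun setT ((fun r => g (clamp r)) : measurableTypeR R -> R).
Proof. by move=> /continuous_clamp; exact: continuous_measurable_fun. Qed.

Lemma derive_clamp (g dg : R -> R) : (forall r : R, 0 < r -> is_derive r 1 g (dg r)) ->
  forall r : R, c1 <= r <= c2 -> is_derive r 1 (fun r => g (clamp r)) (dg r).
Proof.
move=> gd r /(clamp_margin c10)[r0 h1 h2].
apply: near_eq_is_derive (gd r r0).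
have l1 : \forall x \near r, c1 / 2 < x by exact: lt_nbhsr.
have l2 : \forall x \near r, x < c2 + 1 by exact: lt_nbhsl.
near=> x; rewrite clamp_id//; apply/andP; split; apply: ltW; near: x; assumption.
Unshelve. all: by end_near.
Qed.

Lemma continuous_itv_bdd (g : R -> R) (a b : R) : continuous g -> exists2 M, 0 <= M & forall x, a <= x <= b -> `|g x| <= M.
Proof.
move=> cg; have [ab|ba] := leP a b; last first.
  by exists 0 => // x /andP[h1 h2]; have := lt_le_trans ba (le_trans h1 h2); rewrite ltxx.
have cn : {within `[a, b], continuous (fun x => `|g x|)}.
  by apply: continuous_subspaceT => x; apply: cvg_norm; exact: cg.
by have [c _ h] := EVT_max ab cn; exists `|g c| => // x xab; apply: h; rewrite in_itv.
Qed.

(** The pressure law speaks of positive densities only. Composition with [clamp] yields functions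
    measurable on the whole line, unchanged on [[c1, c2]], and a single constant bounds them
    there. *)
Lemma pressure_data : exists p dp P1 P (B : R), [/\ 0 <= B,
  [/\ measurable_fun setT (p : measurableTypeR R -> R), measurable_fun setT (dp : measurableTypeR R -> R),
      measurable_fun setT (P1 : measurableTypeR R -> R) & measurable_fun setT (P : measurableTypeR R -> R)],
  [/\ forall r : R, c1 <= r <= c2 -> is_derive r 1 p (dp r),
      forall r : R, c1 <= r <= c2 -> is_derive r 1 P1 (dp r / r) &
      forall r : R, c1 <= r <= c2 -> is_derive r 1 P (P1 r) /\ {for r, continuous P1}],
  forall r, c1 <= r <= c2 -> [/\ `|p r| <= B, `|dp r| <= B, `|P1 r| <= B & `|P r| <= B] &
  forall r, c1 <= r <= c2 -> p r = pr r /\ P r = potential pr r].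
Proof.
(* [P] is the potential and [P1] its derivative; the two terms in [pr r / r ^+ 2] cancel in the
   derivative of [P1], which is the derivative of the pressure over [r]. *)
pose P1 r := pressure_primitive r + pr r / r; pose P r := r * pressure_primitive r.
have dprc r : 0 < r -> {for r, continuous (derive1 pr)} by move=> /hpr[].
have dP1 (r : R) : 0 < r -> is_derive r 1 P1 (derive1 pr r / r).
  move=> r0; have rn0 : r != 0 by rewrite gt_eqF.
  have h := is_derive_div rn0 (pressure_derive r0) (is_derive_id r (1 : R)).
  apply: is_derive_to; first exact: is_deriveD (pressure_primitive_derive r0) h.
  by field.
have dP (r : R) : 0 < r -> is_derive r 1 P (P1 r).
  move=> r0; have rn0 : r != 0 by rewrite gt_eqF.
  apply: is_derive_to; first exact: is_derive_mul (is_derive_id r (1 : R)) (pressure_primitive_derive r0).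
  by rewrite /P1; field.
have cp r : 0 < r -> {for r, continuous pr} by move=> /pressure_derive; exact: is_derive_continuous.
have cP1 r : 0 < r -> {for r, continuous P1} by move=> /dP1; exact: is_derive_continuous.
have cP r : 0 < r -> {for r, continuous P} by move=> /dP; exact: is_derive_continuous.
have [B1 B10 hB1] := continuous_itv_bdd c1 c2 (continuous_clamp cp).
have [B2 B20 hB2] := continuous_itv_bdd c1 c2 (continuous_clamp dprc).
have [B3 B30 hB3] := continuous_itv_bdd c1 c2 (continuous_clamp cP1).
have [B4 B40 hB4] := continuous_itv_bdd c1 c2 (continuous_clamp cP).
exists (fun r => pr (clamp r)), (fun r => derive1 pr (clamp r)), (fun r => P1 (clamp r)),
  (fun r => P (clamp r)), (B1 + B2 + B3 + B4); split.
- by rewrite !addr_ge0.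
- by split; exact: measurable_clamp.
- split => r h; rewrite (clamp_id' h).
  + exact: derive_clamp pressure_derive r h.
  + exact: derive_clamp dP1 r h.
  + by split; [exact: derive_clamp dP r h|exact: continuous_clamp].
- move=> r h; split; [have := hB1 r h|have := hB2 r h|have := hB3 r h|have := hB4 r h]; lra.
by move=> r h; rewrite (clamp_id' h).
Qed.

End Pressure.

Lemma poweR_comp {R : realType} (x : \bar R) (r s : R) : (0 <= x)%E -> 0 < r -> 0 < s ->
  ((x `^ r) `^ s = x `^ (r * s))%E.
Proof.
case: x => [x|_|//] r0 s0; first by move=> x0 /=; rewrite powRrM.
by rewrite !eqy_poweR// mulr_gt0.
Qed.

Lemma LpLq_spec {R : realType} {d : nat} (T a b : R) (u : R * 'rV[R]_d -> R) :
  0 < a -> 0 < b -> LpLq T a%:E b%:E u ->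
  exists N : R -> R, [/\ measurable_fun setT (N : measurableTypeR R -> R), forall t, 0 <= N t,
    L1 (@lebesgue_measure R) (fun t => N t `^ (a / b)) &
    {ae @lebesgue_measure R, forall t, 0 < t < T ->
      (\int[torus R d]_x (`|u (t, x)| `^ b)%:E)%E = (N t)%:E}].
Proof.
move=> a0 b0 [mu_ fin]; set leb := @lebesgue_measure R; set mu := torus R d.
have ab0 : 0 < a / b by rewrite divr_gt0.
have mC : measurable (cylinder T : set (measurableTypeR R * 'rV[R]_d)).
  by apply: measurableX => //; exact: measurable_itv.
pose w : measurableTypeR R * 'rV[R]_d -> R := u \_ (cylinder T).
have mw : measurable_fun setT w by exact: (measurable_restrictT _ mC).1 mu_.
have wE t x : w (t, x) = if 0 < t < T then u (t, x) else 0.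
  rewrite /w patchE; congr (if _ then _ else _); apply/idP/idP; rewrite inE/=.
    by move=> [/=]; rewrite in_itv.
  by move=> h; split => //=; rewrite in_itv.
pose I t := (\int[mu]_x (`|w (t, x)| `^ b)%:E)%E.
have I0' t : (0 <= I t)%E by apply: integral_ge0 => x _; rewrite lee_fin powR_ge0.
have mI : measurable_fun setT (I : measurableTypeR R -> \bar R).
  apply: (@measurable_fun_fubini_tonelli_F _ _ _ _ _ mu (fun z => (`|w z| `^ b)%:E)) => //.
    by apply/measurable_EFinP; apply: measurable_powRf; exact: measurableT_comp.
have IE t : 0 < t < T -> I t = (\int[mu]_x (`|u (t, x)| `^ b)%:E)%E.
  by move=> tT; apply: eq_integral => x _; rewrite wE tT.
have IN t : ~~ (0 < t < T) -> I t = 0%E.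
  move=> tT; rewrite /I (eq_integral (cst 0%E)) ?integral0// => x _.
  by rewrite wE (negbTE tT) normr0 powR0// gt_eqF.
have mIc : measurable_fun setT (fun t : measurableTypeR R => (I t `^ (a / b))%E).
  exact: (measurableT_comp (measurable_poweR _) mI).
have fin' : (\int[leb]_t (I t `^ (a / b)) < +oo)%E.
  move: fin; rewrite unlock /Lnorm => fin.
  have := lty_poweRy _ fin; rewrite invr_neq0 ?gt_eqF// => /(_ isT).
  rewrite integral_mrestr integral_mkcond; congr (_ < _)%E; apply: eq_integral => t _.
  rewrite patchE; case: ifPn => tT.
    have {}tT : 0 < t < T by move: tT; rewrite inE/= in_itv.
    rewrite (IE _ tT) gee0_abs ?poweR_ge0// poweR_comp ?invr_gt0//.
      by rewrite mulrC; congr (_ `^ _)%E; apply: eq_integral => x _.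
    by apply: integral_ge0 => x _; rewrite poweR_ge0.
  rewrite IN; first by rewrite /= powR0// gt_eqF.
  by apply: contra tT => tT; rewrite inE/= in_itv.
have Iint : leb.-integrable setT (fun t => (I t `^ (a / b))%E).
  apply/integrableP; split => //.
  by under eq_integral do rewrite gee0_abs ?poweR_ge0//.
have aeI := integrable_ae measurableT Iint.
exists (fun t => fine (I t)); split.
- exact: measurableT_comp.
- by move=> t; exact: fine_ge0.
- apply: L1_ge0 => [|t|]; [|exact: powR_ge0|].
    by apply: measurable_powRf; exact: measurableT_comp.
  apply: le_lt_trans fin'; apply: ge0_le_integral => //.
  + by move=> t _; rewrite lee_fin powR_ge0.
  + by apply/measurable_EFinP; apply: measurable_powRf; exact: measurableT_comp.
  + move=> t _; rewrite -fine_poweR; have := poweR_ge0 (I t) (a / b).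
    by case: (I t `^ _)%E => // r _ /=; rewrite leey.
apply: (@filterS _ _ (ae_filter_ringOfSetsType leb)) aeI => t /(_ Logic.I) h tT.
rewrite -IE// fineK// ge0_fin_numE//; apply: (@lty_poweRy _ _ (a / b)); first by rewrite gt_eqF.
by rewrite -ge0_fin_numE// poweR_ge0.
Qed.

(** * Consequences of weak continuity in time *)

Section WeakTime.
Context {R : realType} {d : nat}.
Local Notation mu := (torus R d).
Local Notation leb := (@lebesgue_measure R).
Variables (A : R) (K : nat -> 'rV[R]_d -> R) (dK : nat -> 'I_d -> 'rV[R]_d -> R).
Hypotheses (mo : forall n, moll A n (K n) (dK n)).
Variables (T : R) (u : R * 'rV[R]_d -> R).
Hypotheses (T0 : 0 < T) (wu : weakly_continuous T u)
  (pu : forall t, 0 <= t <= T -> torus_function (fun x => u (t, x))).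

Let mollI n x : \int[mu]_y K n (y - x) = 1.
Proof. by rewrite (I_shift (- x) (mo_test (mo n)).2 (mo_meas (mo n))) (mo_int (mo n)). Qed.

Lemma cv_time_continuous n x : continuous (fun t => cv (fun y => u (tclamp T t, y)) (K n) x).
Proof. exact: within_tclamp (ltW T0) (wu.2 _ (torus_test_sub x (mo_test (mo n)))). Qed.

Lemma cv_zero_ae (f : 'rV[R]_d -> R) (g : nat -> 'rV[R]_d -> R) (w : 'rV[R]_d -> R) : torus_function f -> L1 mu f ->
  L1 mu w -> (forall n x, `|w x| <= `|cv f (K n) x - f x|) -> {ae mu, forall x, w x = 0}.
Proof.
move=> pf fL wL wf; apply: I_norm0_ae => //.
have h := cv_cvg mo fL pf.
have le n : \int[mu]_x `|w x| <= \int[mu]_x `|cv f (K n) x - f x|.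
  have [M hM] := mo_bdd (mo n).
  apply: Ile => //; first exact: L1_norm.
  apply: L1_norm; apply: L1B => //; apply: (@L1_bdd _ _ _ mu (M * \int[mu]_y `|f y|)).
    exact: measurable_cv (L1_meas fL) (mo_meas (mo n)).
  by move=> x; apply: bounded_cv => // [|y]; [exact: mo_meas (mo n)|exact: (hM y).1].
apply/eqP; rewrite eq_le I_ge0// andbT.
have c : cst (\int[mu]_x `|w x|) n @[n --> \oo] --> \int[mu]_x `|w x| by exact: cvg_cst.
rewrite -(cvg_lim (@Rhausdorff R) c) -[X in _ <= X](cvg_lim (@Rhausdorff R) h).
apply: ler_lim; [exact: cvgP c|exact: cvgP h|].
by apply: nearW => n; exact: le.
Qed.

(** Mollification preserves the bound at almost every time, continuity in time carries it to every
    time at each scale, and letting the scale tend to 0 returns it to the slice. The factor [s]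
    allows upper bounds to be treated as lower ones. *)
Lemma slice_lower_bound (s c : R) : {ae leb, forall t, 0 < t < T -> {ae mu, forall x, c <= s * u (t, x)}} ->
  forall t, 0 <= t <= T -> {ae mu, forall x, c <= s * u (t, x)}.
Proof.
move=> H t tT.
have B n x : c <= s * cv (fun y => u (t, y)) (K n) x.
  have := @ae_le_cont R (fun t => s * cv (fun y => u (tclamp T t, y)) (K n) x) T c T0 _ _ t tT.
  rewrite tclamp_id//; apply.
    by move=> r; apply: cvgMl_tmp; exact: cv_time_continuous.
  apply: (@filterS _ _ (ae_filter_ringOfSetsType leb)) H => r hr r0T.
  have r0T' : 0 <= r <= T by have /andP[h1 h2] := r0T; rewrite !ltW.
  rewrite tclamp_id//; have uL : L1 mu (fun x => u (r, x)) := wu.1 _ r0T'.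
  have [M hM] := mo_bdd (mo n).
  have mk := measurable_subr x (mo_meas (mo n)).
  have kL : L1 mu (fun y => K n (y - x)).
    by apply: (@L1_bdd _ _ _ mu M) => // y; exact: (hM _).1.
  rewrite /cv -IZ; last exact: L1_cv uL (mo_meas (mo n)) (fun y => (hM y).1).
  rewrite -[leLHS]mulr1 -(mollI n x) -IZ//.
  have mU := L1_meas (L1Z s uL).
  (* The bound on the slice holds almost everywhere; replacing the integrand by its maximum with [c]
     makes it hold everywhere without changing the integral. *)
  have mm : measurable_fun setT (fun y => Num.max c (s * u (r, y))) by exact: measurable_maxr.
  have mL : L1 mu (fun y => Num.max c (s * u (r, y))).
    apply: (L1_dom (g := fun y => `|c| + `|s * u (r, y)|)) => // [|y].
      by apply: L1D; [exact: L1_cst|exact: L1_norm (L1Z s uL)].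
    by case: (leP c (s * u (r, y))) => _; rewrite ?lerDl ?lerDr.
  rewrite [leRHS](_ : _ = \int[mu]_y (Num.max c (s * u (r, y)) * K n (y - x))); last first.
    apply: Iae.
    - exact: L1_meas (L1Z s (L1_cv x uL (mo_meas (mo n)) (fun y => (hM y).1))).
    - exact: measurable_funM.
    by apply: (@filterS _ _ (ae_filter_ringOfSetsType mu)) (hr r0T) => y h; rewrite max_r// mulrA.
  apply: Ile => [||y]; first exact: L1Z.
    exact: L1_mulb mL mk (fun y => (hM (y - x)).1).
  by rewrite ler_wpM2r ?(mo_ge0 (mo n))// le_max lexx.
have uL : L1 mu (fun x => u (t, x)) := wu.1 _ tT.
(* The violation of the bound. All mollifications are at least [c], so it is at most the
   mollification error at each scale, and therefore vanishes. *)
have wL : L1 mu (fun x => Num.max 0 (c - s * u (t, x))).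
  apply: (L1_dom (g := fun y => `|c| + `|s * u (t, y)|)) => [||y].
  - apply: measurable_maxr => //; apply: measurable_funB => //; exact: L1_meas (L1Z s uL).
  - by apply: L1D; [exact: L1_cst|exact: L1_norm (L1Z s uL)].
  have h := ler_normB c (s * u (t, y)).
  by case: (leP 0 (c - s * u (t, y))) => _ //; rewrite normr0 addr_ge0.
have sL : L1 mu (fun x => s * u (t, x)) by exact: L1Z.
have psf : torus_function (fun x => s * u (t, x)) by move=> x k; rewrite (pu tT).
have cvs n x : cv (fun y => s * u (t, y)) (K n) x = s * cv (fun y => u (t, y)) (K n) x.
  have [M hM] := mo_bdd (mo n).
  rewrite /cv -IZ; last exact: L1_cv uL (mo_meas (mo n)) (fun y => (hM y).1).
  by apply: eq_Rintegral => y _; rewrite mulrA.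
have := cv_zero_ae (fun _ _ => 0) psf sL wL.
move=> Z; apply: (@filterS _ _ (ae_filter_ringOfSetsType mu)) (Z _) => [x h|n x].
  by rewrite leNgt; apply/negP => lt; move: h; rewrite max_r ?subr_ge0 ?ltW// => /eqP; rewrite subr_eq0 => /eqP h; rewrite -h ltxx in lt.
rewrite cvs; have := B n x; set a := s * cv _ _ _; set b := s * u (t, x) => ca.
case: (leP 0 (c - b)) => h; last by rewrite normr0.
rewrite ger0_norm// (le_trans _ (ler_norm _))//; lra.
Qed.

(** Weak continuity and the initial condition describe the limit of the same integrals, so the slice
    at time 0 and [u0] have equal mollifications at every scale. *)
Lemma weak_init (u0 : 'rV[R]_d -> R) : torus_function u0 -> L1 mu u0 ->
  (forall phi, torus_test phi -> \int[mu]_x (u (t, x) * phi x) @[t --> 0^'+] --> \int[mu]_x (u0 x * phi x)) ->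
  {ae mu, forall x, u (0, x) = u0 x}.
Proof.
move=> pu0 u0L lim0.
have t0T : 0 <= (0 : R) <= T by rewrite lexx ltW.
have uL : L1 mu (fun x => u (0, x)) := wu.1 _ t0T.
have fL := L1B uL u0L.
have pf : torus_function (fun x => u (0, x) - u0 x) by move=> x k; rewrite (pu t0T) pu0.
have Z := cv_zero_ae (fun _ _ => 0) pf fL fL.
apply: (@filterS _ _ (ae_filter_ringOfSetsType mu)) (Z _) => [x /eqP|n x].
  by rewrite subr_eq0 => /eqP.
have [M hM] := mo_bdd (mo n).
rewrite (_ : cv _ _ _ = 0) ?sub0r ?normrN//.
have tt := torus_test_sub x (mo_test (mo n)).
have /(continuous_within_itvP _ T0)[_ c0 _] := wu.2 _ tt.
have E := cvg_unique (@Rhausdorff R) c0 (lim0 _ tt).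
have L f (fL' : L1 mu f) := L1_cv x fL' (mo_meas (mo n)) (fun y => (hM y).1).
rewrite /cv (eq_Rintegral _ (g := fun y => u (0, y) * K n (y - x) - u0 y * K n (y - x))); last by move=> y _; rewrite mulrBl.
by rewrite (IB (L _ uL) (L _ u0L)) E subrr.
Qed.

End WeakTime.

(** * From the weak solution to everywhere defined representatives *)

Section MatrixNorm.
Context {R : realType}.

Lemma enorm_sqr m n (M : 'M[R]_(m, n)) : enorm M ^+ 2 = \sum_i \sum_j M i j ^+ 2.
Proof. by rewrite sqr_sqrtr// sumr_ge0// => i _; rewrite sumr_ge0// => j _; exact: sqr_ge0. Qed.

Lemma enorm_ge0 m n (M : 'M[R]_(m, n)) : 0 <= enorm M.
Proof. exact: sqrtr_ge0. Qed.

Lemma enorm_entry m n (M : 'M[R]_(m, n)) i j : `|M i j| <= enorm M.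
Proof.
rewrite -[leLHS](ger0_norm (normr_ge0 _)) -ler_sqr ?nnegrE ?enorm_ge0 ?normr_ge0//.
rewrite enorm_sqr normr_id real_normK ?num_real// (bigD1 i)//= (bigD1 j)//= -addrA lerDl.
rewrite addr_ge0// sumr_ge0// => k _; first exact: sqr_ge0.
by rewrite sumr_ge0// => l _; exact: sqr_ge0.
Qed.

Lemma sum_entry m n (M : 'M[R]_(m, n)) i j : `|M i j| <= \sum_i \sum_j `|M i j|.
Proof.
by rewrite (bigD1 i)//= (bigD1 j)//= -addrA lerDl addr_ge0// sumr_ge0// => k _; rewrite sumr_ge0.
Qed.

Lemma sum_le_enorm m n (M : 'M[R]_(m, n)) : \sum_i \sum_j `|M i j| <= (m * n)%:R * enorm M.
Proof.
apply: (@le_trans _ _ (\sum_(i < m) \sum_(j < n) enorm M)).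
  by apply: ler_sum => i _; apply: ler_sum => j _; exact: enorm_entry.
by rewrite !sumr_const !card_ord -mulrnA mulr_natl mulnC.
Qed.

Lemma measurable_enorm d (X : measurableType d) m n (M : X -> 'M[R]_(m, n)) :
  (forall i j, measurable_fun setT (fun x => M x i j)) -> measurable_fun setT (fun x => enorm (M x)).
Proof.
move=> mM; apply: (@measurableT_comp _ _ _ _ _ _ (@Num.sqrt R)).
  by apply: continuous_measurable_fun; exact: sqrt_continuous.
by apply: measurable_sum => i; apply: measurable_sum => j; exact: measurable_funX.
Qed.

Lemma sym_grad_entry n (M : 'M[R]_n) i j : `|sym_grad M i j| <= \sum_i \sum_j `|M i j|.
Proof.
rewrite /sym_grad !mxE normrM ger0_norm ?invr_ge0//.
have := sum_entry M i j; have := sum_entry M j i; have := ler_normD (M i j) (M j i).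
set s := \sum_i _; set a := `|_ + _|; set b := `|M i j|; set c := `|M j i|; move=> *; lra.
Qed.

Lemma mxtrace_le n (M : 'M[R]_n) : `|\tr M| <= \sum_i \sum_j `|M i j|.
Proof.
rewrite /mxtrace (le_trans (ler_norm_sum _ _ _))//; apply: ler_sum => i _.
by rewrite (bigD1 i)//= lerDl sumr_ge0.
Qed.

(** A symmetric matrix contracts with [M] as with its transpose, hence as with the symmetric part of
    [M]; the multiple of the identity picks out the trace. *)
Lemma stress_contract n (M : 'M[R]_n) (a b : R) :
  \sum_i \sum_j (a * sym_grad M i j + (i == j)%:R * (b * \tr M)) * M i j =
  a * enorm (sym_grad M) ^+ 2 + b * (\tr M) ^+ 2.
Proof.
rewrite enorm_sqr.
transitivity (a * (\sum_i \sum_j sym_grad M i j * M i j) + b * \tr M * \tr M).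
  have -> : b * \tr M * \tr M = \sum_i b * \tr M * M i i by rewrite -mulr_sumr.
  rewrite [a * _]mulr_sumr -big_split/=; apply: eq_bigr => i _.
  rewrite [a * _]mulr_sumr -[X in _ + X](_ : \sum_j (i == j)%:R * (b * \tr M * M i j) = _).
    by rewrite -big_split/=; apply: eq_bigr => j _; ring.
  rewrite (bigD1 i)//= eqxx mul1r big1 ?addr0// => j ji.
  by rewrite eq_sym (negbTE ji) mul0r.
rewrite -mulrA -expr2; congr (a * _ + _).
have E : \sum_i \sum_j sym_grad M i j * M i j = \sum_i \sum_j sym_grad M i j * M j i.
  by rewrite exchange_big; apply: eq_bigr => i _; apply: eq_bigr => j _; rewrite /sym_grad !mxE addrC.
have : \sum_i \sum_j sym_grad M i j ^+ 2 =
    2^-1 * (\sum_i \sum_j sym_grad M i j * M i j + \sum_i \sum_j sym_grad M i j * M j i).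
  rewrite -big_split/= mulr_sumr; apply: eq_bigr => i _; rewrite -big_split/= mulr_sumr.
  apply: eq_bigr => j _; have -> : sym_grad M i j = 2^-1 * (M i j + M j i) by rewrite /sym_grad !mxE.
  by ring.
by rewrite -E => ->; field.
Qed.

End MatrixNorm.

Lemma ae_prob_ex {dd} {X : measurableType dd} {R : realType} (P : probability X R) (Q : X -> Prop) :
  {ae P, forall x, Q x} -> exists x, Q x.
Proof.
move=> [N [mN N0 sN]]; apply: contrapT => H.
have NT : N = setT by apply/seteqP; split => // x _; apply: sN => /= Qx; apply: H; exists x.
by move: N0; rewrite NT probability_setT => -[] /eqP; rewrite oner_eq0.
Qed.

Lemma big_flux {R : realType} {d : nat} (F : 'I_d + 'I_d + bool -> R) :
  \sum_k F k = \sum_j F (inl (inl j)) + \sum_j F (inl (inr j)) + (F (inr true) + F (inr false)).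
Proof. by rewrite big_sumType big_sumType big_bool. Qed.

Lemma addr_flux {R : realType} (x a b c e : R) : x + (a - c + (b - e)) = x + a + b - c - e.
Proof. by ring. Qed.

Lemma half_sum_le {R : realType} (s a b : R) : - b <= a -> s <= 2 * (2^-1 * s + a + b).
Proof. by move=> h; lra. Qed.

Lemma add_le_double {R : realType} (a b w : R) : a <= w -> b <= w -> a + b <= 2 * (1 + w).
Proof. by move=> *; lra. Qed.

Lemma abs_le_sqr {R : realType} (a : R) : `|a| <= 1 + a ^+ 2.
Proof. by rewrite -(real_normK (num_real a)); have := sqr_ge0 (`|a| - 1); have := normr_ge0 a; nra. Qed.

Lemma abs_mul_le {R : realType} (a b : R) : `|a * b| <= a ^+ 2 + b ^+ 2.
Proof.
rewrite normrM -(real_normK (num_real a)) -(real_normK (num_real b)).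
have := sqr_ge0 (`|a| - `|b|); have := normr_ge0 a; have := normr_ge0 b.
move: `|a| `|b| => x y; nra.
Qed.

Lemma L1_chi {R : realType} (T : R) : 0 < T -> L1 (@lebesgue_measure R) (chi T).
Proof.
move=> T0; have -> : chi T = \1_(`]0, T[%classic).
  by apply/funext => t; rewrite /chi indicE; congr ((nat_of_bool _)%:R); apply/idP/idP; rewrite inE/= in_itv.
apply/L1P; split; first exact: measurable_indic.
under eq_integral do rewrite ger0_norm//.
by rewrite integral_indic//= setIT lebesgue_measure_itv/= lte_fin T0 ltry.
Qed.

Lemma chi_bd {R : realType} (T t : R) : 0 <= chi T t <= 1.
Proof. by rewrite /chi; case: ((0 < t) && (t < T)); rewrite ?lexx ?ler01. Qed.

Section SliceBounds.
Context {R : realType} {d : nat}.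
Local Notation TX := (measurableTypeR R * 'rV[R]_d)%type.
Variables (u' w : TX -> R) (C : R) (b : R -> R).
Hypotheses (mu' : measurable_fun setT u') (C0 : 0 <= C) (uw : forall z, `|u' z| <= C * (1 + w z))
  (wL : forall t, L1 (torus R d) (fun x => w (t, x))) (wb : forall t, \int[torus R d]_x w (t, x) <= b t).

Lemma slice_bound t : L1 (torus R d) (fun x => u' (t, x)) /\ \int[torus R d]_x `|u' (t, x)| <= C * (1 + b t).
Proof.
have L1w : L1 (torus R d) (fun x => C * (1 + w (t, x))) by apply: L1Z; apply: L1D => //; exact: L1_cst.
have sL : L1 (torus R d) (fun x => u' (t, x)) by apply: (L1_dom _ L1w) => //; exact: measurable_slice.
split => //; apply: le_trans (Ile (L1_norm sL) L1w (fun x => uw (t, x))) _.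
rewrite IZ; last by apply: L1D => //; exact: L1_cst.
by rewrite ID//; [rewrite I_cst ler_wpM2l// lerD2l|exact: L1_cst].
Qed.

Lemma mk_fld (T : R) (u : TX -> R) : 0 < T -> L1loc T u ->
  {ae spacetime R d, forall z, cylinder T z -> u z = u' z} ->
  L1 (@lebesgue_measure R) (fun t => chi T t * b t) -> fld T u u'.
Proof.
move=> T0 ul uu bL; split => //; first by move=> t; exact: (slice_bound t).1.
have mc : measurable_fun setT (chi T : measurableTypeR R -> R) := L1_meas (L1_chi T0).
apply: (@L1_prod_bound _ _ _ _ R (@lebesgue_measure R) (torus R d) _ (fun t => C * (chi T t + chi T t * b t))) => [||t|t].
- by apply: measurable_funM => //; exact: (measurableT_comp mc measurable_fst).
- by apply: L1Z; apply: L1D => //; exact: L1_chi.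
- by have h := L1Z (chi T t) (slice_bound t).1; exact: h.
have /andP[c0 _] := chi_bd T t.
under eq_Rintegral do rewrite /= normrM (ger0_norm c0).
rewrite (IZ _ (L1_norm (slice_bound t).1)) -{2}[chi T t]mulr1 -mulrDr mulrCA ler_wpM2l//.
exact: (slice_bound t).2.
Qed.

End SliceBounds.

(** Young's inequality with exponents [p / (p - 1)] and [p]. The resulting powers of [V] and [N] are
    exactly those that [LpLq_spec] provides for the mixed norms of the velocity and of its
    gradient. *)
Lemma young_exponents {R : realType} (p q C V N : R) : 1 < p -> 1 < q -> 0 <= C -> 0 <= V -> 0 <= N ->
  V `^ (q / (q - 1))^-1 * (C `^ q * N) `^ q^-1 <=
  C * (V `^ ((2 * p / (p - 1)) / (2 * q / (q - 1))) + N `^ (p / q)).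
Proof.
move=> p1 q1 C0 V0 N0.
have q0 : 0 < q by lra. have p0 : 0 < p by lra.
have pm : 0 < p - 1 by lra. have qm : 0 < q - 1 by lra.
have qn : q != 0 by rewrite gt_eqF. have pn : p != 0 by rewrite gt_eqF.
have pmn : p - 1 != 0 by rewrite gt_eqF. have qmn : q - 1 != 0 by rewrite gt_eqF.
rewrite powRM ?powR_ge0// -[X in _ * (X * _)]powRrM mulfV// powRr1// mulrCA ler_wpM2l//.
set x := V `^ _; set y := N `^ _.
have x0 : 0 <= x by exact: powR_ge0. have y0 : 0 <= y by exact: powR_ge0.
have pp0 : 0 < p / (p - 1) by rewrite divr_gt0.
have pc : (p / (p - 1))^-1 + p^-1 = 1 by field; rewrite pn pmn.
apply: le_trans (conjugate_powR x0 y0 pp0 p0 pc) _.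
have -> : V `^ ((2 * p / (p - 1)) / (2 * q / (q - 1))) = x `^ (p / (p - 1)).
  by rewrite /x -powRrM; congr (_ `^ _); field; rewrite pmn qmn qn.
have -> : N `^ (p / q) = y `^ p by rewrite /y -powRrM mulrC.
apply: lerD; rewrite ler_pdivrMr// ler_peMr ?powR_ge0//; last exact: ltW.
by rewrite ler_pdivlMr// mul1r; lra.
Qed.

(** * Versions of the solution with bounds at every point *)

Section Assembly.
Context {R : realType} {d : nat}.
Local Notation mu := (torus R d).
Local Notation leb := (@lebesgue_measure R).
Local Notation TX := (measurableTypeR R * 'rV[R]_d)%type.
Variables (A : R) (K : nat -> 'rV[R]_d -> R) (dK : nat -> 'I_d -> 'rV[R]_d -> R).
Hypotheses (A0 : 0 < A) (mo : forall n, moll A n (K n) (dK n)).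
Variables (T : R) (pr nu eta : R -> R) (rho : R * 'rV[R]_d -> R) (v : R * 'rV[R]_d -> 'rV[R]_d)
  (G : R * 'rV[R]_d -> 'M[R]_d) (rho0 : 'rV[R]_d -> R) (v0 : 'rV[R]_d -> 'rV[R]_d).
Hypotheses (T0 : 0 < T) (hnu : viscosity_law nu) (heta : viscosity_law eta)
  (sol : weak_solution T pr nu eta rho v G rho0 v0).
Variables (c1 c2 : R).
Hypotheses (c10 : 0 < c1)
  (hrho : {ae spacetime R d, forall z, cylinder T z -> c1 <= rho z <= c2}).
Hypothesis hv0 : in_Lp (2 + 1)%:E (fun x => Num.sqrt (rho0 x) * enorm (v0 x)).

Let T0' : 0 <= T := ltW T0.

Lemma ae_slices (P : R * 'rV[R]_d -> Prop) : {ae spacetime R d, forall z, cylinder T z -> P z} ->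
  {ae leb, forall t, 0 < t < T -> {ae mu, forall x, P (t, x)}}.
Proof.
move=> /(@ae_prod _ _ _ _ R leb mu); apply: (@filterS _ _ (ae_filter_ringOfSetsType leb)) => t h tT.
apply: (@filterS _ _ (ae_filter_ringOfSetsType mu)) h => x; apply; split => //=.
Qed.

Lemma density_bounds : c1 <= c2.
Proof.
have [t tT h] := ae_dense T0 (ae_slices hrho).
by have [x /andP[]] := ae_prob_ex (h tT); exact: le_trans.
Qed.
Let c12 := density_bounds.

Lemma slice_density_bounds t : 0 <= t <= T -> {ae mu, forall x, c1 <= rho (t, x) <= c2}.
Proof.
move=> tT; have pu s (sT : 0 <= s <= T) := (ws_torus sol sT).1.
have H := ae_slices hrho.
have h1 := @slice_lower_bound R d A K dK mo T rho T0 (ws_rho_continuous sol) pu 1 c1.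
have h2 := @slice_lower_bound R d A K dK mo T rho T0 (ws_rho_continuous sol) pu (-1) (- c2).
have {}h1 : {ae mu, forall x, c1 <= 1 * rho (t, x)}.
  apply: h1 => //; apply: (@filterS _ _ (ae_filter_ringOfSetsType leb)) H => s hs sT.
  by apply: (@filterS _ _ (ae_filter_ringOfSetsType mu)) (hs sT) => x /andP[]; rewrite mul1r.
have {}h2 : {ae mu, forall x, - c2 <= -1 * rho (t, x)}.
  apply: h2 => //; apply: (@filterS _ _ (ae_filter_ringOfSetsType leb)) H => s hs sT.
  by apply: (@filterS _ _ (ae_filter_ringOfSetsType mu)) (hs sT) => x /andP[]; rewrite mulN1r lerN2.
move: h1 h2; apply: (@filterS2 _ _ (ae_filter_ringOfSetsType mu)) => x.
by rewrite mul1r mulN1r lerN2 => -> ->.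
Qed.

(** Time is frozen outside [[0, T]] and the values are truncated. By [slice_density_bounds] the
    truncation changes each slice in [[0, T]] on a null set only, so energies and mollifications at
    every time are unaffected. *)
Definition rho_ (z : TX) : R := Num.max c1 (Num.min (rho (tclamp T z.1, z.2)) c2).
Definition v_ (i : 'I_d) (z : TX) : R := v (tclamp T z.1, z.2) 0 i.

Lemma rho_B z : c1 <= rho_ z <= c2.
Proof. by rewrite /rho_ le_max lexx/= ge_max c12 ge_min lexx orbT. Qed.

Let mclamp : measurable_fun setT (fun z : TX => (tclamp T z.1, z.2) : TX).
Proof.
apply/measurable_fun_pairP; split => /=; last exact: measurable_snd.
apply: (measurableT_comp (f := (tclamp T : measurableTypeR R -> measurableTypeR R)) _ measurable_fst).
by apply: continuous_measurable_fun; exact: clamp_continuous.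
Qed.

Let mD : measurable (`[0, T] `*` setT : set TX).
Proof. by apply: measurableX => //; exact: measurable_itv. Qed.

Let clampD : (fun z : TX => (tclamp T z.1, z.2) : TX) @` setT `<=` `[0, T] `*` setT.
Proof. by move=> _ [z _ <-]; split => //=; rewrite in_itv/= tclamp_itv. Qed.

Lemma measurable_rho_ : measurable_fun setT rho_.
Proof.
apply: measurable_maxr => //; apply: measurable_minr => //.
exact: (measurable_comp mD clampD (ws_rho_measurable sol) mclamp).
Qed.

Lemma measurable_v_ i : measurable_fun setT (v_ i).
Proof.
apply: (measurableT_comp (@measurable_mx_entry R 1 d 0 i)).
exact: (measurable_comp mD clampD (ws_v_measurable sol) mclamp).
Qed.

Lemma rho_p t : torus_function (fun x => rho_ (t, x)).
Proof. by move=> x k; rewrite /rho_ /= ((ws_torus sol (tclamp_itv t T0')).1 x k). Qed.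

Lemma v_p i t : torus_function (fun x => v_ i (t, x)).
Proof. by move=> x k; rewrite /v_ /= ((ws_torus sol (tclamp_itv t T0')).2 x k). Qed.

Lemma rho_E t : 0 <= t <= T -> {ae mu, forall x, rho (t, x) = rho_ (t, x)}.
Proof.
move=> tT; apply: (@filterS _ _ (ae_filter_ringOfSetsType mu)) (slice_density_bounds tT) => x /andP[h1 h2].
by rewrite /rho_/= tclamp_id// min_l// max_r.
Qed.

Lemma v_E t x i : 0 <= t <= T -> v (t, x) 0 i = v_ i (t, x).
Proof. by move=> tT; rewrite /v_/= tclamp_id. Qed.

Lemma enorm_row (w : 'rV[R]_d) : enorm w ^+ 2 = \sum_i w 0 i ^+ 2.
Proof. by rewrite enorm_sqr big_ord1. Qed.

Definition nu_ (r : R) := nu (clamp c1 c2 r).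
Definition eta_ (r : R) := eta (clamp c1 c2 r).

(** A switch that removes the gradient outside []0, T[] and at the null set of times with infinite
    L^2 norm, so that the bounds on slices hold for all [t]. *)
Let gc (t : R) : R := chi T t * ((\int[mu]_x (enorm (chi T t *: G (t, x)) ^+ 2)%:E < +oo)%E)%:R.
Definition G_ (z : TX) : 'M[R]_d := gc z.1 *: G z.
Definition W_ (z : TX) : R := nu_ (rho_ z) * enorm (sym_grad (G_ z)) ^+ 2 + eta_ (rho_ z) * (\tr (G_ z)) ^+ 2.

Lemma good_gradient : exists N : R -> R, [/\ measurable_fun setT (N : measurableTypeR R -> R), forall t, 0 <= N t, L1 leb N &
  {ae leb, forall t, 0 < t < T -> (\int[mu]_x (enorm (G (t, x)) ^+ 2)%:E = (N t)%:E)%E /\ forall x, G_ (t, x) = G (t, x)}].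
Proof.
have [N [mN N0 NL H]] := LpLq_spec (ltr0n R 2) (ltr0n R 2) (ws_gradient_bound sol).
exists N; split => //.
  by move: NL; rewrite divff//; congr (L1 _ _); apply/funext => t; rewrite powRr1.
apply: (@filterS _ _ (ae_filter_ringOfSetsType leb)) H => t h tT.
have E : (\int[mu]_x (enorm (G (t, x)) ^+ 2)%:E = (N t)%:E)%E.
  rewrite -(h tT); apply: eq_integral => x _; congr _%:E.
  by rewrite (powR_mulrn 2 (normr_ge0 _)) real_normK ?num_real.
split => // x; rewrite /G_ /gc /= /chi tT mul1r.
by under eq_integral do rewrite scale1r; rewrite E ltry scale1r.
Qed.

Lemma nu_bound (f : R -> R) : viscosity_law f -> exists2 M, 0 <= M & forall r, c1 <= r <= c2 ->
  0 <= f (clamp c1 c2 r) <= M.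
Proof.
move=> hf; have cf (r : R) : 0 < r -> {for r, continuous f} by move=> /hf[].
have [M M0 hM] := continuous_itv_bdd c1 c2 (continuous_clamp (c2 := c2) c10 cf).
exists M => // r h; have := hM r h; have [f0 _] := hf _ (clamp_gt0 c2 c10 r).
by rewrite f0 ger0_norm.
Qed.

Lemma W_ge0 z : 0 <= W_ z.
Proof.
have [n0 _] := hnu (clamp_gt0 c2 c10 (rho_ z)); have [e0 _] := heta (clamp_gt0 c2 c10 (rho_ z)).
by rewrite /W_ addr_ge0// mulr_ge0// sqr_ge0.
Qed.

Lemma dissipationE t : 0 <= t <= T -> dissipation nu eta rho G t =
  (\int[leb]_s (if (0 < s < t)%R then \int[mu]_x (W_ (s, x))%:E else 0))%E.
Proof.
move=> /andP[t0 tT]; have [N [_ _ _ H]] := good_gradient.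
rewrite /dissipation integral_mkcond; apply: ae_integral.
move: H (ae_slices hrho); apply: (@filterS2 _ _ (ae_filter_ringOfSetsType leb)) => s h1 h2.
have sE : (s \in `]0%R, t[%classic) = (0 < s < t) by apply/idP/idP; rewrite inE/= in_itv.
rewrite patchE sE; case: ifPn => // /andP[s0 st].
have sT : 0 < s < T by rewrite s0 (lt_le_trans st tT).
have sT' : 0 <= s <= T by have /andP[h3 h4] := sT; rewrite !ltW.
have [_ GE] := h1 sT.
apply: ae_integral; apply: (@filterS _ _ (ae_filter_ringOfSetsType mu)) (rho_E sT') => x rE.
by rewrite /W_ GE rE /nu_ /eta_ !(clamp_id' c10 (rho_B _)).
Qed.

Section Pressure.
Variables (p dp P1 P : R -> R) (B : R).
Hypotheses (B0 : 0 <= B) (mp : measurable_fun setT (p : measurableTypeR R -> R))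
  (mdp : measurable_fun setT (dp : measurableTypeR R -> R))
  (mP1 : measurable_fun setT (P1 : measurableTypeR R -> R)) (mP : measurable_fun setT (P : measurableTypeR R -> R))
  (dpE : forall r : R, c1 <= r <= c2 -> is_derive r 1 p (dp r))
  (dP1E : forall r : R, c1 <= r <= c2 -> is_derive r 1 P1 (dp r / r))
  (dPE : forall r : R, c1 <= r <= c2 -> is_derive r 1 P (P1 r) /\ {for r, continuous P1})
  (pB : forall r, c1 <= r <= c2 -> [/\ `|p r| <= B, `|dp r| <= B, `|P1 r| <= B & `|P r| <= B])
  (prE : forall r, c1 <= r <= c2 -> p r = pr r /\ P r = potential pr r).

Definition en_ t x := 2^-1 * \sum_i (rho_ (t, x) * v_ i (t, x) * v_ i (t, x)) + P (rho_ (t, x)).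

Lemma measurable_en t : measurable_fun setT (en_ t).
Proof.
have mr := measurable_slice t measurable_rho_; have mv i := measurable_slice t (measurable_v_ i).
apply: measurable_funD; last exact: (measurableT_comp mP).
apply: measurable_funM => //; apply: measurable_sum => i.
by apply: measurable_funM => //; apply: measurable_funM.
Qed.

Lemma energy_atE t : 0 <= t <= T -> (energy_at pr rho v t = \int[mu]_x (en_ t x)%:E)%E.
Proof.
move=> tT; apply: ae_integral.
apply: (@filterS _ _ (ae_filter_ringOfSetsType mu)) (rho_E tT) => x rE.
have [_ PE] := prE (rho_B (t, x)); rewrite rE -PE enorm_row /en_; congr (_ + _)%:E.
rewrite -mulrA mulr_sumr; congr (_ * _); apply: eq_bigr => i _.
by rewrite (v_E x i tT) expr2 mulrA.
Qed.

(** [weak_init] is applied to the density and to each component of the momentum; division by the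
    density, which is positive, then identifies the velocity. *)
Lemma initial_values : {ae mu, forall x, rho (0, x) = rho0 x /\ v (0, x) = v0 x}.
Proof.
have z0 : 0 <= (0 : R) <= T by rewrite lexx T0'.
have pu s (sT : 0 <= s <= T) := (ws_torus sol sT).1.
have pm i s (sT : 0 <= s <= T) : torus_function (fun x => rho (s, x) * v (s, x) 0 i).
  by move=> x k; rewrite (ws_torus sol sT).1 (ws_torus sol sT).2.
have h1 := @weak_init R d A K dK mo T rho T0 (ws_rho_continuous sol) pu rho0
  (ws_torus0 sol).1 (ws_rho0_integrable sol) (ws_rho_initial sol).
have h2 i : {ae mu, forall x, rho (0, x) * v (0, x) 0 i = rho0 x * v0 x 0 i}.
  apply: (@weak_init R d A K dK mo T (fun z => rho z * v z 0 i) T0 (ws_momentum_continuous sol i) (pm i)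
    (fun x => rho0 x * v0 x 0 i)).
  - by move=> x k; rewrite (ws_torus0 sol).1 (ws_torus0 sol).2.
  - exact: ws_momentum0_integrable sol i.
  move=> phi tphi; pose psi j : 'rV[R]_d -> R := fun x => (i == j)%:R * phi x.
  have tpsi j : torus_test (psi j).
    rewrite /psi; case: (i == j).
      by under eq_fun do rewrite mul1r.
    by under eq_fun do rewrite mul0r; split => //; exact: smooth_cst.
  have E (r : 'rV[R]_d -> R) (w : 'rV[R]_d -> 'rV[R]_d) :
      \int[mu]_x (\sum_j r x * w x 0 j * psi j x) = \int[mu]_x (r x * w x 0 i * phi x).
    apply: eq_Rintegral => x _; rewrite (bigD1 i)//= /psi eqxx mul1r big1 ?addr0// => j ji.
    by rewrite eq_sym (negbTE ji) mul0r mulr0.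
  have := ws_momentum_initial sol tpsi; rewrite (E rho0 v0).
  have -> : (fun t => \int[mu]_x (\sum_j rho (t, x) * v (t, x) 0 j * psi j x)) =
    (fun t => \int[mu]_x (rho (t, x) * v (t, x) 0 i * phi x)) by apply/funext => t; exact: E (fun x => rho (t, x)) (fun x => v (t, x)).
  exact.
have h3 := ae_countable h2.
move: h1 h3 (slice_density_bounds z0); apply: (@filterS3 _ _ (ae_filter_ringOfSetsType mu)) => x e1 e2 /andP[r1 _].
split => //; apply/rowP => i.
have r0 : rho0 x != 0 by rewrite -e1 gt_eqF// (lt_le_trans c10 r1).
by have := e2 i; rewrite e1 => /(mulfI r0).
Qed.

Lemma energy0E : (energy pr rho0 v0 = \int[mu]_x (en_ 0 x)%:E)%E.
Proof.
have z0 : 0 <= (0 : R) <= T by rewrite lexx T0'.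
rewrite -(energy_atE z0); apply: ae_integral.
by apply: (@filterS _ _ (ae_filter_ringOfSetsType mu)) initial_values => x [-> ->].
Qed.

Lemma energy0_L1 : L1 mu (en_ 0).
Proof.
have z0 : 0 <= (0 : R) <= T by rewrite lexx T0'.
have [my] := hv0; rewrite unlock /Lnorm => yfin.
pose y x := Num.sqrt (rho0 x) * enorm (v0 x).
have y0 x : 0 <= y x by rewrite mulr_ge0// ?enorm_ge0// sqrtr_ge0.
have y3 : L1 mu (fun x => y x `^ 3).
  apply: L1_ge0 => [|x|]; [exact: measurable_powRf|exact: powR_ge0|].
  have n3 : (2 + 1 : R)^-1 != 0 by rewrite invr_neq0// gt_eqF.
  apply: le_lt_trans (lty_poweRy n3 yfin); rewrite le_eqVlt; apply/orP; left; apply/eqP; apply: eq_integral => x _.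
  by rewrite /= ger0_norm ?y0// (_ : 2 + 1 = 3)//; lra.
have y2 : L1 mu (fun x => y x ^+ 2).
  apply: (L1_dom (g := fun x => 1 + y x `^ 3)) => [||x]; first exact: measurable_funX.
    by apply: L1D => //; exact: L1_cst.
  rewrite ger0_norm ?sqr_ge0//; have -> : y x `^ 3 = y x ^+ 3 by rewrite (powR_mulrn 3 (y0 x)).
  move: (y x) (y0 x) => a a0; have [a1|a1] := leP a 1.
    rewrite (@le_trans _ _ 1) ?expr_le1 ?lerDl ?exprn_ge0//.
  by rewrite (@le_trans _ _ (a ^+ 3))// ?lerDr// [leRHS]exprS ler_peMl ?sqr_ge0// ltW.
have L : L1 mu (fun x => 2^-1 * y x ^+ 2 + P (rho_ (0, x))).
  apply: L1D; first exact: L1Z.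
  apply: (@L1_bdd _ _ _ mu B) => [|x]; first exact: (measurableT_comp mP (measurable_slice 0 measurable_rho_)).
  by have [] := pB (rho_B (0, x)).
apply: L1_ae L; first exact: measurable_en.
move: initial_values (rho_E z0) (slice_density_bounds z0); apply: (@filterS3 _ _ (ae_filter_ringOfSetsType mu)) => x [e1 e2] e3 /andP[r1 _].
rewrite /en_ /y exprMn sqr_sqrtr; last by rewrite -e1 (le_trans (ltW c10)).
rewrite enorm_row -e1 -e2 e3; congr (_ * _ + _); rewrite mulr_sumr; apply: eq_bigr => i _.
by rewrite (v_E x i z0) expr2 mulrA.
Qed.

Lemma en_clamp t x : en_ t x = en_ (tclamp T t) x.
Proof. by rewrite /en_ /rho_ /v_ /= !(tclamp_id (tclamp_itv t T0')). Qed.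

Let E1 : R := \int[mu]_x en_ 0 x.

(** The dissipation is nonnegative, so the energy inequality bounds the energy by its finite initial
    value; the energy density is at least [- B], and [L1_below] applies. *)
Lemma energy_le t : L1 mu (en_ t) /\ \int[mu]_x en_ t x <= E1.
Proof.
have -> : en_ t = en_ (tclamp T t) by apply/funext => x; exact: en_clamp.
have tT := tclamp_itv t T0'; move: (tclamp T t) tT => {}t tT.
have := ws_energy sol tT; rewrite (dissipationE tT) (energy_atE tT) energy0E -(EFinI energy0_L1) => h.
have D0 : (0 <= \int[leb]_s (if (0 < s < t)%R then \int[mu]_x (W_ (s, x))%:E else 0))%E.
  apply: integral_ge0 => s _; case: ifP => // _; apply: integral_ge0 => x _.
  by rewrite lee_fin; exact: W_ge0.
have h2 : (\int[mu]_x (en_ t x)%:E <= E1%:E)%E by apply: le_trans h; rewrite leeDl.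
have L : L1 mu (en_ t).
  apply: (L1_below (g := fun=> - B) (measurable_en t)) => [||].
  - exact: L1_cst.
  - apply: aeW => x; have [_ _ _] := pB (rho_B (t, x)); rewrite ler_norml => /andP[h3 _].
    rewrite /en_ (le_trans h3)// lerDr mulr_ge0// sumr_ge0// => i _.
    by rewrite -mulrA mulr_ge0 ?sqr_ge0//; have /andP[r1 _] := rho_B (t, x); exact: le_trans (ltW c10) r1.
  by apply: le_lt_trans h2 _; exact: ltry.
by split => //; rewrite -lee_fin (EFinI L).
Qed.

(** Obtained by solving [c1 / 2 * v ^+ 2 <= en_ + B], where [B] compensates for a negative
    potential. *)
Definition V2_ : R := 2 / c1 * (E1 + B).

Lemma velocity_L2 i t : L1 mu (fun x => v_ i (t, x) ^+ 2) /\ \int[mu]_x (v_ i (t, x) ^+ 2) <= V2_.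
Proof.
have [L h] := energy_le t.
have LB : L1 mu (fun x => 2 / c1 * (en_ t x + B)) by apply: L1Z; apply: L1D => //; exact: L1_cst.
have le x : v_ i (t, x) ^+ 2 <= 2 / c1 * (en_ t x + B).
  have [_ _ _] := pB (rho_B (t, x)); rewrite ler_norml => /andP[h3 _].
  have /andP[r1 _] := rho_B (t, x).
  have s1 : c1 * v_ i (t, x) ^+ 2 <= \sum_j (rho_ (t, x) * v_ j (t, x) * v_ j (t, x)).
    rewrite (bigD1 i)//= (@le_trans _ _ (rho_ (t, x) * v_ i (t, x) * v_ i (t, x)))//.
      by rewrite -mulrA ler_wpM2r ?sqr_ge0.
    rewrite lerDl sumr_ge0// => j _; rewrite -mulrA mulr_ge0 ?sqr_ge0//.
    exact: le_trans (ltW c10) r1.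
  rewrite mulrAC ler_pdivlMr// mulrC (le_trans s1)// /en_.
  exact: half_sum_le.
have mv := measurable_slice t (measurable_v_ i).
have L' : L1 mu (fun x => v_ i (t, x) ^+ 2).
  apply: (L1_dom _ LB) => [|x]; first exact: measurable_funX.
  by rewrite ger0_norm ?sqr_ge0.
split => //; apply: (le_trans (Ile L' LB le)).
rewrite IZ; last by apply: L1D => //; exact: L1_cst.
rewrite ID//; last exact: L1_cst.
by rewrite I_cst /V2_ ler_wpM2l ?divr_ge0 ?(ltW c10)// lerD2r.
Qed.

Let e2 t := (\int[mu]_x (enorm (chi T t *: G (t, x)) ^+ 2)%:E)%E.
Let gcE t : gc t = chi T t * (e2 t < +oo)%E%:R. Proof. by []. Qed.

Let e2_ge0 t : (0 <= e2 t)%E.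
Proof. by apply: integral_ge0 => x _; rewrite lee_fin sqr_ge0. Qed.

Let mC : measurable (cylinder T : set TX).
Proof. by apply: measurableX => //; exact: measurable_itv. Qed.

Let mchiG i j : measurable_fun setT (fun z : TX => (chi T z.1 *: G z) i j).
Proof.
have m1 : measurable_fun (cylinder T) (fun z : TX => G z i j).
  exact: (measurableT_comp (@measurable_mx_entry R d d i j) (wg_measurable (ws_gradient sol))).
have := (measurable_restrictT _ mC).1 m1; congr (measurable_fun _ _); apply/funext => -[t x].
rewrite mxE patchE /chi /=; have -> : ((t, x) \in cylinder T) = ((0 < t) && (t < T)).
  by apply/idP/idP; rewrite inE/=; [move=> [/=]; rewrite in_itv|move=> h; split => //=; rewrite in_itv].
by case: (_ && _); rewrite ?mul1r ?mul0r.
Qed.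

Let me2 : measurable_fun setT (e2 : measurableTypeR R -> \bar R).
Proof.
apply: (@measurable_fun_fubini_tonelli_F _ _ _ _ _ mu (fun z => (enorm (chi T z.1 *: G z) ^+ 2)%:E)).
  by apply/measurable_EFinP; apply: measurable_funX; apply: measurable_enorm.
by move=> z; rewrite lee_fin sqr_ge0.
Qed.

Lemma measurable_G_ i j : measurable_fun setT (fun z : TX => G_ z i j).
Proof.
have me : measurable_fun setT (fun t : measurableTypeR R => (e2 t < +oo)%E%:R : R).
  have mS : measurable (~` (e2 @^-1` [set +oo%E]) : set (measurableTypeR R)).
    by apply: measurableC; have := me2 measurableT (emeasurable_set1 +oo%E); rewrite setTI.
  have := measurable_indic (R := R) (D := setT) mS; congr (measurable_fun _ _); apply/funext => t.
  rewrite indicE; congr ((nat_of_bool _)%:R); apply/idP/idP; rewrite inE/=.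
    by move=> h; rewrite ltey; apply/eqP.
  by rewrite ltey => /eqP.
have := measurable_funM (mchiG i j) (measurableT_comp me measurable_fst); congr (measurable_fun _ _).
by apply/funext => z; rewrite /= /G_ gcE !mxE mulrAC.
Qed.

Lemma G_p t : torus_function (fun x => G_ (t, x)).
Proof.
move=> x k; rewrite /G_ /= gcE /chi; case: (boolP (_ && _)) => tT; last by rewrite !mul0r !scale0r.
by congr (_ *: _); exact: (wg_torus (ws_gradient sol) tT x k).
Qed.

Let N2 t := fine (e2 t).

Let grad_N2 t : (\int[mu]_x (enorm (G_ (t, x)) ^+ 2)%:E <= (N2 t)%:E)%E.
Proof.
rewrite /G_ /= gcE; have [h|h] := boolP (e2 t < +oo)%E.
  by rewrite mulr1 fineK// ge0_fin_numE.
rewrite (eq_integral (cst 0%E)) ?integral0 ?lee_fin ?fine_ge0// => x _.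
by rewrite mulr0 scale0r enorm_sqr big1// => i _; rewrite big1// => j _; rewrite mxE expr0n.
Qed.

Let N2_L1 : L1 leb N2.
Proof.
have [N [mN N0 NL H]] := good_gradient.
have mc : measurable_fun setT (chi T : measurableTypeR R -> R) := L1_meas (L1_chi T0).
have L := L1_mulb (M := 1) NL mc (fun t => _).
apply: (L1_ae _ _ (L _)) => [||t].
- exact: measurableT_comp.
- apply: (@filterS _ _ (ae_filter_ringOfSetsType leb)) H => t h; rewrite /N2 /e2 /chi.
  case: (boolP (_ && _)) => tT.
    by under [in RHS]eq_integral do rewrite scale1r; rewrite (h tT).1 mulr1.
  rewrite mulr0 (eq_integral (cst 0%E)) ?integral0// => x _.
  by rewrite scale0r enorm_sqr big1// => i _; rewrite big1// => j _; rewrite mxE expr0n.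
by have /andP[h1 h2] := chi_bd T t; rewrite ger0_norm.
Qed.

Let s1 (z : TX) := \sum_i \sum_j `|G_ z i j|.

Let s1_ge0 z : 0 <= s1 z.
Proof. by rewrite sumr_ge0// => i _; rewrite sumr_ge0. Qed.

Let ms1 : measurable_fun setT s1.
Proof. by apply: measurable_sum => i; apply: measurable_sum => j; apply: measurableT_comp => //; exact: measurable_G_. Qed.

(** The factor is the square of the constant in [sum_le_enorm], as the sum of the absolute values of
    the entries is used in place of the Euclidean norm. *)
Let G2 t := (d * d)%:R ^+ 2 * N2 t.

Let G20 t : 0 <= G2 t.
Proof. by rewrite mulr_ge0 ?sqr_ge0// fine_ge0. Qed.

Let s1_G2 t : (\int[mu]_x (s1 (t, x) `^ 2)%:E <= (G2 t)%:E)%E.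
Proof.
have mG := measurable_enorm (fun i j => measurable_slice t (measurable_G_ i j)).
apply: (@le_trans _ _ (\int[mu]_x ((d * d)%:R ^+ 2 * enorm (G_ (t, x)) ^+ 2)%:E)%E).
  apply: ge0_le_integralR => [|||x].
  - by apply: measurable_powRf; exact: measurable_slice.
  - by apply: measurable_funM => //; exact: measurable_funX.
  - by move=> x; exact: powR_ge0.
  rewrite (powR_mulrn 2 (s1_ge0 _)) -exprMn lerXn2r ?nnegrE// ?mulr_ge0 ?enorm_ge0//.
  exact: sum_le_enorm.
under eq_integral do rewrite EFinM.
rewrite ge0_integralZl_EFin ?sqr_ge0//.
- by rewrite /G2 EFinM lee_wpmul2l ?lee_fin ?sqr_ge0.
- by move=> x _; rewrite lee_fin sqr_ge0.
- by apply/measurable_EFinP; exact: measurable_funX.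
Qed.

Let s1sq t : L1 mu (fun x => s1 (t, x) ^+ 2) /\ \int[mu]_x (s1 (t, x) ^+ 2) <= G2 t.
Proof.
have h : (\int[mu]_x (s1 (t, x) ^+ 2)%:E <= (G2 t)%:E)%E.
  by apply: le_trans (s1_G2 t); under [leRHS]eq_integral do rewrite (powR_mulrn 2 (s1_ge0 _)).
have L : L1 mu (fun x => s1 (t, x) ^+ 2).
  apply: L1_ge0 => [|x|]; [by apply: measurable_funX; exact: measurable_slice|exact: sqr_ge0|].
  exact: le_lt_trans h (ltry _).
by split => //; rewrite -lee_fin (EFinI L).
Qed.

Let G2_L1 : L1 leb G2. Proof. exact: L1Z N2_L1. Qed.

Let Sh i j (z : TX) := nu_ (rho_ z) * sym_grad (G_ z) i j.
Let Bu (z : TX) := eta_ (rho_ z) * \tr (G_ z).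
Let S_ i j (z : TX) := Sh i j z + (i == j)%:R * Bu z.

Let visc_meas (f : R -> R) : viscosity_law f -> measurable_fun setT (fun z : TX => f (clamp c1 c2 (rho_ z))).
Proof.
move=> hf; have cf (r : R) : 0 < r -> {for r, continuous f} by move=> /hf[].
exact: (measurableT_comp (measurable_clamp c2 c10 cf) measurable_rho_).
Qed.

Let mSh i j : measurable_fun setT (Sh i j).
Proof.
apply: measurable_funM; first exact: visc_meas.
have -> : (fun z : TX => sym_grad (G_ z) i j) = (fun z => 2^-1 * (G_ z i j + G_ z j i)).
  by apply/funext => z; rewrite /sym_grad !mxE.
by apply: measurable_funM => //; apply: measurable_funD; exact: measurable_G_.
Qed.

Let mBu : measurable_fun setT Bu.
Proof.
apply: measurable_funM; first exact: visc_meas.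
by apply: measurable_sum => i; exact: measurable_G_.
Qed.

Let mS_ i j : measurable_fun setT (S_ i j).
Proof. by apply: measurable_funD => //; apply: measurable_funM. Qed.

Let S_p i j t : torus_function (fun x => S_ i j (t, x)).
Proof. by move=> x k; rewrite /S_ /Sh /Bu (rho_p t x k) (G_p t x k). Qed.

Let stress_bounds : exists2 C, 0 <= C & [/\ forall i j z, `|Sh i j z| <= C * s1 z, forall z, `|Bu z| <= C * s1 z &
  forall i j z, `|S_ i j z| <= C * s1 z].
Proof.
have [M1 M10 h1] := nu_bound hnu; have [M2 M20 h2] := nu_bound heta.
have b1 i j z : `|Sh i j z| <= M1 * s1 z.
  have /andP[n0 n1] := h1 _ (rho_B z); rewrite normrM ger0_norm// ler_pM//.
  exact: sym_grad_entry.
have b2 z : `|Bu z| <= M2 * s1 z.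
  have /andP[n0 n1] := h2 _ (rho_B z); rewrite normrM ger0_norm// ler_pM//.
  exact: mxtrace_le.
exists (M1 + M2); first exact: addr_ge0.
split => [i j z|z|i j z].
- by apply: le_trans (b1 i j z) _; rewrite ler_wpM2r// lerDl.
- by apply: le_trans (b2 z) _; rewrite ler_wpM2r// lerDr.
apply: le_trans (ler_normD _ _) _; rewrite mulrDl lerD//.
apply: le_trans (b2 z); rewrite normrM; case: (i == j); rewrite ?normr1 ?mul1r// normr0 mul0r//.
Qed.

Let T0T (z : TX) : cylinder T z -> 0 < z.1 < T /\ 0 <= z.1 <= T.
Proof. by move=> [/=]; rewrite in_itv/= => h _; split => //; have /andP[h1 h2] := h; rewrite !ltW. Qed.

Let clean_ae : {ae spacetime R d, forall z, cylinder T z ->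
  [/\ rho z = rho_ z, forall i, v z 0 i = v_ i z & G z = G_ z]}.
Proof.
have [N [_ _ _ H]] := good_gradient.
have := @ae_prod1 _ _ _ _ R leb mu _ H; move: hrho.
apply: (@filterS2 _ _ (ae_filter_ringOfSetsType (spacetime R d))) => -[t x] h1 h2 cz.
have [tT tT'] := T0T cz; have /andP[r1 r2] := h1 cz; have [_ GE] := h2 tT.
split; [|by move=> i; exact: v_E|by rewrite GE].
by rewrite /rho_/= tclamp_id// min_l// max_r.
Qed.

Let clean (u u' : TX -> R) : (forall z, rho z = rho_ z -> (forall i, v z 0 i = v_ i z) -> G z = G_ z -> u z = u' z) ->
  {ae spacetime R d, forall z, cylinder T z -> u z = u' z}.
Proof.
move=> h; apply: (@filterS _ _ (ae_filter_ringOfSetsType (spacetime R d))) clean_ae => z hz cz.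
by have [h1 h2 h3] := hz cz; exact: h.
Qed.

Let V20 : 0 <= V2_.
Proof.
rewrite /V2_ mulr_ge0 ?divr_ge0 ?(ltW c10)// -lerBlDr sub0r.
have L := energy0_L1; rewrite -[leLHS](I_cst mu); apply: Ile => //; first exact: L1_cst.
move=> x; have [_ _ _] := pB (rho_B (0, x)); rewrite ler_norml => /andP[h3 _].
rewrite /en_ (le_trans h3)// lerDr mulr_ge0// sumr_ge0// => i _.
by rewrite -mulrA mulr_ge0 ?sqr_ge0//; have /andP[r1 _] := rho_B (0, x); exact: le_trans (ltW c10) r1.
Qed.

Let wv (z : TX) := \sum_i v_ i z ^+ 2.

Let wvL t : L1 mu (fun x => wv (t, x)) /\ \int[mu]_x wv (t, x) <= d%:R * V2_.
Proof.
split; first by apply: L1_sum => i; exact: (velocity_L2 i t).1.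
rewrite Isum; last by move=> i; exact: (velocity_L2 i t).1.
apply: (@le_trans _ _ (\sum_(i < d) V2_)); first by apply: ler_sum => i _; exact: (velocity_L2 i t).2.
by rewrite sumr_const card_ord mulr_natl.
Qed.

Let wv_ge i z : v_ i z ^+ 2 <= wv z.
Proof. by rewrite /wv (bigD1 i)//= lerDl sumr_ge0// => j _; exact: sqr_ge0. Qed.

Let wv_ge0 z : 0 <= wv z. Proof. by rewrite sumr_ge0// => j _; exact: sqr_ge0. Qed.

Let chiL c : L1 leb (fun t => chi T t * c).
Proof. by have := L1Z c (L1_chi T0); congr (L1 _ _); apply/funext => t; rewrite mulrC. Qed.

Let chiG : L1 leb (fun t => chi T t * G2 t).
Proof.
have := L1_mulb (M := 1) G2_L1 (L1_meas (L1_chi T0)) (fun t => _).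
rewrite (_ : (fun x => G2 x * chi T x) = (fun t => chi T t * G2 t)).
  by apply => t; have /andP[h1 h2] := chi_bd T t; rewrite ger0_norm.
by apply/funext => t; rewrite mulrC.
Qed.

Let c20 : 0 <= c2 := le_trans (ltW c10) c12.

Let rho_abs z : `|rho_ z| <= c2.
Proof. by have /andP[r1 r2] := rho_B z; rewrite ger0_norm// (le_trans (ltW c10)). Qed.

Let rv_le j z : `|rho_ z * v_ j z| <= c2 * (1 + wv z).
Proof.
rewrite normrM ler_pM ?rho_abs// (le_trans (abs_le_sqr _))// lerD2l; exact: wv_ge.
Qed.

Let rvL j t := slice_bound (measurable_funM measurable_rho_ (measurable_v_ j)) c20 (rv_le j)
  (fun t => (wvL t).1) (fun t => (wvL t).2) t.

Let s1_le z : s1 z <= 1 + s1 z ^+ 2.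
Proof. by rewrite -{1}(ger0_norm (s1_ge0 z)); exact: abs_le_sqr. Qed.

Let fld_rho : fld T rho rho_.
Proof.
apply: (mk_fld (w := fun=> 0) (C := c2) (b := fun=> 0)) => //.
- exact: measurable_rho_.
- by move=> z; rewrite addr0 mulr1.
- by move=> t; exact: L1_cst.
- by move=> t; rewrite I_cst.
- by have [] := ws_mass sol.
- by apply: clean.
Qed.

Let fld_rv j : fld T (fun z => rho z * v z 0 j) (fun z => rho_ z * v_ j z).
Proof.
apply: (mk_fld (w := wv) (C := c2) (b := fun=> d%:R * V2_)) => //.
- by apply: measurable_funM; [exact: measurable_rho_|exact: measurable_v_].
- by move=> t; exact: (wvL t).1.
- by move=> t; exact: (wvL t).2.
- by have [] := ws_mass sol.
- by apply: clean => z -> ->.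
Qed.

Let fld_v j : fld T (fun z => v z 0 j) (v_ j).
Proof.
apply: (mk_fld (w := wv) (C := 1) (b := fun=> d%:R * V2_)) => //.
- exact: measurable_v_.
- by move=> z; rewrite mul1r (le_trans (abs_le_sqr _))// lerD2l; exact: wv_ge.
- by move=> t; exact: (wvL t).1.
- by move=> t; exact: (wvL t).2.
- exact: wg_locl (ws_gradient sol) j.
- by apply: clean => z _ ->.
Qed.

Let fld_rvv i j : fld T (fun z => rho z * v z 0 i * v z 0 j) (fun z => rho_ z * v_ i z * v_ j z).
Proof.
apply: (mk_fld (w := wv) (C := c2 * 2) (b := fun=> d%:R * V2_)) => //.
- by apply: measurable_funM; [apply: measurable_funM; [exact: measurable_rho_|]|]; exact: measurable_v_.
- by rewrite mulr_ge0.
- move=> z; rewrite -mulrA normrM -mulrA ler_pM ?rho_abs// (le_trans (abs_mul_le _ _))//.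
  exact: add_le_double (wv_ge i z) (wv_ge j z).
- by move=> t; exact: (wvL t).1.
- by move=> t; exact: (wvL t).2.
- exact: me_convection (ws_momentum sol) i j.
- by apply: clean => z -> h _; rewrite !h.
Qed.

Let fld_p : fld T (fun z => pr (rho z)) (fun z => p (rho_ z)).
Proof.
apply: (mk_fld (w := fun=> 0) (C := B) (b := fun=> 0)) => //.
- exact: (measurableT_comp mp measurable_rho_).
- by move=> z; rewrite addr0 mulr1; have [] := pB (rho_B z).
- by move=> t; exact: L1_cst.
- by move=> t; rewrite I_cst.
- exact: me_pressure (ws_momentum sol).
- by apply: clean => z -> _ _; have [-> _] := prE (rho_B z).
Qed.

Let nu_E (f : R -> R) z : rho z = rho_ z -> f (rho z) = f (clamp c1 c2 (rho_ z)).
Proof. by move=> ->; rewrite (clamp_id' c10 (rho_B _)). Qed.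

Let s1_C C z a : 0 <= C -> a <= C * s1 z -> a <= C * (1 + s1 z ^+ 2).
Proof. by move=> C0 h; rewrite (le_trans h)// ler_wpM2l//; exact: s1_le. Qed.

Let fld_Sh i j : fld T (fun z => nu (rho z) * sym_grad (G z) i j) (Sh i j).
Proof.
have [C C0 [h1 _ _]] := stress_bounds.
apply: (mk_fld (w := fun z => s1 z ^+ 2) (C := C) (b := G2)) => //.
- by move=> z; exact: s1_C.
- by move=> t; exact: (s1sq t).1.
- by move=> t; exact: (s1sq t).2.
- exact: me_shear (ws_momentum sol) i j.
- by apply: clean => z h _ ->; rewrite (nu_E nu h).
Qed.

Let fld_Bu : fld T (fun z => eta (rho z) * \tr (G z)) Bu.
Proof.
have [C C0 [_ h1 _]] := stress_bounds.
apply: (mk_fld (w := fun z => s1 z ^+ 2) (C := C) (b := G2)) => //.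
- by move=> z; exact: s1_C.
- by move=> t; exact: (s1sq t).1.
- by move=> t; exact: (s1sq t).2.
- exact: me_bulk (ws_momentum sol).
- by apply: clean => z h _ ->; rewrite (nu_E eta h).
Qed.

Let fld_G i j : fld T (fun z => G z i j) (fun z => G_ z i j).
Proof.
apply: (mk_fld (w := fun z => s1 z ^+ 2) (C := 1) (b := G2)) => //.
- exact: measurable_G_.
- by move=> z; apply: s1_C => //; rewrite mul1r; exact: sum_entry.
- by move=> t; exact: (s1sq t).1.
- by move=> t; exact: (s1sq t).2.
- exact: wg_locr (ws_gradient sol) i j.
- by apply: clean => z _ _ ->.
Qed.

Let mass_prim n x : prim T (fun t => cv (fun y => rho_ (t, y)) (K n) x)
  (fun t => chi T t * drho (fun y => rho_ (t, y)) (dK n) (fun j y => v_ j (t, y)) x).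
Proof.
have [M hM] := mo_bdd (mo n).
have law : forall phi, spacetime_test T phi ->
  pairing T rho (d_t phi) + \sum_k 1 * pairing T (fun z => rho z * v z 0 k) (d_x k phi) = 0.
  by move=> phi tphi; under eq_bigr do rewrite mul1r; have [_ _] := ws_mass sol; exact.
have := @conservation_prim R d T 'I_d A n (K n) (dK n) rho rho_ _ _ id (fun=> 1) T0 (mo n) fld_rho fld_rv law x (M * c2).
have -> : (fun t => chi T t * \sum_k 1 * cv (fun y => rho_ (t, y) * v_ k (t, y)) (dK n (id k)) x) =
   (fun t => chi T t * drho (fun y => rho_ (t, y)) (dK n) (fun j y => v_ j (t, y)) x).
  by apply/funext => t; congr (_ * _); apply: eq_bigr => k _; rewrite mul1r.
apply.
  have cc : continuous (fun t => cv (fun y => rho (tclamp T t, y)) (K n) x) :=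
    @cv_time_continuous R d A K dK mo T rho T0 (ws_rho_continuous sol) n x.
  (* On each slice [rho_] and the time-clamped [rho] agree almost everywhere, so they have the same
     mollification, which is continuous in time by weak continuity. *)
  suff <- : (fun t : R => cv (fun y => rho (tclamp T t, y)) (K n) x) =
      (fun t : R => cv (fun y => rho_ (t, y)) (K n) x) by exact: cc.
  apply/funext => t; have tT := tclamp_itv t T0'.
  apply: Iae.
  - exact: L1_meas (L1_cv x ((ws_rho_continuous sol).1 _ tT) (mo_meas (mo n)) (fun y => (hM y).1)).
  - apply: measurable_funM; first exact: measurable_slice measurable_rho_.
    exact: measurable_subr (mo_meas (mo n)).
  apply: (@filterS _ _ (ae_filter_ringOfSetsType mu)) (rho_E tT) => y ->.
  by rewrite /rho_ /= (tclamp_id tT).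
move=> t; apply: le_trans (bounded_cv x (fld_slice fld_rho t) (mo_meas (mo n)) (fun y => (hM y).1)) _.
rewrite ler_wpM2l//; first exact: le_trans (normr_ge0 _) (hM 0).1.
rewrite -[leRHS](I_cst mu); apply: Ile; [exact: L1_norm (fld_slice fld_rho t)|exact: L1_cst|].
by move=> y; exact: rho_abs.
Qed.

Let momentum_prim n i x : prim T (fun t => cv (fun y => rho_ (t, y) * v_ i (t, y)) (K n) x)
  (fun t => chi T t * dmom (fun y => rho_ (t, y)) (dK n) (fun j y => v_ j (t, y)) (fun y => p (rho_ (t, y)))
    (fun i j y => S_ i j (t, y)) i x).
Proof.
have [M hM] := mo_bdd (mo n).
(* The fluxes of the i-th momentum equation: convection and shear in each direction [j], then
   pressure ([true]) and bulk viscosity ([false]) in direction [i]; both viscous fluxes carry the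
   sign -1. *)
pose I : finType := ('I_d + 'I_d + bool)%type.
pose f (k : I) : TX -> R := match k with
  | inl (inl j) => fun z => rho z * v z 0 i * v z 0 j
  | inl (inr j) => fun z => nu (rho z) * sym_grad (G z) i j
  | inr true => fun z => pr (rho z) | inr false => fun z => eta (rho z) * \tr (G z) end.
pose f' (k : I) : TX -> R := match k with
  | inl (inl j) => fun z => rho_ z * v_ i z * v_ j z
  | inl (inr j) => Sh i j | inr true => fun z => p (rho_ z) | inr false => Bu end.
pose J (k : I) : 'I_d := match k with inl (inl j) => j | inl (inr j) => j | inr _ => i end.
pose s (k : I) : R := match k with inl (inl _) => 1 | inl (inr _) => -1 | inr true => 1 | inr false => -1 end.
have ff k : fld T (f k) (f' k) by case: k => [[j|j]|[]]; [exact: fld_rvv|exact: fld_Sh|exact: fld_p|exact: fld_Bu].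
have law phi : spacetime_test T phi ->
    pairing T (fun z => rho z * v z 0 i) (d_t phi) + \sum_k s k * pairing T (f k) (d_x (J k) phi) = 0.
  move=> tphi; have := me_eq (ws_momentum sol) i tphi.
  move=> h; rewrite -[RHS]h big_flux.
  have -> : \sum_j s (inl (inl j)) * pairing T (f (inl (inl j))) (d_x (J (inl (inl j))) phi) =
      \sum_j pairing T (fun z => rho z * v z 0 i * v z 0 j) (d_x j phi).
    by apply: eq_bigr => j _; exact: mul1r.
  have -> : \sum_j s (inl (inr j)) * pairing T (f (inl (inr j))) (d_x (J (inl (inr j))) phi) =
      - \sum_j pairing T (fun z => nu (rho z) * sym_grad (G z) i j) (d_x j phi).
    by rewrite -sumrN; apply: eq_bigr => j _; exact: mulN1r.
  have -> : s (inr true) * pairing T (f (inr true)) (d_x (J (inr true)) phi) =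
      pairing T (fun z => pr (rho z)) (d_x i phi) by exact: mul1r.
  have -> : s (inr false) * pairing T (f (inr false)) (d_x (J (inr false)) phi) =
      - pairing T (fun z => eta (rho z) * \tr (G z)) (d_x i phi) by exact: mulN1r.
  exact: addr_flux.
have := @conservation_prim R d T I A n (K n) (dK n) _ _ f f' J s T0 (mo n) (fld_rv i) ff law x (M * (c2 * (1 + d%:R * V2_))).
have -> : (fun t => chi T t * \sum_k s k * cv (fun y => f' k (t, y)) (dK n (J k)) x) =
  (fun t => chi T t * dmom (fun y => rho_ (t, y)) (dK n) (fun j y => v_ j (t, y)) (fun y => p (rho_ (t, y)))
    (fun i j y => S_ i j (t, y)) i x).
  apply/funext => t; congr (_ * _); rewrite big_flux /dmom.
  have cS j : cv (fun y => S_ i j (t, y)) (dK n j) x =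
      cv (fun y => Sh i j (t, y)) (dK n j) x + (i == j)%:R * cv (fun y => Bu (t, y)) (dK n j) x.
    have L u u' (uu : fld T u u') := L1_cv x (fld_slice uu t) (mo_measd (mo n) j) (fun y => (hM y).2 j).
    rewrite /cv -IZ; last exact: L fld_Bu.
    rewrite -ID; [|exact: L (fld_Sh i j)|by apply: L1Z; exact: L fld_Bu].
    by apply: eq_Rintegral => y _; rewrite /S_; ring.
  rewrite [X in _ = _ + _ - X](eq_bigr _ (fun j _ => cS j)) big_split/=.
  have -> : \sum_j (i == j)%:R * cv (fun y => Bu (t, y)) (dK n j) x = cv (fun y => Bu (t, y)) (dK n i) x.
    by rewrite (bigD1 i)//= eqxx mul1r big1 ?addr0// => j ji; rewrite eq_sym (negbTE ji) mul0r.
  have -> : \sum_j s (inl (inl j)) * cv (fun y => f' (inl (inl j)) (t, y)) (dK n (J (inl (inl j)))) x =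
      \sum_j cv (fun y => rho_ (t, y) * v_ i (t, y) * v_ j (t, y)) (dK n j) x.
    by apply: eq_bigr => j _; exact: mul1r.
  have -> : \sum_j s (inl (inr j)) * cv (fun y => f' (inl (inr j)) (t, y)) (dK n (J (inl (inr j)))) x =
      - \sum_j cv (fun y => Sh i j (t, y)) (dK n j) x.
    by rewrite -sumrN; apply: eq_bigr => j _; exact: mulN1r.
  have -> : s (inr true) * cv (fun y => f' (inr true) (t, y)) (dK n (J (inr true))) x =
      cv (fun y => p (rho_ (t, y))) (dK n i) x by exact: mul1r.
  have -> : s (inr false) * cv (fun y => f' (inr false) (t, y)) (dK n (J (inr false))) x =
      - cv (fun y => Bu (t, y)) (dK n i) x by exact: mulN1r.
  by rewrite addrACA -opprD.
apply.
  have cc : continuous (fun t => cv (fun y => rho (tclamp T t, y) * v (tclamp T t, y) 0 i) (K n) x) :=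
    @cv_time_continuous R d A K dK mo T (fun z => rho z * v z 0 i) T0 (ws_momentum_continuous sol i) n x.
  suff <- : (fun t : R => cv (fun y => rho (tclamp T t, y) * v (tclamp T t, y) 0 i) (K n) x) =
      (fun t : R => cv (fun y => rho_ (t, y) * v_ i (t, y)) (K n) x) by exact: cc.
  apply/funext => t; have tT := tclamp_itv t T0'.
  apply: Iae.
  - exact: L1_meas (L1_cv x ((ws_momentum_continuous sol i).1 _ tT) (mo_meas (mo n)) (fun y => (hM y).1)).
  - apply: measurable_funM; first exact: measurable_slice (fld_meas (fld_rv i)).
    exact: measurable_subr (mo_meas (mo n)).
  apply: (@filterS _ _ (ae_filter_ringOfSetsType mu)) (rho_E tT) => y ->.
  by rewrite /rho_ /v_ /= (tclamp_id tT).
move=> t; apply: le_trans (bounded_cv x (fld_slice (fld_rv i) t) (mo_meas (mo n)) (fun y => (hM y).1)) _.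
rewrite ler_wpM2l//; first exact: le_trans (normr_ge0 _) (hM 0).1.
exact: (rvL i t).2.
Qed.

(** * The energy identity for the weak solution *)

Section Conclusion.
Variables (a b : R).
Hypotheses (a1 : 1 < a) (b1 : 1 < b)
  (hvab : LpLq T (2 * a / (a - 1))%:E (2 * b / (b - 1))%:E (fun z => enorm (v z)))
  (hgab : LpLq T a%:E b%:E (fun z => enorm (G z))).

Let SG2 : exists2 C, 0 <= C & forall i j t, (\int[mu]_x (`|S_ i j (t, x)| `^ 2)%:E <= (C * G2 t)%:E)%E.
Proof.
have [C C0 [_ _ h]] := stress_bounds; exists (C ^+ 2); first exact: sqr_ge0.
move=> i j t; have [L le] := s1sq t.
apply: (@le_trans _ _ (\int[mu]_x (C ^+ 2 * s1 (t, x) ^+ 2)%:E)%E).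
  apply: ge0_le_integralR => [|||x].
  - by apply: measurable_powRf; apply: measurableT_comp => //; exact: measurable_slice.
  - exact: L1_meas (L1Z (C ^+ 2) L).
  - by move=> x; exact: powR_ge0.
  rewrite (powR_mulrn 2 (normr_ge0 _)) -exprMn lerXn2r ?nnegrE// mulr_ge0//.
by rewrite -(EFinI (L1Z (C ^+ 2) L)) (IZ _ L) lee_fin ler_wpM2l// sqr_ge0.
Qed.

Let SGL i j t : L1 mu (fun x => S_ i j (t, x) * G_ (t, x) i j).
Proof.
have [C C0 [_ _ h]] := stress_bounds; have [L le] := s1sq t.
apply: (L1_dom _ (L1Z C L)) => [|x].
  by apply: measurable_funM; [exact: measurable_slice|exact: measurable_slice (measurable_G_ i j)].
by rewrite normrM expr2 mulrA ler_pM//; exact: sum_entry.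
Qed.

Lemma energy_identity t : 0 <= t <= T ->
  (energy_at pr rho v t + dissipation nu eta rho G t = energy pr rho0 v0)%E.
Proof.
move=> tT; have [t0 tT'] := andP tT.
have am : 0 < a - 1 by rewrite subr_gt0. have bm : 0 < b - 1 by rewrite subr_gt0.
have a0 : 0 < a by exact: lt_trans a1. have b0 : 0 < b by exact: lt_trans b1.
have [V [mV V0 VL Vae]] := LpLq_spec (divr_gt0 (mulr_gt0 (ltr0n R 2) a0) am) (divr_gt0 (mulr_gt0 (ltr0n R 2) b0) bm) hvab.
have [N [mN N0 NL Nae]] := LpLq_spec a0 b0 hgab.
pose Cd : R := (d * d)%:R; have Cd0 : 0 <= Cd by exact: ler0n.
pose Gq t := Cd `^ b * N t.
have Gq0 r : 0 <= Gq r by rewrite mulr_ge0// powR_ge0.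
(* Here [a] and [b] are the exponents called [p] and [q] in the theorem. The number [s] is conjugate
   to [b], and [2 * s] is the spatial exponent assumed for the velocity. *)
pose s := b / (b - 1).
have s1' : 1 <= s by rewrite ler_pdivlMr// mul1r lerBlDr lerDl.
have sq : s^-1 + b^-1 = 1 by rewrite /s; field; rewrite !gt_eqF.
have s2 : 2 * b / (b - 1) = 2 * s by rewrite mulrA.
have mc := L1_meas (L1_chi T0).
(* The exponent [a] enters here: Young's inequality in time dominates the product by the two
   integrable powers [VL] and [NL]. *)
have VGi : L1 leb (fun t => chi T t * (V t `^ s^-1 * Gq t `^ b^-1)).
  apply: (L1_dom _ (L1Z Cd (L1D VL NL))) => [|r].
    apply: measurable_funM => //; apply: measurable_funM; first exact: measurable_powRf.
    by apply: measurable_powRf; apply: measurable_funM.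
  have /andP[h1 h2] := chi_bd T r.
  have p0 : 0 <= V r `^ s^-1 * Gq r `^ b^-1 by rewrite mulr_ge0// powR_ge0.
  rewrite (ger0_norm (mulr_ge0 h1 p0)); apply: le_trans (ler_piMl p0 h2) _.
  exact: young_exponents.
have [CS CS0 hS] := SG2.
have [N' [_ _ _ Gae]] := good_gradient.
have Wae := weak_grad_all T0 mo fld_v fld_G (fun i j phi h => wg_eq (ws_gradient sol) i j h).
have good : {ae leb, forall t, 0 < t < T ->
  [/\ forall i, (\int[mu]_x (`|v_ i (t, x)| `^ (2 * s))%:E <= (V t)%:E)%E,
      (\int[mu]_x ((\sum_i \sum_j `|G_ (t, x) i j|) `^ b)%:E <= (Gq t)%:E)%E,
      forall n i j x, cv (fun y => v_ i (t, y)) (dK n j) x = - cv (fun y => G_ (t, y) i j) (K n) x &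
      forall n i j y, \int[mu]_x (v_ i (t, x) * dK n j (y - x)) = \int[mu]_x (G_ (t, x) i j * K n (y - x))]}.
  have VN : {ae leb, forall t, 0 < t < T -> (\int[mu]_x (`|enorm (v (t, x))| `^ (2 * b / (b - 1)))%:E = (V t)%:E)%E /\
      (\int[mu]_x (`|enorm (G (t, x))| `^ b)%:E = (N t)%:E)%E}.
    move: Vae Nae; apply: (@filterS2 _ _ (ae_filter_ringOfSetsType leb)) => r h1 h2 rT.
    by split; [exact: h1|exact: h2].
  move: VN Gae Wae; apply: (@filterS3 _ _ (ae_filter_ringOfSetsType leb)) => r hVN hG hW rT.
  have [hV hN] := hVN rT.
  have rT' : 0 <= r <= T by have /andP[h1 h2] := rT; rewrite !ltW.
  have [w1 w2] := hW rT; have [_ GE] := hG rT.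
  have s20 : 0 <= 2 * s by rewrite mulr_ge0// (le_trans _ s1').
  split => //.
  - move=> i; rewrite -hV s2.
    apply: (ge0_le_integralR mu (f := fun x => `|v_ i (r, x)| `^ (2 * s)) (g := fun x => `|enorm (v (r, x))| `^ (2 * s))) => [|||x].
    + by apply: measurable_powRf; apply: measurableT_comp => //; exact: measurable_slice (measurable_v_ i).
    + apply: measurable_powRf; apply: measurableT_comp => //.
      have := @measurable_enorm R _ _ 1 d (fun x => v (r, x)); apply => i' j'; rewrite (ord1 i').
      under eq_fun do rewrite (v_E _ _ rT').
      exact: measurable_slice (measurable_v_ j').
    + by move=> x; exact: powR_ge0.
    by apply: powR_le => //; rewrite -(v_E x i rT') (ger0_norm (enorm_ge0 _)); exact: enorm_entry.
  have mG := measurable_enorm (fun i j => measurable_slice r (measurable_G_ i j)).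
  apply: (@le_trans _ _ (\int[mu]_x (Cd `^ b * `|enorm (G (r, x))| `^ b)%:E)%E).
    apply: ge0_le_integralR => [|||x].
    + by apply: measurable_powRf; exact: measurable_slice ms1.
    + apply: measurable_funM => //; apply: measurable_powRf; apply: measurableT_comp => //.
      by move: mG; congr (measurable_fun _ _); apply/funext => x; rewrite GE.
    + by move=> x; exact: powR_ge0.
    rewrite -powRM// GE; apply: powR_le; [exact: ltW|by rewrite sumr_ge0// => i _; rewrite sumr_ge0|].
    by rewrite (ger0_norm (enorm_ge0 _)); exact: sum_le_enorm.
  under eq_integral do rewrite EFinM.
  rewrite ge0_integralZl_EFin ?powR_ge0//.
  + by rewrite hN /Gq EFinM.
  apply/measurable_EFinP; apply: measurable_powRf; apply: measurableT_comp => //.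
  by move: mG; congr (measurable_fun _ _); apply/funext => x; rewrite GE.
have rhoE := rho_B.
have [IL IE] := core_identity A0 mo T0 c10 measurable_rho_ measurable_v_ measurable_G_ mS_ rho_B rho_p v_p
  (fun i j t x k => congr1 (fun M : 'M[R]_d => M i j) (G_p t x k)) S_p V20 (fun i t => (velocity_L2 i t).1) (fun i t => (velocity_L2 i t).2)
  B0 mp mdp mP1 mP dpE dP1E dPE pB CS0 G20 G2_L1 s1_G2 hS mass_prim momentum_prim
  s1' (ltW b1) sq V0 Gq0 VGi good t0 tT'.
rewrite (energy_atE tT) energy0E (dissipationE tT) -(EFinI (energy_le t).1) -(EFinI energy0_L1).
have E (r : R) : (if (0 < r < t)%R then (\int[mu]_x (W_ (r, x))%:E)%E else 0%E) =
    (chi T r * (\sum_i \sum_j \int[mu]_x (S_ i j (r, x) * G_ (r, x) i j)) * itv 0 t r)%:E.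
  rewrite /chi /itv; have [r0|r0] := boolP (0 < r); last by rewrite /= !mul0r.
  have [rt|rt] := boolP (r < t); last by rewrite /= andbF mulr0.
  rewrite (lt_le_trans rt tT') (ltW r0) /= mul1r mulr1.
  have -> : \sum_i \sum_j \int[mu]_x (S_ i j (r, x) * G_ (r, x) i j) =
      \int[mu]_x (\sum_i \sum_j S_ i j (r, x) * G_ (r, x) i j).
    rewrite Isum; last by move=> i; exact: L1_sum.
    by apply: eq_bigr => i _; rewrite Isum.
  rewrite EFinI; last by apply: L1_sum => i; exact: L1_sum.
  by apply: eq_integral => x _; congr _%:E; rewrite /W_ -stress_contract.
have -> : (\int[leb]_s (if (0 < s < t)%R then \int[mu]_x (W_ (s, x))%:E else 0) =
  (\int[leb]_r (chi T r * (\sum_i \sum_j \int[mu]_x (S_ i j (r, x) * G_ (r, x) i j)) * itv 0 t r))%:E)%E.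
  by rewrite (EFinI IL); apply: eq_integral => r _; exact: E.
by rewrite -EFinD; congr _%:E; exact: IE.
Qed.

End Conclusion.

End Pressure.

End Assembly.

Unset Implicit Arguments.

Theorem theorem1p1 (R : realType) (d : nat) (hd : (2 <= d)%N)
    (T : R) (hT : 0 < T) (pr nu mu : R -> R)
    (hpr : pressure_law pr) (hnu : viscosity_law nu) (hmu : viscosity_law mu)
    (rho : R * 'rV[R]_d -> R) (v : R * 'rV[R]_d -> 'rV[R]_d)
    (gradv : R * 'rV[R]_d -> 'M[R]_d)
    (rho0 : 'rV[R]_d -> R) (v0 : 'rV[R]_d -> 'rV[R]_d)
    (hsol : weak_solution T pr nu mu rho v gradv rho0 v0)
    (p q : R) (hp : 1 < p) (hq : 1 < q)
    (c1 c2 : R) (hc1 : 0 < c1)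
    (hrho : {ae spacetime R d, forall z, cylinder T z -> c1 <= rho z <= c2})
    (hv2 : LpLq T +oo 2%:E (fun z => enorm (v z)))
    (hg2 : LpLq T 2%:E 2%:E (fun z => enorm (gradv z)))
    (hvpq : LpLq T (2 * p / (p - 1))%:E (2 * q / (q - 1))%:E
      (fun z => enorm (v z)))
    (hgpq : LpLq T p%:E q%:E (fun z => enorm (gradv z)))
    (hv0 : forall delta : R, 0 < delta ->
      in_Lp (2 + delta)%:E (fun x => Num.sqrt (rho0 x) * enorm (v0 x))) :
  forall t : R, 0 <= t <= T ->
    (energy_at pr rho v t + dissipation nu mu rho gradv t
     = energy pr rho0 v0)%E.
Proof.
have [A A0 hA] := moll_exists R d.
have [K hK] := choice hA.
have [dK mo] := choice hK.
have [pf [dp [P1 [P [B [B0 [mp mdp mP1 mP] [dpE dP1E dPE] pB prE]]]]]] := pressure_data hpr c2 hc1.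
move=> t; exact: (energy_identity A0 mo hT hnu hmu hsol hc1 hrho (hv0 1 ltr01) B0 mp mdp mP1 mP dpE dP1E dPE pB prE
  hp hq hvpq hgpq).
Qed.
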